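(* Let $n\geq 1$, let $f\in\operatorname{supp}S^0(\mathbb{D}^n)$ and let $\{f_t\}_{t\geq 0}$ be a normalized Loewner chain on $\mathbb{D}^n$ with $f_0=f$ such that $\{e^{-t}f_t\}_{t\geq 0}$ is a normal family on $\mathbb{D}^n$. Then $e^{-t}f_t\in\operatorname{supp}S^0(\mathbb{D}^n)$ for all $t\geq 0$.
   Context: $\mathbb{D}\subset\mathbb{C}$ is the open unit disc, $\mathbb{D}^n$ the polydisc, $\|z\|_\infty=\max_j|z_j|$. $\mathcal{H}(\mathbb{D}^n,\mathbb{C}^n)$ is the locally convex space of holomorphic mappings $\mathbb{D}^n\to\mathbb{C}^n$ with the topology of locally uniform convergence. $S(\mathbb{D}^n)$ is the set of univalent (injective holomorphic) $f:\mathbb{D}^n\to\mathbb{C}^n$ with $f(0)=0$, $Df(0)=I_n$. $\mathcal{M}(\mathbb{D}^n)$ is the set of $h\in\mathcal{H}(\mathbb{D}^n,\mathbb{C}^n)$ with $h(0)=0$, $Dh(0)=-I_n$ and $\operatorname{Re}(h_j(z)/z_j)\leq 0$ whenever $z\in\mathbb{D}^n$ and $\|z\|_\infty=|z_j|>0$. A Herglotz vector field is a mapping $G:\mathbb{D}^n\times[0,\infty)\to\mathbb{C}^n$ with $G(\cdot,t)\in\mathcal{M}(\mathbb{D}^n)$ for all $t\geq 0$ and $G(z,\cdot)$ measurable for all $z\in\mathbb{D}^n$. Its Loewner equation is $\frac{\partial}{\partial t}\varphi_{s,t}(z)=G(\varphi_{s,t}(z),t)$ for almost all $t\geq s$, $\varphi_{s,s}(z)=z$;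 its solutions are univalent maps $\varphi_{s,t}:\mathbb{D}^n\to\mathbb{D}^n$ ($0\le s\le t$), and the limit $\lim_{t\to\infty}e^t\varphi_{0,t}$ exists locally uniformly on $\mathbb{D}^n$ and lies in $S(\mathbb{D}^n)$. $S^0(\mathbb{D}^n)$ is the set of all $f\in S(\mathbb{D}^n)$ having parametric representation, i.e. $f=\lim_{t\to\infty}e^t\varphi_{0,t}$ for some Herglotz vector field $G$. Known fact: $f\in S^0(\mathbb{D}^n)$ if and only if there is a normalized Loewner chain $\{f_t\}_{t\ge0}$ with $f_0=f$ such that $\{e^{-t}f_t\}_{t\ge0}$ is a normal family on $\mathbb{D}^n$. A normalized Loewner chain on $\mathbb{D}^n$ is a family $\{f_t\}_{t\geq 0}$ of univalent mappings $f_t:\mathbb{D}^n\to\mathbb{C}^n$ with $f_t(0)=0$, $Df_t(0)=e^tI_n$ and $f_s(\mathbb{D}^n)\subseteq f_t(\mathbb{D}^n)$ for all $0\leq s\leq t$. For a subset $E$ of a locally convex complex vector space $X$, $\operatorname{supp}E$ (the support points of $E$) is the set of $x\in E$ for which there is a continuous linear functional $L:X\to\mathbb{C}$ such that $\operatorname{Re}L$ is non-constant on $E$ and $\operatorname{Re}L(x)=\max_{y\in E}\operatorname{Re}L(y)$. Here $X=\mathcal{H}(\mathbb{D}^n,\mathbb{C}^n)$ and $E=S^0(\mathbb{D}^n)$. *)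

(* Defs.v *)
From HB Require Import structures.
From mathcomp Require Import all_boot all_order all_algebra.
From mathcomp Require Import all_classical all_reals all_analysis.
From mathcomp.real_closed Require Import complex.

Set Implicit Arguments.
Unset Strict Implicit.
Unset Printing Implicit Defensive.

Import Order.TTheory GRing.Theory Num.Theory.
Import numFieldNormedType.Exports.

Local Open Scope classical_set_scope.
Local Open Scope ring_scope.
Local Open Scope complex_scope.

(* R[i] is given the topology and norm of its modulus, by the same copies that
   numFieldNormedType makes for an abstract numClosedFieldType. The norm of
   'rV[R[i]]_n is then the maximum norm (with values in R[i]), and
   differentiable and 'd are C-differentiability and the C-linear
   differential. *)
#[non_forgetful_inheritance]
HB.instance Definition _ (R : realType) := PseudoPointedMetric.copy R[i] R[i]^o.
#[non_forgetful_inheritance]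
HB.instance Definition _ (R : realType) := GRing.ComAlgebra.copy R[i] R[i]^o.
#[non_forgetful_inheritance]
HB.instance Definition _ (R : realType) := Vector.copy R[i] R[i]^o.
#[non_forgetful_inheritance]
HB.instance Definition _ (R : realType) := NormedModule.copy R[i] R[i]^o.

Section curves.
Context {R : realType} {n : nat}.
Implicit Types (g : R -> 'rV[R[i]]_n) (u : R -> R) (a b t : R).

Definition abs_continuous u a b : Prop :=
  forall e : R, 0 < e -> exists2 d : R, 0 < d &
    forall (m : nat) (x y : 'I_m -> R),
      (forall i, [/\ a <= x i, x i <= y i & y i <= b]) ->
      trivIset setT (fun i => `]x i, y i[%classic) ->
      \sum_(i < m) (y i - x i) < d ->
      \sum_(i < m) `|u (y i) - u (x i)| < e.

Definition abs_continuous_curve g a b : Prop := forall j,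
  abs_continuous (fun t => complex.Re (g t ord0 j)) a b /\
  abs_continuous (fun t => complex.Im (g t ord0 j)) a b.

(* The derivative of g with respect to the real variable at t is v. *)
Definition has_time_derivative g t (v : 'rV[R[i]]_n) : Prop := forall j,
  is_derive t 1 (fun s => complex.Re (g s ord0 j)) (complex.Re (v ord0 j)) /\
  is_derive t 1 (fun s => complex.Im (g s ord0 j)) (complex.Im (v ord0 j)).

(* Lebesgue measurability: the sigma-algebra on the source is that of the
   Caratheodory-measurable sets of the Lebesgue outer measure. *)
Definition lebesgue_measurable_fun (D : set R) u : Prop :=
  measurable_fun (D : set (caratheodory_type (wlength (@idfun R))^*%mu)) u.

Definition lebesgue_measurable_curve (D : set R) g : Prop := forall j,
  lebesgue_measurable_fun D (fun t => complex.Re (g t ord0 j)) /\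
  lebesgue_measurable_fun D (fun t => complex.Im (g t ord0 j)).

End curves.

(* A mapping from the polydisc to C^n is represented by a total function
   C^n -> C^n; none of the notions below depends on its values off the
   polydisc. *)
Section polydisc.
Context {R : realType} {n : nat}.
Local Notation C := R[i].
Local Notation Cn := 'rV[R[i]]_n.

Definition polydisc : set Cn := [set z | `|z| < 1].

(* The topology of locally uniform convergence on the polydisc, i.e. of uniform
   convergence on its compact subsets. *)
Definition mappings := {family compactly_in polydisc, Cn -> Cn}.
HB.instance Definition _ := Uniform.on mappings.

Definition holomorphic : set mappings :=
  [set f | forall z, polydisc z -> differentiable (f : Cn -> Cn) z].

Definition univalent : set mappings :=
  [set f | holomorphic f /\ {in polydisc &, injective f}].

(* Sequential form of normality, in the space of holomorphic mappings. *)
Definition normal_family (E : set mappings) : Prop :=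
  forall u : nat -> mappings, (forall k, E (u k)) ->
    exists (s : nat -> nat) (g : mappings),
      [/\ {homo s : i j / (i < j)%N}, holomorphic g & u \o s @ \oo --> g].

Definition class_S : set mappings :=
  [set f | [/\ univalent f, f 0 = 0 & 'd (f : Cn -> Cn) 0 =1 id]].

Definition class_M : set mappings :=
  [set h | [/\ holomorphic h, h 0 = 0, 'd (h : Cn -> Cn) 0 =1 -%R &
    forall (z : Cn) (j : 'I_n), polydisc z ->
      `|z| = `|z ord0 j| -> 0 < `|z ord0 j| ->
      complex.Re (h z ord0 j / z ord0 j) <= 0]].

Definition Herglotz_field (G : Cn -> R -> Cn) : Prop :=
  (forall t, 0 <= t -> class_M (G^~ t)) /\
  (forall z, polydisc z -> lebesgue_measurable_curve `[0, +oo[ (G z)).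

(* phi t is the mapping phi_(s,t). As usual for an equation that holds for
   almost all t, solutions are locally absolutely continuous in t. *)
Definition Loewner_solution (G : Cn -> R -> Cn) (s : R) (phi : R -> mappings) :
    Prop :=
  forall z, polydisc z ->
    [/\ phi s z = z,
        forall t, s <= t -> polydisc (phi t z),
        forall t, s <= t -> abs_continuous_curve (phi^~ z) s t &
        {ae lebesgue_measure, forall t, s <= t ->
          has_time_derivative (phi^~ z) t (G (phi t z) t)}].

Definition class_S0 : set mappings :=
  [set f | class_S f /\
    exists (G : Cn -> R -> Cn) (phi : R -> mappings),
      [/\ Herglotz_field G, Loewner_solution G 0 phi &
          ((fun z => (expR t)%:C *: phi t z) : mappings) @[t --> +oo] --> f]].

Definition normalized_Loewner_chain (F : R -> mappings) : Prop :=
  (forall t, 0 <= t ->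
    [/\ univalent (F t), F t 0 = 0 &
        forall v, 'd (F t : Cn -> Cn) 0 v = (expR t)%:C *: v]) /\
  (forall s t, 0 <= s -> s <= t -> F s @` polydisc `<=` F t @` polydisc).

(* Continuous C-linear functionals on the space of holomorphic mappings.
   Mappings that agree on the polydisc are inseparable in this topology, so
   L f depends only on the restriction of f to the polydisc. *)
Definition continuous_linear_functional (L : mappings -> C) : Prop :=
  (forall (a : C) (f g : mappings), holomorphic f -> holomorphic g ->
    L (fun z => a *: f z + g z) = a * L f + L g) /\
  {within holomorphic, continuous L}.

Definition supp (E : set mappings) : set mappings :=
  [set f | E f /\ exists L : mappings -> C,
    [/\ continuous_linear_functional L,
        exists g h, [/\ E g, E h & complex.Re (L g) <> complex.Re (L h)] &
        forall g, E g -> complex.Re (L g) <= complex.Re (L f)]].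

End polydisc.

Arguments mappings : clear implicits.
Arguments polydisc : clear implicits.

(* Main.v *)
(* Let phi_(s,t) = F_t^-1 o F_s be the transition maps of the chain. If g is in
   S^0, gluing the Herglotz vector field of the chain on [0, t[ to that of g
   after time t shows that e^t g o phi_(0,t) is in S^0. Hence, if L is maximal
   at f = F_t o phi_(0,t), the functional g |-> L (e^t g o phi_(0,t)) is
   maximal over S^0 at e^-t F_t. It is not constant on S^0: otherwise, id + c g
   being starlike for small c, L (g o phi_(0,t)) = 0 for all g of order two at
   the origin that are holomorphic beyond the closed polydisc. For s close to
   t, phi_(s,t) is close to the identity, so that any such g is, on the smaller
   polydisc carrying L, a limit of maps p o phi_(s,t), where p is a partial sum
   of the homogeneous expansion of g o phi_(s,t)^-1. Going back to time 0 in
   small steps gives L g = 0 for all such g, and L is constant on S^0.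

   A normal chain has a Herglotz vector field because phi_(s,t) is Lipschitz in
   t by the Schwarz lemma, hence differentiable for almost every t, first for
   countably many s and z, then for all z by equicontinuity. *)

Require Import Defs.
From HB Require Import structures.
From mathcomp Require Import all_boot all_order all_algebra.
From mathcomp Require Import all_classical all_reals all_analysis.
From mathcomp.real_closed Require Import complex.
From mathcomp Require Import perm ring lra.

Set Implicit Arguments.
Unset Strict Implicit.
Unset Printing Implicit Defensive.

Import Order.TTheory GRing.Theory Num.Theory.
Import numFieldNormedType.Exports.

Local Open Scope classical_set_scope.
Local Open Scope ring_scope.
Local Open Scope complex_scope.

(** * The real-valued norm and complex differentials *)

Section real_norm.
Context {R : realType}.
Local Notation C := R[i].

(** The delicate point is that the pulled back functional is not constant. For one transition map
    phi one would approximate g o phi^-1 on the image of phi by maps holomorphic beyond the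
    polydisc, which asks for a Runge property of that image. Short steps avoid it: the inverse of a
    map close to the identity is defined on a whole polydisc, where homogeneous expansions converge.
    The admissible step length depends only on the polydisc that carries L and not on the time, so
    finitely many steps reach time 0. Perturbations id + c g keep the normalization, and c may be
    multiplied by i, so constancy of a real part already forces a complex number to vanish.
    Transition maps are holomorphic because injective holomorphic maps between spaces of equal
    dimension have invertible differentials. That theorem and the Schwarz lemma rest on one-variable
    Cauchy theory, built here from dyadic Riemann sums. The vector field is a limit of difference
    quotients along one sequence of steps, with value -w at exceptional times, because it must lie
    in the class M at every time. *)

Definition nrm {V : normedModType R[i]} (v : V) : R := complex.Re `|v|.

Section generic.
Context {V : normedModType C}.
Implicit Types (v w : V) (a : C).

(** The norm itself has values in R[i]; estimates are carried out on its real part, where the order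
    is total and [lra] applies. *)
Lemma nrmE v : `|v| = (nrm v)%:C.
Proof. by rewrite /nrm RRe_real // normr_real. Qed.

Lemma nrm_ge0 v : 0 <= nrm v.
Proof. by rewrite -ler0c -nrmE. Qed.

Lemma nrm0 : nrm (0 : V) = 0.
Proof. by rewrite /nrm normr0. Qed.

Lemma nrm_eq0 v : nrm v = 0 -> v = 0.
Proof. by move=> h; apply/eqP; rewrite -normr_eq0 nrmE h. Qed.

Lemma nrm_gt0 v : v != 0 -> 0 < nrm v.
Proof.
move=> v0; rewrite lt_neqAle nrm_ge0 andbT eq_sym.
by apply/eqP => /nrm_eq0/eqP; exact/negP.
Qed.

Lemma nrmD v w : nrm (v + w) <= nrm v + nrm w.
Proof. by rewrite -lecR rmorphD /= -!nrmE ler_normD. Qed.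

Lemma nrmN v : nrm (- v) = nrm v.
Proof. by rewrite /nrm normrN. Qed.

Lemma nrmB v w : nrm (v - w) <= nrm v + nrm w.
Proof. by rewrite -(nrmN w) nrmD. Qed.

Lemma nrmC v w : nrm (v - w) = nrm (w - v).
Proof. by rewrite -nrmN opprB. Qed.

Lemma nrm_tri u v w : nrm (v - w) <= nrm (v - u) + nrm (u - w).
Proof. by rewrite -[v - w](subrKA u) nrmD. Qed.

Lemma nrm_lowD v w : nrm v - nrm w <= nrm (v + w).
Proof. by rewrite lerBlDr -{1}(addrK w v) (le_trans (nrmB _ _)). Qed.

Lemma nrm_dist v w : `|nrm v - nrm w| <= nrm (v - w).
Proof.
have h1 := nrm_lowD v (- w); have h2 := nrm_lowD w (- v).
rewrite !nrmN in h1 h2; rewrite nrmC in h2.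
by rewrite ler_norml; apply/andP; split; lra.
Qed.

Lemma nrmZ a v : nrm (a *: v) = nrm (a : C) * nrm v.
Proof. by apply: complexI; rewrite rmorphM /= -!nrmE normrZ. Qed.

Lemma nrm_sum (I : Type) (r : seq I) (P : pred I) (F : I -> V) :
  nrm (\sum_(i <- r | P i) F i) <= \sum_(i <- r | P i) nrm (F i).
Proof.
elim/big_ind2 : _ => [|x1 x2 y1 y2 h1 h2|//]; first by rewrite nrm0.
exact: le_trans (nrmD _ _) (lerD h1 h2).
Qed.

Lemma nbhs_nrm v (P : set V) :
  nbhs v P <-> exists2 d : R, 0 < d & forall w, nrm (w - v) < d -> P w.
Proof.
split=> [/nbhs_ballP [e /= e0 h]|[d d0 h]].
- exists (complex.Re e); first by move: e0; rewrite ltcE /= => /andP[].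
  move=> w hw; apply: h; rewrite -ball_normE /= distrC nrmE.
  have -> : e = (complex.Re e)%:C by rewrite RRe_real ?gtr0_real.
  by rewrite ltcR.
- apply/nbhs_ballP; exists d%:C => /=; first by rewrite -[0]/(0%:C) ltcR.
  by move=> w; rewrite -ball_normE /= distrC nrmE ltcR; apply: h.
Qed.

Lemma cvg_nrm {T : Type} (F : set_system T) {FF : Filter F} (f : T -> V) v :
  f @ F --> v <-> forall e : R, 0 < e -> \forall x \near F, nrm (f x - v) < e.
Proof.
split=> [h e e0|h P /nbhs_nrm [d d0 hd]].
- by apply: (h [set w | nrm (w - v) < e]); apply/nbhs_nrm; exists e.
- by apply: filterS (h _ d0) => x; apply: hd.
Qed.

End generic.

Lemma nrmc (z : C) : nrm z = Num.sqrt (complex.Re z ^+ 2 + complex.Im z ^+ 2).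
Proof. by rewrite /nrm normc_def. Qed.

Lemma nrmM (a b : C) : nrm (a * b) = nrm a * nrm b.
Proof. exact: nrmZ. Qed.

Lemma nrm1 : nrm (1 : C) = 1.
Proof. by rewrite /nrm normr1. Qed.

Lemma nrmX (a : C) k : nrm (a ^+ k) = nrm a ^+ k.
Proof.
by elim: k => [|k ih]; rewrite ?expr0 ?nrm1 // !exprS nrmM ih.
Qed.

Lemma nrmV (a : C) : nrm a^-1 = (nrm a)^-1.
Proof. by apply: complexI; rewrite fmorphV /= -!nrmE normfV. Qed.

Lemma nrm_real (x : R) : nrm (x%:C : C) = `|x|.
Proof. by rewrite nrmc /= expr0n addr0 sqrtr_sqr. Qed.

Lemma nrm_i : nrm ('i%C : C) = 1.
Proof. by rewrite nrmc /= expr0n add0r expr1n sqrtr1. Qed.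

Lemma ler_Re_nrm (z : C) : `|complex.Re z| <= nrm z.
Proof. by rewrite nrmc -sqrtr_sqr ler_wsqrtr // lerDl sqr_ge0. Qed.

Lemma ler_Im_nrm (z : C) : `|complex.Im z| <= nrm z.
Proof. by rewrite nrmc -sqrtr_sqr ler_wsqrtr // lerDr sqr_ge0. Qed.

Lemma nrm_le_ReIm (z : C) : nrm z <= `|complex.Re z| + `|complex.Im z|.
Proof.
rewrite [z]complexE (le_trans (nrmD _ _)) //= nrmM nrm_i mul1r !nrm_real.
by rewrite !mulr0 !mul0r !mul1r ?subr0 ?addr0 ?add0r.
Qed.

Lemma ReD (a b : C) : complex.Re (a + b) = complex.Re a + complex.Re b.
Proof. by case: a b => [? ?] []. Qed.
Lemma ImD (a b : C) : complex.Im (a + b) = complex.Im a + complex.Im b.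
Proof. by case: a b => [? ?] []. Qed.
Lemma ReN (a : C) : complex.Re (- a) = - complex.Re a.
Proof. by case: a. Qed.
Lemma ImN (a : C) : complex.Im (- a) = - complex.Im a.
Proof. by case: a. Qed.
Lemma ReB (a b : C) : complex.Re (a - b) = complex.Re a - complex.Re b.
Proof. by rewrite ReD ReN. Qed.
Lemma ImB (a b : C) : complex.Im (a - b) = complex.Im a - complex.Im b.
Proof. by rewrite ImD ImN. Qed.
Lemma ReZ (x : R) (a : C) : complex.Re (x%:C * a) = x * complex.Re a.
Proof. by case: a => a b /=; rewrite mul0r subr0. Qed.
Lemma ImZ (x : R) (a : C) : complex.Im (x%:C * a) = x * complex.Im a.
Proof. by case: a => a b /=; rewrite mul0r addr0. Qed.

Section rows.
Context {n : nat}.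
Local Notation Cn := 'rV[C]_n.

Lemma nrm_coord (v : Cn) j : nrm (v ord0 j : C) <= nrm v.
Proof.
rewrite -lecR -!nrmE [leRHS]/Num.norm /= mx_normE -[leLHS]nngE num_le.
exact: (le_bigmax _ (fun i => `|v i.1 i.2|%:nng) (ord0, j)).
Qed.

Lemma nrm_attained (v : Cn) : v != 0 -> exists j, nrm v = nrm (v ord0 j : C).
Proof.
rewrite -normr_eq0 => /mx_norm_neq0 [[i j]] /=; rewrite (ord1 i) => h; exists j.
by apply: complexI; rewrite -!nrmE [LHS]/Num.norm.
Qed.

Lemma nrm_row_le (v : Cn) (r : R) : 0 <= r ->
  (forall j, nrm (v ord0 j : C) <= r) -> nrm v <= r.
Proof.
move=> r0 h; have [->|/nrm_attained [j ->]] := eqVneq v 0; last exact: h.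
by rewrite nrm0.
Qed.

Lemma polydiscE (z : Cn) : polydisc R n z = (nrm z < 1) :> Prop.
Proof. by rewrite /polydisc /= nrmE -[1]/(1%:C) ltcR. Qed.

End rows.
End real_norm.

(* [v] and [w] agree up to the choice of canonical instances. *)
Ltac alike v w := first
  [ constr_eq v w
  | lazymatch v with
    | ?a + ?b => lazymatch w with ?c + ?d => alike a c; alike b d end
    | - ?a => lazymatch w with - ?c => alike a c end
    end ].

(* Abstracting the norms keeps [lra] from comparing vectors up to conversion. *)
Ltac order_lra := first
  [ solve [ repeat match goal with H : ?T |- _ => lazymatch T with
        | is_true (_ <= _) => fail | is_true (_ < _) => fail
        | is_true (_ <= _ <= _) => fail | is_true (_ < _ < _) => fail
        | is_true (_ < _ <= _) => fail | is_true (_ <= _ < _) => fail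
        | _ = _ :> Real.sort _ => fail
        | _ => clear H end end;
      repeat match goal with H := _ |- _ => clearbody H end;
      repeat match goal with H : is_true _ |- _ => revert H | H : _ = _ |- _ => revert H end;
      repeat match goal with |- context [@nrm ?A ?B ?v] =>
        repeat match goal with |- context [@nrm ?A' ?B' ?w] =>
          assert_fails (constr_eq (@nrm A B v) (@nrm A' B' w)); alike v w;
          change (@nrm A' B' w) with (@nrm A B v) end;
        generalize (@nrm A B v); intro end;
      intros; lra ]
  | lra ].

Section differentials.
Context {R : realType} {V W : normedModType R[i]}.
Implicit Types (f : V -> W) (x : V).

Lemma diff_nrm f x : differentiable f x -> forall e : R, 0 < e ->
  exists2 d : R, 0 < d & forall h, nrm h < d ->
    nrm (f (x + h) - f x - 'd f x h) <= e * nrm h.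
Proof.
move=> df e e0.
have /eqaddoP h := diff_locally df.
have /h : 0 < e%:C by rewrite -[0]/(0%:C) ltcR.
move=> /nbhs_nrm [d d0 hd]; exists d => // w wd.
have := hd w; rewrite subr0 => /(_ wd) /=.
rewrite [X in X w]/= !fctE /=.
by rewrite !nrmE -rmorphM lecR opprD addrA [w + x]addrC.
Qed.

(** Existence and value of a differential come together: by uniqueness it is any continuous linear
    map that satisfies the first order estimate. *)
Lemma nrm_diff f x (L : {linear V -> W}) : continuous L ->
  (forall e : R, 0 < e -> exists2 d : R, 0 < d & forall h, nrm h < d ->
    nrm (f (x + h) - f x - L h) <= e * nrm h) ->
  differentiable f x /\ 'd f x =1 L.
Proof.
move=> Lc h.
have H : f \o shift x = cst (f x) + L +o_ 0 id.
  apply/eqaddoP => e e0.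
  have e0' : 0 < complex.Re e by move: e0; rewrite ltcE /= => /andP[].
  have eE : e = (complex.Re e)%:C by rewrite RRe_real ?gtr0_real.
  have [d d0 hd] := h _ e0'.
  apply/nbhs_nrm; exists d => // w; rewrite subr0 => /hd.
  rewrite !fctE /= !nrmE eE -rmorphM lecR [w + x]addrC.
  by rewrite opprD addrA.
have dE := diff_unique Lc H.
split; last by move=> w; rewrite dE.
by apply/diff_locallyP; rewrite dE; split.
Qed.

Lemma diff_ext f g x : differentiable f x ->
  (exists2 d : R, 0 < d & forall y, nrm (y - x) < d -> g y = f y) ->
  differentiable g x /\ 'd g x =1 'd f x.
Proof.
move=> df [d d0 hd]; apply: (@nrm_diff g x ('d f x)); first exact: diff_continuous.
move=> e e0; have [d' d0' hd'] := diff_nrm df e0.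
exists (Num.min d d'); first by rewrite lt_min d0.
move=> h; rewrite lt_min => /andP[h1 h2].
by rewrite !hd ?subrr ?nrm0 //; [exact: hd'|rewrite addrAC subrr add0r].
Qed.

Lemma diff_cont f x : differentiable f x -> forall e : R, 0 < e ->
  exists2 d : R, 0 < d & forall y, nrm (y - x) < d -> nrm (f y - f x) < e.
Proof.
move=> /differentiable_continuous /cvg_nrm h e /h /nbhs_nrm [d d0 hd].
by exists d.
Qed.

End differentials.

Section pointwise_differentiability.
Context {R : realType} {V W : normedModType R[i]}.
Implicit Types (f g : V -> W) (a b : V -> R[i]) (x : V).

Lemma dD f g x : differentiable f x -> differentiable g x ->
  differentiable (fun y => f y + g y) x.
Proof. exact: differentiableD. Qed.

Lemma dB f g x : differentiable f x -> differentiable g x ->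
  differentiable (fun y => f y - g y) x.
Proof. exact: differentiableB. Qed.

Lemma dM a b x : differentiable a x -> differentiable b x ->
  differentiable (fun y => a y * b y) x.
Proof. exact: differentiableM. Qed.

Lemma dV a x : differentiable a x -> a x != 0 -> differentiable (fun y => (a y)^-1) x.
Proof. exact: differentiableV. Qed.

Lemma dX a x k : differentiable a x -> differentiable (fun y => a y ^+ k) x.
Proof.
move=> h; elim: k => [|k ih]; first exact: (differentiable_cst (1 : R[i])).
have -> : (fun y => a y ^+ k.+1) = (fun y => a y * a y ^+ k).
  by apply/funext => y; rewrite exprS.
exact: dM.
Qed.

Lemma dbigsum (I : Type) (r : seq I) (F : I -> V -> W) x :
  (forall i, differentiable (F i) x) -> differentiable (fun y => \sum_(i <- r) F i y) x.
Proof.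
move=> h; elim: r => [|i r ih].
  have -> : (fun y => \sum_(i <- [::]) F i y) = cst 0.
    by apply/funext => y; rewrite big_nil.
  exact: differentiable_cst.
have -> : (fun y => \sum_(i0 <- i :: r) F i0 y) = (fun y => F i y + \sum_(j <- r) F j y).
  by apply/funext => y; rewrite big_cons.
exact: dD.
Qed.

End pointwise_differentiability.

Lemma dcoord {R : realType} {n : nat} (v : 'rV[R[i]]_n) j :
  differentiable (fun w : 'rV[R[i]]_n => w ord0 j) v.
Proof. exact: differentiable_coord. Qed.

Lemma did {R : realType} {V : normedModType R[i]} (v : V) : differentiable (fun w => w) v.
Proof. exact: ex_diff. Qed.

Lemma dcst {R : realType} {V W : normedModType R[i]} (w : W) (v : V) :
  differentiable (fun=> w) v.
Proof. exact: differentiable_cst. Qed.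

Lemma dcomp {R : realType} {U V W : normedModType R[i]} (f : U -> V) (g : V -> W) x :
  differentiable f x -> differentiable g (f x) -> differentiable (fun y => g (f y)) x.
Proof. by move=> h1 h2; apply: (@differentiable_comp _ _ _ _ f g). Qed.

(** * Cauchy's theory in one variable *)

Section dyadic.
Context {R : realType}.
Local Notation C := R[i].
Implicit Types (u v : R -> C) (m k : nat) (e M : R) (c a b z w : C).

Lemma cvg_seqP {V : normedModType C} (s : nat -> V) (l : V) :
  s @ \oo --> l <-> forall e, 0 < e -> exists N : nat, forall k, (N <= k)%N ->
    nrm (s k - l) < e.
Proof.
split=> [/cvg_nrm h e /h [N _ hN]|h]; first by exists N => k /hN.
by apply/cvg_nrm => e /h [N hN]; exists N.
Qed.

Lemma ler_cvg_nrm {V : normedModType C} (s : nat -> V) (l : V) M :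
  s @ \oo --> l -> (exists N : nat, forall k, (N <= k)%N -> nrm (s k) <= M) -> nrm l <= M.
Proof.
move=> /cvg_seqP h [N0 hM]; apply/ler_addgt0Pr => e /h [N hN].
have k1 := hN _ (leq_maxr N0 N); have k2 := hM _ (leq_maxl N0 N).
have := nrm_lowD (s (maxn N0 N)) (l - s (maxn N0 N)).
have := nrmD (s (maxn N0 N)) (l - s (maxn N0 N)).
rewrite addrC subrK nrmC; rewrite nrmC in k1; rewrite nrmC in k1; order_lra.
Qed.

Lemma cvgC_uniq {V : normedModType C} (s : nat -> V) (l l' : V) :
  s @ \oo --> l -> s @ \oo --> l' -> l = l'.
Proof.
move=> /cvg_seqP h /cvg_seqP h'; apply/eqP; rewrite -subr_eq0; apply/eqP.
apply: nrm_eq0; apply/eqP; rewrite eq_le nrm_ge0 andbT.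
apply/ler_addgt0Pr => e e0; have e2 : 0 < e / 2 by order_lra.
have [N hN] := h _ e2; have [N' hN'] := h' _ e2.
have k1 := hN _ (leq_maxl N N'); have k2 := hN' _ (leq_maxr N N').
have := nrm_tri (s (maxn N N')) l l'; rewrite nrmC in k1; order_lra.
Qed.

Lemma half_pow_small e : 0 < e -> exists N : nat, forall k, (N <= k)%N -> (2^-1 : R) ^+ k < e.
Proof.
move=> e0; have : ((2^-1 : R) ^+ k) @[k --> \oo] --> (0 : R).
  by apply: cvg_expr; rewrite ger0_norm ?invr_ge0 // invf_lt1 // ltr1n.
move=> /cvgrPdist_lt /(_ _ e0) [N _ hN]; exists N => k /hN /=.
by rewrite sub0r normrN ger0_norm // exprn_ge0 // invr_ge0.
Qed.

Lemma cauchyC (s : nat -> C) :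
  (forall e, 0 < e -> exists N : nat, forall i j, (N <= i)%N -> (N <= j)%N ->
     nrm (s i - s j) <= e) -> exists l : C, s @ \oo --> l.
Proof.
move=> h.
have cv (g : C -> R) : (forall x y, `|g x - g y| <= nrm (x - y)) ->
    exists l : R, g \o s @ \oo --> l.
  move=> gl; suff /cvg_ex : cvg (g \o s @ \oo) by [].
  apply/cauchy_cvgP/cauchy_exP => e e0.
  have e2 : 0 < e / 2 by order_lra.
  have [N hN] := h _ e2; exists (g (s N)); exists N => // k hk /=.
  rewrite /ball /=; have := gl (s N) (s k); have := hN N k (leqnn N) hk; order_lra.
have [a ha] := cv (@complex.Re R) (fun x y => eq_ind _ (fun t => `|t| <= _) (ler_Re_nrm (x - y)) _ (ReB x y)).
have [b hb] := cv (@complex.Im R) (fun x y => eq_ind _ (fun t => `|t| <= _) (ler_Im_nrm (x - y)) _ (ImB x y)).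
exists (a +i* b); apply/cvg_seqP => e e0; have e2 : 0 < e / 2 by order_lra.
move/cvgrPdist_lt: ha => /(_ _ e2) [N _ hN].
move/cvgrPdist_lt: hb => /(_ _ e2) [N' _ hN'].
exists (maxn N N') => k hk; have := nrm_le_ReIm (s k - (a +i* b)).
have := hN k (leq_trans (leq_maxl _ _) hk); have := hN' k (leq_trans (leq_maxr _ _) hk).
rewrite /= ReB ImB /= ![`|a - _|]distrC ![`|b - _|]distrC; order_lra.
Qed.

(** Left Riemann sum over the 2^m dyadic cells of [0, 1]. The recursion cuts at 1/2, so that halving
    the interval is an identity between sums and not only between limits. *)
Fixpoint dsum m u : C :=
  if m is m'.+1 then
    2^-1 * (dsum m' (fun x => u (x / 2)) + dsum m' (fun x => u ((1 + x) / 2)))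
  else u 0.

Lemma nrm_half : nrm (2^-1 : C) = 2^-1.
Proof. by rewrite nrmV -(rmorph_nat (real_complex R)) nrm_real normr_nat. Qed.

Lemma eq_dsum m u v : (forall x, 0 <= x <= 1 -> u x = v x) -> dsum m u = dsum m v.
Proof.
elim: m u v => [|m ih] u v h /=; first by apply: h; rewrite lexx ler01.
by congr (_ * (_ + _)); apply: ih => x /andP[x0 x1]; apply: h; apply/andP; order_lra.
Qed.

Lemma dsum_lin m (a b : C) u v :
  dsum m (fun x => a * u x + b * v x) = a * dsum m u + b * dsum m v.
Proof. by elim: m u v => [//|m ih] u v /=; rewrite !ih; ring. Qed.

Lemma dsum_cst m (a : C) : dsum m (fun=> a) = a.
Proof. by elim: m => [//|m ih] /=; rewrite !ih; field. Qed.

Lemma dsum_id m : dsum m (fun x => x%:C) = 2^-1 - 2^-1 * (2^-1) ^+ m.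
Proof.
elim: m => [|m ih] /=; first by rewrite expr0; field.
transitivity (2^-1 * (dsum m (fun x => 2^-1 * x%:C + 0 * x%:C) +
  dsum m (fun x => 2^-1 * (fun=> 1) x + 2^-1 * x%:C)) : C).
  have h2 : (2 : R)%:C = 2 :> C by rewrite -(rmorph_nat (real_complex R)).
  congr (_ * (_ + _)); apply: eq_dsum => x _.
    by rewrite rmorphM fmorphV /= h2; ring.
  by rewrite rmorphM fmorphV rmorphD /= h2; ring.
by rewrite !dsum_lin dsum_cst ih exprS; field.
Qed.

Lemma dsum_bound m u M : (forall x, 0 <= x <= 1 -> nrm (u x) <= M) ->
  nrm (dsum m u) <= M.
Proof.
elim: m u => [|m ih] u h /=; first by apply: h; rewrite lexx ler01.
rewrite nrmM nrm_half.
have h1 : nrm (dsum m (fun x => u (x / 2))) <= M.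
  by apply: ih => x /andP[x0 x1]; apply: h; apply/andP; order_lra.
have h2 : nrm (dsum m (fun x => u ((1 + x) / 2))) <= M.
  by apply: ih => x /andP[x0 x1]; apply: h; apply/andP; order_lra.
have := nrmD (dsum m (fun x => u (x / 2))) (dsum m (fun x => u ((1 + x) / 2))).
order_lra.
Qed.

(** The scale 2^-m is the mesh of [dsum m]; rescaling a half interval to [0, 1] lowers m by one, in
    step with the recursion. *)
Definition osc_le m u e := forall x y, 0 <= x <= 1 -> 0 <= y <= 1 ->
  `|x - y| <= 2^-1 ^+ m -> nrm (u x - u y) <= e.

Lemma osc_leSl m u e : osc_le m.+1 u e -> osc_le m (fun x => u (x / 2)) e.
Proof.
move=> h x y /andP[x0 x1] /andP[y0 y1] xy; apply: h; try by apply/andP; order_lra.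
rewrite exprS -mulrBl normrM mulrC [`|_^-1|]ger0_norm ?invr_ge0 //.
by rewrite ler_pM2l // invr_gt0.
Qed.

Lemma osc_leSr m u e : osc_le m.+1 u e -> osc_le m (fun x => u ((1 + x) / 2)) e.
Proof.
move=> h x y /andP[x0 x1] /andP[y0 y1] xy; apply: h; try by apply/andP; order_lra.
rewrite exprS -mulrBl normrM mulrC [`|_^-1|]ger0_norm ?invr_ge0 //.
by rewrite ler_pM2l ?invr_gt0 // [1 + x]addrC addrKA.
Qed.

(** At level 0 the refined sum is a mean of values of u, each within e of u 0; halving carries this
    to every level. Hence the sums are Cauchy once u is uniformly continuous. *)
Lemma dsum_osc m k u e : osc_le m u e -> nrm (dsum (m + k) u - dsum m u) <= e.
Proof.
elim: m u => [|m ih] u h.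
  have -> : dsum (0 + k) u - dsum 0 u = dsum k (fun x => 1 * u x + (-1) * (fun=> u 0) x).
    by rewrite dsum_lin dsum_cst /= add0n; ring.
  apply: dsum_bound => x x01; rewrite mul1r mulN1r; apply: h => //.
    by rewrite lexx ler01.
  by rewrite subr0 expr0 ger0_norm; case/andP: x01.
rewrite addSn /=.
set A := dsum _ _; set B := dsum _ _; set A' := dsum m _; set B' := dsum m _.
have hA : nrm (A - A') <= e by apply/ih/osc_leSl.
have hB : nrm (B - B') <= e by apply/ih/osc_leSr.
have -> : 2^-1 * (A + B) - 2^-1 * (A' + B') = 2^-1 * ((A - A') + (B - B')) by ring.
rewrite nrmM nrm_half; have := nrmD (A - A') (B - B'); order_lra.
Qed.

(** Reversal turns left sums into right sums, which differ from the left ones by the oscillation on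
    one cell. *)
Lemma dsum_rev m u e : osc_le m u e ->
  nrm (dsum m (fun x => u (1 - x)) - dsum m u) <= e.
Proof.
elim: m u => [|m ih] u h /=.
  by rewrite subr0; apply: h; rewrite ?lexx ?ler01 // subr0 normr1 expr0.
have hA := ih _ (osc_leSl h); have hB := ih _ (osc_leSr h).
have e1 : dsum m (fun x => u (1 - x / 2)) = dsum m (fun x => u ((1 + (1 - x)) / 2)).
  by apply: eq_dsum => x _; congr u; field.
have e2 : dsum m (fun x => u (1 - (1 + x) / 2)) = dsum m (fun x => u ((1 - x) / 2)).
  by apply: eq_dsum => x _; congr u; field.
rewrite e1 e2.
set A := dsum m _ in hA *; set B := dsum m _ in hB *.
move: hA hB; set A' := dsum m _; set B' := dsum m _ => hA hB.
have -> : 2^-1 * (B + A) - 2^-1 * (A' + B') = 2^-1 * ((A - A') + (B - B')) by ring.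
rewrite nrmM nrm_half; have := nrmD (A - A') (B - B'); order_lra.
Qed.

Definition cont01 u := forall x, 0 <= x <= 1 -> forall e, 0 < e ->
  exists2 d, 0 < d & forall y, 0 <= y <= 1 -> `|y - x| < d -> nrm (u y - u x) < e.

(** Uniform continuity on a compact interval, by covering [0, 1] with the neighbourhoods that
    continuity provides. *)
Lemma cont01_osc u : cont01 u -> forall e, 0 < e -> exists N : nat, forall m,
  (N <= m)%N -> osc_le m u e.
Proof.
move=> cu e e0.
have /compact_near_coveringP/near_covering_withinP := @segment_compact R 0 1.
pose P (m : nat) (x : R) := forall y, 0 <= y <= 1 ->
  `|x - y| <= 2^-1 ^+ m -> nrm (u x - u y) <= e.
move=> /(_ nat \oo P _) [].
  move=> x; rewrite /= in_itv /= => x01.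
  have e2 : 0 < e / 2 by order_lra.
  have [d d0 hd] := cu x x01 _ e2.
  (* One half of d is spent on the distance from x' to x, the other half on the mesh. *)
  have d2 : 0 < d / 2 by order_lra.
  have [N hN] := half_pow_small d2.
  exists ([set y | `|x - y| < d / 2], [set m | (N <= m)%N]) => /=.
    by split; [exact: (@nbhsx_ballx _ _ x (d/2) d2)|exists N].
  move=> [x' m] /= [hx' hm]; rewrite in_itv /= => x'01 y y01 hy.
  have := hN m hm => hN'.
  have h1 : nrm (u x' - u x) < e / 2 by apply: hd => //; rewrite distrC; order_lra.
  have h2 : nrm (u y - u x) < e / 2.
    apply: hd => //; have := ler_distD x' y x.
    rewrite [`|y - x'|]distrC [`|x' - x|]distrC; order_lra.
  have := nrm_tri (u x) (u x') (u y); rewrite [nrm (u x - u y)]nrmC; order_lra.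
move=> N _ hN; exists N => m hm x y x01 y01 xy.
by apply: (hN m hm x) => //; rewrite /= in_itv.
Qed.

(** The integral over [0, 1] as the limit of the dyadic sums, with the default value 0 if they
    diverge. *)
Definition dint u : C := xget 0 [set l | dsum^~ u @ \oo --> l].

Lemma dintP u : cont01 u -> dsum^~ u @ \oo --> dint u.
Proof.
move=> cu; suff h : exists l : C, dsum^~ u @ \oo --> l.
  exact: (xgetPex 0 (P := [set l : C | dsum^~ u @ \oo --> l]) h).
apply: cauchyC => e e0; have e2 : 0 < e / 2 by order_lra.
have [N hN] := cont01_osc cu e2; exists N => i j hi hj.
have := nrm_tri (dsum N u) (dsum i u) (dsum j u).
have := dsum_osc (i - N) (hN _ (leqnn N)); have := dsum_osc (j - N) (hN _ (leqnn N)).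
rewrite !subnKC // => h1 h2; rewrite [nrm (dsum N u - _)]nrmC; order_lra.
Qed.

Lemma dint_eq u l : dsum^~ u @ \oo --> l -> dint u = l.
Proof.
move=> h; apply: (cvgC_uniq _ h).
exact: (xgetPex 0 (P := [set l | dsum^~ u @ \oo --> l]) (ex_intro _ l h)).
Qed.

Lemma eq_dint u v : (forall x, 0 <= x <= 1 -> u x = v x) -> dint u = dint v.
Proof.
move=> h; rewrite /dint; congr xget; apply/seteqP.
have -> : dsum^~ u = dsum^~ v by apply/funext => m; exact: eq_dsum.
by split.
Qed.

Lemma dint_lin (a b : C) u v : cont01 u -> cont01 v ->
  dint (fun x => a * u x + b * v x) = a * dint u + b * dint v.
Proof.
move=> cu cv; apply: dint_eq.
have -> : dsum^~ (fun x => a * u x + b * v x) =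
    (fun m => a * dsum m u + b * dsum m v).
  by apply/funext => m; exact: dsum_lin.
by apply: cvgD; apply: cvgM; [exact: cvg_cst|exact: dintP|exact: cvg_cst|exact: dintP].
Qed.

Lemma dint_cst (a : C) : dint (fun=> a) = a.
Proof.
apply: dint_eq.
have -> : dsum^~ (fun=> a) = (fun=> a) by apply/funext => m; exact: dsum_cst.
exact: cvg_cst.
Qed.

Lemma dint_id : dint (fun x => x%:C) = 2^-1.
Proof.
apply: dint_eq; apply/cvg_seqP => e e0; have [N hN] := half_pow_small e0.
exists N => k /hN h; rewrite dsum_id addrAC subrr add0r nrmN nrmM nrmX nrm_half.
have : 0 <= (2^-1 : R) ^+ k by rewrite exprn_ge0 // invr_ge0.
order_lra.
Qed.

Lemma dint_bound u M : cont01 u -> (forall x, 0 <= x <= 1 -> nrm (u x) <= M) ->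
  nrm (dint u) <= M.
Proof.
move=> /dintP /ler_cvg_nrm h hM; apply: h; exists 0%N => k _; exact: dsum_bound.
Qed.

Lemma cont01_halfl u : cont01 u -> cont01 (fun x => u (x / 2)).
Proof.
move=> cu x /andP[x0 x1] e e0; have [|d d0 hd] := cu (x / 2) _ e e0.
  by apply/andP; order_lra.
exists d => // y /andP[y0 y1] yx; apply: hd; first by apply/andP; order_lra.
rewrite -mulrBl normrM [`|_^-1|]ger0_norm ?invr_ge0 //.
have := normr_ge0 (y - x); order_lra.
Qed.

Lemma cont01_halfr u : cont01 u -> cont01 (fun x => u ((1 + x) / 2)).
Proof.
move=> cu x /andP[x0 x1] e e0; have [|d d0 hd] := cu ((1 + x) / 2) _ e e0.
  by apply/andP; order_lra.
exists d => // y /andP[y0 y1] yx; apply: hd; first by apply/andP; order_lra.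
rewrite -mulrBl normrM [`|_^-1|]ger0_norm ?invr_ge0 // [1 + y]addrC addrKA.
have := normr_ge0 (y - x); order_lra.
Qed.

Lemma dint_split u : cont01 u ->
  dint u = 2^-1 * (dint (fun x => u (x / 2)) + dint (fun x => u ((1 + x) / 2))).
Proof.
move=> cu; apply: dint_eq.
rewrite -(cvg_shiftS (dsum^~ u)) /=; apply: cvgM; first exact: cvg_cst.
by apply: cvgD; apply: dintP; [exact: cont01_halfl|exact: cont01_halfr].
Qed.

Lemma dint_rev u : cont01 u -> dint (fun x => u (1 - x)) = dint u.
Proof.
move=> cu; apply: dint_eq; apply/cvg_seqP => e e0; have e2 : 0 < e / 2 by order_lra.
have [N hN] := cont01_osc cu e2.
have /cvg_seqP /(_ _ e2) [N' hN'] := dintP cu.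
exists (maxn N N') => k hk.
have h1 := hN' _ (leq_trans (leq_maxr _ _) hk).
have h2 := dsum_rev (hN _ (leq_trans (leq_maxl _ _) hk)).
have := nrm_tri (dsum k u) (dsum k (fun x => u (1 - x))) (dint u); order_lra.
Qed.

End dyadic.

(** * Goursat's theorem for parallelograms *)

Section goursat.
Context {R : realType}.
Local Notation C := R[i].
Implicit Types (h g : C -> C) (c a b z w : C).

(** Here [P x y k] speaks of the square of side 2^-k with lower left corner (x, y). A failure on the
    unit square would descend through nested squares to a point, near which P holds. *)
Lemma bisection (P : R -> R -> nat -> Prop) :
  (forall x y k, let d := 2^-1 ^+ k.+1 in
    P x y k.+1 -> P (x + d) y k.+1 -> P x (y + d) k.+1 -> P (x + d) (y + d) k.+1 ->
    P x y k) ->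
  (forall p q, 0 <= p <= 1 -> 0 <= q <= 1 -> exists K : nat, forall k x y,
    (K <= k)%N -> x <= p <= x + 2^-1 ^+ k -> y <= q <= y + 2^-1 ^+ k -> P x y k) ->
  P 0 0 0%N.
Proof.
move=> Psplit Ploc; apply: contrapT => nP.
have step (s : nat * (R * R)) : exists t : R * R,
    let k := s.1 in let d := 2^-1 ^+ k.+1 in
    ~ P s.2.1 s.2.2 k -> [/\ ~ P t.1 t.2 k.+1,
      s.2.1 <= t.1 <= s.2.1 + d & s.2.2 <= t.2 <= s.2.2 + d].
  case: s => k [x y] /=; have d0 : 0 <= 2^-1 ^+ k.+1 :> R by rewrite exprn_ge0 // invr_ge0.
  (* The choice below needs a total function; (0, 0) is an arbitrary value for squares on which P
     holds. *)
  have [h|h] := pselect (P x y k); first by exists (0, 0).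
  apply: contrapT => nt; apply: h; apply: Psplit.
  - apply: contrapT => h; apply: nt; exists (x, y) => _ /=; split => //; apply/andP; order_lra.
  - apply: contrapT => h; apply: nt; exists (x + 2^-1 ^+ k.+1, y) => _ /=; split => //; apply/andP; order_lra.
  - apply: contrapT => h; apply: nt; exists (x, y + 2^-1 ^+ k.+1) => _ /=; split => //; apply/andP; order_lra.
  - apply: contrapT => h; apply: nt; exists (x + 2^-1 ^+ k.+1, y + 2^-1 ^+ k.+1) => _ /=; split => //; apply/andP; order_lra.
have [f hf] := choice step.
pose z (k : nat) : R * R := iteri k (fun i s => f (i, s)) (0, 0).
have nPz k : ~ P (z k).1 (z k).2 k.
  by elim: k => [//|k ih]; have [] := hf (k, z k) ih.
have zS k : let d := 2^-1 ^+ k.+1 in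
    (z k).1 <= (z k.+1).1 <= (z k).1 + d /\ (z k).2 <= (z k.+1).2 <= (z k).2 + d.
  by have [] := hf (k, z k) (nPz k).
have lim (x : nat -> R) : x 0%N = 0 ->
    (forall k, x k <= x k.+1 <= x k + 2^-1 ^+ k.+1) ->
    exists2 p, 0 <= p <= 1 & forall k, x k <= p <= x k + 2^-1 ^+ k.
  move=> x0 hx.
  (* All later corners stay within the geometric sum 2^-k - 2^-(k+j) of the steps in between. *)
  have up k j : x k <= x (k + j)%N <= x k + 2^-1 ^+ k - 2^-1 ^+ (k + j).
    elim: j => [|j /andP[ih1 ih2]]; first by rewrite addn0 addrK lexx.
    have /andP[h1 h2] := hx (k + j)%N; rewrite addnS.
    have : 2^-1 ^+ (k + j) = 2 * 2^-1 ^+ (k + j).+1 :> R.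
      by rewrite exprS mulrA divff ?mul1r.
    move=> h3; apply/andP; split; first order_lra.
    move: h3 h2 ih2; set t := 2^-1 ^+ (k + j); set t' := 2^-1 ^+ (k + j).+1; order_lra.
  have ub k j : x j <= x k + 2^-1 ^+ k.
    have d0 i : 0 <= 2^-1 ^+ i :> R by rewrite exprn_ge0 // invr_ge0.
    have [kj|jk] := leqP k j.
      by have /andP[_] := up k (j - k)%N; rewrite subnKC //; have := d0 j; order_lra.
    have /andP[h1 h2] := up j (k - j)%N; move: h1 h2; rewrite subnKC 1?ltnW //.
    by have := d0 k; order_lra.
  have hs : has_sup (range x) by split; [exists (x 0%N), 0%N|exists (x 0%N + 2^-1 ^+ 0) => _ [j _ <-]; exact: ub].
  have key k : x k <= sup (range x) <= x k + 2^-1 ^+ k.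
    apply/andP; split; first by apply: (sup_upper_bound hs); exists k.
    by apply: ge_sup; [case: hs|move=> _ [j _ <-]; exact: ub].
  by exists (sup (range x)) => //; have := key 0%N; rewrite x0 expr0 add0r.
have [p p01 hp] := lim (fun k => (z k).1) erefl (fun k => (zS k).1).
have [q q01 hq] := lim (fun k => (z k).2) erefl (fun k => (zS k).2).
have [K hK] := Ploc p q p01 q01.
by apply: (nPz K); apply: hK.
Qed.

Definition contAt h z := forall e : R, 0 < e -> exists2 d : R, 0 < d &
  forall w, nrm (w - z) < d -> nrm (h w - h z) < e.

Lemma diff_contAt h z : differentiable h z -> contAt h z.
Proof. by move=> dh e /(diff_cont dh). Qed.

Lemma contAtB h g z : contAt h z -> contAt g z -> contAt (fun w => h w - g w) z.
Proof.
move=> ch cg e e0; have e2 : 0 < e / 2 by order_lra.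
have [d d0 hd] := ch _ e2; have [d' d0' hd'] := cg _ e2.
exists (Num.min d d'); first by rewrite lt_min d0.
move=> w; rewrite lt_min => /andP[/hd h1 /hd' h2].
have -> : h w - g w - (h z - g z) = (h w - h z) - (g w - g z) by ring.
by have := nrmB (h w - h z) (g w - g z); order_lra.
Qed.

(** Integral of h dz along the segment from c to c + a. *)
Definition edge h c a := a * dint (fun x => h (c + x%:C * a)).

(** Integral of h dz along the boundary of the parallelogram with vertices c, c + a, c + a + b, c +
    b, in this order. *)
Definition par h c a b :=
  edge h c a + edge h (c + a) b - edge h (c + b) a - edge h c b.

Lemma cont01_line h c a :
  (forall x : R, 0 <= x <= 1 -> contAt h (c + x%:C * a)) ->
  cont01 (fun x => h (c + x%:C * a)).
Proof.
move=> hc x x01 e e0; have [d d0 hd] := hc x x01 e e0.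
have a1 : 0 < nrm a + 1 by have := nrm_ge0 a; order_lra.
exists (d / (nrm a + 1)); first exact: divr_gt0.
move=> y _ yx; apply: hd; rewrite opprD addrACA subrr add0r -mulrBl -rmorphB /=.
rewrite nrmM nrm_real; apply: le_lt_trans (_ : `|y - x| * (nrm a + 1) < _).
  by rewrite ler_wpM2l // lerDl.
by rewrite -ltr_pdivlMr.
Qed.

Lemma half_C (x : R) : (x / 2)%:C = 2^-1 * x%:C :> C.
Proof. by rewrite rmorphM fmorphV /= (rmorph_nat (real_complex R)) mulrC. Qed.

Lemma edge_split h c a :
  (forall x : R, 0 <= x <= 1 -> contAt h (c + x%:C * a)) ->
  edge h c a = edge h c (a / 2) + edge h (c + a / 2) (a / 2).
Proof.
move=> hc; rewrite /edge dint_split; last exact: cont01_line.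
have -> : dint (fun x => h (c + (x / 2)%:C * a)) = dint (fun x => h (c + x%:C * (a / 2))).
  by apply: eq_dint => x _; congr h; rewrite half_C; ring.
have -> : dint (fun x => h (c + ((1 + x) / 2)%:C * a)) =
    dint (fun x => h (c + a / 2 + x%:C * (a / 2))).
  by apply: eq_dint => x _; congr h; rewrite half_C rmorphD /=; ring.
ring.
Qed.

Lemma edge_rev h c a :
  (forall x : R, 0 <= x <= 1 -> contAt h (c + x%:C * a)) ->
  edge h (c + a) (- a) = - edge h c a.
Proof.
move=> hc; rewrite /edge mulNr; congr (- (_ * _)).
rewrite -[RHS]dint_rev; last exact: cont01_line.
by apply: eq_dint => x _; congr h; rewrite rmorphB /=; ring.
Qed.

Definition inpar c a b z := exists x y : R,
  [/\ 0 <= x <= 1, 0 <= y <= 1 & z = c + x%:C * a + y%:C * b].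

Lemma inpar_edges c a b :
  [/\ forall x : R, 0 <= x <= 1 -> inpar c a b (c + x%:C * a),
      forall x : R, 0 <= x <= 1 -> inpar c a b (c + a + x%:C * b),
      forall x : R, 0 <= x <= 1 -> inpar c a b (c + b + x%:C * a) &
      forall x : R, 0 <= x <= 1 -> inpar c a b (c + x%:C * b)].
Proof.
have i0 : 0 <= (0 : R) <= 1 by rewrite lexx ler01.
have i1 : 0 <= (1 : R) <= 1 by rewrite lexx ler01.
split=> x x01; [exists x, 0|exists 1, x|exists x, 1|exists 0, x]; split => //;
  rewrite ?rmorph0 ?rmorph1; ring.
Qed.

(** The inner edges of the four quarters are run through twice in opposite directions and cancel. *)
Lemma par_split h c a b : (forall z, inpar c a b z -> contAt h z) ->
  par h c a b = par h c (a / 2) (b / 2) + par h (c + a / 2) (a / 2) (b / 2) +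
    par h (c + b / 2) (a / 2) (b / 2) + par h (c + a / 2 + b / 2) (a / 2) (b / 2).
Proof.
move=> hc; have [e1 e2 e3 e4] := inpar_edges c a b.
rewrite /par.
rewrite (@edge_split h c a) ?(@edge_split h (c + a) b) ?(@edge_split h (c + b) a)
  ?(@edge_split h c b); try by move=> x x01; apply: hc; auto.
have -> : c + a / 2 + a / 2 = c + a by field.
have -> : c + b / 2 + b / 2 = c + b by field.
have -> : c + b / 2 + a / 2 = c + a / 2 + b / 2 by ring.
have -> : c + a / 2 + b / 2 + a / 2 = c + a + b / 2 by field.
have -> : c + a / 2 + b / 2 + b / 2 = c + b + a / 2 by field.
ring.
Qed.

Lemma edge_bound h c a (M : R) :
  (forall x : R, 0 <= x <= 1 -> contAt h (c + x%:C * a) /\ nrm (h (c + x%:C * a)) <= M) ->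
  nrm (edge h c a) <= nrm a * M.
Proof.
move=> hM; rewrite /edge nrmM ler_wpM2l ?nrm_ge0 //; apply: dint_bound.
  by apply: cont01_line => x /hM [].
by move=> x /hM [].
Qed.

Lemma par_bound h c a b (M : R) :
  (forall z, inpar c a b z -> contAt h z /\ nrm (h z) <= M) ->
  nrm (par h c a b) <= 2 * (nrm a + nrm b) * M.
Proof.
move=> hM; have [e1 e2 e3 e4] := inpar_edges c a b.
have h1 : nrm (edge h c a) <= nrm a * M by apply: edge_bound; auto.
have h2 : nrm (edge h (c + a) b) <= nrm b * M by apply: edge_bound; auto.
have h3 : nrm (edge h (c + b) a) <= nrm a * M by apply: edge_bound; auto.
have h4 : nrm (edge h c b) <= nrm b * M by apply: edge_bound; auto.
rewrite /par; have := nrmB (edge h c a + edge h (c + a) b - edge h (c + b) a) (edge h c b).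
have := nrmB (edge h c a + edge h (c + a) b) (edge h (c + b) a).
have := nrmD (edge h c a) (edge h (c + a) b); order_lra.
Qed.

Lemma contAt_affine (p q : C) z : contAt (fun z => p + q * z) z.
Proof.
apply: diff_contAt; apply: dD; [exact: dcst|by apply: dM; [exact: dcst|exact: did]].
Qed.

Lemma cont01_id : cont01 (fun x : R => x%:C : C).
Proof.
by move=> x _ e e0; exists e => // y _ h; rewrite -rmorphB /= nrm_real.
Qed.

Lemma cont01_cst (p : C) : cont01 (fun=> p).
Proof. by move=> x _ e e0; exists 1 => // y _ _; rewrite subrr nrm0. Qed.

Lemma edge_affine (p q : C) c a :
  edge (fun z => p + q * z) c a = a * (p + q * (c + a / 2)).
Proof.
rewrite /edge; congr (_ * _).
transitivity (dint (fun x => (p + q * c) * (fun=> 1) x + (q * a) * x%:C)).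
  by apply: eq_dint => x _; ring.
by rewrite dint_lin ?dint_cst ?dint_id; [ring|exact: cont01_cst|exact: cont01_id].
Qed.

Lemma par_affine (p q : C) c a b : par (fun z => p + q * z) c a b = 0.
Proof. by rewrite /par !edge_affine; field. Qed.

Lemma edgeB h g c a :
  (forall x : R, 0 <= x <= 1 -> contAt h (c + x%:C * a) /\ contAt g (c + x%:C * a)) ->
  edge (fun z => h z - g z) c a = edge h c a - edge g c a.
Proof.
move=> hg; rewrite /edge -mulrBr; congr (_ * _).
transitivity (dint (fun x => 1 * h (c + x%:C * a) + (-1) * g (c + x%:C * a))).
  by apply: eq_dint => x _; ring.
by rewrite dint_lin; [ring| |]; apply: cont01_line => x /hg [].
Qed.

Lemma parB h g c a b :
  (forall z, inpar c a b z -> contAt h z /\ contAt g z) ->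
  par (fun z => h z - g z) c a b = par h c a b - par g c a b.
Proof.
move=> hg; have [e1 e2 e3 e4] := inpar_edges c a b.
rewrite /par !edgeB; first ring.
all: by move=> x x01; apply: hg; auto.
Qed.

Lemma inpar_sub c a b (x y t : R) (z : C) : 0 <= x -> x + t <= 1 -> 0 <= y -> y + t <= 1 ->
  0 <= t -> inpar (c + x%:C * a + y%:C * b) (t%:C * a) (t%:C * b) z -> inpar c a b z.
Proof.
move=> x0 x1 y0 y1 t0 [u [v [/andP[u0 u1] /andP[v0 v1] ->]]].
have tu : 0 <= u * t <= t by rewrite mulr_ge0 //= ler_piMl.
have tv : 0 <= v * t <= t by rewrite mulr_ge0 //= ler_piMl.
exists (x + u * t), (y + v * t); split; try by apply/andP; order_lra.
by rewrite !rmorphD !rmorphM /=; ring.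
Qed.

(** Bisection for the claim that the integral over a copy scaled by t is at most e t^2, a bound that
    adds up over the four quarters. Near a point h differs from an affine map, whose integral
    vanishes, by a small multiple of the distance. *)
Lemma goursat h c a b : (forall z, inpar c a b z -> differentiable h z) ->
  par h c a b = 0.
Proof.
move=> dh; apply: nrm_eq0; apply/eqP; rewrite eq_le nrm_ge0 andbT.
apply/ler_addgt0Pr => e e0; rewrite add0r.
pose S := nrm a + nrm b.
have S0 : 0 <= S by rewrite addr_ge0 ?nrm_ge0.
(* The side conditions keep the small parallelogram inside the given one; they belong to P because
   the bisection principle ranges over all corners. *)
pose P (x y : R) (k : nat) := let t : R := 2^-1 ^+ k in
  0 <= x -> x + t <= 1 -> 0 <= y -> y + t <= 1 ->
  nrm (par h (c + x%:C * a + y%:C * b) (t%:C * a) (t%:C * b)) <= e * (t * t).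
have t0 k : 0 < 2^-1 ^+ k :> R by rewrite exprn_gt0 // invr_gt0.
suff : P 0 0 0%N.
  by rewrite /P expr0 rmorph0 rmorph1 !mul0r !addr0 !mul1r !mulr1 add0r; apply.
apply: bisection => [x y k d P1 P2 P3 P4|p q /andP[p0 p1] /andP[q0 q1]].
  rewrite /P; set t := 2^-1 ^+ k => x0 x1 y0 y1.
  have td : t = d + d by rewrite /t /d exprS -mulrDl; field.
  have d0 : 0 < d := t0 k.+1.
  rewrite par_split; last first.
    by move=> z /(inpar_sub x0 x1 y0 y1 (ltW (t0 k))) /dh /diff_contAt.
  have hC u : t%:C * u / 2 = d%:C * u by rewrite td rmorphD /=; field.
  rewrite !hC.
  have -> : c + x%:C * a + y%:C * b + d%:C * a = c + (x + d)%:C * a + y%:C * b.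
    by rewrite rmorphD /=; ring.
  have -> : c + x%:C * a + y%:C * b + d%:C * b = c + x%:C * a + (y + d)%:C * b.
    by rewrite rmorphD /=; ring.
  have -> : c + (x + d)%:C * a + y%:C * b + d%:C * b = c + (x + d)%:C * a + (y + d)%:C * b.
    by rewrite !rmorphD /=; ring.
  have aux (u : R) : 0 <= u -> u + t <= 1 -> [/\ u + d <= 1, 0 <= u + d & u + d + d <= 1].
    by rewrite td; move: d0; clear; move=> *; split; order_lra.
  have [x2 x3 x4] := aux x x0 x1; have [y2 y3 y4] := aux y y0 y1.
  have h1 := P1 x0 x2 y0 y2; have h2 := P2 x3 x4 y0 y2.
  have h3 := P3 x0 x2 y3 y4; have h4 := P4 x3 x4 y3 y4.
  rewrite -/d in h1 h2 h3 h4.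
  apply: le_trans (nrmD _ _) _.
  apply: le_trans (lerD (nrmD _ _) (lexx _)) _.
  apply: le_trans (lerD (lerD (nrmD _ _) (lexx _)) (lexx _)) _.
  have -> : e * (t * t) = e * (d * d) + e * (d * d) + e * (d * d) + e * (d * d).
    by rewrite td; ring.
  exact: lerD (lerD (lerD h1 h2) h3) h4.
pose z0 := c + p%:C * a + q%:C * b.
have dz0 : differentiable h z0.
  by apply: dh; exists p, q; split => //; apply/andP; split.
(* The perimeter 2 t S times the error e' t S has to stay below e t^2; the added 1 excludes a
   division by 0. *)
pose e' := e / (2 * S * S + 1).
have S1 : 0 < 2 * S * S + 1 by rewrite ltr_wpDl // mulr_ge0 // mulr_ge0.
have e'0 : 0 < e' by rewrite divr_gt0.
have [d d0 hd] := diff_nrm dz0 e'0.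
have [K hK] := @half_pow_small R (d / (S + 1)) (divr_gt0 d0 (ltr_wpDl S0 ltr01)).
exists K => k x y /hK; set t := 2^-1 ^+ k => ht /andP[xp px] /andP[yq qy].
have t00 : 0 < t := t0 k.
rewrite /P -/t => x0 x1 y0 y1.
pose A z := h z0 - 'd h z0 1 * z0 + 'd h z0 1 * z.
have hcont z : inpar (c + x%:C * a + y%:C * b) (t%:C * a) (t%:C * b) z ->
    contAt h z /\ contAt A z.
  move=> /(inpar_sub x0 x1 y0 y1 (ltW t00)) /dh /diff_contAt ?; split => //.
  exact: contAt_affine.
have -> : par h (c + x%:C * a + y%:C * b) (t%:C * a) (t%:C * b) =
  par (fun z => h z - A z) (c + x%:C * a + y%:C * b) (t%:C * a) (t%:C * b).
  by rewrite parB // par_affine subr0.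
apply: le_trans (par_bound (M := e' * (t * S)) _) _; last first.
  rewrite !nrmM !nrm_real ger0_norm ?(ltW t00) // -mulrDr -/S.
  have -> : 2 * (t * S) * (e' * (t * S)) = (2 * S * S * e') * (t * t) by ring.
  rewrite ler_wpM2r ?mulr_ge0 ?(ltW t00) // /e' mulrA ler_pdivrMr // mulrC.
  by rewrite ler_pM2l // lerDl.
move=> z hz; split.
  by have [h1 h2] := hcont _ hz; apply: contAtB.
have [u [v [/andP[u0 u1] /andP[v0 v1] zE]]] := hz.
have hw : nrm (z - z0) <= t * S.
  have -> : z - z0 = (x + u * t - p)%:C * a + (y + v * t - q)%:C * b.
    by rewrite zE /z0 !(rmorphB, rmorphD, rmorphM) /=; ring.
  apply: le_trans (nrmD _ _) _; rewrite !nrmM !nrm_real mulrDr.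
  have tu : 0 <= u * t <= t by rewrite mulr_ge0 ?(ltW t00) //= ler_piMl // ltW.
  have tv : 0 <= v * t <= t by rewrite mulr_ge0 ?(ltW t00) //= ler_piMl // ltW.
  apply: lerD; apply: ler_wpM2r; rewrite ?nrm_ge0 // ler_norml; apply/andP; order_lra.
have wd : nrm (z - z0) < d.
  apply: le_lt_trans hw _; apply: le_lt_trans (_ : t * (S + 1) < _).
    by rewrite ler_pM2l // lerDl.
  by rewrite -ltr_pdivlMr // ltr_wpDl.
have := hd _ wd; rewrite subrKC.
have -> : 'd h z0 (z - z0) = 'd h z0 1 * (z - z0).
  by rewrite -[z - z0 in LHS]mulr1 -[_ * 1]/(_ *: 1) linearZ /= mulrC.
have -> : h z - h z0 - 'd h z0 1 * (z - z0) = h z - A z by rewrite /A; ring.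
move=> /le_trans; apply; rewrite ler_pM2l //.
Qed.

Lemma par_rev_a h c a b : (forall z, inpar c a b z -> contAt h z) ->
  par h (c + a) (- a) b = - par h c a b.
Proof.
move=> hc; have [e1 e2 e3 e4] := inpar_edges c a b.
rewrite /par edge_rev; last by auto.
have -> : c + a + b = c + b + a by ring.
rewrite edge_rev; last by auto.
rewrite addrK; ring.
Qed.

Lemma par_sym h c a b : par h c a b = - par h c b a.
Proof. by rewrite /par; ring. Qed.

(* A bounded corner singularity is absorbed: halving towards the corner leaves
   only the quarter at the corner, whose perimeter tends to 0. *)
Lemma goursat_corner h c a b :
  (forall z, inpar c a b z -> contAt h z) ->
  (forall (x y : R), 0 <= x <= 1 -> 0 <= y <= 1 -> (x, y) != (0, 0) ->
    differentiable h (c + x%:C * a + y%:C * b)) ->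
  par h c a b = 0.
Proof.
move=> hc dh.
have i0 : 0 <= (0 : R) <= 1 by rewrite lexx ler01.
have t0 k : 0 < 2^-1 ^+ k :> R by rewrite exprn_gt0 // invr_gt0.
have t1 k : 2^-1 ^+ k <= 1 :> R by rewrite exprn_ile1 ?invr_ge0 // invf_le1 // ler1n.
have step k : par h c a b = par h c ((2^-1 ^+ k)%:C * a) ((2^-1 ^+ k)%:C * b).
  elim: k => [|k ->]; first by rewrite expr0 rmorph1 !mul1r.
  set t := 2^-1 ^+ k; have tt : 0 < t <= 1 by rewrite t0 t1.
  set d := 2^-1 ^+ k.+1; have dd : 0 < d by exact: t0.
  have td : t = d + d by rewrite /t /d exprS -mulrDl; field.
  have hC u : t%:C * u / 2 = d%:C * u by rewrite td rmorphD /=; field.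
  have sub z : inpar c (t%:C * a) (t%:C * b) z -> inpar c a b z.
    have -> : inpar c (t%:C * a) (t%:C * b) z =
        inpar (c + (0 : R)%:C * a + (0 : R)%:C * b) (t%:C * a) (t%:C * b) z.
      by rewrite rmorph0 !mul0r !addr0.
    by case/andP: tt => t00 t11; apply: (@inpar_sub c a b 0 0 t); rewrite ?add0r // ltW.
  rewrite par_split ?hC; last by move=> z /sub; exact: hc.
  have aux (r s : R) (z : C) : 0 <= r -> r + d <= 1 -> 0 <= s -> s + d <= 1 -> 0 < r + s ->
      z = c + r%:C * a + s%:C * b -> par h z (d%:C * a) (d%:C * b) = 0.
    move=> r0 r1 s0 s1 rs ->; apply: goursat => _ [u [v [/andP[u0 u1] /andP[v0 v1] ->]]].
    have tu : 0 <= u * d <= d by rewrite mulr_ge0 ?(ltW dd) //= ler_piMl // ltW.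
    have tv : 0 <= v * d <= d by rewrite mulr_ge0 ?(ltW dd) //= ler_piMl // ltW.
    have -> : c + r%:C * a + s%:C * b + u%:C * (d%:C * a) + v%:C * (d%:C * b) =
        c + (r + u * d)%:C * a + (s + v * d)%:C * b.
      by rewrite !(rmorphD, rmorphM) /=; ring.
    apply: dh; try (apply/andP; order_lra).
    apply/eqP => -[e1 e2]; order_lra.
  have h1 := aux d 0 (c + d%:C * a); have h2 := aux 0 d (c + d%:C * b).
  have h3 := aux d d (c + d%:C * a + d%:C * b).
  have d1 : 0 + d <= 1 by case/andP: tt; move: td dd; clear; order_lra.
  have d2 : d + d <= 1 by case/andP: tt; move: td dd; clear; order_lra.
  have d3 : 0 < d + d by rewrite addr_gt0.
  rewrite add0r in d1.
  by rewrite h1 ?h2 ?h3 ?addr0 ?add0r ?rmorph0 ?mul0r ?addr0 ?lexx // ltW.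
have [|d d0 hd] := hc c _ 1 ltr01.
  by exists 0, 0; split => //; rewrite rmorph0 !mul0r !addr0.
pose S := nrm a + nrm b; have S0 : 0 <= S by rewrite addr_ge0 ?nrm_ge0.
pose M := nrm (h c) + 1; have M0 : 0 < M by rewrite ltr_wpDl ?nrm_ge0.
apply: nrm_eq0; apply/eqP; rewrite eq_le nrm_ge0 andbT.
apply/ler_addgt0Pr => e e0; rewrite add0r.
have d1 : 0 < Num.min (d / (S + 1)) (e / (2 * S * M + 1)).
  rewrite lt_min !divr_gt0 // ?ltr_wpDl // mulr_ge0 ?(ltW M0) // mulr_ge0 //.
have [N hN] := half_pow_small d1; have := hN N (leqnn N).
rewrite (step N); have := t0 N; have := t1 N; set t := 2^-1 ^+ N => tl1 tgt0.
rewrite lt_min => /andP[]; rewrite !ltr_pdivlMr ?ltr_wpDl //; last first.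
  by rewrite mulr_ge0 ?(ltW M0) // mulr_ge0.
move=> h1 h2; apply: le_trans (par_bound (M := M) _) _.
  move=> z hz; split.
    apply: hc; have := @inpar_sub c a b 0 0 t z; rewrite rmorph0 !mul0r !addr0 !add0r.
    by apply; rewrite // ltW.
  have [u [v [/andP[u0 u1] /andP[v0 v1] zE]]] := hz.
  have : nrm (z - c) < d.
    have -> : z - c = u%:C * (t%:C * a) + v%:C * (t%:C * b) by rewrite zE; ring.
    apply: le_lt_trans (nrmD _ _) _; rewrite !nrmM !nrm_real !ger0_norm ?(ltW tgt0) //.
    apply: le_lt_trans h1; rewrite [X in _ <= X]mulrDr mulr1 /S mulrDr.
    have : u * (t * nrm a) <= t * nrm a by rewrite ler_piMl // mulr_ge0 ?nrm_ge0 // ltW.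
    have : v * (t * nrm b) <= t * nrm b by rewrite ler_piMl // mulr_ge0 ?nrm_ge0 // ltW.
    by move: tgt0; order_lra.
  move=> /hd; have := nrmD (h z - h c) (h c); rewrite subrK /M; order_lra.
rewrite !nrmM !nrm_real ger0_norm ?(ltW tgt0) // -mulrDr -/S.
by move: h2 tgt0; rewrite mulrDr mulr1; order_lra.
Qed.

(* The same for a singularity at the centre [p]: each quarter has it as a corner. *)
Lemma goursat_center h p a b :
  (forall x y : R, -1 <= x <= 1 -> -1 <= y <= 1 -> contAt h (p + x%:C * a + y%:C * b)) ->
  (forall x y : R, -1 <= x <= 1 -> -1 <= y <= 1 -> (x, y) != (0, 0) ->
    differentiable h (p + x%:C * a + y%:C * b)) ->
  par h (p - a - b) (2 * a) (2 * b) = 0.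
Proof.
move=> hc dh.
(* With both signs of a and of b each of the four quarters has p as its distinguished corner; the
   reversals further down restore the common orientation. *)
have corner (s t : R) : s = 1 \/ s = -1 -> t = 1 \/ t = -1 ->
    par h p (s%:C * a) (t%:C * b) = 0.
  have sgn (r x : R) : r = 1 \/ r = -1 -> 0 <= x <= 1 -> -1 <= r * x <= 1.
    by case=> -> /andP[*]; apply/andP; order_lra.
  have sgn0 (r : R) : r = 1 \/ r = -1 -> r != 0.
    by case=> ->; rewrite ?oppr_eq0 oner_eq0.
  move=> hs ht; apply: goursat_corner.
    move=> _ [x [y [x01 y01 ->]]].
    have -> : p + x%:C * (s%:C * a) + y%:C * (t%:C * b) =
      p + (s * x)%:C * a + (t * y)%:C * b by rewrite !rmorphM /=; ring.
    by apply: hc; apply: sgn.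
  move=> x y x01 y01 xy.
  have -> : p + x%:C * (s%:C * a) + y%:C * (t%:C * b) =
    p + (s * x)%:C * a + (t * y)%:C * b by rewrite !rmorphM /=; ring.
  apply: dh; try exact: sgn.
  move: xy; rewrite !xpair_eqE !mulf_eq0.
  by rewrite (negbTE (sgn0 s hs)) (negbTE (sgn0 t ht)).
have big z : inpar (p - a - b) (2 * a) (2 * b) z -> contAt h z.
  move=> [x [y [/andP[x0 x1] /andP[y0 y1] ->]]].
  have h2 : (2 : R)%:C = 2 :> C by rewrite -(rmorph_nat (real_complex R)).
  have -> : p - a - b + x%:C * (2 * a) + y%:C * (2 * b) =
      p + (2 * x - 1)%:C * a + (2 * y - 1)%:C * b.
    by rewrite !rmorphB !rmorphM !rmorph1 /= h2; ring.
  by apply: hc; apply/andP; order_lra.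
have c1 := corner 1 1 (or_introl erefl) (or_introl erefl).
have c2 := corner (-1) 1 (or_intror erefl) (or_introl erefl).
have c3 := corner 1 (-1) (or_introl erefl) (or_intror erefl).
have c4 := corner (-1) (-1) (or_intror erefl) (or_intror erefl).
rewrite !rmorphN !rmorph1 !mulN1r !mul1r in c1 c2 c3 c4.
have revc (s t : R) z : s = 1 \/ s = -1 -> t = 1 \/ t = -1 ->
    inpar p (s%:C * a) (t%:C * b) z -> contAt h z.
  move=> hs ht [x [y [/andP[x0 x1] /andP[y0 y1] ->]]].
  have -> : p + x%:C * (s%:C * a) + y%:C * (t%:C * b) =
    p + (s * x)%:C * a + (t * y)%:C * b by rewrite !rmorphM /=; ring.
  by apply: hc; [case: hs|case: ht] => ->; apply/andP; order_lra.
rewrite par_split // ![2 * _]mulrC !mulfK ?pnatr_eq0 //.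
have -> : p - a - b + a + b = p by ring.
have -> : p - a - b + a = p - b by ring.
have -> : p - a - b + b = p - a by ring.
have e2 : par h (p - a) a b = 0.
  rewrite -[a in X in par _ _ X _]opprK par_rev_a ?c2 ?oppr0 //.
  by move=> z; have := @revc (-1) 1 z (or_intror erefl) (or_introl erefl); rewrite rmorphN !rmorph1 mulN1r mul1r.
have e3 : par h (p - b) a b = 0.
  rewrite par_sym -[b in X in par _ _ X _]opprK par_rev_a ?opprK -?par_sym.
    by rewrite par_sym c3 oppr0.
  move=> z [x [y [x01 y01 ->]]].
  apply: (@revc 1 (-1) _ (or_introl erefl) (or_intror erefl)).
  by exists y, x; split => //; rewrite rmorphN !rmorph1 mulN1r mul1r addrAC.
have e4 : par h (p - a - b) a b = 0.
  have e5 : par h (p - a) a (- b) = 0.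
    have := @par_rev_a h (p - a) a (- b); rewrite subrK c4 => /(_ _)/eqP.
    rewrite eq_sym oppr_eq0 => H; apply/eqP/H => _ [x [y [/andP[x0 x1] /andP[y0 y1] ->]]].
    have -> : p - a + x%:C * a + y%:C * - b = p + (x - 1)%:C * a + (- y)%:C * b.
      by rewrite rmorphB rmorphN rmorph1 /=; ring.
    by apply: hc; apply/andP; order_lra.
  rewrite par_sym; apply/eqP; rewrite oppr_eq0; apply/eqP.
  have := @par_rev_a h (p - a - b) b a; rewrite subrK par_sym e5 oppr0 => /(_ _)/eqP.
  rewrite eq_sym oppr_eq0 => H; apply/eqP/H => _ [x [y [/andP[x0 x1] /andP[y0 y1] ->]]].
  have -> : p - a - b + x%:C * b + y%:C * a = p + (y - 1)%:C * a + (x - 1)%:C * b.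
    by rewrite !rmorphB rmorph1 /=; ring.
  by apply: hc; apply/andP; order_lra.
by rewrite e2 e3 e4 c1 !addr0.
Qed.

End goursat.

(** * The complex exponential function *)

Section complex_exponential.
Context {R : realType}.
Local Notation C := R[i].
Implicit Types (c z w p : C) (x y e : R).

Lemma diff1P {W : normedModType C} (f : C -> W) z (a : W) :
  (forall e : R, 0 < e -> exists2 d : R, 0 < d & forall h, nrm h < d ->
    nrm (f (z + h) - f z - h *: a) <= e * nrm h) ->
  differentiable f z /\ forall h, 'd f z h = h *: a.
Proof.
move=> H; pose d (h : C) := h *: a.
have lin_scal : linear d by move=> ? ? ?; rewrite /d scalerDl scalerA.
pose scallM := GRing.isLinear.Build _ _ _ _ _ lin_scal.
pose scalL : {linear _ -> _} := HB.pack d scallM.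
by apply: (@nrm_diff _ _ _ f z scalL) => //; apply: scalel_continuous.
Qed.

Lemma diff1E_nrm {W : normedModType C} (f : C -> W) z : differentiable f z ->
  forall h, 'd f z h = h *: 'd f z 1.
Proof. by move=> df h; rewrite -linearZ /= -[h in LHS]mulr1. Qed.

Lemma real_deriveP (f : R -> R) x df : is_derive x 1 f df <->
  forall e, 0 < e -> exists2 d, 0 < d & forall h, `|h| < d ->
    `|f (x + h) - f x - h * df| <= e * `|h|.
Proof.
have key : ((fun h => h^-1 *: ((f \o shift x) (h *: 1) - f x)) @ 0^' --> df) <->
    forall e, 0 < e -> exists2 d, 0 < d & forall h, `|h| < d ->
    `|f (x + h) - f x - h * df| <= e * `|h|.
  have E h : h != 0 -> df - h^-1 *: ((f \o shift x) (h *: 1) - f x) =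
      - (h^-1 * (f (x + h) - f x - h * df)).
    move=> h0; rewrite /= /GRing.scale /= mulr1 [h + x]addrC.
    by rewrite [in RHS]mulrBr mulKf // opprB.
  split=> [/cvgrPdist_le H e e0|H].
    have /nbhs_ballP [d /= d0 hd] := H e e0; exists d => // h hd'.
    have [->|h0] := eqVneq h 0.
      by rewrite addr0 subrr mul0r subr0 normr0 mulr0.
    have := hd h; rewrite /ball /= sub0r normrN => /(_ hd' h0).
    by rewrite E // normrN normrM normfV mulrC ler_pdivrMr // normr_gt0.
  apply/cvgrPdist_le => e e0; have [d d0 hd] := H e e0.
  apply/nbhs_ballP; exists d => //= h; rewrite /ball /= sub0r normrN => hd' h0.
  by rewrite E // normrN normrM normfV mulrC ler_pdivrMr ?normr_gt0 //; apply: hd.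
split=> [[d1 d2]|H].
  by apply/key; move: d1; rewrite /derivable => /cvgP; rewrite /derive in d2; rewrite d2.
by move/key: H => H; split; [apply/cvg_ex; exists df|apply/cvg_lim].
Qed.

Definition cexp z : C :=
  (expR (complex.Re z) * cos (complex.Im z)) +i* (expR (complex.Re z) * sin (complex.Im z)).

Lemma cexpD z w : cexp (z + w) = cexp z * cexp w.
Proof.
rewrite /cexp ReD ImD expRD cosD sinD; apply/eqP; rewrite eq_complex /=.
by apply/andP; split; apply/eqP; ring.
Qed.

Lemma nrm_cexp z : nrm (cexp z) = expR (complex.Re z).
Proof.
rewrite nrmc /= !exprMn -mulrDr cos2Dsin2 mulr1 sqrtr_sqr ger0_norm // expR_ge0.
Qed.

Lemma cexp_neq0 z : cexp z != 0.
Proof.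
by apply/eqP => h; have := expR_gt0 (complex.Re z); rewrite -nrm_cexp h nrm0 ltxx.
Qed.

(** The period 2 pi i of [cexp]. *)
Definition tau : C := 0 +i* (pi *+ 2).

Lemma cexp_tau : cexp tau = 1.
Proof. by rewrite /cexp /= expR0 cos2pi sin2pi mulr1 mulr0. Qed.

Lemma tau_half : tau / 2 = 0 +i* pi.
Proof.
rewrite /tau -(rmorph_nat (real_complex R)) -fmorphV /=; apply/eqP.
by rewrite eq_complex /= !mulr0 !mul0r ?addr0 ?add0r ?subr0 mulr2n; apply/andP; split; apply/eqP; field.
Qed.

Lemma tau_neq0 : tau != 0.
Proof.
apply/eqP => -[h]; have := pi_gt0 R; have : pi *+ 2 = 0 :> R := h.
by rewrite mulr2n; order_lra.
Qed.

(** The addition formula reduces the claim to the origin, where the real derivatives of exp, sin and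
    cos give the estimate. *)
Lemma cexp_diff z : differentiable cexp z.
Proof.
suff [] : differentiable cexp z /\ forall h, 'd cexp z h = h *: cexp z by [].
apply: diff1P => e e0.
pose M := nrm (cexp z); have M0 : 0 <= M := nrm_ge0 _.
(* The error of the real part will be at most 3 e' |h| and that of the imaginary part at most 4 e'
   |h|, whence the 7. *)
pose e' := Num.min 1 (e / (7 * M + 1)).
have M1 : 0 < 7 * M + 1 by order_lra.
have e'0 : 0 < e' by rewrite lt_min ltr01 divr_gt0.
have [d1 d10 h1] := (real_deriveP (@expR R) 0 (expR 0)).1 (is_derive_expR 0) e' e'0.
have [d2 d20 h2] := (real_deriveP (@sin R) 0 (cos 0)).1 (is_derive_sin 0) e' e'0.
have [d3 d30 h3] := (real_deriveP (@cos R) 0 (- sin 0)).1 (is_derive_cos 0) e' e'0.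
exists (Num.min (Num.min d1 d2) (Num.min d3 e')).
  by rewrite 3!lt_min d10 d20 d30 e'0.
move=> h; rewrite 3!lt_min => /andP[/andP[hd1 hd2] /andP[hd3 hd4]].
rewrite cexpD -[h *: _]/(h * _).
have -> : cexp z * cexp h - cexp z - h * cexp z = cexp z * (cexp h - 1 - h) by ring.
rewrite nrmM -/M.
have hR := ler_Re_nrm h; have hI := ler_Im_nrm h.
have {}h1 := h1 (complex.Re h) (le_lt_trans hR hd1).
have {}h2 := h2 (complex.Im h) (le_lt_trans hI hd2).
have {}h3 := h3 (complex.Im h) (le_lt_trans hI hd3).
rewrite !add0r expR0 mulr1 in h1; rewrite !add0r sin0 cos0 subr0 mulr1 in h2.
rewrite !add0r cos0 sin0 oppr0 mulr0 subr0 in h3.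
have e1 : `|complex.Re h| <= 1.
  by rewrite (le_trans hR) // (le_trans (ltW hd4)) // ge_min lexx.
have e2 : `|complex.Im h| <= e' by rewrite (le_trans hI) // ltW.
suff : nrm (cexp h - 1 - h) <= 7 * e' * nrm h.
  move=> H; apply: le_trans (ler_wpM2l M0 H) _.
  rewrite !mulrA ler_wpM2r ?nrm_ge0 // [M * 7]mulrC.
  have : 7 * M * e' <= (7 * M + 1) * e' by rewrite ler_wpM2r ?lerDl // ltW.
  move=> /le_trans; apply.
  rewrite mulrC -ler_pdivlMr // /e' ge_min lexx orbT.
  by [].
apply: le_trans (nrm_le_ReIm _) _; rewrite !ReB !ImB /= subr0.
move: h1 h2 h3 e1 e2 hR hI.
set x := complex.Re h; set y := complex.Im h; set X := nrm h.
set E := expR x; set c := cos y; set s := sin y => h1 h2 h3 e1 e2 hR hI.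
have c1 : `|c| <= 1 by rewrite ler_norml cos_geN1 cos_le1.
have s1 : `|s| <= 1 by rewrite ler_norml sin_geN1 sin_le1.
have x2 : `|1 + x| <= 2 by rewrite (le_trans (ler_normD _ _)) // normr1; order_lra.
have eR : E * c - 1 - x = c * (E - 1 - x) + (1 + x) * (c - 1) by ring.
have eI : E * s - y = s * (E - 1 - x) + (1 + x) * (s - y) + x * y by ring.
have e'w : 0 <= e' := ltW e'0.
have {}h1 : `|E - 1 - x| <= e' * X by rewrite (le_trans h1) // ler_wpM2l.
have {}h2 : `|s - y| <= e' * X by rewrite (le_trans h2) // ler_wpM2l.
have {}h3 : `|c - 1| <= e' * X by rewrite (le_trans h3) // ler_wpM2l.
have bR : `|E * c - 1 - x| <= 1 * (e' * X) + 2 * (e' * X).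
  by rewrite eR (le_trans (ler_normD _ _)) // !normrM lerD // ler_pM.
have bI : `|E * s - y| <= 1 * (e' * X) + 2 * (e' * X) + X * e'.
  rewrite eI (le_trans (ler_normD _ _)) // lerD //; last by rewrite normrM ler_pM.
  by rewrite (le_trans (ler_normD _ _)) // !normrM lerD // ler_pM.
apply: le_trans (lerD bR bI) _; rewrite le_eqVlt; apply/orP; left; apply/eqP; ring.
Qed.

Lemma clog z : z != 0 -> exists p, cexp p = z.
Proof.
move=> z0; have r0 := nrm_gt0 z0.
pose x := complex.Re z / nrm z; pose y := complex.Im z / nrm z.
have xy : x ^+ 2 + y ^+ 2 = 1.
  rewrite !exprMn -mulrDl exprVn.
  have -> : complex.Re z ^+ 2 + complex.Im z ^+ 2 = nrm z ^+ 2.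
    by rewrite nrmc sqr_sqrtr // addr_ge0 ?sqr_ge0.
  by rewrite divff // expf_neq0 // gt_eqF.
have x1 : -1 <= x <= 1.
  rewrite -ler_norml -(@ler_pXn2r _ 2) ?nnegrE // expr1n real_normK ?num_real //.
  by rewrite -xy lerDl sqr_ge0.
have [t ht1 ht2] : exists2 t, cos t = x & sin t = y.
  have h : sin (acos x) = `|y|.
    by rewrite sin_acos // -xy addrAC subrr add0r sqrtr_sqr.
  have ac : cos (acos x) = x by rewrite acosK // in_itv.
  have [y0|y0] := leP 0 y.
    by exists (acos x); rewrite // h ger0_norm.
  by exists (- acos x); rewrite ?cosN // sinN h ltr0_norm // opprK.
exists (ln (nrm z) +i* t); rewrite /cexp /= lnK ?posrE // ht1 ht2.
rewrite /x /y ![nrm z * _]mulrC !divfK ?gt_eqF //.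
by case: (z).
Qed.

End complex_exponential.

(** * Means over circles *)

Section cauchy.
Context {R : realType}.
Local Notation C := R[i].
Implicit Types (f g q : C -> C) (c z w p rho : C) (x y e r : R).

Lemma contAt_comp f g z : contAt g z -> contAt f (g z) -> contAt (fun w => f (g w)) z.
Proof.
move=> cg cf e /cf [d d0 hd]; have [d' d'0 hd'] := cg d d0.
by exists d' => // w /hd' /hd.
Qed.

(** The contour integral of f(z) dz / (2 pi i z) over the circle of radius |rho|, started at rho. In
    the coordinate log z circles become vertical segments, so that results on parallelograms
    apply. *)
Definition cmean f rho := dint (fun x : R => f (rho * cexp (x%:C * tau))).

Lemma nrm_circle rho x : nrm (rho * cexp (x%:C * tau)) = nrm rho.
Proof. by rewrite nrmM nrm_cexp /= mul0r mulr0 subr0 expR0 mulr1. Qed.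

Definition contCirc f r := forall z, nrm z = r -> contAt f z.

Lemma cont01_circ f rho : contCirc f (nrm rho) ->
  cont01 (fun x : R => f (rho * cexp (x%:C * tau))).
Proof.
move=> cf.
have := @cont01_line R (fun w => f (rho * cexp w)) 0 tau.
have -> : (fun x : R => f (rho * cexp (0 + x%:C * tau))) =
  (fun x : R => f (rho * cexp (x%:C * tau))) by apply/funext => x; rewrite add0r.
apply=> x x01; rewrite add0r; apply: (@contAt_comp f (fun w => rho * cexp w)).
  by apply: diff_contAt; apply: dM; [exact: dcst|exact: cexp_diff].
by apply: cf; exact: nrm_circle.
Qed.

Lemma cmean_lin (a b : C) f g rho : contCirc f (nrm rho) -> contCirc g (nrm rho) ->
  cmean (fun z => a * f z + b * g z) rho = a * cmean f rho + b * cmean g rho.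
Proof. by move=> cf cg; rewrite /cmean dint_lin //; exact: cont01_circ. Qed.

Lemma cmean_cst (a : C) rho : cmean (fun=> a) rho = a.
Proof. exact: dint_cst. Qed.

Lemma eq_cmean f g rho : (forall z, nrm z = nrm rho -> f z = g z) ->
  cmean f rho = cmean g rho.
Proof. by move=> h; apply: eq_dint => x _; apply: h; exact: nrm_circle. Qed.

Lemma cmean_bound f rho (M : R) : contCirc f (nrm rho) ->
  (forall z, nrm z = nrm rho -> nrm (f z) <= M) -> nrm (cmean f rho) <= M.
Proof.
move=> cf hM; apply: dint_bound; first exact: cont01_circ.
by move=> x _; apply: hM; exact: nrm_circle.
Qed.

Lemma edge_cexp f c : edge (fun w => f (cexp w)) c tau = tau * cmean f (cexp c).
Proof.
by rewrite /edge /cmean; congr (_ * _); apply: eq_dint => x _; rewrite cexpD.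
Qed.

(** The exponential wraps a parallelogram with one side tau around the origin; by periodicity its
    two edges parallel to a cancel. *)
Lemma par_cexp f c a : par (fun w => f (cexp w)) c a tau =
  tau * (cmean f (cexp (c + a)) - cmean f (cexp c)).
Proof.
rewrite /par !edge_cexp.
have -> : edge (fun w => f (cexp w)) (c + tau) a = edge (fun w => f (cexp w)) c a.
  rewrite /edge; congr (_ * _); apply: eq_dint => x _.
  by rewrite addrAC (cexpD (c + _)) cexp_tau mulr1.
ring.
Qed.

(** Goursat's theorem for f o cexp on the period parallelogram that joins logarithms of rho and
    rho'. *)
Lemma cmean_annulus f rho rho' (m M : R) : 0 < m ->
  m <= nrm rho <= M -> m <= nrm rho' <= M ->
  (forall z, m <= nrm z <= M -> differentiable f z) ->
  cmean f rho = cmean f rho'.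
Proof.
move=> m0 h1 h2 df.
have ne0 w : m <= nrm w <= M -> w != 0.
  by move=> /andP[h _]; apply/eqP => w0; move: h; rewrite w0 nrm0 leNgt m0.
have [c hc] := clog (ne0 _ h1); have [c' hc'] := clog (ne0 _ h2).
have := @par_cexp f c (c' - c); rewrite goursat => [/esym/eqP|_ [x [y [/andP[x0 x1] _ ->]]]].
  rewrite mulf_eq0 (negbTE tau_neq0) /= subrKC hc hc' subr_eq0.
  by move/eqP/esym.
apply: (@dcomp _ _ _ _ cexp f); first exact: cexp_diff.
apply: df; rewrite nrm_cexp !ReD ReZ ReB.
have -> : complex.Re (y%:C * tau) = 0 by rewrite /= mul0r mulr0 subr0.
rewrite -hc nrm_cexp in h1; rewrite -hc' nrm_cexp in h2.
set a := complex.Re c in h1 *; set b := complex.Re c' in h2 *.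
case/andP: h1 => h1 h1'; case/andP: h2 => h2 h2'.
have [ab|ab] := leP a b.
  apply/andP; split; [apply: le_trans h1 _|apply: le_trans h2']; rewrite ler_expR.
    have : 0 <= x * (b - a) by rewrite mulr_ge0 // subr_ge0.
    order_lra.
  have : x * (b - a) <= b - a by rewrite ler_piMl // subr_ge0.
  order_lra.
apply/andP; split; [apply: le_trans h2 _|apply: le_trans h1']; rewrite ler_expR.
  have : x * (a - b) <= a - b by rewrite ler_piMl // subr_ge0 ltW.
  order_lra.
have : 0 <= x * (a - b) by rewrite mulr_ge0 // subr_ge0 ltW.
order_lra.
Qed.

(** Its purpose: a period parallelogram centred at p meets the fibre of [cexp p] only in p. *)
Lemma half_tau_inj x y : -1 <= y <= 1 -> cexp (x%:C + y%:C * (tau / 2)) = 1 ->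
  x = 0 /\ y = 0.
Proof.
move=> /andP[y0 y1] h.
have E : x%:C + y%:C * (tau / 2) = x +i* (y * pi).
  rewrite tau_half; apply/eqP; rewrite eq_complex /=.
  by apply/andP; split; apply/eqP; ring.
have x0 : x = 0.
  have := congr1 nrm h; rewrite nrm_cexp nrm1 E /= => /eqP.
  by rewrite -[1]expR0 => /eqP /expR_inj.
split=> //; have := congr1 (@complex.Re R) h; rewrite E /cexp /= x0 expR0 mul1r.
move=> hc; have pp := pi_gt0 R.
have : cos (`|y| * pi) = 1.
  by have [yp|yn] := leP 0 y; [rewrite ger0_norm|rewrite ltr0_norm // mulNr cosN].
have y1' : `|y| <= 1 by rewrite ler_norml y0.
move=> /(congr1 (@acos R)); rewrite cosK; last first.
  by rewrite in_itv /= mulr_ge0 ?(ltW pp) //= ler_piMl // ltW.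
rewrite acos1 => /eqP; rewrite mulf_eq0 (gt_eqF pp) orbF normr_eq0.
by move/eqP.
Qed.

(** The circle may pass over one point where f is merely continuous. Subtracting tau / 2 puts the
    logarithm p of that point at the centre of the period parallelogram. *)
Lemma cmean_center f p (d : R) : 0 < d ->
  (forall z, nrm (cexp p) * expR (- d) <= nrm z <= nrm (cexp p) * expR d ->
     contAt f z /\ (z != cexp p -> differentiable f z)) ->
  cmean f (cexp (p - d%:C - tau / 2)) = cmean f (cexp (p + d%:C - tau / 2)).
Proof.
move=> d0 hf.
have pt x y : -1 <= x <= 1 -> -1 <= y <= 1 ->
    nrm (cexp p) * expR (- d) <= nrm (cexp (p + x%:C * d%:C + y%:C * (tau / 2))) <=
    nrm (cexp p) * expR d.
  move=> /andP[x0 x1] _; rewrite cexpD cexpD !nrmM -mulrA.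
  have -> : nrm (cexp (y%:C * (tau / 2))) = 1.
    by rewrite nrm_cexp ReZ tau_half /= mulr0 expR0.
  rewrite mulr1 [nrm (cexp (x%:C * _))]nrm_cexp ReZ /= !ler_pM2l ?nrm_cexp ?expR_gt0 // !ler_expR.
  have h1 : x * d <= d by rewrite -[leRHS]mul1r ler_pM2r.
  have h2 : -1 * d <= x * d by rewrite ler_pM2r.
  by apply/andP; order_lra.
have := @goursat_center R (fun w => f (cexp w)) p d%:C (tau / 2).
have -> : 2 * (tau / 2) = tau :> C by field.
rewrite par_cexp => H.
have : tau * (cmean f (cexp (p - d%:C - tau / 2 + 2 * d%:C)) -
              cmean f (cexp (p - d%:C - tau / 2))) = 0 :> C.
  apply: H => x y hx hy.
    apply: contAt_comp; first by apply: diff_contAt; exact: cexp_diff.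
    by have [] := hf _ (pt x y hx hy).
  move=> xy; apply: (@dcomp _ _ _ _ cexp f); first exact: cexp_diff.
  have [_] := hf _ (pt x y hx hy); apply.
  apply: contra xy => /eqP; rewrite -addrA cexpD => /eqP.
  rewrite -[X in _ == X]mulr1 (inj_eq (mulfI (cexp_neq0 p))) => /eqP.
  rewrite -rmorphM => /half_tau_inj -/(_ hy) [xd ->].
  by rewrite xpair_eqE eqxx andbT; move/eqP: xd; rewrite mulf_eq0 (gt_eqF d0) orbF.
have -> : p - d%:C - tau / 2 + 2 * d%:C = p + d%:C - tau / 2 by ring.
move=> /eqP; rewrite mulf_eq0 (negbTE tau_neq0) /= subr_eq0 => /eqP.
by [].
Qed.

(** Shrinking the circle does not change the mean, which by continuity tends to the value at the
    centre. *)
Lemma cmean_origin q rho (s : R) : 0 < nrm rho < s -> contAt q 0 ->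
  (forall z, 0 < nrm z < s -> differentiable q z) -> cmean q rho = q 0.
Proof.
move=> /andP[r0 rs] cq dq.
have ind t : 0 < t <= 1 -> cmean q rho = cmean q (t%:C * rho).
  move=> /andP[t0 t1].
  have tr : t * nrm rho <= nrm rho by rewrite ler_piMl // nrm_ge0.
  apply: (@cmean_annulus _ _ _ (t * nrm rho) (nrm rho)).
  - by rewrite mulr_gt0.
  - by rewrite lexx tr.
  - by rewrite nrmM nrm_real gtr0_norm // lexx tr.
  - move=> z /andP[h1 h2]; apply: dq.
    by rewrite (lt_le_trans _ h1) ?mulr_gt0 // (le_lt_trans h2).
apply/eqP; rewrite -subr_eq0; apply/eqP/nrm_eq0/eqP.
rewrite eq_le nrm_ge0 andbT; apply/ler_addgt0Pr => e e0; rewrite add0r.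
have [d d0 hd] := cq e e0.
pose t := Num.min 1 (d / (2 * nrm rho)).
have t0 : 0 < t by rewrite lt_min ltr01 divr_gt0 // mulr_gt0.
have t1 : t <= 1 by rewrite ge_min lexx.
have td : t * nrm rho < d.
  apply: le_lt_trans (_ : d / (2 * nrm rho) * nrm rho < _).
    by rewrite ler_pM2r // ge_min lexx orbT.
  have -> : d / (2 * nrm rho) * nrm rho = d / 2 by field; rewrite gt_eqF.
  order_lra.
have tn : nrm (t%:C * rho) = t * nrm rho by rewrite nrmM nrm_real gtr0_norm.
have cc : contCirc q (nrm (t%:C * rho)).
  move=> z zE; apply: diff_contAt; apply: dq; rewrite zE tn mulr_gt0 //=.
  by apply: le_lt_trans rs; rewrite ler_piMl // ltW.
rewrite (ind t) ?t0 //.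
have -> : cmean q (t%:C * rho) - q 0 =
    cmean (fun z => 1 * q z + (-1) * (fun=> q 0) z) (t%:C * rho).
  rewrite cmean_lin ?cmean_cst //; first by rewrite mul1r mulN1r.
  by move=> z _; apply: diff_contAt; exact: dcst.
have E : (fun z => 1 * q z + -1 * q 0) = (fun z => q z - q 0).
  by apply/funext => z; rewrite mul1r mulN1r.
rewrite E; apply: cmean_bound => [z zE|z zE].
  by apply: contAtB; [exact: cc|apply: diff_contAt; exact: dcst].
by apply/ltW/hd; rewrite subr0 zE tn.
Qed.

End cauchy.

(** * Cauchy's formula, Taylor expansion and the Schwarz lemma *)

Section cauchy_formula.
Context {R : realType}.
Local Notation C := R[i].
Implicit Types (f g q : C -> C) (c z w p rho t : C) (x y e r s : R).

Definition holdisc f s := forall z, nrm z < s -> differentiable f z.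

Lemma nrm_lt_neq z w : nrm w < nrm z -> z - w != 0.
Proof. by move=> h; rewrite subr_eq0; apply/eqP => E; move: h; rewrite E ltxx. Qed.

(** The circle can be enlarged without changing the mean, and t / (t - z) tends to 1 at infinity. *)
Lemma cmean_kernel rho z : nrm z < nrm rho ->
  cmean (fun t => t / (t - z)) rho = 1.
Proof.
move=> zr; apply/eqP; rewrite -subr_eq0; apply/eqP/nrm_eq0/eqP.
have r0 : 0 < nrm rho by apply: le_lt_trans zr; exact: nrm_ge0.
rewrite eq_le nrm_ge0 andbT; apply/ler_addgt0Pr => e e0; rewrite add0r.
have dk t : nrm rho <= nrm t -> differentiable (fun t => t / (t - z)) t.
  move=> ht; apply: dM; first exact: did.
  apply: dV; first by apply: dB; [exact: did|exact: dcst].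
  by apply: nrm_lt_neq; exact: lt_le_trans ht.
pose k : R := 1 + (nrm z + nrm z / e) / nrm rho.
have k0 : 1 <= k by rewrite lerDl !(divr_ge0, addr_ge0, nrm_ge0) // ltW.
have kn : nrm (k%:C * rho) = k * nrm rho.
  by rewrite nrmM nrm_real ger0_norm // (le_trans _ k0).
have kr : nrm rho <= k * nrm rho by rewrite ler_peMl // ltW.
rewrite (@cmean_annulus _ _ rho (k%:C * rho) (nrm rho) (k * nrm rho)); [|exact: r0|..].
- have -> : cmean (fun t => t / (t - z)) (k%:C * rho) - 1 =
      cmean (fun t => 1 * (t / (t - z)) + (-1) * (fun=> 1) t) (k%:C * rho).
    rewrite cmean_lin ?cmean_cst ?mul1r ?mulN1r //.
      by move=> t tE; apply: diff_contAt; apply: dk; rewrite tE kn.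
    by move=> t _; apply: diff_contAt; exact: dcst.
  rewrite (@eq_cmean _ _ (fun t => z * (t - z)^-1)); last first.
    move=> t tE; have : t - z != 0.
      by apply: nrm_lt_neq; rewrite tE kn; exact: lt_le_trans kr.
    by move=> h; field.
  have zk t : nrm t = nrm (k%:C * rho) -> nrm z / e <= nrm (t - z) /\ t - z != 0.
    move=> tE; split; last first.
      by apply: nrm_lt_neq; rewrite tE kn; exact: lt_le_trans kr.
    have := nrm_lowD t (- z); rewrite nrmN tE kn; apply: le_trans.
    have -> : k * nrm rho = nrm rho + (nrm z + nrm z / e) by rewrite /k; field; rewrite !gt_eqF.
    order_lra.
  apply: cmean_bound => t /zk [h1 h2].
    apply: diff_contAt; apply: dM; first exact: dcst.
    by apply: dV; [apply: dB; [exact: did|exact: dcst]|].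
  rewrite nrmM nrmV ler_pdivrMr ?nrm_gt0 //.
  by rewrite mulrC -ler_pdivrMr.
- by rewrite lexx kr.
- by rewrite kn lexx kr.
- by move=> t /andP[/dk].
Qed.

(** The function t (f t - f z) / (t - z) extends continuously to z and vanishes at 0. Its mean is 0
    on circles inside the one through z and remains 0 after crossing z; on the outer circle the mean
    of t / (t - z) is 1, which leaves f z. *)
Lemma cauchy_formula f s rho z : holdisc f s -> nrm z < nrm rho < s ->
  f z = cmean (fun t => f t * (t / (t - z))) rho.
Proof.
move=> df /andP[zr rs].
have r0 : 0 < nrm rho by apply: le_lt_trans zr; exact: nrm_ge0.
have [->|z0] := eqVneq z 0.
  rewrite (@eq_cmean _ _ f); last first.
    move=> t tE; rewrite subr0 divff ?mulr1 //.
    by apply/eqP => t0; move: tE r0; rewrite t0 nrm0 => <-; rewrite ltxx.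
  apply/esym/(@cmean_origin _ _ _ s); first by rewrite r0.
    by apply: diff_contAt; apply: df; rewrite nrm0 (lt_trans r0).
  by move=> t /andP[_ /df].
pose g t := if t == z then 'd f z 1 else (f t - f z) / (t - z).
pose q t := t * g t.
have dg t : nrm t < s -> t != z -> differentiable g t.
  move=> ts tz.
  have : differentiable (fun t => (f t - f z) / (t - z)) t.
    apply: dM; first by apply: dB; [exact: df|exact: dcst].
    by apply: dV; [apply: dB; [exact: did|exact: dcst]|rewrite subr_eq0].
  move=> /diff_ext H; have [|//] := H g _.
  exists (nrm (t - z)); first by rewrite nrm_gt0 // subr_eq0.
  move=> y hy; rewrite /g ifN //; apply/eqP => yz.
  by move: hy; rewrite yz nrmC ltxx.
have cg : contAt g z.
  move=> e e0; have [d d0 hd] := diff_nrm (df _ (lt_trans zr rs)) (divr_gt0 e0 (ltr0n R 2)).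
  exists d => // w hw; rewrite {2}/g eqxx /g.
  have [_|wz] := eqVneq w z; first by rewrite subrr nrm0.
  have wz0 : w - z != 0 by rewrite subr_eq0.
  have := hd _ hw; rewrite subrKC (diff1E_nrm (df _ (lt_trans zr rs)) (w - z)) -[_ *: _]/(_ * _).
  have -> : f w - f z - (w - z) * 'd f z 1 = ((f w - f z) / (w - z) - 'd f z 1) * (w - z).
    by field.
  rewrite nrmM ler_pM2r ?nrm_gt0 // => h; apply: le_lt_trans h _; order_lra.
have cq t : nrm t < s -> contAt q t.
  move=> ts; have [->|tz] := eqVneq t z; last first.
    by apply: diff_contAt; apply: dM; [exact: did|exact: dg].
  move=> e e0; pose A := nrm z + 1; pose B := nrm (g z) + 1.
  have A0 : 0 < A by rewrite ltr_wpDl ?nrm_ge0.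
  have B0 : 0 < B by rewrite ltr_wpDl ?nrm_ge0.
  have e1 : 0 < Num.min 1 (e / 2 / A) by rewrite lt_min ltr01 !divr_gt0.
  have [d d0 hd] := cg _ e1.
  exists (Num.min d (e / 2 / B)); first by rewrite lt_min d0 !divr_gt0.
  move=> w; rewrite lt_min => /andP[/hd]; rewrite lt_min => /andP[h1 h2] h3.
  have -> : q w - q z = (w - z) * g w + z * (g w - g z) by rewrite /q; ring.
  apply: le_lt_trans (nrmD _ _) _; rewrite !nrmM.
  have gB : nrm (g w) <= B.
    by have := nrmD (g w - g z) (g z); rewrite subrK /B; order_lra.
  have : nrm (w - z) * nrm (g w) <= nrm (w - z) * B by rewrite ler_wpM2l ?nrm_ge0.
  have : nrm z * nrm (g w - g z) <= A * nrm (g w - g z).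
    by rewrite ler_wpM2r ?nrm_ge0 // lerDl.
  move: h2 h3; rewrite !ltr_pdivlMr // [A * _]mulrC; order_lra.
have dq t : nrm t < s -> t != z -> differentiable q t.
  by move=> ts tz; apply: dM; [exact: did|exact: dg].
(* The crossing is centred at a logarithm p of z, and d is chosen so that the outer circle has
   radius |rho|. *)
have [p hp] := clog z0.
pose d := ln (nrm rho / nrm z).
have nz0 : 0 < nrm z := nrm_gt0 z0.
have d0 : 0 < d by rewrite ln_gt0 // ltr_pdivlMr // mul1r.
have ed : expR d = nrm rho / nrm z by rewrite lnK // posrE divr_gt0.
have zz : nrm z * (nrm rho / nrm z) = nrm rho by field; rewrite gt_eqF.
have nn k : nrm (cexp (p + k%:C - tau / 2)) = nrm z * expR k.
  rewrite nrm_cexp ReB ReD tau_half /= subr0 expRD -nrm_cexp hp.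
  by [].
have mid := @cmean_center _ q p d d0.
have mq : cmean q (cexp (p + d%:C - tau / 2)) = 0.
  have <- : cmean q (cexp (p - d%:C - tau / 2)) = cmean q (cexp (p + d%:C - tau / 2)).
    apply: mid => t; rewrite hp ed zz => /andP[h1 h2].
    have ts := le_lt_trans h2 rs.
    by split; [exact: cq|exact: dq].
  have n1 : nrm (cexp (p - d%:C - tau / 2)) < nrm z.
    rewrite -rmorphN nn -[X in _ < X]mulr1 ltr_pM2l // -expR0 ltr_expR; order_lra.
  rewrite (@cmean_origin _ _ _ (nrm z)); first by rewrite /q mul0r.
  - by rewrite nrm_cexp expR_gt0 -nrm_cexp.
  - by apply: cq; rewrite nrm0 (lt_trans nz0) // (lt_trans zr).
  - move=> t /andP[t0 t1]; apply: dq; first by rewrite (lt_trans t1) // (lt_trans zr).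
    by apply/eqP => tz; move: t1; rewrite tz ltxx.
set rho' := cexp _ in mq.
have n2 : nrm rho' = nrm rho.
  by rewrite nn ed.
have kne t : nrm t = nrm rho -> t - z != 0.
  by move=> tE; apply: nrm_lt_neq; rewrite tE.
have dint' t : nrm t = nrm rho -> differentiable (fun t => f t * (t / (t - z))) t.
  move=> tE; apply: dM; first by apply: df; rewrite tE.
  apply: dM; first exact: did.
  by apply: dV; [apply: dB; [exact: did|exact: dcst]|exact: kne].
have main : cmean (fun t => f t * (t / (t - z))) rho' = f z.
  apply/eqP; rewrite -subr_eq0; apply/eqP.
  rewrite -[RHS]mq (@eq_cmean _ q (fun t => 1 * (f t * (t / (t - z))) + (- f z) * (t / (t - z)))).
    rewrite cmean_lin ?cmean_kernel ?n2 //; first by ring.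
      by move=> t tE; apply: diff_contAt; apply: dint'; rewrite tE.
    move=> t tE; apply: diff_contAt; apply: dM; first exact: did.
    by apply: dV; [apply: dB; [exact: did|exact: dcst]|apply: kne; rewrite tE].
  move=> t; rewrite n2 => /kne tz; rewrite /q /g ifN; first by field.
  by rewrite -subr_eq0.
rewrite -main; apply/esym/(@cmean_annulus _ _ _ _ (nrm rho) (nrm rho)); [exact: r0|by rewrite lexx|by rewrite n2 lexx|].
move=> t /andP[t1 t2]; apply: dint'; apply/eqP; rewrite eq_le t1 t2 //.
Qed.

(** The k-th Taylor coefficient of f at 0, in Cauchy's form. *)
Definition coef f rho (k : nat) := cmean (fun t => f t / t ^+ k) rho.

(** The factor of z^k in Cauchy's remainder after k terms. *)
Definition rem f rho z (k : nat) := cmean (fun t => f t / t ^+ k * (t / (t - z))) rho.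

(** Cauchy's formula combined k times with t / (t - z) = 1 + (z / t) (t / (t - z)). *)
Lemma taylor_rem f s rho z k : holdisc f s -> nrm z < nrm rho < s ->
  f z = \sum_(i < k) z ^+ i * coef f rho i + z ^+ k * rem f rho z k.
Proof.
move=> df /andP[zr rs].
have r0 : 0 < nrm rho by apply: le_lt_trans zr; exact: nrm_ge0.
have tne t : nrm t = nrm rho -> t != 0.
  by move=> tE; apply/eqP => t0; move: r0; rewrite -tE t0 nrm0 ltxx.
have tnz t : nrm t = nrm rho -> t - z != 0.
  by move=> tE; apply: nrm_lt_neq; rewrite tE.
elim: k => [|k ih].
  rewrite big_ord0 add0r expr0 mul1r /rem {1}(@cauchy_formula f s rho z) ?zr //.
  by apply: eq_cmean => t _; rewrite expr0 divr1.
rewrite big_ord_recr /= [LHS]ih -addrA; congr (_ + _).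
rewrite exprSr -mulrA -mulrDr; congr (_ * _).
transitivity (cmean (fun t => 1 * (f t / t ^+ k) + z * (f t / t ^+ k.+1 * (t / (t - z)))) rho).
  apply: eq_cmean => t tE; rewrite exprS.
  have h1 := tne t tE; have h2 := tnz t tE; field.
  by rewrite h1 h2 expf_neq0.
have d1 i t : nrm t = nrm rho -> differentiable (fun t => f t / t ^+ i) t.
  move=> tE; apply: dM; first by apply: df; rewrite tE.
  apply: dV; first by apply: dX; exact: did.
  by rewrite expf_neq0 // tne.
rewrite cmean_lin ?mul1r //.
  by move=> t tE; apply: diff_contAt; exact: d1.
move=> t tE; apply: diff_contAt; apply: dM; first exact: d1.
apply: dM; first exact: did.
by apply: dV; [apply: dB; [exact: did|exact: dcst]|exact: tnz].
Qed.

Lemma coef_indep f s rho rho' k : holdisc f s -> 0 < nrm rho < s ->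
  0 < nrm rho' < s -> coef f rho k = coef f rho' k.
Proof.
move=> df /andP[h1 h2] /andP[h3 h4].
apply: (@cmean_annulus _ _ _ _ (Num.min (nrm rho) (nrm rho')) (Num.max (nrm rho) (nrm rho'))).
- by rewrite lt_min h1.
- by rewrite ge_min le_max !lexx.
- by rewrite ge_min le_max !lexx !orbT.
- move=> t /andP[t1 t2]; apply: dM.
    by apply: df; apply: le_lt_trans t2 _; rewrite gt_max h2.
  apply: dV; first by apply: dX; exact: did.
  rewrite expf_neq0 //; apply/eqP => t0; move: t1.
  by rewrite t0 nrm0 leNgt lt_min h1 h3.
Qed.

Lemma coef_bound f s rho k (M : R) : holdisc f s -> 0 < nrm rho < s ->
  (forall t, nrm t = nrm rho -> nrm (f t) <= M) ->
  nrm (coef f rho k) <= M / nrm rho ^+ k.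
Proof.
move=> df /andP[r0 rs] hM; apply: cmean_bound => t tE.
  apply: diff_contAt; apply: dM; first by apply: df; rewrite tE.
  apply: dV; first by apply: dX; exact: did.
  by rewrite expf_neq0 //; apply/eqP => t0; move: r0; rewrite -tE t0 nrm0 ltxx.
by rewrite nrmM nrmV nrmX tE ler_wpM2r ?hM // invr_ge0 exprn_ge0 // ltW.
Qed.

Lemma rem_bound f s rho z k (M : R) : holdisc f s -> nrm z < nrm rho < s ->
  (forall t, nrm t = nrm rho -> nrm (f t) <= M) ->
  nrm (rem f rho z k) <= M / nrm rho ^+ k * (nrm rho / (nrm rho - nrm z)).
Proof.
move=> df /andP[zr rs] hM.
have r0 : 0 < nrm rho by apply: le_lt_trans zr; exact: nrm_ge0.
apply: cmean_bound => t tE.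
  apply: diff_contAt; apply: dM.
    apply: dM; first by apply: df; rewrite tE.
    apply: dV; first by apply: dX; exact: did.
    by rewrite expf_neq0 //; apply/eqP => t0; move: r0; rewrite -tE t0 nrm0 ltxx.
  apply: dM; first exact: did.
  by apply: dV; [apply: dB; [exact: did|exact: dcst]|apply: nrm_lt_neq; rewrite tE].
have tz : nrm rho - nrm z <= nrm (t - z).
  by have := nrm_lowD t (- z); rewrite nrmN tE.
have p0 : 0 < nrm rho - nrm z by rewrite subr_gt0.
have M0 : 0 <= M := le_trans (nrm_ge0 _) (hM t tE).
rewrite !nrmM !nrmV nrmX tE ler_pM //.
- by rewrite divr_ge0 ?nrm_ge0 // exprn_ge0 // ltW.
- by rewrite divr_ge0 ?nrm_ge0 // ltW.
- by rewrite ler_wpM2r ?hM // invr_ge0 exprn_ge0 // ltW.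
- by rewrite ler_wpM2l ?(ltW r0) // lef_pV2 ?posrE // (lt_le_trans p0).
Qed.

(** If x > y > 0, the powers of x / y outgrow K by Bernoulli's inequality. *)
Lemma power_trick (x y K : R) : 0 <= x -> 0 <= y ->
  (forall m : nat, x ^+ m <= K * y ^+ m) -> x <= y.
Proof.
move=> x0 y0 h; rewrite leNgt; apply/negP => yx.
have [y00|yn0] := eqVneq y 0.
  have := h 1%N; rewrite !expr1 y00 mulr0 leNgt (le_lt_trans _ yx) //.
have yp : 0 < y by rewrite lt_neqAle eq_sym yn0.
pose q := x / y; have q1 : 0 < q - 1 by rewrite subr_gt0 ltr_pdivlMr // mul1r.
have hq m : q ^+ m <= K by rewrite expr_div_n ler_pdivrMr ?exprn_gt0.
have bern m : 1 + m%:R * (q - 1) <= q ^+ m.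
  elim: m => [|m ih]; first by rewrite mul0r addr0 expr0.
  rewrite exprS -natr1; apply: le_trans (_ : q * (1 + m%:R * (q - 1)) <= _); last first.
    by rewrite ler_wpM2l //; order_lra.
  have : 0 <= m%:R * (q - 1) * (q - 1) by rewrite !mulr_ge0 ?(ltW q1).
  set mm := m%:R; order_lra.
have [m hm] : exists m : nat, K / (q - 1) < m%:R.
  by exists (Num.trunc `|K / (q - 1)|).+1; apply: le_lt_trans (ler_norm _) _; rewrite truncnS_gt.
have := hq m; have := bern m; move: hm; rewrite ltr_pdivrMr //; order_lra.
Qed.

(** The coefficient is the same for all radii, and for a small radius r it is at most K r^(N -
    k). *)
Lemma coef_small f s rho (k N : nat) (K d : R) : holdisc f s -> 0 <= K -> 0 < d ->
  (forall t, nrm t < d -> nrm (f t) <= K * nrm t ^+ N) -> (k < N)%N ->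
  0 < nrm rho < s -> coef f rho k = 0.
Proof.
move=> df K0 d0 hK kN /andP[r0 rs]; apply: nrm_eq0; apply/eqP.
have s0 : 0 < s := lt_trans r0 rs.
rewrite eq_le nrm_ge0 andbT; apply/ler_addgt0Pr => e e0; rewrite add0r.
pose r : R := Num.min (Num.min 1 (d / 2)) (Num.min (s / 2) (e / (K + 1))).
have K1 : 0 < K + 1 by rewrite ltr_wpDl.
have rr0 : 0 < r by rewrite !lt_min ltr01 !divr_gt0.
have r1 : r <= 1 by rewrite !ge_min lexx.
have rd : r < d by apply: le_lt_trans (_ : d / 2 < _); [rewrite !ge_min lexx ?orbT|order_lra].
have rrs : r < s by apply: le_lt_trans (_ : s / 2 < _); [rewrite !ge_min lexx ?orbT|order_lra].
have re : r <= e / (K + 1) by rewrite !ge_min lexx ?orbT.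
have nr : nrm (r%:C : C) = r by rewrite nrm_real gtr0_norm.
rewrite (@coef_indep f s rho r%:C) ?nr ?r0 ?rr0 //.
apply: le_trans (coef_bound (M := K * r ^+ N) _ df _ _) _; rewrite ?nr ?rr0 //.
  by move=> t tr; rewrite (le_trans (hK t _)) ?tr.
have -> : K * r ^+ N / r ^+ k = K * r ^+ (N - k).
  by rewrite -[in LHS](subnK (ltnW kN)) exprD mulrA mulfK // expf_neq0 // gt_eqF.
have h : r ^+ (N - k) <= r.
  by rewrite -[X in _ <= X]expr1 ler_wiXn2l ?subn_gt0 // ltW.
apply: le_trans (ler_wpM2l K0 h) _; apply: le_trans (_ : (K + 1) * r <= _).
  by rewrite ler_wpM2r ?lerDl // ltW.
by rewrite mulrC -ler_pdivlMr.
Qed.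

Lemma bernoulli_le (x : R) (N : nat) : 0 <= x <= 1 -> 1 - N%:R * x <= (1 - x) ^+ N.
Proof.
move=> /andP[x0 x1]; elim: N => [|N ih]; first by rewrite mul0r subr0 expr0.
rewrite exprS -natr1; apply: le_trans (_ : (1 - x) * (1 - N%:R * x) <= _); last first.
  by rewrite ler_wpM2l // subr_ge0.
have : 0 <= N%:R * x * x by rewrite !mulr_ge0.
set n := N%:R; order_lra.
Qed.

Lemma holdiscX f s k : holdisc f s -> holdisc (fun t => f t ^+ k) s.
Proof. by move=> df t /df h; apply: dX. Qed.

(* Landau's trick: Cauchy's formula for the powers of [f] removes the constant. *)
Lemma schwarz_circle f s rho z (N : nat) (K d M : R) : holdisc f s -> 0 <= K -> 0 < d ->
  (forall t, nrm t < d -> nrm (f t) <= K * nrm t ^+ N) ->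
  nrm z < nrm rho < s -> (forall t, nrm t = nrm rho -> nrm (f t) <= M) ->
  nrm (f z) <= M * (nrm z / nrm rho) ^+ N.
Proof.
move=> df K0 d0 hK /andP[zr rs] hM.
have r0 : 0 < nrm rho by apply: le_lt_trans zr; exact: nrm_ge0.
have M0 : 0 <= M by apply: le_trans (hM rho _) => //; exact: nrm_ge0.
have zr0 : 0 <= nrm z / nrm rho by rewrite divr_ge0 ?nrm_ge0.
apply: (@power_trick _ _ (nrm rho / (nrm rho - nrm z))).
- exact: nrm_ge0.
- by rewrite mulr_ge0 // exprn_ge0.
move=> m; rewrite -nrmX.
have dm := holdiscX m df.
(* The Taylor coefficients of f^m below order N m vanish, so that only the remainder survives. *)
rewrite (@taylor_rem _ s rho z (N * m) dm) ?zr // big1 ?add0r; last first.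
  move=> [i hi] _ /=; rewrite (@coef_small _ s rho i (N * m) (K ^+ m) d) ?mulr0 ?r0 ?exprn_ge0 //.
  by move=> t /hK h; rewrite nrmX exprM -exprMn lerXn2r ?nnegrE ?nrm_ge0 // mulr_ge0 // exprn_ge0 // nrm_ge0.
rewrite nrmM nrmX.
have := @rem_bound _ s rho z (N * m) (M ^+ m) dm.
rewrite zr rs => /(_ erefl) h.
apply: le_trans (ler_wpM2l (exprn_ge0 _ (nrm_ge0 _)) (h _)) _.
  by move=> t /hM ?; rewrite nrmX lerXn2r ?nnegrE ?nrm_ge0.
rewrite exprMn -exprM expr_div_n le_eqVlt; apply/orP; left; apply/eqP.
by field; rewrite subr_eq0 !gt_eqF ?exprn_gt0.
Qed.

Lemma growth0 f : differentiable f 0 -> exists K d : R, [/\ 0 <= K, 0 < d &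
  forall t, nrm t < d -> nrm (f t) <= K * nrm t ^+ 0].
Proof.
move=> /diff_cont /(_ 1 ltr01) [d d0 hd]; exists (nrm (f 0) + 1), d.
split; [by rewrite addr_ge0 ?nrm_ge0|by []|move=> t td; rewrite expr0 mulr1].
have := hd t; rewrite subr0 => /(_ td); have := nrmD (f t - f 0) (f 0); rewrite subrK; order_lra.
Qed.

Lemma growth1 f : differentiable f 0 -> f 0 = 0 -> exists K d : R, [/\ 0 <= K, 0 < d &
  forall t, nrm t < d -> nrm (f t) <= K * nrm t ^+ 1].
Proof.
move=> df f0; have [d d0 hd] := diff_nrm df ltr01.
exists (nrm ('d f 0 1 : C) + 1), d.
split; [by rewrite addr_ge0 ?nrm_ge0|by []|move=> t td; rewrite expr1].
have := hd t td; rewrite add0r f0 subr0 (diff1E_nrm df) -[_ *: _]/(_ * _).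
have := nrmD (f t - t * 'd f 0 1) (t * 'd f 0 1); rewrite subrK nrmM.
rewrite mulrDl mulrC; order_lra.
Qed.

Lemma max_disc f s rho z (M : R) : holdisc f s -> nrm z < nrm rho < s ->
  (forall t, nrm t = nrm rho -> nrm (f t) <= M) -> nrm (f z) <= M.
Proof.
move=> df /andP[zr rs] hM.
have [|K [d [K0 d0 h]]] := @growth0 f.
  by apply: df; rewrite nrm0 (le_lt_trans (nrm_ge0 z)) // (lt_trans zr).
have := schwarz_circle df K0 d0 h; rewrite -[M in X in _ -> X]mulr1 -(expr0 (nrm z / nrm rho)).
by apply; rewrite ?zr.
Qed.

(** The radius of the circle in [schwarz_circle] tends to s. The radius s (1 - del) costs a factor
    (1 - del)^N, which Bernoulli's inequality bounds below by 1 - N del. *)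
Lemma schwarz_order f s (N : nat) (K d M : R) z : holdisc f s -> 0 <= K -> 0 < d ->
  (forall t, nrm t < d -> nrm (f t) <= K * nrm t ^+ N) ->
  (forall t, nrm t < s -> nrm (f t) <= M) -> nrm z < s ->
  nrm (f z) <= M * (nrm z / s) ^+ N.
Proof.
move=> df K0 d0 hK hM zs; have s0 : 0 < s by apply: le_lt_trans zs; exact: nrm_ge0.
have fM := hM z zs; set x := nrm (f z) in fM *; have x0 : 0 <= x := nrm_ge0 _.
apply/ler_addgt0Pr => e e0.
pose u := nrm z / s; have u1 : u < 1 by rewrite ltr_pdivrMr // mul1r.
have u0 : 0 <= u by rewrite divr_ge0 ?nrm_ge0 // ltW.
have k0 : 0 < x * N%:R + 1 by rewrite ltr_wpDl // mulr_ge0.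
pose del := Num.min ((1 - u) / 2) (e / (x * N%:R + 1)).
have del0 : 0 < del by rewrite lt_min !divr_gt0 // subr_gt0.
have del1 : del <= (1 - u) / 2 by rewrite ge_min lexx.
have del2 : del <= e / (x * N%:R + 1) by rewrite ge_min lexx orbT.
pose r := s * (1 - del).
have r0 : 0 < r by rewrite mulr_gt0 //; order_lra.
have nr : nrm (r%:C : C) = r by rewrite nrm_real gtr0_norm.
have zr : nrm z < r.
  have -> : nrm z = s * u by rewrite /u mulrCA divff ?mulr1 // gt_eqF.
  rewrite ltr_pM2l //; order_lra.
have rs : r < s by rewrite -[X in _ < X]mulr1 ltr_pM2l //; order_lra.
have := @schwarz_circle f s r%:C z N K d M df K0 d0 hK.
rewrite nr zr rs => /(_ erefl) H.
have {}H : x <= M * (nrm z / r) ^+ N.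
  by apply: H => t tr; apply: hM; rewrite tr.
have q0 : 0 < (1 - del) ^+ N by rewrite exprn_gt0 //; order_lra.
have E : M * (nrm z / r) ^+ N = M * u ^+ N / (1 - del) ^+ N.
  rewrite /r /u !expr_div_n exprMn; field.
  by rewrite (gt_eqF q0) (gt_eqF (exprn_gt0 N s0)).
rewrite E ler_pdivlMr // in H.
have b := @bernoulli_le del N ltac:(apply/andP; order_lra).
have : x * (1 - N%:R * del) <= x * (1 - del) ^+ N by rewrite ler_wpM2l.
have : (x * N%:R + 1) * del <= e by rewrite mulrC -ler_pdivlMr.
move: H; rewrite -/u; set A := M * u ^+ N; set B := x * (1 - del) ^+ N.
set n := N%:R; order_lra.
Qed.

Lemma schwarz f s (M : R) z : holdisc f s -> f 0 = 0 ->
  (forall t, nrm t < s -> nrm (f t) <= M) -> nrm z < s ->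
  nrm (f z) <= M * (nrm z / s).
Proof.
move=> df f0 hM zs; have s0 : 0 < s by apply: le_lt_trans zs; exact: nrm_ge0.
have [|K [d [K0 d0 h]]] := @growth1 f _ f0; first by apply: df; rewrite nrm0.
by have := schwarz_order df K0 d0 h hM zs; rewrite expr1.
Qed.

(** In the remainder after two terms the factor r / (r - |z|) is at most 2. The two coefficients are
    recognised as f 0, by setting z = 0, and as the derivative, by comparison with the definition of
    the differential. *)
Lemma taylor2 f s (r M : R) z : holdisc f s -> 0 < r < s ->
  (forall t, nrm t = r -> nrm (f t) <= M) -> nrm z <= r / 2 ->
  nrm (f z - f 0 - z * 'd f 0 1) <= 2 * M / r ^+ 2 * nrm z ^+ 2.
Proof.
move=> df /andP[r0 rs] hM zr.
have nr : nrm (r%:C : C) = r by rewrite nrm_real gtr0_norm.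
pose c0 := coef f r%:C 0; pose c1 := coef f r%:C 1.
have M0 : 0 <= M by apply: le_trans (hM r%:C _) => //; exact: nrm_ge0.
have T w : nrm w <= r / 2 -> nrm (f w - c0 - w * c1) <= 2 * M / r ^+ 2 * nrm w ^+ 2.
  move=> wr; have wr' : nrm w < r by order_lra.
  rewrite {1}(@taylor_rem f s r%:C w 2 df) ?nr ?wr' // !big_ord_recl big_ord0 /=.
  rewrite -[bump 0 0]/1%N !expr0 mul1r addr0 expr1 -/c0 -/c1.
  have -> : c0 + w * c1 + w ^+ 2 * rem f r%:C w 2 - c0 - w * c1 = w ^+ 2 * rem f r%:C w 2.
    by ring.
  rewrite nrmM nrmX mulrC ler_wpM2r ?exprn_ge0 ?nrm_ge0 //.
  have := @rem_bound f s r%:C w 2 M df; rewrite nr wr' rs => /(_ isT hM) /le_trans; apply.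
  have -> : 2 * M / r ^+ 2 = M / r ^+ 2 * 2 by ring.
  rewrite ler_wpM2l ?divr_ge0 ?exprn_ge0 ?(ltW r0) //.
  rewrite ler_pdivrMr ?subr_gt0 //; order_lra.
have c0E : c0 = f 0.
  have := T 0; rewrite nrm0 mul0r subr0 expr0n mulr0 => /(_ _) h.
  have {}h : nrm (f 0 - c0) <= 0 by apply: h; order_lra.
  by apply/esym/eqP; rewrite -subr_eq0; apply/eqP/nrm_eq0/eqP; rewrite eq_le h nrm_ge0.
suff c1E : c1 = 'd f 0 1 by have := T z zr; rewrite c0E c1E.
apply/eqP; rewrite -subr_eq0; apply/eqP/nrm_eq0/eqP.
rewrite eq_le nrm_ge0 andbT; apply/ler_addgt0Pr => e e0; rewrite add0r.
have e2 : 0 < e / 2 by order_lra.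
have df0 : differentiable f 0 by apply: df; rewrite nrm0; order_lra.
have [d d0 hd] := diff_nrm df0 e2.
pose A := 2 * M / r ^+ 2; have A0 : 0 <= A by rewrite divr_ge0 ?exprn_ge0 ?(ltW r0) // mulr_ge0.
pose u := Num.min (Num.min (d / 2) (r / 2)) (e / 2 / (A + 1)).
have u0 : 0 < u by rewrite !lt_min !divr_gt0 // ltr_wpDl.
have ud : u < d by apply: le_lt_trans (_ : d / 2 < _); [rewrite !ge_min lexx ?orbT|order_lra].
have ur : u <= r / 2 by rewrite !ge_min lexx ?orbT.
have uA : (A + 1) * u <= e / 2.
  by rewrite mulrC -ler_pdivlMr ?ltr_wpDl // !ge_min lexx ?orbT.
have nu : nrm (u%:C : C) = u by rewrite nrm_real gtr0_norm.
have h1 := T u%:C; rewrite nu -/A in h1; have {}h1 := h1 ur.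
have h2 := hd u%:C; rewrite nu add0r (diff1E_nrm df0) -[_ *: _]/(_ * _) in h2; have {}h2 := h2 ud.
have : nrm (u%:C * (c1 - 'd f 0 1)) <= A * u ^+ 2 + e / 2 * u.
  have -> : u%:C * (c1 - 'd f 0 1) = (f u%:C - f 0 - u%:C * 'd f 0 1) - (f u%:C - c0 - u%:C * c1).
    by rewrite c0E; ring.
  apply: le_trans (nrmB _ _) _; order_lra.
rewrite nrmM nu expr2 mulrA -mulrDl mulrC ler_pM2r // => h.
apply: le_trans h _; move: uA u0; order_lra.
Qed.

(** The Schwarz lemma for f - f 0, which is bounded by 2 M, controls the difference quotients at
    0. *)
Lemma deriv_bound f s (r M : R) : holdisc f s -> 0 < r < s ->
  (forall t, nrm t <= r -> nrm (f t) <= M) -> nrm ('d f 0 1 : C) <= 2 * M / r.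
Proof.
move=> df /andP[r0 rs] hM.
have df0 : differentiable f 0 by apply: df; rewrite nrm0; order_lra.
apply/ler_addgt0Pr => e e0; have [d d0 hd] := diff_nrm df0 e0.
pose u := Num.min (d / 2) (r / 2).
have u0 : 0 < u by rewrite !lt_min !divr_gt0.
have ud : u < d by apply: le_lt_trans (_ : d / 2 < _); [rewrite !ge_min lexx ?orbT|order_lra].
have ur : u <= r / 2 by rewrite !ge_min lexx ?orbT.
have nu : nrm (u%:C : C) = u by rewrite nrm_real gtr0_norm.
have h2 := hd u%:C; rewrite nu add0r (diff1E_nrm df0) -[_ *: _]/(_ * _) in h2; have {}h2 := h2 ud.
have dg : holdisc (fun t => f t - f 0) r.
  by move=> t tr; apply: dB; [apply: df; exact: lt_trans rs|exact: dcst].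
have h1 : nrm (f u%:C - f 0) <= 2 * M * (u / r).
  have := @schwarz _ r (2 * M) u%:C dg; rewrite subrr nu; apply => //; last order_lra.
  move=> t tr; have := nrmB (f t) (f 0); have := hM t (ltW tr); have := hM 0.
  rewrite nrm0 => /(_ (ltW r0)); order_lra.
have : nrm (u%:C * 'd f 0 1) <= 2 * M * (u / r) + e * u.
  have := nrmB (f u%:C - f 0) (f u%:C - f 0 - u%:C * 'd f 0 1).
  have -> : f u%:C - f 0 - (f u%:C - f 0 - u%:C * 'd f 0 1) = u%:C * 'd f 0 1 by ring.
  order_lra.
rewrite nrmM nu.
have -> : 2 * M * (u / r) + e * u = u * (2 * M / r + e) by ring.
by rewrite ler_pM2l.
Qed.

End cauchy_formula.

(** * Holomorphic maps of several variables *)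

Section several_variables.
Context {R : realType}.
Local Notation C := R[i].

Lemma linear_bounded_continuous {V W : normedModType C} (L : {linear V -> W}) (K : R) :
  (forall h, nrm (L h) <= K * nrm h) -> continuous L.
Proof.
move=> hK x; apply/(@cvg_nrm _ _ _ (nbhs x)) => e e0.
have K1 : 0 < `|K| + 1 by rewrite ltr_wpDl.
apply/nbhs_nrm; exists (e / (`|K| + 1)); first exact: divr_gt0.
move=> y hy; rewrite -linearB; apply: le_lt_trans (hK _) _.
apply: le_lt_trans (_ : (`|K| + 1) * nrm (y - x) < e).
  by rewrite ler_wpM2r ?nrm_ge0 // (le_trans (ler_norm _)) // lerDl.
by rewrite mulrC -ltr_pdivlMr.
Qed.

Lemma linear_bounded {V W : normedModType C} (L : {linear V -> W}) : continuous L ->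
  exists2 K : R, 0 < K & forall h, nrm (L h) <= K * nrm h.
Proof.
move=> /linear_lipschitz [k k0 hk]; exists (complex.Re k).
  by move: k0; rewrite ltcE => /andP[].
move=> h; have := hk h; rewrite !nrmE.
have -> : k = (complex.Re k)%:C by rewrite RRe_real ?gtr0_real.
by rewrite -rmorphM lecR.
Qed.

Lemma dline {V W : normedModType C} (f : V -> W) (z u : V) (t : C) :
  differentiable f (z + t *: u) ->
  differentiable (fun s : C => f (z + s *: u)) t /\
  'd (fun s : C => f (z + s *: u)) t 1 = 'd f (z + t *: u) u.
Proof.
move=> df.
have [dl El] : differentiable (fun s : C => z + s *: u) t /\
    forall h, 'd (fun s : C => z + s *: u) t h = h *: u.
  apply: diff1P => e e0; exists 1 => // h _.
  have -> : z + (t + h) *: u - (z + t *: u) - h *: u = 0.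
    by rewrite scalerDl addrA [z + t *: u + h *: u]addrC addrK subrr.
  by rewrite nrm0 mulr_ge0 ?nrm_ge0 // ltW.
split; first exact: (@dcomp R _ V W (fun s : C => z + s *: u) f t dl df).
have := @diff_comp _ _ _ _ (fun s : C => z + s *: u) f t dl df.
by move=> /(congr1 (fun g => g 1)) /=; rewrite El scale1r.
Qed.

(** * Cauchy estimates for scalar functions on balls *)

Section scalar.
Context {V : normedModType C}.
Implicit Types (f : V -> C) (z h u : V) (r M : R).

Definition holball f z r := forall w, nrm (w - z) < r -> differentiable f w.

Lemma holball_line f z r h (s : R) : holball f z r -> 0 < nrm h -> s * nrm h <= r ->
  holdisc (fun t : C => f (z + t *: h)) s.
Proof.
move=> df h0 sr t ts; apply: (dline _).1; apply: df.
rewrite addrAC subrr add0r nrmZ; apply: lt_le_trans sr.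
by rewrite ltr_pM2r.
Qed.

Lemma diff_line0 f z h : differentiable f z ->
  'd (fun t : C => f (z + t *: h)) 0 1 = 'd f z h.
Proof.
move=> df; have := @dline _ _ f z h 0; rewrite scale0r addr0.
by move=> /(_ df) [].
Qed.

(** The complex line through z in direction h meets the ball in a disc of radius s = r / |h|. The
    one-variable estimate is used on half that disc, and 2 M / (s / 2)^2 = 8 M |h|^2 / r^2. *)
Lemma holball_taylor2 f z r M h : 0 < r -> holball f z r ->
  (forall w, nrm (w - z) < r -> nrm (f w) <= M) -> nrm h <= r / 4 ->
  nrm (f (z + h) - f z - 'd f z h) <= 8 * M / r ^+ 2 * nrm h ^+ 2.
Proof.
move=> r0 df hM hr; have [->|h0] := eqVneq h 0.
  by rewrite linear0 addr0 subrr subr0 !nrm0 expr0n mulr0.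
have hp := nrm_gt0 h0; pose s := r / nrm h.
have s0 : 0 < s by rewrite divr_gt0.
have sh : s * nrm h = r by rewrite /s divfK // gt_eqF.
have hd : holdisc (fun t : C => f (z + t *: h)) s.
  by apply: (holball_line df hp); rewrite sh.
have s2 : 0 < s / 2 < s by apply/andP; order_lra.
have := @taylor2 _ _ s (s / 2) M 1 hd s2.
rewrite scale1r scale0r addr0 mul1r diff_line0; last by apply: df; rewrite subrr nrm0.
rewrite nrm1 expr1n mulr1 => H.
have E : 8 * M / r ^+ 2 * nrm h ^+ 2 = 2 * M / (s / 2) ^+ 2.
  by rewrite /s; field; rewrite !gt_eqF.
rewrite E; apply: H.
  move=> t ts; apply: hM; rewrite addrAC subrr add0r nrmZ ts -sh.
  by rewrite ltr_pM2r //; order_lra.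
have : 4 * nrm h <= r by order_lra.
by rewrite -ler_pdivlMr // -/s; order_lra.
Qed.

(** The Schwarz lemma for f - f z on the complex line in direction h. *)
Lemma holball_lip f z r M h : 0 < r -> holball f z r ->
  (forall w, nrm (w - z) < r -> nrm (f w) <= M) -> nrm h < r ->
  nrm (f (z + h) - f z) <= 2 * M / r * nrm h.
Proof.
move=> r0 df hM hr; have [->|h0] := eqVneq h 0.
  by rewrite addr0 subrr !nrm0 mulr0.
have hp := nrm_gt0 h0; pose s := r / nrm h.
have s0 : 0 < s by rewrite divr_gt0.
have sh : s * nrm h = r by rewrite /s divfK // gt_eqF.
have hd : holdisc (fun t : C => f (z + t *: h)) s.
  by apply: (holball_line df hp); rewrite sh.
have := @schwarz _ (fun t : C => f (z + t *: h) - f z) s (2 * M) 1.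
rewrite scale1r scale0r addr0 subrr nrm1 => H.
have E : 2 * M / r * nrm h = 2 * M * (1 / s).
  by rewrite /s; field; rewrite !gt_eqF.
rewrite E; apply: H; [|by []|..].
- by move=> t ts; apply: dB; [exact: hd|exact: dcst].
- move=> t ts; have : nrm (z + t *: h - z) < r.
    by rewrite addrAC subrr add0r nrmZ -sh ltr_pM2r.
  move=> /hM; have := hM z; rewrite subrr nrm0 => /(_ r0).
  have := nrmB (f (z + t *: h)) (f z); order_lra.
- by rewrite ltr_pdivlMr // mul1r.
Qed.

Lemma holball_deriv f z r M h : 0 < r -> holball f z r ->
  (forall w, nrm (w - z) < r -> nrm (f w) <= M) ->
  nrm ('d f z h : C) <= 4 * M / r * nrm h.
Proof.
move=> r0 df hM; have [->|h0] := eqVneq h 0.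
  by rewrite linear0 !nrm0 mulr0.
have hp := nrm_gt0 h0; pose s := r / nrm h.
have s0 : 0 < s by rewrite divr_gt0.
have sh : s * nrm h = r by rewrite /s divfK // gt_eqF.
have hd : holdisc (fun t : C => f (z + t *: h)) s.
  by apply: (holball_line df hp); rewrite sh.
have s2 : 0 < s / 2 < s by apply/andP; order_lra.
have := @deriv_bound _ _ s (s / 2) M hd s2.
rewrite diff_line0; last by apply: df; rewrite subrr nrm0.
have -> : 4 * M / r * nrm h = 2 * M / (s / 2).
  by rewrite /s; field; rewrite !gt_eqF.
apply=> t ts; apply: hM; rewrite addrAC subrr add0r nrmZ -sh ltr_pM2r //; order_lra.
Qed.

(** Compares two approximate derivatives p and q through six errors: two Taylor errors, and four
    distances to the values a, b of the limit function. *)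
Lemma quotient_diff (x1 x2 y1 y2 p q a b t : C) : nrm (t * (p - q)) <=
  nrm (x1 - x2 - t * p) + nrm (y1 - y2 - t * q) + nrm (x1 - a) + nrm (y1 - a) +
  nrm (x2 - b) + nrm (y2 - b).
Proof.
have -> : t * (p - q) = (y1 - y2 - t * q) - (x1 - x2 - t * p)
   + ((x1 - a) - (y1 - a)) - ((x2 - b) - (y2 - b)) by ring.
have n1 := nrmB (y1 - y2 - t * q) (x1 - x2 - t * p).
have n2 := nrmB (x1 - a) (y1 - a); have n3 := nrmB (x2 - b) (y2 - b).
apply: le_trans (nrmB _ _) _; apply: le_trans (lerD (nrmD _ _) (lexx _)) _; order_lra.
Qed.

(* A locally bounded, pointwise convergent sequence: the uniform second order
   Taylor bound makes the differentials converge. *)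
Lemma lim_hol (F : nat -> V -> C) f z r M : 0 < r ->
  (forall k, holball (F k) z r) ->
  (forall k w, nrm (w - z) < r -> nrm (F k w) <= M) ->
  (forall w, nrm (w - z) < r -> F^~ w @ \oo --> f w) ->
  differentiable f z /\ forall h, (fun k => 'd (F k) z h : C) @ \oo --> ('d f z h : C).
Proof.
move=> r0 dF hM hF.
pose A := 8 * M / r ^+ 2.
have M0 : 0 <= M by apply: le_trans (hM 0%N z _); rewrite ?nrm_ge0 // subrr nrm0.
have A0 : 0 <= A by rewrite divr_ge0 ?exprn_ge0 ?(ltW r0) // mulr_ge0.
have T k h : nrm h <= r / 4 -> nrm (F k (z + h) - F k z - 'd (F k) z h) <= A * nrm h ^+ 2.
  by move=> hr; apply: holball_taylor2 => // w; exact: hM.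
have zr : nrm (z - z) < r by rewrite subrr nrm0.
have cau h : exists l : C, (fun k => 'd (F k) z h : C) @ \oo --> l.
  apply: cauchyC => e e0.
  pose B := A * nrm h ^+ 2; have B0 : 0 <= B by rewrite mulr_ge0 ?exprn_ge0 ?nrm_ge0.
  have h1 : 0 < nrm h + 1 by rewrite ltr_wpDl ?nrm_ge0.
  (* A small t makes the quadratic Taylor error at t h at most (e / 4) t, which survives the
     division by t. *)
  pose t := Num.min (r / 4 / (nrm h + 1)) (e / 4 / (B + 1)).
  have t0 : 0 < t by rewrite lt_min !divr_gt0 // ltr_wpDl.
  have tB : (B + 1) * t <= e / 4.
    by rewrite mulrC -ler_pdivlMr ?ltr_wpDl // ge_min lexx orbT.
  have th : nrm (t%:C *: h) <= r / 4.
    rewrite nrmZ nrm_real gtr0_norm //; apply: le_trans (_ : t * (nrm h + 1) <= _).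
      by rewrite ler_pM2l // lerDl.
    by rewrite -ler_pdivlMr // ge_min lexx.
  have zh : nrm (z + t%:C *: h - z) < r by rewrite addrAC subrr add0r (le_lt_trans th) //; order_lra.
  have et : 0 < e * t / 8 by rewrite !mulr_gt0.
  have /cvg_seqP /(_ _ et) [N1 hN1] := hF _ zr.
  have /cvg_seqP /(_ _ et) [N2 hN2] := hF _ zh.
  exists (maxn N1 N2) => i j; rewrite !geq_max => /andP[i1 i2] /andP[j1 j2].
  have a1 := hN1 i i1; have a2 := hN1 j j1; have b1 := hN2 i i2; have b2 := hN2 j j2.
  have c1 := T i _ th; have c2 := T j _ th.
  have lz k : 'd (F k) z (t%:C *: h) = t%:C * 'd (F k) z h by rewrite linearZ.
  rewrite lz in c1; rewrite lz in c2.
  have tn : nrm (t%:C *: h) = t * nrm h by rewrite nrmZ nrm_real gtr0_norm.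
  have := quotient_diff (F i (z + t%:C *: h)) (F i z) (F j (z + t%:C *: h)) (F j z)
    ('d (F i) z h) ('d (F j) z h) (f (z + t%:C *: h)) (f z) t%:C.
  rewrite tn in c1 c2; rewrite nrmM nrm_real gtr0_norm // => H.
  rewrite -(ler_pM2l t0); apply: le_trans H _.
  have AB : A * (t * nrm h) ^+ 2 = B * t * t by rewrite /B; ring.
  have Bt : B * t * t <= e / 4 * t.
    by rewrite ler_wpM2r ?(ltW t0) // (le_trans _ tB) // ler_wpM2r ?lerDl // ltW.
  rewrite AB in c1 c2.
  have ar (x1 x2 x3 x4 x5 x6 y et' : R) : x1 <= y -> x2 <= y -> x3 < et' / 8 -> x4 < et' / 8 ->
      x5 < et' / 8 -> x6 < et' / 8 -> y <= et' / 4 -> x1 + x2 + x3 + x4 + x5 + x6 <= et'.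
    by clear; order_lra.
  rewrite [t * e]mulrC; apply: (ar _ _ _ _ _ _ _ _ c1 c2 b1 b2 a1 a2).
  by rewrite [e / 4 * t]mulrAC in Bt.
have [L hL] := choice cau.
have Llin : linear L.
  move=> a u v; apply: (cvgC_uniq (hL (a *: u + v))).
  have -> : (fun k => 'd (F k) z (a *: u + v) : C) = (fun k => a * 'd (F k) z u + 'd (F k) z v).
    by apply/funext => k; rewrite linearP.
  apply: cvgD; last exact: hL.
  by apply: cvgM; [exact: cvg_cst|exact: hL].
pose Lm := GRing.isLinear.Build _ _ _ _ _ Llin.
pose LL : {linear V -> C} := HB.pack L Lm.
have LLc : continuous LL.
  apply: (@linear_bounded_continuous _ _ LL (4 * M / r)) => h.
  apply: ler_cvg_nrm (hL h) _; exists 0%N => k _.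
  by apply: holball_deriv => // w; exact: hM.
have [df Ef] : differentiable f z /\ 'd f z =1 LL.
  apply: nrm_diff => // e e0.
  exists (Num.min (r / 4) (e / (A + 1))); first by rewrite lt_min !divr_gt0 // ltr_wpDl.
  move=> h; rewrite lt_min => /andP[h1 h2].
  have zh : nrm (z + h - z) < r by rewrite addrAC subrr add0r; order_lra.
  apply: le_trans (_ : A * nrm h ^+ 2 <= _).
    have cv : (fun k => F k (z + h) - F k z - 'd (F k) z h) @ \oo --> f (z + h) - f z - L h.
      by apply: cvgB; [apply: cvgB; exact: hF|exact: hL].
    by apply: ler_cvg_nrm cv _; exists 0%N => k _; apply: T; exact: ltW.
  rewrite expr2 mulrA ler_wpM2r ?nrm_ge0 //.
  apply: le_trans (_ : (A + 1) * nrm h <= _).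
    by rewrite ler_wpM2r ?nrm_ge0 // lerDl.
  by rewrite mulrC -ler_pdivlMr ?ltr_wpDl // ltW.
split; first exact: df.
by move=> h; exact: (eq_ind_r (fun l : C => (fun k => 'd (F k) z h : C) @ \oo --> l) (hL h) (Ef h)).
Qed.

Lemma hol_locally_bounded f z : differentiable f z ->
  exists2 d : R, 0 < d & forall w, nrm (w - z) < d -> nrm (f w) <= nrm (f z) + 1.
Proof.
move=> /diff_cont /(_ 1 ltr01) [d d0 hd]; exists d => // w /hd.
by have := nrmD (f w - f z) (f z); rewrite subrK; order_lra.
Qed.

(** The difference quotients in direction u are holomorphic, uniformly bounded by the Lipschitz
    estimate and convergent, so [lim_hol] applies. *)
Lemma dderiv f z r u : 0 < r -> holball f z r -> differentiable (fun w => 'd f w u : C) z.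
Proof.
move=> r0 df; have [d d0 hd] : exists2 d : R, 0 < d & forall w, nrm (w - z) < d -> nrm (f w) <= nrm (f z) + 1.
  by apply: hol_locally_bounded; apply: df; rewrite subrr nrm0.
pose r1 := Num.min r d; have r10 : 0 < r1 by rewrite lt_min r0.
set M := nrm (f z) + 1 in hd.
have u1 : 0 < nrm u + 1 by rewrite ltr_wpDl ?nrm_ge0.
have e0 : 0 < r1 / 4 / (nrm u + 1) by rewrite !divr_gt0.
have [N hN] := half_pow_small e0.
(* The shift by N keeps every increment a k u short enough to stay in the ball. *)
pose a k : R := 2^-1 ^+ (k + N).
have a0 k : 0 < a k by rewrite exprn_gt0 // invr_gt0.
have au k : nrm ((a k)%:C *: u) < r1 / 4.
  rewrite nrmZ nrm_real gtr0_norm //; apply: le_lt_trans (_ : a k * (nrm u + 1) < _).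
    by rewrite ler_pM2l // lerDl.
  by rewrite -ltr_pdivlMr //; apply: hN; exact: leq_addl.
pose F k w := (a k)%:C^-1 * (f (w + (a k)%:C *: u) - f w).
have r2 : 0 < r1 / 2 by order_lra.
have inr w w' : nrm (w - z) < r1 / 2 -> nrm (w' - w) < r1 / 2 -> nrm (w' - z) < r1.
  by move=> h1 h2; have := nrm_tri w w' z; order_lra.
have rr w : nrm (w - z) < r1 -> differentiable f w /\ nrm (f w) <= M.
  by rewrite lt_min => /andP[h1 h2]; split; [exact: df|exact: hd].
apply: (@lim_hol F (fun w => 'd f w u) z (r1 / 2) (2 * M / (r1 / 2) * nrm u) r2 _ _ _).1.
- move=> k w wz; apply: dM; first exact: dcst.
  apply: dB; last by apply: (rr _ _).1; order_lra.
  apply: (@dcomp _ _ _ _ (fun w => w + (a k)%:C *: u) f); first by apply: dD; [exact: did|exact: dcst].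
  by apply: (rr _ _).1; apply: inr wz _; rewrite addrAC subrr add0r; have := au k; order_lra.
- move=> k w wz; rewrite /F nrmM nrmV nrm_real gtr0_norm // mulrC ler_pdivrMr //.
  have := @holball_lip f w (r1 / 2) M ((a k)%:C *: u) r2.
  rewrite nrmZ nrm_real gtr0_norm //.
  have -> : 2 * M / (r1 / 2) * (a k * nrm u) = 2 * M / (r1 / 2) * nrm u * a k by ring.
  apply.
  - by move=> w' h; apply: (rr _ _).1; exact: inr h.
  - by move=> w' h; apply: (rr _ _).2; exact: inr h.
  - by have := au k; rewrite nrmZ nrm_real gtr0_norm //; order_lra.
- move=> w wz; apply/cvg_seqP => e ee.
  have dw : differentiable f w by apply: (rr _ _).1; order_lra.
  have ee' : 0 < e / 2 / (nrm u + 1) by rewrite !divr_gt0.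
  have [d' d'0 hd'] := diff_nrm dw ee'.
  have d'1 : 0 < d' / (nrm u + 1) by rewrite divr_gt0.
  have [N' hN'] := half_pow_small d'1; exists N' => k kN.
  have ak : nrm ((a k)%:C *: u) < d'.
    rewrite nrmZ nrm_real gtr0_norm //; apply: le_lt_trans (_ : a k * (nrm u + 1) < _).
      by rewrite ler_pM2l // lerDl.
    by rewrite -ltr_pdivlMr //; apply: hN'; rewrite (leq_trans kN) // leq_addr.
  have := hd' _ ak; rewrite linearZ /= -[_ *: 'd f w u]/(_ * _).
  have ane : (a k)%:C != 0 :> C by apply/eqP => /complexI h; have := a0 k; rewrite h ltxx.
  have -> : f (w + (a k)%:C *: u) - f w - (a k)%:C * 'd f w u = (a k)%:C * (F k w - 'd f w u).
    by rewrite /F; field.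
  rewrite nrmM nrmZ nrm_real gtr0_norm //.
  have -> : e / 2 / (nrm u + 1) * (a k * nrm u) = a k * (e / 2 / (nrm u + 1) * nrm u) by ring.
  rewrite ler_pM2l // => h; apply: le_lt_trans h _.
  apply: le_lt_trans (_ : e / 2 < _); last order_lra.
  rewrite -mulrA ler_piMr //; first order_lra.
  by rewrite mulrC ler_pdivrMr // mul1r lerDl.
Qed.

End scalar.

Section rows.
Context {V : normedModType C} {m : nat}.
Local Notation Cm := 'rV[C]_m.
Implicit Types (f : V -> Cm) (z h : V).

Lemma dcoordE f z j : differentiable f z ->
  differentiable (fun w => f w ord0 j) z /\
  forall h, 'd (fun w => f w ord0 j) z h = ('d f z h) ord0 j.
Proof.
move=> df.
have dl : differentiable (fun v : Cm => v ord0 j) (f z) := dcoord _ _.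
split; first exact: (@dcomp _ _ _ _ f (fun v : Cm => v ord0 j)).
move=> h; have := @diff_comp _ _ _ _ f (fun v : Cm => v ord0 j) z df dl.
move=> /(congr1 (fun g => g h)) /= ->.
have [f0 f0E] : exists f0 : {linear Cm -> C}, f0 =1 (fun v => v ord0 j).
  have lin : linear (fun v : Cm => v ord0 j : C) by move=> a u v; rewrite !mxE.
  pose lm := GRing.isLinear.Build _ _ _ _ _ lin.
  by exists (HB.pack (fun v : Cm => v ord0 j : C) lm : {linear Cm -> C}).
have E : (fun v : Cm => v ord0 j) = f0 by apply/funext => v; rewrite f0E.
rewrite E diff_lin //; rewrite -E; exact: coord_continuous.
Qed.

Lemma drow f z : (forall j, differentiable (fun w => f w ord0 j) z) -> differentiable f z.
Proof.
move=> df; pose L h : Cm := \row_j 'd (fun w => f w ord0 j) z h.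
have Llin : linear L by move=> a u v; apply/rowP => j; rewrite !mxE linearP.
pose Lm := GRing.isLinear.Build _ _ _ _ _ Llin.
pose LL : {linear V -> Cm} := HB.pack L Lm.
suff [] : differentiable f z /\ 'd f z =1 LL by [].
have bd : exists2 K : R, 0 <= K & forall j h, nrm ('d (fun w => f w ord0 j) z h : C) <= K * nrm h.
  have /choice [K hK] : forall j, exists K : R, 0 < K /\ forall h, nrm ('d (fun w => f w ord0 j) z h : C) <= K * nrm h.
    by move=> j; have [K K0 h] := linear_bounded (diff_continuous (df j)); exists K.
  exists (\sum_j K j); first by rewrite sumr_ge0 // => j _; apply: ltW; case: (hK j).
  move=> j h; have [_ /(_ h) hj] := hK j; apply: le_trans hj _.
  rewrite ler_wpM2r ?nrm_ge0 // (bigD1 j) //= lerDl sumr_ge0 // => i _.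
  by apply: ltW; case: (hK i).
have [K K0 hK] := bd.
apply: nrm_diff.
  apply: (@linear_bounded_continuous _ _ LL K) => h.
  by apply: nrm_row_le => [|j]; [rewrite mulr_ge0 ?nrm_ge0|rewrite mxE; exact: hK].
move=> e e0.
have /choice [d hd] : forall j, exists d : R, 0 < d /\ forall h, nrm h < d ->
    nrm (f (z + h) ord0 j - f z ord0 j - 'd (fun w => f w ord0 j) z h) <= e * nrm h.
  by move=> j; have [d d0 h] := diff_nrm (df j) e0; exists d.
exists (\big[Num.min/1]_j d j).
  by elim/big_ind : _ => [//|x y x0 y0|j _]; [rewrite lt_min x0|case: (hd j)].
move=> h hh; apply: nrm_row_le => [|j]; first by rewrite mulr_ge0 ?nrm_ge0 // ltW.
rewrite !mxE; have [_] := hd j; apply; apply: lt_le_trans hh _.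
by rewrite (bigD1 j) //= ge_min lexx.
Qed.

End rows.

Lemma dlinear {V W : normedModType C} (L : {linear V -> W}) (z : V) : continuous L ->
  differentiable L z.
Proof. by move=> Lc; apply: linear_differentiable. Qed.

Lemma dscale {V W : normedModType C} (a : C) (f : V -> W) (z : V) :
  differentiable f z -> differentiable (fun w => a *: f w) z.
Proof. exact: differentiableZ. Qed.

End several_variables.

(** * Compactness and locally uniform convergence *)

Section compactness.
Context {R : realType}.
Local Notation C := R[i].

Lemma nrm_continuous {V : normedModType C} : continuous (@nrm R V).
Proof.
move=> v; apply/cvgrPdist_lt => e e0; apply/nbhs_nrm; exists e => // w hw.
by rewrite distrC; apply: le_lt_trans hw; exact: nrm_dist.
Qed.

Lemma compact_square (r : R) :
  compact [set z : C | -r <= complex.Re z <= r /\ -r <= complex.Im z <= r].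
Proof.
pose f (p : R * R) : C := p.1 +i* p.2.
have fc : continuous f.
  move=> p; apply/(@cvg_nrm _ _ _ (nbhs p)) => e e0.
  have e2 : 0 < e / 2 by order_lra.
  apply/nbhs_ballP; exists (e / 2) => // q [/= h1 h2].
  apply: le_lt_trans (nrm_le_ReIm _) _; rewrite ReB ImB /=.
  by move: h1 h2; rewrite /ball /= [`|p.1 - _|]distrC [`|p.2 - _|]distrC; order_lra.
have := @continuous_compact _ _ f (`[-r, r]%classic `*` `[-r, r]%classic).
have -> : f @` (`[-r, r]%classic `*` `[-r, r]%classic) =
    [set z : C | -r <= complex.Re z <= r /\ -r <= complex.Im z <= r].
  apply/seteqP; split=> [_ [[x y] /= [] + + <-]|[x y] /= [h1 h2]].
    by rewrite !in_itv.
  by exists (x, y) => //=; rewrite !in_itv.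
apply; first exact: continuous_subspaceT.
by apply: compact_setX; exact: segment_compact.
Qed.

Definition cball {n : nat} (r : R) : set 'rV[C]_n := [set v | nrm v <= r].

Lemma compact_cball {n : nat} (r : R) : compact (@cball n r).
Proof.
have cs := @rV_compact C n (fun=> [set z : C | -r <= complex.Re z <= r /\ -r <= complex.Im z <= r])
  (fun=> @compact_square r).
apply: (subclosed_compact _ cs) => [|v hv j /=].
  apply: (@closed_comp _ _ (@nrm R 'rV[C]_n) [set x | x <= r]); last exact: closed_le.
  by move=> v _; exact: nrm_continuous.
have h := nrm_coord v j; have h1 := ler_Re_nrm (v ord0 j); have h2 := ler_Im_nrm (v ord0 j).
by rewrite -!ler_norml; split; apply: le_trans hv; apply: le_trans h.
Qed.

(** Turns an index that works locally into one that works on all of K; k then serves as an upper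
    bound k or as a margin 2^-k. *)
Lemma compact_eventually {T : topologicalType} (K : set T) (P : nat -> T -> Prop) :
  compact K -> (forall x, K x -> exists2 U, nbhs x U & exists N : nat,
    forall k y, (N <= k)%N -> U y -> K y -> P k y) ->
  exists N : nat, forall k, (N <= k)%N -> forall y, K y -> P k y.
Proof.
move=> /compact_near_coveringP/near_covering_withinP H hP.
have [] := H nat \oo P _; last by move=> N _ hN; exists N => k hk y Ky; exact: (hN k hk).
move=> x /hP [U xU [N hN]].
exists (U, [set k | (N <= k)%N]) => /=; first by split => //; exists N.
by move=> [y k] /= [Uy Nk] Ky; exact: hN.
Qed.

Lemma natr_large (x : R) : exists N : nat, forall k, (N <= k)%N -> x < k%:R.
Proof.
exists (Num.trunc `|x|).+1 => k hk; apply: le_lt_trans (ler_norm _) _.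
by apply: lt_le_trans (truncnS_gt _) _; rewrite ler_nat.
Qed.

Lemma cball_bounded {n : nat} {W : normedModType C} (f : 'rV[C]_n -> W) (r : R) :
  (forall z, nrm z <= r -> differentiable f z) ->
  exists2 M : R, 0 <= M & forall z, nrm z <= r -> nrm (f z) <= M.
Proof.
move=> df; have [] := @compact_eventually _ (@cball n r) (fun k z => nrm (f z) <= k%:R) (@compact_cball n r).
  move=> z /df /diff_cont /(_ 1 ltr01) [d d0 hd].
  exists [set w | nrm (w - z) < d]; first by apply/nbhs_nrm; exists d.
  have [N hN] := natr_large (nrm (f z) + 1); exists N => k w /hN h /hd h' _.
  by have := nrmD (f w - f z) (f z); rewrite subrK; order_lra.
by move=> N hN; exists N%:R => // z hz; apply: (hN N).
Qed.

Lemma compact_polydisc {n : nat} (K : set 'rV[C]_n) : compact K -> K `<=` polydisc R n ->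
  exists2 r : R, 0 <= r < 1 & K `<=` cball r.
Proof.
move=> Kc KD; have [] := @compact_eventually _ K (fun k z => nrm z <= 1 - 2^-1 ^+ k) Kc.
  move=> z /KD; rewrite polydiscE => z1.
  have d0 : 0 < (1 - nrm z) / 2 by order_lra.
  exists [set w | nrm (w - z) < (1 - nrm z) / 2]; first by apply/nbhs_nrm; exists ((1 - nrm z) / 2).
  have [N hN] := half_pow_small d0; exists N => k w /hN h /= h' _.
  by have := nrmD (w - z) z; rewrite subrK; order_lra.
move=> N hN; exists (1 - 2^-1 ^+ N); last by move=> z /(hN N (leqnn N)).
have : 0 < 2^-1 ^+ N :> R by rewrite exprn_gt0 // invr_gt0.
have : 2^-1 ^+ N <= 1 :> R by rewrite exprn_ile1 ?invr_ge0 // invf_le1 // ler1n.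
by move=> *; apply/andP; split; order_lra.
Qed.

(** * Locally uniform convergence in terms of smaller polydiscs *)

Section topology_of_mappings.
Context {n : nat}.
Local Notation Cn := 'rV[C]_n.
Local Notation map := (mappings R n).

(** Each compact subset of the polydisc lies in a closed polydisc of some radius r < 1, so these
    describe the topology. *)
Lemma mapping_cvgP {T : Type} (F : set_system T) {FF : Filter F} (u : T -> map) (g : map) :
  u @ F --> g <-> forall r e : R, 0 <= r < 1 -> 0 < e ->
    \forall x \near F, forall z : Cn, nrm z <= r -> nrm (u x z - g z) < e.
Proof.
split=> [h r e /andP[r0 r1] e0|h].
  pose E := [set p : Cn * Cn | nrm (p.2 - p.1) < e].
  have entE : entourage E.
    rewrite -entourage_ballE; exists e%:C => /=; first by rewrite -[0]/(0%:C) ltcR.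
    by move=> [x y] /=; rewrite -ball_normE /= distrC nrmE ltcR.
  have cK : compactly_in (polydisc R n) (@cball n r).
    split; last exact: (@compact_cball n r).
    by move=> z zr; rewrite polydiscE; apply: le_lt_trans r1.
  have := h _ (@fam_nbhs _ _ (compactly_in (polydisc R n)) (@cball n r) E g entE cK).
  move=> H; have {}H : F [set x | forall y, cball r y -> E (g y, u x y)] := H.
  by apply: (@filterS _ F FF _ _ _ H) => x hx z zr; exact: (hx z zr).
apply/(@fam_cvgP _ _ (compactly_in (polydisc R n)) (u @ F) g) => K [KD Kc] P /uniform_nbhs [E [entE EP]].
have [r r01 Kr] := compact_polydisc Kc KD.
move: entE; rewrite -entourage_ballE => -[e /= e0 eE].
have e0' : 0 < complex.Re e by move: e0; rewrite ltcE /= => /andP[].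
have := h r _ r01 e0'; apply: filterS => x hx; apply: EP => z /Kr /hx hz.
apply: eE => /=; rewrite -ball_normE /= distrC nrmE.
have -> : e = (complex.Re e)%:C by rewrite RRe_real ?gtr0_real.
by rewrite ltcR.
Qed.

End topology_of_mappings.
End compactness.

(** * Local inversion *)

Lemma dcompE {R : realType} {U V W : normedModType R[i]} (f : U -> V) (g : V -> W) x :
  differentiable f x -> differentiable g (f x) ->
  forall h, 'd (fun y => g (f y)) x h = 'd g (f x) ('d f x h).
Proof. by move=> h1 h2 h; exact: (congr1 (fun F => F h) (diff_comp h1 h2)). Qed.

Section strict.
Context {R : realType} {V : normedModType R[i]}.
Local Notation C := R[i].
Implicit Types (r s e M : R).

(** The ball of radius 3 r / 4 about x lies in the ball of radius r about c, which lets both points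
    vary near c. *)
Lemma holball_lip2 (f : V -> C) (c x x' : V) r M : 0 < r -> holball f c r ->
  (forall w, nrm (w - c) < r -> nrm (f w) <= M) ->
  nrm (x - c) <= r / 4 -> nrm (x' - c) <= r / 4 ->
  nrm (f x' - f x) <= 4 * M / r * nrm (x' - x).
Proof.
move=> r0 df hM hx hx'.
have sub w : nrm (w - x) < 3 / 4 * r -> nrm (w - c) < r.
  by move=> h; have := nrm_tri x w c; order_lra.
have r3 : 0 < 3 / 4 * r by order_lra.
have xx : nrm (x' - x) < 3 / 4 * r by have := nrm_tri c x' x; rewrite [nrm (c - x)]nrmC; order_lra.
have := @holball_lip _ _ f x (3 / 4 * r) M (x' - x) r3 _ _ xx.
rewrite subrKC => H; apply: le_trans (H _ _) _.
- by move=> w /sub; exact: df.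
- by move=> w /sub; exact: hM.
have M0 : 0 <= M by apply: le_trans (hM c _); rewrite ?nrm_ge0 // subrr nrm0.
rewrite ler_wpM2r ?nrm_ge0 // ler_pdivrMr // -subr_ge0.
have -> : 4 * M / r * (3 / 4 * r) - 2 * M = M by field; rewrite gt_eqF.
by [].
Qed.

(** On a small ball of radius s the function minus its first order part is at most e s / 4, so the
    Cauchy estimate gives it the Lipschitz constant e. *)
Lemma strict_diff_scalar (f : V -> C) (z : V) r e : 0 < r -> holball f z r -> 0 < e ->
  exists2 d : R, 0 < d & forall x x', nrm (x - z) <= d -> nrm (x' - z) <= d ->
    nrm (f x' - f x - 'd f z (x' - x)) <= e * nrm (x' - x).
Proof.
move=> r0 df e0; have dz : differentiable f z by apply: df; rewrite subrr nrm0.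
pose g w := f w - f z - 'd f z (w - z).
have [d d0 hd] : exists2 d : R, 0 < d & forall w, nrm (w - z) < d -> nrm (g w) <= e / 4 * nrm (w - z).
  have e4 : 0 < e / 4 by order_lra.
  have [d d0 hd] := diff_nrm dz e4; exists d => // w /hd.
  by rewrite subrKC.
pose s := Num.min r d; have s0 : 0 < s by rewrite lt_min r0.
have dg : holball g z s.
  move=> w; rewrite lt_min => /andP[wr _]; rewrite /g.
  apply: dB; first by apply: dB; [exact: df|exact: dcst].
  apply: (@dcomp _ _ _ _ (fun w => w - z) ('d f z)); first by apply: dB; [exact: did|exact: dcst].
  by apply: dlinear; exact: diff_continuous.
have Mg w : nrm (w - z) < s -> nrm (g w) <= e / 4 * s.
  move=> ws; move: (ws); rewrite lt_min => /andP[_ /hd] /le_trans; apply.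
  by rewrite ler_pM2l ?ltW //; order_lra.
exists (s / 4) => [|x x' h1 h2]; first order_lra.
have := holball_lip2 s0 dg Mg h1 h2.
have -> : 4 * (e / 4 * s) / s = e by field; rewrite gt_eqF.
have -> // : g x' - g x = f x' - f x - 'd f z (x' - x).
have -> : 'd f z (x' - x) = 'd f z (x' - z) - 'd f z (x - z).
  by rewrite -linearB /= opprB addrA subrK.
by rewrite /g; ring.
Qed.

Lemma strict_diff {m : nat} (f : V -> 'rV[C]_m) (z : V) r e : 0 < r ->
  (forall w, nrm (w - z) < r -> differentiable f w) -> 0 < e ->
  exists2 d : R, 0 < d & forall x x', nrm (x - z) <= d -> nrm (x' - z) <= d ->
    nrm (f x' - f x - 'd f z (x' - x)) <= e * nrm (x' - x).
Proof.
move=> r0 df e0; have dz : differentiable f z by apply: df; rewrite subrr nrm0.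
have /choice [d hd] : forall j, exists d : R, 0 < d /\ forall x x', nrm (x - z) <= d ->
    nrm (x' - z) <= d -> nrm (f x' ord0 j - f x ord0 j - 'd (fun w => f w ord0 j) z (x' - x))
      <= e * nrm (x' - x).
  move=> j; have hj : holball (fun w => f w ord0 j) z r.
    by move=> w /df /(dcoordE j) [].
  by have [d d0 h] := strict_diff_scalar r0 hj e0; exists d.
exists (\big[Num.min/1]_j d j).
  by elim/big_ind : _ => [//|x y x0 y0|j _]; [rewrite lt_min x0|case: (hd j)].
move=> x x' h1 h2; apply: nrm_row_le => [|j]; first by rewrite mulr_ge0 ?nrm_ge0 // ltW.
have le j' : \big[Num.min/1]_j d j <= d j' by rewrite (bigD1 j') //= ge_min lexx.
have [_ H] := hd j; have := H x x' (le_trans h1 (le j)) (le_trans h2 (le j)).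
by have [_ ->] := dcoordE j dz; rewrite !mxE.
Qed.

Lemma row_taylor2 {m : nat} (f : V -> 'rV[C]_m) (z : V) r M : 0 < r -> 0 <= M ->
  (forall w, nrm (w - z) < r -> differentiable f w /\ nrm (f w) <= M) ->
  forall h, nrm h <= r / 4 ->
  nrm (f (z + h) - f z - 'd f z h) <= 8 * M / r ^+ 2 * nrm h ^+ 2.
Proof.
move=> r0 M0 hf h hr; apply: nrm_row_le => [|j].
  apply: mulr_ge0; last by rewrite exprn_ge0 // nrm_ge0.
  by apply: divr_ge0; [exact: mulr_ge0|rewrite exprn_ge0 // ltW].
have hj : holball (fun w => f w ord0 j) z r by move=> w /hf [/(dcoordE j) []].
have := @holball_taylor2 _ _ _ z r M h r0 hj; rewrite !mxE.
have dz : differentiable f z by apply: (hf z _).1; rewrite subrr nrm0.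
have [_ ->] := dcoordE j dz; apply=> // w /hf [_]; apply: le_trans.
exact: nrm_coord.
Qed.

Lemma row_lip2 {m : nat} (f : V -> 'rV[C]_m) (c x x' : V) r M : 0 < r -> 0 <= M ->
  (forall w, nrm (w - c) < r -> differentiable f w /\ nrm (f w) <= M) ->
  nrm (x - c) <= r / 4 -> nrm (x' - c) <= r / 4 ->
  nrm (f x' - f x) <= 4 * M / r * nrm (x' - x).
Proof.
move=> r0 M0 hf h1 h2; apply: nrm_row_le => [|j].
  by rewrite mulr_ge0 ?nrm_ge0 // divr_ge0 ?mulr_ge0 // ltW.
have hj : holball (fun w => f w ord0 j) c r by move=> w /hf [/(dcoordE j) []].
rewrite !mxE; apply: (holball_lip2 r0 hj) => // w /hf [_]; apply: le_trans.
exact: nrm_coord.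
Qed.

End strict.

Section inverse.
Context {R : realType} {n : nat}.
Local Notation C := R[i].
Local Notation Cn := 'rV[C]_n.
Implicit Types (f h : Cn -> Cn) (z w x y c v : Cn) (r M : R).

Lemma cvg_row {T : Type} (F : set_system T) {FF : Filter F} (u : T -> Cn) (l : Cn) :
  (forall j, (fun t => u t ord0 j) @ F --> l ord0 j) -> u @ F --> l.
Proof.
move=> h; apply/cvg_nrm => e e0; have e2 : 0 < e / 2 by order_lra.
suff : \forall t \near F, forall j, nrm (u t ord0 j - l ord0 j) < e / 2.
  apply: filterS => t ht; apply: le_lt_trans (_ : e / 2 < e); last order_lra.
  by apply: nrm_row_le => [|j]; [exact: ltW|rewrite !mxE; exact: ltW].
by apply: filter_forall => j; move/cvg_nrm: (h j); apply.
Qed.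

Lemma cauchyCn (s : nat -> Cn) :
  (forall e : R, 0 < e -> exists N : nat, forall i j, (N <= i)%N -> (N <= j)%N ->
     nrm (s i - s j) <= e) -> exists l : Cn, s @ \oo --> l.
Proof.
move=> h; have /choice [l hl] : forall j, exists l : C, (fun k => s k ord0 j) @ \oo --> l.
  move=> j; apply: cauchyC => e /h [N hN]; exists N => a b Na Nb.
  by have := nrm_coord (s a - s b) j; rewrite !mxE => /le_trans; apply; exact: hN.
by exists (\row_j l j); apply: cvg_row => j; rewrite mxE; exact: hl.
Qed.

(* [h] is half-Lipschitz close to the identity, so Picard iteration solves [h x = y]. *)
Lemma solve_near_identity h c (r : R) y : 0 <= r ->
  (forall x x', nrm (x - c) <= r -> nrm (x' - c) <= r ->
     nrm ((h x - x) - (h x' - x')) <= 2^-1 * nrm (x - x')) ->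
  nrm (y - h c) <= r / 2 -> exists x, nrm (x - c) <= r /\ h x = y.
Proof.
move=> r0 hL yc; pose T x := x + (y - h x).
have TL x x' : nrm (x - c) <= r -> nrm (x' - c) <= r -> nrm (T x - T x') <= 2^-1 * nrm (x - x').
  move=> h1 h2; rewrite -nrmN; have -> : - (T x - T x') = (h x - x) - (h x' - x').
    by apply/rowP => j; rewrite /T !mxE; ring.
  exact: hL.
have cc : nrm (c - c) <= r by rewrite subrr nrm0.
have TB x : nrm (x - c) <= r -> nrm (T x - c) <= r.
  move=> hx; have h1 := TL x c hx cc; have := nrm_tri (T c) (T x) c.
  have -> : T c - c = y - h c by rewrite /T addrC addKr.
  order_lra.
pose s k := iter k T c.
have sB k : nrm (s k - c) <= r by elim: k => [//|k ih]; exact: TB.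
have sS k : nrm (s k.+1 - s k) <= r * 2^-1 ^+ k.+1.
  elim: k => [|k ih].
    have -> : s 1%N - s 0%N = y - h c by rewrite /s /= /T addrC addKr.
    by rewrite expr1.
  have := TL (s k.+1) (s k) (sB _) (sB _); rewrite -/(s k.+2) => /le_trans; apply.
  by rewrite [X in _ <= r * X]exprS mulrCA ler_pM2l // invr_gt0.
have sC k j : nrm (s (k + j)%N - s k) <= r * 2^-1 ^+ k - r * 2^-1 ^+ (k + j).
  elim: j => [|j ih]; first by rewrite addn0 !subrr nrm0.
  have := nrm_tri (s (k + j)%N) (s (k + j.+1)%N) (s k); rewrite addnS => /le_trans; apply.
  have := sS (k + j)%N; have : 2^-1 ^+ (k + j) = 2 * 2^-1 ^+ (k + j).+1 :> R.
    by rewrite exprS mulrA divff ?mul1r.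
  move=> E; rewrite E in ih; order_lra.
have [x hx] : exists x : Cn, s @ \oo --> x.
  apply: cauchyCn => e e0; have r1 : 0 < r + 1 by rewrite ltr_wpDl.
  have [N hN] := @half_pow_small R (e / 2 / (r + 1)) (divr_gt0 (divr_gt0 e0 (ltr0n _ 2)) r1).
  have bd i : (N <= i)%N -> nrm (s i - s N) <= e / 2.
    move=> Ni; have := sC N (i - N)%N; rewrite subnKC // => /le_trans; apply.
    have : 0 <= r * 2^-1 ^+ i by rewrite mulr_ge0 // exprn_ge0 // invr_ge0.
    have : r * 2^-1 ^+ N <= (r + 1) * 2^-1 ^+ N by rewrite ler_wpM2r ?exprn_ge0 ?invr_ge0 // lerDl.
    have := hN N (leqnn N); rewrite ltr_pdivlMr // mulrC; order_lra.
  exists N => i j /bd h1 /bd h2; have := nrm_tri (s N) (s i) (s j).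
  rewrite [nrm (s N - _)]nrmC; order_lra.
have xB : nrm (x - c) <= r.
  apply: (@ler_cvg_nrm _ _ (fun k => s k - c)); last by exists 0%N.
  by apply: cvgB; [exact: hx|exact: cvg_cst].
exists x; split=> //.
have : T x = x.
  apply: (@cvgC_uniq _ _ (fun k => s k.+1)); last by rewrite (cvg_shiftS s).
  apply/cvg_seqP => e e0; have /cvg_seqP /(_ _ e0) [N hN] := hx.
  exists N => k /hN sx; apply: le_lt_trans (TL _ _ (sB k) xB) _.
  have := nrm_ge0 (s k - x); order_lra.
by move=> /eqP; rewrite -subr_eq0 /T addrC addKr subr_eq0 => /eqP ->.
Qed.

Lemma near_identity_inj h c (r : R) x x' :
  (forall x x', nrm (x - c) <= r -> nrm (x' - c) <= r ->
     nrm ((h x - x) - (h x' - x')) <= 2^-1 * nrm (x - x')) ->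
  nrm (x - c) <= r -> nrm (x' - c) <= r -> nrm (x - x') <= 2 * nrm (h x - h x').
Proof.
move=> hL h1 h2; have := hL x x' h1 h2.
have -> : (h x - x) - (h x' - x') = (h x - h x') - (x - x').
  by apply/rowP => j; rewrite !mxE; ring.
by have := nrmB (h x - h x') (h x - h x' - (x - x')); rewrite subKr; order_lra.
Qed.

Lemma mulmx_bound (A : 'M[C]_n) : exists2 K : R, 0 < K &
  forall v : Cn, nrm (v *m A) <= K * nrm v.
Proof.
pose K := \sum_i \sum_j nrm (A i j).
have K0 : 0 <= K by rewrite sumr_ge0 // => i _; rewrite sumr_ge0 // => j _; exact: nrm_ge0.
exists (K + 1) => [|v]; first by rewrite ltr_wpDl.
apply: nrm_row_le => [|j]; first by rewrite mulr_ge0 ?nrm_ge0 // addr_ge0.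
rewrite mxE; apply: le_trans (nrm_sum _ _ _) _.
apply: le_trans (_ : K * nrm v <= _); last by rewrite ler_wpM2r ?nrm_ge0 // lerDl.
rewrite /K mulr_suml; apply: ler_sum => i _; rewrite nrmM mulrC.
rewrite ler_pM ?nrm_ge0 ?nrm_coord // (bigD1 j) //= lerDl sumr_ge0 // => l _.
exact: nrm_ge0.
Qed.

Lemma diff_mulmx {V : normedModType C} (f : V -> Cn) (A : 'M[C]_n) (x : V) :
  differentiable f x -> differentiable (fun w : V => f w *m A) x /\
  forall h : V, 'd (fun w : V => f w *m A) x h = 'd f x h *m A.
Proof.
move=> df; have [K K0 hK] := mulmx_bound A.
have [L LE] : exists L : {linear Cn -> Cn}, L =1 (fun v => v *m A).
  have lin : linear (fun v : Cn => v *m A) by move=> a u v; rewrite mulmxDl scalemxAl.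
  pose lm := GRing.isLinear.Build _ _ _ _ _ lin.
  by exists (HB.pack (fun v : Cn => v *m A) lm : {linear Cn -> Cn}).
have Lc : continuous L.
  by apply: (@linear_bounded_continuous _ _ _ L K) => h; rewrite LE; exact: hK.
have E : (fun w : V => f w *m A) = (fun w : V => L (f w)).
  by apply/funext => w; rewrite LE.
rewrite E; have dL : differentiable L (f x) by exact: dlinear.
split; first exact: (@dcomp _ _ _ _ f L x df dL).
have dLE : 'd L (f x) = L :> (Cn -> Cn) := diff_lin (f x) Lc.
move=> h; apply: (etrans (dcompE df dL h)).
by apply: (etrans (congr1 (fun F : Cn -> Cn => F ('d f x h)) dLE)); exact: LE.
Qed.

(** Vectors are rows multiplied from the right, so this is the transpose of the usual Jacobian
    matrix. *)
Definition Jac f z : 'M[C]_n := lin1_mx ('d f z).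

Lemma JacE f z v : v *m Jac f z = 'd f z v.
Proof. exact: mul_rV_lin1. Qed.

Definition regular f z := forall v, 'd f z v = 0 -> v = 0.

Lemma regularP f z : regular f z <-> \det (Jac f z) != 0.
Proof.
split=> [h|/negP h v hv].
  apply/det0P => -[v v0 hv]; move/eqP: v0; apply; apply: h; rewrite -JacE //.
apply/eqP/negPn/negP => v0; apply: h; apply/det0P; exists v => //.
by rewrite JacE.
Qed.

(** A kernel vector v would give f (z + t v) - f z = o(t), against the expansion of distances. *)
Lemma expanding_regular f z r (K : R) : 0 < r -> differentiable f z ->
  (forall x, nrm (x - z) < r -> nrm (x - z) <= K * nrm (f x - f z)) -> regular f z.
Proof.
move=> r0 df hK v hv; apply/eqP/negPn/negP => v0; have nv := nrm_gt0 v0.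
have K1 : 0 < `|K| + 1 by rewrite ltr_wpDl.
have e0 : 0 < 2^-1 / (`|K| + 1) by rewrite divr_gt0 ?invr_gt0.
have [d d0 hd] := diff_nrm df e0.
pose t := Num.min r d / (2 * nrm v).
have t0 : 0 < t by rewrite divr_gt0 ?mulr_gt0 // lt_min r0.
have tv : nrm (t%:C *: v) = Num.min r d / 2.
  by rewrite nrmZ nrm_real gtr0_norm // /t; field; rewrite gt_eqF.
have m0 : 0 < Num.min r d by rewrite lt_min r0.
have tr : nrm (t%:C *: v) < Num.min r d by rewrite tv; order_lra.
move: (tr); rewrite lt_min => /andP[h1 h2].
have := hd _ h2; rewrite linearZ /= hv scaler0 subr0 => h3.
have := hK (z + t%:C *: v); rewrite addrAC subrr add0r => /(_ h1).
have nv' : 0 < nrm (t%:C *: v) by rewrite tv; order_lra.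
move=> h4; have : nrm (t%:C *: v) <= (`|K| + 1) * (2^-1 / (`|K| + 1) * nrm (t%:C *: v)).
  apply: le_trans h4 _; apply: le_trans (_ : (`|K| + 1) * nrm (f (z + t%:C *: v) - f z) <= _).
    by rewrite ler_wpM2r ?nrm_ge0 // (le_trans (ler_norm _)) // lerDl.
  by rewrite ler_pM2l.
rewrite mulrA mulrCA divff ?gt_eqF // mulr1; order_lra.
Qed.

(** With k = g (f z + h) - z one has h = 'd f z k + o(k) and k = O(h); the inverse matrix turns this
    into a first order expansion of g. *)
Lemma inverse_diff f (g : Cn -> Cn) z (d K : R) : differentiable f z -> regular f z ->
  0 < d -> g (f z) = z ->
  (forall y, nrm (y - f z) < d -> f (g y) = y /\ nrm (g y - z) <= K * nrm (y - f z)) ->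
  differentiable g (f z).
Proof.
move=> df /regularP reg d0 gz hg.
have uJ : Jac f z \in unitmx by rewrite unitmxE unitfE.
have [B B0 hB] := mulmx_bound (invmx (Jac f z)).
have [L LE] : exists L : {linear Cn -> Cn}, L =1 (fun v => v *m invmx (Jac f z)).
  have lin : linear (fun v : Cn => v *m invmx (Jac f z)) by move=> a u v; rewrite mulmxDl scalemxAl.
  pose lm := GRing.isLinear.Build _ _ _ _ _ lin.
  by exists (HB.pack (fun v : Cn => v *m invmx (Jac f z)) lm : {linear Cn -> Cn}).
apply: (@nrm_diff _ _ _ g (f z) L _ _).1.
  by apply: (@linear_bounded_continuous _ _ _ L B) => h; rewrite LE; exact: hB.
move=> e e0; have K1 : 0 < `|K| + 1 by rewrite ltr_wpDl.
have e1 : 0 < e / (B * (`|K| + 1)) by rewrite divr_gt0 // mulr_gt0.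
have [d1 d10 hd1] := diff_nrm df e1.
exists (Num.min d (d1 / (`|K| + 1))); first by rewrite lt_min d0 divr_gt0.
move=> h; rewrite lt_min => /andP[hd]; rewrite ltr_pdivlMr // => hd'.
have [E1 E2] : f (g (f z + h)) = f z + h /\ nrm (g (f z + h) - z) <= K * nrm h.
  by have := hg (f z + h); rewrite addrAC subrr add0r; apply.
set k := g (f z + h) - z in E2.
have Kk : nrm k <= (`|K| + 1) * nrm h.
  apply: le_trans E2 _; rewrite ler_wpM2r ?nrm_ge0 //.
  by rewrite (le_trans (ler_norm _)) // lerDl.
have := hd1 k; rewrite subrKC E1 [f z + h - f z]addrAC subrr add0r => H.
have {}H : nrm (h - 'd f z k) <= e / (B * (`|K| + 1)) * nrm k.
  by apply: H; apply: le_lt_trans Kk _; rewrite mulrC.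
have -> : g (f z + h) - g (f z) - L h = - ((h - 'd f z k) *m invmx (Jac f z)).
  by rewrite LE gz mulmxBl -(JacE f z k) mulmxK // opprB.
rewrite nrmN; apply: le_trans (hB _) _.
apply: le_trans (ler_wpM2l (ltW B0) H) _.
apply: le_trans (_ : B * (e / (B * (`|K| + 1)) * ((`|K| + 1) * nrm h)) <= _).
  by rewrite ler_pM2l // ler_pM2l.
rewrite le_eqVlt; apply/orP; left; apply/eqP.
by field; rewrite !gt_eqF.
Qed.

(** By strict differentiability, f followed by the inverse of its differential is half-Lipschitz
    close to the identity, and Picard iteration applies. As f expands distances near z, nearby
    points are regular too, whence g is differentiable on a full neighbourhood. *)
Lemma local_inverse f z r : 0 < r ->
  (forall w, nrm (w - z) < r -> differentiable f w) -> regular f z ->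
  exists (rho d K : R) (g : Cn -> Cn), [/\ 0 < rho < r, 0 < d, 0 < K,
    forall x x', nrm (x - z) <= rho -> nrm (x' - z) <= rho ->
      nrm (x - x') <= K * nrm (f x - f x') &
    forall y, nrm (y - f z) < d ->
      [/\ nrm (g y - z) < rho, f (g y) = y & differentiable g y]].
Proof.
move=> r0 df reg; move/regularP: (reg) => dJ.
have uJ : Jac f z \in unitmx by rewrite unitmxE unitfE.
have [B B0 hB] := mulmx_bound (invmx (Jac f z)).
pose h w := f w *m invmx (Jac f z).
have dz : differentiable f z by apply: df; rewrite subrr nrm0.
have e0 : 0 < 2^-1 / B by rewrite divr_gt0 ?invr_gt0.
have [d1 d10 hd1] := strict_diff r0 df e0.
pose rho := Num.min d1 (r / 2).
have rho0 : 0 < rho by rewrite lt_min d10; order_lra.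
have rhor : rho < r by apply: le_lt_trans (_ : r / 2 < r); [rewrite ge_min lexx orbT|order_lra].
have rhod : rho <= d1 by rewrite ge_min lexx.
have hL x x' : nrm (x - z) <= rho -> nrm (x' - z) <= rho ->
    nrm ((h x - x) - (h x' - x')) <= 2^-1 * nrm (x - x').
  move=> h1 h2.
  have -> : (h x - x) - (h x' - x') = (f x - f x' - 'd f z (x - x')) *m invmx (Jac f z).
    rewrite !mulmxBl -(JacE f z (x - x')) mulmxK // /h.
    by apply/rowP => j; rewrite !mxE; ring.
  apply: le_trans (hB _) _.
  apply: le_trans (ler_wpM2l (ltW B0) (hd1 x' x (le_trans h2 rhod) (le_trans h1 rhod))) _.
  by rewrite mulrA mulrCA divff ?gt_eqF // mulr1.
have hh x : f x = h x *m Jac f z by rewrite /h mulmxKV.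
have expd x x' : nrm (x - z) <= rho -> nrm (x' - z) <= rho ->
    nrm (x - x') <= (2 * B) * nrm (f x - f x').
  move=> h1 h2; apply: le_trans (near_identity_inj hL h1 h2) _.
  by rewrite /h -mulmxBl -mulrA ler_pM2l.
have zz : nrm (z - z) <= rho by rewrite subrr nrm0 ltW.
(* Preimages then lie within 2 B d = rho / 2 of z, strictly inside the ball. *)
pose d := rho / (4 * B).
have d0 : 0 < d by rewrite divr_gt0 // mulr_gt0.
have hg y : exists x, nrm (y - f z) < d -> nrm (x - z) < rho /\ f x = y.
  have [yd|yd] := pselect (nrm (y - f z) < d); last by exists z.
  have [] := @solve_near_identity h z rho (y *m invmx (Jac f z)) (ltW rho0) hL.
    rewrite /h -mulmxBl; apply: le_trans (hB _) _.
    have := yd; rewrite /d ltr_pdivlMr ?mulr_gt0 //.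
    have -> : nrm (y - f z) * (4 * B) = 4 * (B * nrm (y - f z)) by ring.
    by have := nrm_ge0 (y - f z); order_lra.
  move=> x [x1 x2]; have fx : f x = y by rewrite hh x2 mulmxKV.
  exists x => _; split=> //; apply: le_lt_trans (expd _ _ x1 zz) _.
  by rewrite fx mulrC -ltr_pdivlMr ?mulr_gt0 //; apply: lt_le_trans yd _;
     rewrite /d ler_wpM2l ?(ltW rho0) // lef_pV2 ?posrE ?mulr_gt0 // ler_pM2r //; order_lra.
have [g {}hg] := choice hg.
exists rho, d, (2 * B), g; split; [by rewrite rho0|exact: d0|by rewrite mulr_gt0|exact: expd|].
move=> y yd; have [g1 g2] := hg y yd; split; [exact: g1|exact: g2|].
have gyd : differentiable f (g y) by apply: df; exact: lt_trans rhor.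
have r1 : 0 < rho - nrm (g y - z) by rewrite subr_gt0.
rewrite -g2; apply: (@inverse_diff f g (g y) (d - nrm (y - f z)) (2 * B)); first exact: gyd.
- apply: (@expanding_regular f (g y) (rho - nrm (g y - z)) (2 * B)); [exact: r1|exact: gyd|] => x hx.
  by apply: expd; last exact: ltW; have := nrm_tri (g y) x z; order_lra.
- by rewrite subr_gt0.
- by rewrite g2.
- rewrite g2 => y' hy'; have y'd : nrm (y' - f z) < d by have := nrm_tri y y' (f z); order_lra.
  have [g3 g4] := hg y' y'd; split=> //.
  by have := expd (g y') (g y) (ltW g3) (ltW g1); rewrite g4 g2.
Qed.

End inverse.

(** * Injective holomorphic maps are regular *)

Section one_variable_injectivity.
Context {R : realType}.
Local Notation C := R[i].
Implicit Types (f g : C -> C) (z w t : C) (s r e d M K : R).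

Lemma real_C_nrm (x : R) : 0 <= x -> nrm (x%:C : C) = x.
Proof. by move=> x0; rewrite nrm_real ger0_norm. Qed.

Lemma quad_scale (B a b r : R) : 0 <= B -> 0 <= b -> b <= r ->
  B * (a * b) ^+ 2 <= B * r ^+ 2 * a ^+ 2.
Proof.
move=> B0 b0 br; rewrite -mulrA ler_wpM2l // exprMn mulrC ler_wpM2r ?sqr_ge0 //.
by rewrite lerXn2r ?nnegrE // (le_trans b0).
Qed.

(* Subdividing [0, 1] makes the quadratic error terms disappear. *)
Lemma chain_bound {V : normedModType C} (g : R -> V) (A K d : R) : 0 <= A -> 0 <= K -> 0 < d ->
  (forall s s', 0 <= s <= 1 -> 0 <= s' <= 1 -> `|s' - s| <= d ->
     nrm (g s' - g s) <= A * `|s' - s| + K * `|s' - s| ^+ 2) ->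
  nrm (g 1 - g 0) <= A.
Proof.
move=> A0 K0 d0 H; apply/ler_addgt0Pr => e e0.
have [N hN] := natr_large (Num.max (d^-1) (K / e)).
have N0 : (0 : R) < N.+1%:R by rewrite ltr0n.
have := hN N.+1 (leqnSn N); rewrite gt_max => /andP[Nd Ne].
set q := N.+1%:R in N0 Nd Ne.
have step k : (k <= N.+1)%N -> nrm (g (k%:R / q) - g 0) <= k%:R * (A / q + K / q ^+ 2).
  elim: k => [_|k ih kN]; first by rewrite !mul0r subrr nrm0.
  have kq i : (i <= N.+1)%N -> 0 <= i%:R / q <= 1.
    by move=> h; rewrite divr_ge0 ?(ltW N0) //= ler_pdivrMr // mul1r ler_nat.
  have dif : k.+1%:R / q - k%:R / q = q^-1 by rewrite -mulrBl -natrB // subSnn mul1r.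
  have iq : `|q^-1| = q^-1 by rewrite gtr0_norm // invr_gt0.
  have qd : `|k.+1%:R / q - k%:R / q| <= d.
    by rewrite dif iq -[d]invrK lef_pV2 ?posrE ?invr_gt0 // ltW.
  have := H _ _ (kq k (ltnW kN)) (kq k.+1 kN) qd; rewrite dif iq => h1.
  have -> : k.+1%:R * (A / q + K / q ^+ 2) = k%:R * (A / q + K / q ^+ 2) + (A * q^-1 + K * q^-1 ^+ 2).
    by rewrite -natr1 exprVn; ring.
  apply: le_trans (nrm_tri (g (k%:R / q)) (g (k.+1%:R / q)) (g 0)) _; rewrite addrC.
  exact: lerD (ih (ltnW kN)) h1.
have := step N.+1 (leqnn _); rewrite -/q divff ?gt_eqF // => /le_trans; apply.
have -> : q * (A / q + K / q ^+ 2) = A + K / q by field; rewrite gt_eqF.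
rewrite lerD2l ler_pdivrMr // mulrC -ler_pdivrMr // ltW //.
Qed.

Lemma compact_circle r : compact [set z : C | nrm z = r].
Proof.
apply: (subclosed_compact _ (@compact_square R r)) => [|z /= zr].
  apply: (@closed_comp _ _ (@nrm R C) [set x | x = r]); last exact: closed_eq.
  by move=> z _; exact: nrm_continuous.
by rewrite -!ler_norml -zr ler_Re_nrm ler_Im_nrm.
Qed.

Lemma circle_lower f r : (forall z, nrm z = r -> differentiable f z /\ f z != 0) ->
  exists2 m : R, 0 < m & forall z, nrm z = r -> m <= nrm (f z).
Proof.
move=> hf; have [] := @compact_eventually _ _ (fun k z => 2^-1 ^+ k <= nrm (f z)) (@compact_circle r).
  move=> z /hf [df fz]; have e0 : 0 < nrm (f z) / 2 by rewrite divr_gt0 // nrm_gt0.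
  have [d d0 hd] := diff_cont df e0.
  exists [set w | nrm (w - z) < d]; first by apply/nbhs_nrm; exists d.
  have [N hN] := half_pow_small e0; exists N => k w /hN h /= /hd h' _.
  by have := nrm_tri (f w) (f z) 0; rewrite !subr0 [nrm (f z - f w)]nrmC; order_lra.
by move=> N hN; exists (2^-1 ^+ N); [rewrite exprn_gt0 // invr_gt0|exact: (hN N)].
Qed.

(** From f w = c0 + c1 w + c2 w^2 + O(w^3) the derivative of f is c1, and the quotient c1 + c2 w +
    O(w^2) is differentiable at 0 with derivative c2. *)
Lemma quotient_hol f s a b : 0 < s -> holdisc f s -> 'd f 0 1 = a -> f 0 = b ->
  differentiable (fun w => if w == 0 then a else (f w - b) / w) 0.
Proof.
move=> s0 df <- <-; pose r := s / 2; have r0 : 0 < r by rewrite divr_gt0.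
have rs : r < s by rewrite /r; order_lra.
have nr : nrm (r%:C : C) = r by rewrite real_C_nrm // ltW.
have [M M0 hM] : exists2 M : R, 0 <= M & forall t, nrm t = r -> nrm (f t) <= M.
  have [] := @compact_eventually _ _ (fun k z => nrm (f z) <= k%:R) (@compact_circle r).
    move=> z zr; have zs : nrm z < s by rewrite zr.
    have [d d0 hd] := hol_locally_bounded (df z zs).
    exists [set w | nrm (w - z) < d]; first by apply/nbhs_nrm; exists d.
    have [N hN] := natr_large (nrm (f z) + 1); exists N => k w /hN h /= /hd h' _; order_lra.
  by move=> N hN; exists N%:R => //; exact: (hN N (leqnn N)).
pose c k := coef f r%:C k.
pose B := M / r ^+ 3 * 2; have B0 : 0 <= B by rewrite mulr_ge0 // divr_ge0 // exprn_ge0 // ltW.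
have T w : nrm w <= r / 2 -> exists2 q : C, nrm q <= B & f w = c 0%N + w * c 1%N + w ^+ 2 * c 2%N + w ^+ 3 * q.
  move=> wr; have wr' : nrm w < r by order_lra.
  exists (rem f r%:C w 3).
    have := @rem_bound _ f s r%:C w 3 M df; rewrite nr wr' rs => /(_ isT hM) /le_trans; apply.
    rewrite ler_wpM2l ?divr_ge0 ?exprn_ge0 ?(ltW r0) //.
    by rewrite ler_pdivrMr ?subr_gt0 //; order_lra.
  rewrite {1}(@taylor_rem _ f s r%:C w 3 df) ?nr ?wr' // !big_ord_recl big_ord0 /=.
  by rewrite -/(c _) -[bump 0 0]/1%N -[bump 0 1]/2%N addr0 expr0 mul1r expr1 !addrA.
have T0 : f 0 = c 0%N.
  by have [|q _ ->] := T 0; [rewrite nrm0; order_lra|rewrite expr0n /=; ring].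
have r2 : 0 < r / 2 by order_lra.
have [_ E1] : differentiable f 0 /\ forall h, 'd f 0 h = h *: c 1%N.
  apply: diff1P => e e0; pose A := nrm (c 2%N) + r * B.
  have A0 : 0 <= A by rewrite addr_ge0 ?nrm_ge0 // mulr_ge0 // ltW.
  exists (Num.min (r / 2) (e / (A + 1))); first by rewrite lt_min r2 divr_gt0 // ltr_wpDl.
  move=> h; rewrite lt_min add0r T0 => /andP[h1 h2].
  have [q qB ->] := T h (ltW h1).
  have -> : c 0%N + h * c 1%N + h ^+ 2 * c 2%N + h ^+ 3 * q - c 0%N - h *: c 1%N =
      (h * c 2%N + h * h * q) * h by rewrite -[_ *: _]/(_ * _); ring.
  rewrite nrmM ler_wpM2r ?nrm_ge0 //; apply: le_trans (nrmD _ _) _; rewrite !nrmM.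
  have : nrm h * nrm h * nrm q <= nrm h * (r * B).
    by rewrite -mulrA ler_wpM2l ?nrm_ge0 // ler_pM ?nrm_ge0 //; order_lra.
  have : nrm h * (A + 1) <= e by rewrite -ler_pdivlMr ?ltr_wpDl // ltW.
  have := nrm_ge0 h; rewrite /A; order_lra.
apply: (@diff1P _ _ _ _ (c 2%N) _).1 => e e0.
exists (Num.min (r / 2) (e / (B + 1))); first by rewrite lt_min r2 divr_gt0 // ltr_wpDl.
move=> h; rewrite lt_min add0r eqxx => /andP[h1 h2].
have [->|h0] := eqVneq h 0; first by rewrite scale0r subrr subr0 nrm0 mulr0.
have [q qB ->] := T h (ltW h1).
rewrite T0 E1 scale1r.
have -> : (c 0%N + h * c 1%N + h ^+ 2 * c 2%N + h ^+ 3 * q - c 0%N) / h - c 1%N - h *: c 2%N =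
    (h * q) * h by rewrite -[_ *: _]/(_ * _); field.
rewrite nrmM ler_wpM2r ?nrm_ge0 // nrmM.
have : nrm h * (B + 1) <= e by rewrite -ler_pdivlMr ?ltr_wpDl // ltW.
have : nrm h * nrm q <= nrm h * B by rewrite ler_wpM2l ?nrm_ge0.
have := nrm_ge0 h; order_lra.
Qed.

Lemma quotient_holdisc f s z : holdisc f s -> nrm z < s ->
  holdisc (fun w => if w == z then 'd f z 1 else (f w - f z) / (w - z)) s.
Proof.
move=> df zs w ws; have [wz|wz] := eqVneq w z.
  have h0 : 0 < s - nrm z by rewrite subr_gt0.
  have hd : holdisc (fun t => f (z + t)) (s - nrm z).
    move=> t ht; apply: (@dcomp R _ _ _ (fun t : C => z + t) f).
      by apply: dD; [exact: dcst|exact: did].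
    by apply: df; apply: le_lt_trans (nrmD _ _) _; order_lra.
  have dz := df z zs.
  have E : 'd (fun t => f (z + t)) 0 1 = 'd f z 1.
    have Eg : (fun t => f (z + t)) = (fun t : C => f (z + t *: (1 : C))).
      by apply/funext => t; rewrite -[t *: 1]/(t * 1) mulr1.
    by rewrite Eg; exact: diff_line0.
  have H := quotient_hol h0 hd E (congr1 f (addr0 z)).
  have : differentiable (fun w => (if w - z == 0 then 'd f z 1 else (f (z + (w - z)) - f z) / (w - z))) z.
    apply: (@dcomp R _ _ _ (fun w : C => w - z) (fun w => if w == 0 then 'd f z 1 else (f (z + w) - f z) / w)).
      by apply: dB; [exact: did|exact: dcst].
    by rewrite subrr.
  rewrite wz; congr (differentiable _ _); apply/funext => t.
  by rewrite subr_eq0 subrKC.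
have : differentiable (fun w => (f w - f z) / (w - z)) w.
  apply: dM; first by apply: dB; [exact: df|exact: dcst].
  by apply: dV; [apply: dB; [exact: did|exact: dcst]|rewrite subr_eq0].
move=> /diff_ext H; have [|//] := H (fun w => if w == z then 'd f z 1 else (f w - f z) / (w - z)) _.
exists (nrm (w - z)); first by rewrite nrm_gt0 // subr_eq0.
move=> y hy; rewrite ifN //; apply/eqP => yz.
by move: hy; rewrite yz nrmC ltxx.
Qed.

(** Along a segment the first order terms vanish, and [chain_bound] removes the quadratic ones. *)
Lemma deriv0_const f s : 0 < s -> holdisc f s -> (forall t, nrm t < s -> 'd f t 1 = 0) ->
  exists2 d, 0 < d & forall t, nrm t < d -> f t = f 0.
Proof.
move=> s0 df d1; have f0 : differentiable f 0 by apply: df; rewrite nrm0.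
have [d d0 hd] := hol_locally_bounded f0; set M := nrm (f 0) + 1 in hd.
have M0 : 0 <= M by rewrite addr_ge0 ?nrm_ge0.
pose r := Num.min s d / 2; have r0 : 0 < r by rewrite divr_gt0 // lt_min s0.
have rs w : nrm w < 2 * r -> nrm w < s /\ nrm w < d.
  by rewrite /r mulrCA divff ?mulr1 // lt_min => /andP[].
pose K := 8 * M / r ^+ 2 * r ^+ 2.
have B0 : 0 <= 8 * M / r ^+ 2 by apply: divr_ge0; [exact: mulr_ge0|exact: sqr_ge0].
have K0 : 0 <= K by apply: mulr_ge0; [exact: B0|exact: sqr_ge0].
exists r => // t tr.
have t1 : 0 < nrm t + 1 by rewrite ltr_wpDl ?nrm_ge0.
have := @chain_bound _ (fun x : R => f (x%:C * t)) 0 K (r / 4 / (nrm t + 1)) (lexx 0) K0.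
rewrite rmorph0 rmorph1 mul0r mul1r => H.
suff : nrm (f t - f 0) <= 0.
  move=> h; apply/eqP; rewrite -subr_eq0; apply/eqP/nrm_eq0/eqP.
  by rewrite eq_le h nrm_ge0.
apply: H; first by apply: divr_gt0 => //; apply: divr_gt0.
move=> x x' /andP[x0 x1] /andP[x0' x1'] xx; rewrite mul0r add0r.
have xt : nrm (x%:C * t) < r.
  by rewrite nrmM real_C_nrm //; apply: le_lt_trans tr; rewrite ler_piMl ?nrm_ge0.
have hb : holball f (x%:C * t) r.
  by move=> w hw; apply: df; apply: (rs w _).1; have := nrm_tri (x%:C * t) w 0; rewrite !subr0; order_lra.
have hm w : nrm (w - x%:C * t) < r -> nrm (f w) <= M.
  move=> hw; apply: hd; rewrite subr0; apply: (rs w _).2.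
  by have := nrm_tri (x%:C * t) w 0; rewrite !subr0; order_lra.
have nh : nrm ((x' - x)%:C * t) = `|x' - x| * nrm t by rewrite nrmM nrm_real.
have hr : nrm ((x' - x)%:C * t) <= r / 4.
  rewrite nh; apply: le_trans (_ : `|x' - x| * (nrm t + 1) <= _).
    by rewrite ler_wpM2l // lerDl.
  by rewrite -ler_pdivlMr.
have xt' : nrm (x%:C * t) < s by apply: (rs _ _).1; order_lra.
have := holball_taylor2 r0 hb hm hr.
have -> : x%:C * t + (x' - x)%:C * t = x'%:C * t by rewrite rmorphB /=; ring.
rewrite (diff1E_nrm (df _ xt') ((x' - x)%:C * t)) d1 // scaler0 subr0 nh => /le_trans; apply.
exact: quad_scale B0 (nrm_ge0 t) (ltW tr).
Qed.

(** Suppose f'(0) = 0, and let eta be a point near 0 with f'(eta) != 0. The quotient q w = (f w - f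
    eta) / (w - eta), with q eta = f'(eta), has no zero by injectivity. The maximum principle for 1
    / q bounds |q 0| below by mu, whereas f'(0) = 0 makes |q 0| at most mu / 2 when eta is close to
    0. *)
Lemma injective_deriv_neq0 f s : 0 < s -> holdisc f s ->
  (forall z w, nrm z < s -> nrm w < s -> f z = f w -> z = w) -> 'd f 0 1 != 0.
Proof.
move=> s0 df inj; apply/eqP => f'0.
pose r := s / 4; have r0 : 0 < r by rewrite divr_gt0.
have rs : r < s by rewrite /r; order_lra.
have n0 : nrm (0 : C) < s by rewrite nrm0.
have [m m0 hm] : exists2 m : R, 0 < m & forall z, nrm z = r -> m <= nrm (f z - f 0).
  apply: circle_lower => z zr; have zs : nrm z < s by rewrite zr.
  split; first by apply: dB; [exact: df|exact: dcst].
  rewrite subr_eq0; apply/eqP => /inj -/(_ zs n0) z0.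
  by move: zr r0; rewrite z0 nrm0 => <-; rewrite ltxx.
(* On the circle of radius r the numerator of q is at least m - m / 2 and its denominator at most 2
   r. *)
pose mu := m / 2 / (2 * r); have mu0 : 0 < mu by rewrite !divr_gt0 // mulr_gt0.
have df0 := df _ n0.
have mu2 : 0 < mu / 2 by order_lra.
have [d1 d10 h1] := diff_nrm df0 mu2.
have m2 : 0 < m / 2 by order_lra.
have [d2 d20 h2] := diff_cont df0 m2.
pose d := Num.min (Num.min d1 d2) (r / 2).
have d0 : 0 < d by rewrite !lt_min d10 d20 divr_gt0.
(* Points with nonzero derivative accumulate at 0, since otherwise f would be constant near 0. *)
have [eta [etad eta'0]] : exists eta, nrm eta < d /\ 'd f eta 1 != 0.
  apply: contrapT => H; have hd : holdisc f d.
    move=> t; rewrite !lt_min => /andP[_ h]; apply: df; rewrite /r in h; order_lra.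
  have [|d' d'0 hd'] := deriv0_const d0 hd.
    by move=> t td; apply/eqP/negPn/negP => h; apply: H; exists t.
  pose u := Num.min (d' / 2) (s / 2); have u0 : 0 < u by rewrite lt_min !divr_gt0.
  have ud : u < d' by apply: le_lt_trans (_ : d' / 2 < _); [rewrite ge_min lexx|order_lra].
  have us : u < s by apply: le_lt_trans (_ : s / 2 < _); [rewrite ge_min lexx orbT|order_lra].
  have nu : nrm (u%:C : C) = u by rewrite real_C_nrm // ltW.
  have := hd' u%:C; rewrite nu => /(_ ud) /inj; rewrite nu => /(_ us n0) uz.
  by move: nu; rewrite uz nrm0 => uu; move: u0; rewrite -uu ltxx.
have eta0 : eta != 0 by apply/eqP => h; move: eta'0; rewrite h f'0 eqxx.
move: (etad); rewrite !lt_min => /andP[/andP[e1 e2] e3].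
have es : nrm eta < s by rewrite /r in e3; order_lra.
pose q w := if w == eta then 'd f eta 1 else (f w - f eta) / (w - eta).
have dq : holdisc q s by exact: quotient_holdisc.
have q0 w : nrm w < s -> q w != 0.
  move=> ws; rewrite /q; have [//|we] := eqVneq w eta.
  rewrite mulf_neq0 ?invr_eq0 ?subr_eq0 //; apply/eqP => /inj -/(_ ws es).
  by move/eqP; rewrite (negbTE we).
have dQ : holdisc (fun w => (q w)^-1) s.
  by move=> w ws; apply: dV; [exact: dq|exact: q0].
have nr : nrm (r%:C : C) = r by rewrite real_C_nrm // ltW.
have := @max_disc _ _ s r%:C 0 mu^-1 dQ; rewrite nr nrm0 r0 rs => /(_ isT) H.
have {}H : nrm (q 0)^-1 <= mu^-1.
  apply: H => t tr; rewrite nrmV lef_pV2 ?posrE ?nrm_gt0 ?q0 ?tr //.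
  rewrite /q; have te : t != eta by apply/eqP => h; move: e3; rewrite -h tr; order_lra.
  rewrite (negbTE te) nrmM nrmV /mu; apply: ler_pM.
  - exact: ltW.
  - by rewrite invr_ge0 mulr_ge0 // ltW.
  - have := hm t tr; have := h2 eta; rewrite subr0 => /(_ e2).
    by have := nrm_tri (f eta) (f t) (f 0); clear; order_lra.
  - rewrite lef_pV2 ?posrE ?mulr_gt0 ?nrm_gt0 ?subr_eq0 //.
    by have := nrmB t eta; rewrite tr; move: e3 r0; clear; order_lra.
move: H; rewrite nrmV lef_pV2 ?posrE ?nrm_gt0 ?q0 //.
rewrite /q eq_sym (negbTE eta0) sub0r nrmM nrmV nrmN ler_pdivlMr ?nrm_gt0 //.
rewrite nrmC => H; have := h1 eta e1; rewrite add0r (diff1E_nrm df0) f'0 scaler0 subr0.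
have := nrm_gt0 eta0; nra.
Qed.

(* If all iterated derivatives vanish at the origin, every iterate is O(t^N) for all N. *)
Lemma flat_zero (j : nat -> C -> C) s : 0 < s -> (forall m, holdisc (j m) s) ->
  (forall m t, nrm t < s -> 'd (j m) t 1 = j m.+1 t) -> (forall m, j m 0 = 0) ->
  exists2 d, 0 < d & forall t, nrm t < d -> j 0%N t = 0.
Proof.
move=> s0 dj j' j0; have ns : nrm (0 : C) < s by rewrite nrm0.
have growth N : forall m, exists K d : R, [/\ 0 <= K, 0 < d & forall t, nrm t < d -> nrm (j m t) <= K * nrm t ^+ N].
  elim: N => [|N ih] m; first exact: growth0 (dj m _ ns).
  have [K [d [K0 d0 hK]]] := ih m.+1.
  have [b b0 hb] := hol_locally_bounded (dj m _ ns).
  rewrite j0 nrm0 add0r in hb.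
  pose r := Num.min (Num.min s d) b / 2.
  have r0 : 0 < r by rewrite divr_gt0 // !lt_min s0 d0.
  have rr w : nrm w < 2 * r -> [/\ nrm w < s, nrm w < d & nrm w < b].
    by rewrite /r mulrCA divff ?mulr1 // !lt_min => /andP[/andP[]].
  exists K, r; split=> // t tr.
  have t1 : 0 < nrm t + 1 by rewrite ltr_wpDl ?nrm_ge0.
  pose L := 8 * 1 / r ^+ 2 * r ^+ 2.
  have B0 : 0 <= 8 * 1 / r ^+ 2 by apply: divr_ge0; [exact: mulr_ge0|exact: sqr_ge0].
  have L0 : 0 <= L by apply: mulr_ge0; [exact: B0|exact: sqr_ge0].
  have A0 : 0 <= K * nrm t ^+ N.+1 by rewrite mulr_ge0 // exprn_ge0 // nrm_ge0.
  have := @chain_bound _ (fun x : R => j m (x%:C * t)) _ L (r / 4 / (nrm t + 1)) A0 L0.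
  rewrite rmorph0 rmorph1 mul0r mul1r j0 subr0; apply; first by apply: divr_gt0 => //; apply: divr_gt0.
  move=> x x' /andP[x0 x1] /andP[x0' x1'] xx.
  have xt : nrm (x%:C * t) <= nrm t by rewrite nrmM real_C_nrm // ler_piMl ?nrm_ge0.
  have xr w : nrm (w - x%:C * t) < r -> nrm w < 2 * r.
    by move=> hw; have := nrm_tri (x%:C * t) w 0; rewrite !subr0; order_lra.
  have hb' : holball (j m) (x%:C * t) r.
    by move=> w /xr /rr [h _ _]; exact: dj.
  have hm w : nrm (w - x%:C * t) < r -> nrm (j m w) <= 1.
    by move=> /xr /rr [_ _ h]; apply: hb; rewrite subr0.
  have nh : nrm ((x' - x)%:C * t) = `|x' - x| * nrm t by rewrite nrmM nrm_real.
  have hr : nrm ((x' - x)%:C * t) <= r / 4.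
    rewrite nh; apply: le_trans (_ : `|x' - x| * (nrm t + 1) <= _).
      by rewrite ler_wpM2l // lerDl.
    by rewrite -ler_pdivlMr.
  have [xs xd _] : [/\ nrm (x%:C * t) < s, nrm (x%:C * t) < d & nrm (x%:C * t) < b].
    by apply: rr; order_lra.
  have := holball_taylor2 r0 hb' hm hr.
  have -> : x%:C * t + (x' - x)%:C * t = x'%:C * t by rewrite rmorphB /=; ring.
  rewrite (diff1E_nrm (dj m _ xs) ((x' - x)%:C * t)) j' // -[_ *: _]/(_ * _) => H1.
  have := nrmD (j m (x'%:C * t) - j m (x%:C * t) - (x' - x)%:C * t * j m.+1 (x%:C * t)) ((x' - x)%:C * t * j m.+1 (x%:C * t)).
  rewrite subrK => /le_trans; apply; rewrite addrC; apply: lerD.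
    rewrite nrmM nh.
    have -> : K * nrm t ^+ N.+1 * `|x' - x| = `|x' - x| * nrm t * (K * nrm t ^+ N).
      by rewrite exprS; ring.
    rewrite ler_wpM2l ?mulr_ge0 ?nrm_ge0 //.
    apply: le_trans (hK _ xd) _; rewrite ler_wpM2l //.
    by apply: lerXn2r; rewrite ?nnegrE ?nrm_ge0.
  apply: le_trans H1 _; rewrite nh.
  exact: quad_scale B0 (nrm_ge0 t) (ltW tr).
have [b b0 hb] := hol_locally_bounded (dj 0%N _ ns).
rewrite j0 nrm0 add0r in hb.
pose r := Num.min s b / 2; have r0 : 0 < r by rewrite divr_gt0 // lt_min s0.
have rs : r < s by apply: lt_le_trans (_ : Num.min s b <= s); [rewrite /r; have : 0 < Num.min s b by rewrite lt_min s0|rewrite ge_min lexx]; order_lra.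
have rb : r < b by apply: lt_le_trans (_ : Num.min s b <= b); [rewrite /r; have : 0 < Num.min s b by rewrite lt_min s0|rewrite ge_min lexx orbT]; order_lra.
exists r => // t tr; apply: nrm_eq0; apply/eqP; rewrite eq_le nrm_ge0 andbT.
have u1 : nrm t / r < 1 by rewrite ltr_pdivrMr // mul1r.
have u0 : 0 <= nrm t / r by rewrite divr_ge0 ?nrm_ge0 // ltW.
have nr : nrm (r%:C : C) = r by rewrite real_C_nrm // ltW.
(* The constants K and d depend on N, but the bound 1 on the circle of radius r does not, and only
   the latter enters the Schwarz estimate. *)
have H N : nrm (j 0%N t) <= (nrm t / r) ^+ N.
  have [K [d [K0 d0 hK]]] := growth N 0%N.
  have := @schwarz_circle _ _ s r%:C t N K d 1 (dj 0%N) K0 d0 hK.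
  rewrite nr tr rs mul1r; apply=> // w wr; apply: hb; rewrite subr0 wr //.
apply/ler_addgt0Pr => e e0; rewrite add0r.
have : (nrm t / r) ^+ k @[k --> \oo] --> (0 : R) by apply: cvg_expr; rewrite ger0_norm.
move=> /cvgrPdist_lt /(_ _ e0) [N _ hN]; apply: le_trans (H N) _.
by have := hN N (leqnn N); rewrite /= sub0r normrN ger0_norm ?exprn_ge0 // => /ltW.
Qed.

End one_variable_injectivity.

(** * Osgood's theorem: injective holomorphic maps have invertible differentials *)

Section osgood.
Context {R : realType} {n : nat}.
Local Notation C := R[i].
Local Notation Cn := 'rV[C]_n.
Implicit Types (F : Cn -> Cn) (z w x y a u v : Cn) (r s d : R).

Lemma nrm_lowB {V : normedModType C} (p q : V) : nrm p - nrm (q - p) <= nrm q.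
Proof. by have := nrm_lowD p (q - p); rewrite [p + _]addrC subrK. Qed.

Lemma diffid {V : normedModType C} (z v : V) : 'd (fun w : V => w) z v = v.
Proof.
have lin : linear (fun w : V => w) by [].
pose lm := GRing.isLinear.Build _ _ _ _ _ lin.
have [L LE] : exists L : {linear V -> V}, L =1 (fun w : V => w).
  by pose L : {linear V -> V} := HB.pack (fun w : V => w) lm; exists L.
have Lc : continuous L by apply: (@linear_bounded_continuous _ _ _ L 1) => h; rewrite LE mul1r.
have [_ E] : differentiable (fun w : V => w) z /\ 'd (fun w : V => w) z =1 L.
  apply: nrm_diff => // e e0; exists 1 => // h _.
  by rewrite [L h]LE [z + h]addrC addrK subrr nrm0 mulr_ge0 ?nrm_ge0 ?ltW.
by apply: (etrans (E v)).
Qed.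

Definition ebase (i : 'I_n) : Cn := delta_mx ord0 i.

Lemma ebaseE i j : ebase i ord0 j = (j == i)%:R.
Proof. by rewrite mxE eqxx. Qed.

Lemma nrm_ebase i : nrm (ebase i) = 1.
Proof.
apply/eqP; rewrite eq_le; apply/andP; split.
  apply: nrm_row_le => // j; rewrite ebaseE.
  by case: (j == i); rewrite ?nrm1 ?nrm0.
by have := nrm_coord (ebase i) i; rewrite ebaseE eqxx nrm1.
Qed.

Lemma diff_basis F z v j : ('d F z v) ord0 j = \sum_i v ord0 i * ('d F z (ebase i)) ord0 j.
Proof.
have -> : 'd F z v = v *m Jac F z by rewrite JacE.
by rewrite mxE; apply: eq_bigr => i _; rewrite /Jac mxE.
Qed.

(* Osgood's theorem is proved by induction on the number [k] of coordinates that
   [F] changes. *)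
Definition inj_fixing (k : nat) F z r := [/\ 0 < r,
  forall w, nrm (w - z) < r -> differentiable F w,
  forall x y, nrm (x - z) < r -> nrm (y - z) < r -> F x = F y -> x = y &
  forall (i : 'I_n) w, (k <= i)%N -> nrm (w - z) < r -> F w ord0 i = w ord0 i].

Lemma inj_fixing_sub k F z r a s : inj_fixing k F z r -> 0 < s -> nrm (a - z) + s <= r ->
  inj_fixing k F a s.
Proof.
move=> [r0 df inj fx] s0 h.
have sub w : nrm (w - a) < s -> nrm (w - z) < r by move=> ?; have := nrm_tri a w z; order_lra.
split=> [//|w /sub|x y /sub h1 /sub h2|i w ki /sub]; [exact: df|exact: inj|exact: fx].
Qed.

(** Let Psi replace only the coordinate [kap] by that of F. The nonzero partial derivative makes Psi
    a local coordinate system, and F o Psi^-1 is injective and fixes one coordinate more. By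
    induction it is regular, and so is F. *)
Lemma inj_fixing_reduce k (kap : 'I_n) F a r : kap = k :> nat ->
  (forall F z r, inj_fixing k F z r -> regular F z) ->
  inj_fixing k.+1 F a r -> ('d F a (ebase kap)) ord0 kap != 0 -> regular F a.
Proof.
move=> kapk IH [r0 df inj fx] p0.
pose Psi z : Cn := \row_l (if l == kap then F z ord0 kap else z ord0 l).
have PsiE z l : Psi z ord0 l = if l == kap then F z ord0 kap else z ord0 l by rewrite mxE.
have dPsi w : nrm (w - a) < r -> differentiable Psi w.
  move=> wr; apply: drow => l.
  have -> : (fun w => Psi w ord0 l) = (fun w => if l == kap then F w ord0 kap else w ord0 l).
    by apply/funext => t; rewrite PsiE.
  case: (l == kap); last exact: dcoord.
  by have [] := dcoordE kap (df _ wr).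
have aa : nrm (a - a) < r by rewrite subrr nrm0.
have dFa := df _ aa; have dPa := dPsi _ aa.
have dPsiE v l : ('d Psi a v) ord0 l = if l == kap then ('d F a v) ord0 kap else v ord0 l.
  have [_ E] := dcoordE l dPa; apply: (etrans (esym (E v))).
  have -> : (fun w => Psi w ord0 l) = (fun w => if l == kap then F w ord0 kap else w ord0 l).
    by apply/funext => t; rewrite PsiE.
  case: (l == kap).
    by have [_ E'] := dcoordE kap dFa; exact: E'.
  by have [_ E'] := dcoordE l (did a); apply: (etrans (E' v)); exact: (congr1 (fun u : Cn => u ord0 l) (diffid a v)).
have regP : regular Psi a.
  move=> v hv.
  have vE l : (if l == kap then ('d F a v) ord0 kap else v ord0 l) = 0.
    apply: (etrans (esym (dPsiE v l))); apply: (etrans (congr1 (fun u : Cn => u ord0 l) hv)).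
    by rewrite mxE.
  have vl l : l != kap -> v ord0 l = 0 by move=> lk; have := vE l; rewrite (negbTE lk).
  apply/rowP => l; rewrite [RHS]mxE; have [->|lk] := eqVneq l kap; last exact: vl.
  have := vE kap; rewrite eqxx diff_basis (bigD1 kap) //= big1 ?addr0.
    by move=> /eqP; rewrite mulf_eq0 (negbTE p0) orbF => /eqP.
  by move=> i ik; rewrite vl ?mul0r.
have [rho [d [K [g [/andP[rho0 rhor] d0 K0 expd hg]]]]] := local_inverse r0 dPsi regP.
pose H w := F (g w).
have gin y : nrm (y - Psi a) < d -> nrm (g y - a) < r.
  by move=> /hg [h _ _]; exact: lt_trans rhor.
have dH w : nrm (w - Psi a) < d -> differentiable H w.
  by move=> wd; have [_ _ dg] := hg _ wd; apply: (dcomp dg); apply: df; exact: gin.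
have regH : regular H (Psi a).
  apply: (IH H (Psi a) d); split=> [//|//|x y xd yd|i w ki wd].
    move=> /inj -/(_ (gin _ xd) (gin _ yd)) gg.
    by have [_ Ex _] := hg _ xd; have [_ Ey _] := hg _ yd; rewrite -Ex -Ey gg.
  have [_ gw _] := hg _ wd; have := PsiE (g w) i; rewrite gw => ->.
  have [->//|ik] := eqVneq i kap; rewrite /H fx //; last exact: gin.
  by rewrite ltn_neqAle ki andbT -kapk; apply: contra ik => /eqP h; apply/eqP/val_inj.
have [d' d'0 hd'] := diff_cont dPa d0.
have E : forall v, 'd F a v = 'd H (Psi a) ('d Psi a v).
  have dHP : differentiable H (Psi a) by apply: dH; rewrite subrr nrm0.
  move=> v; apply: (etrans _ (dcompE dPa dHP v)).
  suff [_ EE] : differentiable F a /\ 'd F a =1 'd (fun z => H (Psi z)) a by exact: EE.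
  apply: (diff_ext (dcomp dPa dHP)).
  exists (Num.min d' rho) => [|y]; first by rewrite lt_min d'0.
  rewrite lt_min => /andP[/hd' yd yr]; rewrite /H; congr F.
  have [h1 h2 _] := hg _ yd.
  apply/eqP; rewrite -subr_eq0; apply/eqP/nrm_eq0/eqP; rewrite eq_le nrm_ge0 andbT.
  have := expd y (g (Psi y)) (ltW yr) (ltW h1).
  by rewrite h2 subrr nrm0 mulr0.
by move=> v hv; apply: regP; apply: regH; apply: (etrans (esym (E v))).
Qed.

(** Transposing coordinates in the source and in the target moves the entry (i, j) of the
    differential to the position ([kap], [kap]), where a nonzero entry would make F regular. So at a
    singular point a whole block of the differential vanishes. *)
Lemma inj_fixing_partial k (kap : 'I_n) F a r : kap = k :> nat ->
  (forall F z r, inj_fixing k F z r -> regular F z) ->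
  inj_fixing k.+1 F a r -> ~ regular F a ->
  forall i j : 'I_n, (i <= k)%N -> (j <= k)%N -> ('d F a (ebase i)) ord0 j = 0.
Proof.
move=> kapk IH [r0 df inj fx] nreg i j ik jk; apply/eqP/negPn/negP => p0; apply: nreg.
pose X (l : 'I_n) : 'M[C]_n := perm_mx (tperm l kap).
have XE l (v : Cn) m : (v *m X l) ord0 m = v ord0 (tperm l kap m).
  have -> : v *m X l = col_perm (tperm l kap) v by rewrite col_permE tpermV.
  by rewrite mxE.
have XX l (v : Cn) : v *m X l *m X l = v.
  by apply/rowP => m; rewrite !XE tpermK.
have nX l (v : Cn) : nrm (v *m X l) <= nrm v.
  by apply: nrm_row_le => [|m]; rewrite ?nrm_ge0 // XE; exact: nrm_coord.
have Xk (l m : 'I_n) : (l <= k)%N -> (k.+1 <= m)%N -> forall v : Cn, (v *m X l) ord0 m = v ord0 m.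
  move=> lk km v; rewrite XE tpermD //; apply/eqP => h.
    by move: km; rewrite -h ltnNge lk.
  by move: km; rewrite -h kapk ltnn.
pose F' z := F (z *m X i) *m X j.
have inB w : nrm (w - a *m X i) < r -> nrm (w *m X i - a) < r.
  by move=> h; apply: le_lt_trans h; rewrite -{1}(XX i a) -mulmxBl; exact: nX.
have dX w : differentiable (fun z : Cn => z *m X i) w /\ forall h, 'd (fun z : Cn => z *m X i) w h = h *m X i.
  by have [h1 h2] := diff_mulmx (X i) (did w); split=> [//|h]; rewrite h2 diffid.
have dF' w : nrm (w - a *m X i) < r -> differentiable F' w /\
    forall h, 'd F' w h = 'd F (w *m X i) (h *m X i) *m X j.
  move=> wr; have [d1 e1] := dX w; have d2 := df _ (inB _ wr).
  have [d3 e3] := diff_mulmx (X j) (dcomp d1 d2); split=> [//|h].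
  apply: (etrans (e3 h)); apply: (congr1 (fun v => v *m X j)).
  by apply: (etrans (dcompE d1 d2 h)); apply: (congr1 ('d F (w *m X i))); exact: e1.
have aa : nrm (a *m X i - a *m X i) < r by rewrite subrr nrm0.
have regF' : regular F' (a *m X i).
  apply: (@inj_fixing_reduce k kap F' (a *m X i) r kapk IH).
    split=> [//|w /dF' [] //|x y xr yr|l w kl wr].
      move=> /(congr1 (fun v => v *m X j)); rewrite !XX => /inj -/(_ (inB _ xr) (inB _ yr)).
      by move=> /(congr1 (fun v => v *m X i)); rewrite !XX.
    by rewrite /F' Xk // fx ?Xk //; exact: inB.
  have [_ EF] := dF' _ aa; rewrite (EF (ebase kap)) XX XE tpermR.
  have -> : ebase kap *m X i = ebase i.
    apply/rowP => m; rewrite XE !ebaseE; congr (_%:R); congr nat_of_bool.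
    by apply/eqP/eqP => [h|->]; [rewrite -(tpermK i kap m) h tpermR|rewrite tpermL].
  exact: p0.
move=> v hv; rewrite -(XX i v) (regF' (v *m X i)) ?mul0mx //.
by have [_ EF] := dF' _ aa; rewrite (EF (v *m X i)) !XX hv mul0mx.
Qed.

Lemma dbigprod (I : Type) (q : seq I) (f : I -> Cn -> C) x :
  (forall i, differentiable (f i) x) -> differentiable (fun y => \prod_(i <- q) f i y) x.
Proof.
move=> h; elim: q => [|i q ih].
  have -> : (fun y => \prod_(i <- [::]) f i y) = (fun=> 1) by apply/funext => y; rewrite big_nil.
  exact: dcst.
have -> : (fun y => \prod_(j <- i :: q) f j y) = (fun y => f i y * \prod_(j <- q) f j y).
  by apply/funext => y; rewrite big_cons.
exact: dM.
Qed.

Definition Jdet F x : C := \det (Jac F x).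

Lemma dJdet F z r : 0 < r -> (forall w, nrm (w - z) < r -> differentiable F w) ->
  differentiable (Jdet F) z.
Proof.
move=> r0 df.
have dJ i j : differentiable (fun x => Jac F x i j) z.
  have hj : holball (fun w => F w ord0 j) z r by move=> w /df /(dcoordE j) [].
  have [] // := @diff_ext _ _ _ _ (fun x => Jac F x i j) z (dderiv (ebase i) r0 hj) _.
  exists r => // y /df /(dcoordE j) [_ ->]; by rewrite /Jac mxE.
have -> : Jdet F = (fun x => \sum_(s <- index_enum 'S_n) (-1) ^+ s * \prod_(i <- index_enum 'I_n) Jac F x i (s i)).
  by apply/funext.
apply: dbigsum => s; apply: dM; first exact: dcst.
by apply: dbigprod => i; exact: dJ.
Qed.

Fixpoint iter_d (f : Cn -> C) u m : Cn -> C :=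
  if m is m'.+1 then (fun x => 'd (iter_d f u m') x u) else f.

Lemma diter f u z r : (forall x, nrm (x - z) < r -> differentiable f x) ->
  forall m x, nrm (x - z) < r -> differentiable (iter_d f u m) x.
Proof.
move=> df; elim=> [|m ih] x xr; first exact: df.
have s0 : 0 < r - nrm (x - z) by rewrite subr_gt0.
apply: (dderiv u s0) => w wx; apply: ih; have := nrm_tri x w z; order_lra.
Qed.

(** At singular points the first derivatives in the coordinates 0, ..., k vanish, so in a slice
    where the other coordinates are fixed F moves only to second order between singular points. A
    Lipschitz curve of singular points in a slice would be collapsed by F, against injectivity. For
    k = 0 the one-variable theorem decides. For k > 0 a curve is found in the zero set of the
    Jacobian determinant J: some derivative of J along coordinate 0 vanishes at all singular points
    near a but has nonzero slope at a, which confines them to cones, and a zero of J persists while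
    coordinate 1 varies. *)
Lemma inj_fixing_regular_step k :
  (forall F z r, inj_fixing k F z r -> regular F z) ->
  forall F z r, inj_fixing k.+1 F z r -> regular F z.
Proof.
move=> IH F z0 r1 hyp1.
have [nk|kn] := leqP n k.
  apply: (IH F z0 r1); case: hyp1 => r0 df inj fx; split=> // i w ki.
  by have := leq_trans (ltn_ord i) (leq_trans nk ki); rewrite ltnn.
pose kap := Ordinal kn; apply: contrapT => sing0.
have [r [M [r0 M0 hyp FM]]] : exists r M : R, [/\ 0 < r, 0 <= M, inj_fixing k.+1 F z0 r &
    forall w, nrm (w - z0) < r -> nrm (F w) <= M].
  case: (hyp1) => r10 df inj fx.
  have zz1 : nrm (z0 - z0) < r1 by rewrite subrr nrm0.
  have [d d0 hd] := diff_cont (df z0 zz1) ltr01.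
  pose r := Num.min r1 d; have r0 : 0 < r by rewrite lt_min r10.
  exists r, (nrm (F z0) + 1); split=> //.
  - by rewrite addr_ge0 ?nrm_ge0.
  - by apply: (inj_fixing_sub hyp1 r0); rewrite subrr nrm0 add0r ge_min lexx.
  - move=> w; rewrite lt_min => /andP[_ /hd h].
    by have := nrmD (F w - F z0) (F z0); rewrite subrK; order_lra.
have [_ df inj fx] := hyp.
pose Sing x := ~ regular F x.
have part x (i j : 'I_n) : nrm (x - z0) < r -> Sing x -> (i <= k)%N -> (j <= k)%N -> ('d F x (ebase i)) ord0 j = 0.
  move=> xr sx; have s0 : 0 < r - nrm (x - z0) by rewrite subr_gt0.
  apply: (@inj_fixing_partial k kap F x (r - nrm (x - z0)) erefl IH _ sx).
  by apply: (inj_fixing_sub hyp s0); rewrite subrKC.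
pose K := 8 * M / (r / 2) ^+ 2.
have K0 : 0 <= K by apply: divr_ge0; [exact: mulr_ge0|exact: sqr_ge0].
(* For y - x inside the slice the differential at the singular point x contributes nothing in the
   coordinates up to k, and the other coordinates of F agree; the second order Taylor bound
   remains. *)
have quad x y : nrm (x - z0) <= r / 16 -> nrm (y - z0) <= r / 16 -> Sing x ->
    (forall l : 'I_n, (k < l)%N -> x ord0 l = y ord0 l) -> nrm (F y - F x) <= K * nrm (y - x) ^+ 2.
  move=> xr yr sx xy; have r2 : 0 < r / 2 by order_lra.
  have ball w : nrm (w - x) < r / 2 -> nrm (w - z0) < r.
    by move=> h; have := nrm_tri x w z0; order_lra.
  have hb w : nrm (w - x) < r / 2 -> differentiable F w /\ nrm (F w) <= M.
    by move=> /ball h; split; [exact: df|exact: FM].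
  have hr : nrm (y - x) <= r / 2 / 4.
    by have := nrm_tri z0 y x; rewrite [nrm (z0 - x)]nrmC; order_lra.
  have := row_taylor2 r2 M0 hb hr; rewrite subrKC -/K => T.
  apply: nrm_row_le => [|j]; first by rewrite mulr_ge0 // sqr_ge0.
  have [kj|jk] := ltnP k j.
    have xr' : nrm (x - z0) < r by order_lra.
    have yr' : nrm (y - z0) < r by order_lra.
    by rewrite !mxE !fx // xy // subrr nrm0 mulr_ge0 // sqr_ge0.
  apply: le_trans T; have := nrm_coord (F y - F x - 'd F x (y - x)) j.
  suff -> : (F y - F x - 'd F x (y - x)) ord0 j = (F y - F x) ord0 j by [].
  rewrite [LHS]mxE [X in _ + X]mxE diff_basis big1 ?subr0 // => i _.
  have [ki|ik] := ltnP k i; first by rewrite !mxE xy // subrr mul0r.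
  by rewrite part ?mulr0 //; order_lra.
have n0 : (0 < n)%N by exact: (leq_ltn_trans (leq0n k)).
pose u := ebase (Ordinal n0); have nu : nrm u = 1 by exact: nrm_ebase.
have ul (t : C) (l : 'I_n) : (0 < l)%N -> (t *: u) ord0 l = 0.
  by move=> l0; rewrite mxE ebaseE -val_eqE /= (gtn_eqF l0) mulr0.
(* If a whole segment in direction u were singular, [chain_bound] with linear part 0 would give F
   the same value at both ends. *)
have line a d : nrm (a - z0) < r / 32 -> 0 < d -> exists2 t : R, 0 <= t <= d & regular F (a + t%:C *: u).
  move=> ar d0; apply: contrapT => H.
  pose e := Num.min d (r / 32); have e0 : 0 < e by rewrite lt_min d0; order_lra.
  have ed : e <= d by rewrite ge_min lexx.
  have er : e <= r / 32 by rewrite ge_min lexx orbT.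
  have sing t : 0 <= t <= e -> Sing (a + t%:C *: u).
    by move=> /andP[t0 te] h; apply: H; exists t; [rewrite t0; exact: (le_trans te)|exact: h].
  have inb t : 0 <= t <= e -> nrm (a + t%:C *: u - z0) <= r / 16.
    move=> /andP[t0 te]; rewrite addrAC; apply: le_trans (nrmD _ _) _.
    by rewrite nrmZ nu mulr1 real_C_nrm //; order_lra.
  have se s : 0 <= s <= 1 -> 0 <= s * e <= e.
    by move=> /andP[s0 s1]; rewrite mulr_ge0 ?(ltW e0) //= ler_piMl // ltW.
  have := @chain_bound _ _ (fun s => F (a + (s * e)%:C *: u)) 0 (K * e ^+ 2) 1 (lexx 0)
    (mulr_ge0 K0 (sqr_ge0 e)) ltr01.
  rewrite mul0r mul1r rmorph0 scale0r addr0 => chain.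
  have : nrm (F (a + e%:C *: u) - F a) <= 0.
    apply: chain => s s' s01 s'01 _; rewrite mul0r add0r.
    apply: le_trans (quad _ _ (inb _ (se _ s01)) (inb _ (se _ s'01)) (sing _ (se _ s01)) _) _.
      by move=> l kl; rewrite [LHS]mxE [RHS]mxE !ul // (leq_ltn_trans (leq0n k) kl).
    have -> : a + (s' * e)%:C *: u - (a + (s * e)%:C *: u) = ((s' - s) * e)%:C *: u.
      by apply/rowP => l; rewrite !mxE !rmorphM rmorphB /=; ring.
    by rewrite nrmZ nu mulr1 nrm_real normrM (gtr0_norm e0); apply: quad_scale; [exact: K0|exact: ltW|exact: lexx].
  move=> h; have /inj : F (a + e%:C *: u) = F a.
    by apply/eqP; rewrite -subr_eq0; apply/eqP/nrm_eq0/eqP; rewrite eq_le h nrm_ge0.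
  have := inb e; rewrite lexx (ltW e0) => /(_ isT) h1.
  have h2 : nrm (a + e%:C *: u - z0) < r by order_lra.
  have h3 : nrm (a - z0) < r by order_lra.
  move=> /(_ h2 h3) /eqP; rewrite addrC -subr_eq0 addrK => /eqP /(congr1 nrm).
  by rewrite nrmZ nu mulr1 real_C_nrm ?(ltW e0) // nrm0 => h4; move: e0; rewrite h4 ltxx.
have zz : nrm (z0 - z0) < r by rewrite subrr nrm0.
have [k0|k0] := posnP k.
  pose f (t : C) := F (z0 + t *: u) ord0 kap.
  have tb (t : C) : nrm t < r -> nrm (z0 + t *: u - z0) < r.
    by move=> h; rewrite addrAC subrr add0r nrmZ nu mulr1.
  have hf : holdisc f r.
    move=> t /tb tr; have [dl _] := @dline _ _ _ F z0 u t (df _ tr).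
    by have [] := dcoordE kap dl.
  have := injective_deriv_neq0 r0 hf.
  have -> : 'd f 0 1 = 0.
    have E0 : z0 + (0 : C) *: u = z0 by rewrite scale0r addr0.
    have dF0 : differentiable F (z0 + (0 : C) *: u) by rewrite E0; exact: df.
    have [dl El] := @dline _ _ _ F z0 u 0 dF0.
    have [_ ->] := dcoordE kap dl; rewrite El E0.
    exact: (part z0 (Ordinal n0) kap zz sing0 (leq0n k) (leqnn k)).
  rewrite eqxx => H; suff : false by []; apply: H => t t' tr t'r E.
  have : z0 + t *: u = z0 + t' *: u.
    apply: inj; [exact: tb|exact: tb|].
    apply/rowP => l; have [->//|lk] := eqVneq l kap.
    have l0 : (k < l)%N.
      rewrite ltn_neqAle k0 leq0n andbT eq_sym; apply: contra lk => /eqP h.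
      by apply/eqP/val_inj; rewrite /= k0.
    by rewrite !fx ?tb // mxE [RHS]mxE !ul // -k0.
  move=> /addrI /(congr1 (fun v : Cn => v ord0 (Ordinal n0))).
  by rewrite !mxE !eqxx !mulr1.
pose J := Jdet F.
have dJ x : nrm (x - z0) < r -> differentiable J x.
  move=> xr; have s0 : 0 < r - nrm (x - z0) by rewrite subr_gt0.
  by apply: (dJdet s0) => w wx; apply: df; have := nrm_tri x w z0; order_lra.
have singP x : Sing x <-> J x = 0.
  split=> [h|h]; first by apply/eqP/negPn/negP => /regularP.
  by move=> /regularP; rewrite -/(Jdet F x) -/(J x) h eqxx.
pose G := iter_d J u.
have dG := diter u dJ.
(* If all derivatives of J along u vanished at z0, then J would vanish on a piece of the line
   through z0, against [line]. *)
have exm : exists m, `[< exists a, [/\ nrm (a - z0) < r / 32, Sing a & G m a <> 0] >].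
  apply: contrapT => H.
  have Gz m : G m z0 = 0.
    apply: contrapT => h; apply: H; exists m; apply/asboolP; exists z0.
    by split=> //; rewrite subrr nrm0; order_lra.
  have tb (t : C) : nrm t < r -> nrm (z0 + t *: u - z0) < r.
    by move=> h; rewrite addrAC subrr add0r nrmZ nu mulr1.
  have [] := @flat_zero _ (fun m t => G m (z0 + t *: u)) r r0.
  - by move=> m t /tb tr; have [] := @dline _ _ _ (G m) z0 u t (dG m _ tr).
  - by move=> m t /tb tr; have [_ ->] := @dline _ _ _ (G m) z0 u t (dG m _ tr).
  - by move=> m; rewrite scale0r addr0.
  move=> d d0 hd.
  have r32 : 0 < r / 32 by order_lra.
  have [||t /andP[t0 td] reg] := @line z0 (d / 2); [by rewrite subrr nrm0|order_lra|].
  have : Sing (z0 + t%:C *: u).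
    apply: (proj2 (singP _)); apply: (hd t%:C); rewrite (real_C_nrm t0); move: td d0; clear; order_lra.
  by apply.
(* By minimality of the order, the derivative one order lower vanishes at every singular point near
   z0. The order is positive because J itself vanishes at a. *)
have [m /asboolP [a [ar sa Gma]] minm] := ex_minnP exm.
case: m Gma minm => [|m] Gma minm; first by case: Gma; apply/singP.
have hz x : nrm (x - z0) < r / 32 -> Sing x -> G m x = 0.
  move=> xr sx; apply: contrapT => h; have := minm m.
  by rewrite ltnn => H; have : false; [apply: H; apply/asboolP; exists x|].
have ar' : 0 < r - nrm (a - z0) by move: ar r0; clear; order_lra.
(* Strict differentiability at a of the derivative of the lower order, with slope [Lh u] != 0 along
   u: differences of singular points near a avoid a cone around the direction u. *)
have [Lh [d1 [LD LZ Lu0 d10 hd1]]] : exists (Lh : Cn -> C) (d1 : R), [/\ forall x y, Lh (x + y) = Lh x + Lh y,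
    forall c x, Lh (c *: x) = c * Lh x, Lh u <> 0, 0 < d1 & forall x x', nrm (x - a) <= d1 ->
    nrm (x' - a) <= d1 -> G m x = 0 -> G m x' = 0 -> nrm (Lh (x' - x)) <= nrm (Lh u) / 2 * nrm (x' - x)].
  have hbh : holball (G m) a (r - nrm (a - z0)).
    by move=> w wa; apply: dG; move: (nrm_tri a w z0) wa; clear; order_lra.
  have D2 : 0 < nrm ('d (G m) a u : C) / 2 by rewrite divr_gt0 //; apply: nrm_gt0; apply/eqP.
  have [d1 d10 hd1] := strict_diff_scalar ar' hbh D2.
  exists ('d (G m) a), d1; split; [exact: linearD|by move=> c x; rewrite linearZ|exact: Gma|exact: d10|].
  move=> x x' xa xa' hx hx'; have := hd1 x x' xa xa'.
  by rewrite hx hx' subrr sub0r nrmN.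
pose D := Lh u.
have D0 : 0 < nrm (D : C) by apply: nrm_gt0; apply/eqP.
have daJ : differentiable J a by apply: dJ; order_lra.
have [db db0 hdb] := hol_locally_bounded daJ.
have Ja : J a = 0 by apply/singP.
rewrite Ja nrm0 add0r in hdb.
pose rb := Num.min db (r - nrm (a - z0)); have rb0 : 0 < rb by rewrite lt_min db0.
have Jlip x x' : nrm (x - a) <= rb / 4 -> nrm (x' - a) <= rb / 4 -> nrm (J x' - J x) <= 4 * 1 / rb * nrm (x' - x).
  have hb2 w : nrm (w - a) < rb -> nrm (w - a) < db /\ nrm (w - z0) < r.
    rewrite lt_min => /andP[w1 w2]; split; first exact: w1.
    by apply: le_lt_trans (nrm_tri a w z0) _; rewrite -ltrBrDr.
  exact: (holball_lip2 rb0 (fun w h => dJ w (hb2 w h).2) (fun w h => hdb w (hb2 w h).1)).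
pose r2 := Num.min (Num.min d1 (r / 32 - nrm (a - z0))) (rb / 4) / 4.
have m0 : 0 < Num.min (Num.min d1 (r / 32 - nrm (a - z0))) (rb / 4).
  by rewrite !lt_min d10 subr_gt0 ar divr_gt0.
have r20 : 0 < r2 by rewrite divr_gt0.
have r2P x : nrm (x - a) <= 2 * r2 -> [/\ nrm (x - a) <= d1, nrm (x - z0) < r / 32,
    nrm (x - a) <= rb / 4 & nrm (x - z0) < r].
  move=> hx; have : nrm (x - a) < Num.min (Num.min d1 (r / 32 - nrm (a - z0))) (rb / 4).
    by move: hx m0; rewrite /r2; set mm := Num.min _ _; clear; order_lra.
  rewrite !lt_min => /andP[/andP[h1 h2] h3]; have := nrm_tri a x z0.
  move=> h4; split; [exact: ltW|move: h2 h4; clear; order_lra|exact: ltW|move: h2 h4 r0; clear; order_lra].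
(* The cone condition between a and a + t u would read |t| |Lh u| <= |t| |Lh u| / 2. *)
have nz (t : C) : 0 < nrm t <= r2 -> J (a + t *: u) != 0.
  move=> /andP[t0 tr]; apply/eqP => Jt.
  have ta : nrm (a + t *: u - a) = nrm t by rewrite addrAC subrr add0r nrmZ nu mulr1.
  have [h1 h2 _ _] : [/\ nrm (a + t *: u - a) <= d1, nrm (a + t *: u - z0) < r / 32,
    nrm (a + t *: u - a) <= rb / 4 & nrm (a + t *: u - z0) < r] by apply: r2P; rewrite ta; order_lra.
  have aa : nrm (a - a) <= d1 by rewrite subrr nrm0 ltW.
  have st : Sing (a + t *: u) by exact: (proj2 (singP _)).
  have := hd1 a (a + t *: u) aa h1 (hz _ ar sa) (hz _ h2 st).
  have -> : a + t *: u - a = t *: u by rewrite addrAC subrr add0r.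
  rewrite LZ -/D nrmM nrmZ nu mulr1.
  have : 0 < nrm t * nrm (D : C) by exact: mulr_gt0.
  by move=> h4 h5; move: h4 h5; rewrite [nrm (D : C) / 2 * _]mulrC mulrA; set q := nrm t * _; clear; order_lra.
have rhalf : 0 < r2 / 2 by order_lra.
have [mu mu0 hmu] : exists2 mu : R, 0 < mu & forall t : C, nrm t = r2 / 2 -> mu <= nrm (J (a + t *: u)).
  apply: circle_lower => t tr; split; last by apply: nz; rewrite tr; apply/andP; order_lra.
  apply: (@dline _ _ _ J a u t _).1; apply: dJ.
  have ta : nrm (a + t *: u - a) = nrm t by rewrite addrAC subrr add0r nrmZ nu mulr1.
  by have [] : [/\ nrm (a + t *: u - a) <= d1, nrm (a + t *: u - z0) < r / 32,
    nrm (a + t *: u - a) <= rb / 4 & nrm (a + t *: u - z0) < r] by apply: r2P; rewrite ta tr; order_lra.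
have n1 : (1 < n)%N by exact: (leq_ltn_trans _ kn).
pose v := ebase (Ordinal n1); have nv : nrm v = 1 by exact: nrm_ebase.
(* The constant 4 / rb is a Lipschitz constant of J near a, so moving by eta along v changes J by
   less than mu / 2. *)
pose eta := Num.min (r2 / 2) (mu * rb / 16).
have eta0 : 0 < eta by rewrite lt_min rhalf divr_gt0 // mulr_gt0.
have etar : eta <= r2 / 2 by rewrite ge_min lexx.
have etamu : 4 * 1 / rb * eta < mu / 2.
  apply: le_lt_trans (_ : 4 * 1 / rb * (mu * rb / 16) < _).
    by rewrite ler_wpM2l ?divr_ge0 ?(ltW rb0) // ge_min lexx orbT.
  have -> : 4 * 1 / rb * (mu * rb / 16) = mu / 4 by field; rewrite gt_eqF.
  order_lra.
pose pt (s : R) (t : C) : Cn := a + s%:C *: v + t *: u.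
have ptE s t : pt s t = a + (s%:C *: v + t *: u) by rewrite addrA.
have ptB s t : 0 <= s <= eta -> nrm t <= r2 -> nrm (pt s t - a) <= 2 * r2.
  move=> /andP[s0 se] tr; have -> : pt s t - a = s%:C *: v + t *: u by rewrite ptE [LHS]addrC addKr.
  apply: le_trans (nrmD _ _) _; rewrite !nrmZ nu nv !mulr1 real_C_nrm //; order_lra.
(* A Hurwitz argument: without a zero, the maximum principle for 1 / J would bound |J| below by mu /
   2 at the centre, where J is within less than mu / 2 of J a = 0. *)
have exz s : exists t : C, 0 <= s <= eta -> nrm t < r2 /\ J (pt s t) = 0.
  have [s01|s01] := boolP (0 <= s <= eta); last by exists 0.
  apply: contrapT => H.
  have ne t : nrm t < r2 -> J (pt s t) != 0.
    by move=> tr; apply/eqP => Jt; apply: H; exists t.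
  have hd : holdisc (fun t => (J (pt s t))^-1) r2.
    move=> t tr; apply: dV; last exact: ne.
    apply: (@dline _ _ _ J (a + s%:C *: v) u t _).1; apply: dJ.
    by have [] := r2P _ (ptB s t s01 (ltW tr)).
  have nr : nrm ((r2 / 2)%:C : C) = r2 / 2 by rewrite real_C_nrm // ltW.
  have := @max_disc _ _ r2 (r2 / 2)%:C 0 (mu / 2)^-1 hd; rewrite nr nrm0.
  have h1 : 0 < r2 / 2 < r2 by apply/andP; order_lra.
  have near0 t : nrm t <= r2 / 2 -> nrm (J (pt s t) - J (a + t *: u)) < mu / 2.
    move=> tr; have tr2 : nrm t <= r2 by order_lra.
    apply: le_lt_trans etamu.
    have := Jlip (a + t *: u) (pt s t).
    have -> : pt s t - (a + t *: u) = s%:C *: v by rewrite /pt [a + _ + _]addrAC [LHS]addrC addKr.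
    rewrite nrmZ nv mulr1; case/andP: (s01) => s0 se; rewrite real_C_nrm // => HH.
    apply: le_trans (HH _ _) _.
    - have := ptB 0 t; rewrite lexx (ltW eta0) => /(_ isT tr2) /r2P.
      by rewrite /pt rmorph0 scale0r addr0 => -[].
    - by have [] := r2P _ (ptB s t s01 tr2).
    - by rewrite mulr1 ler_wpM2l // divr_ge0 // ltW.
  move=> /(_ h1) HH; have {}HH : nrm (J (pt s 0))^-1 <= (mu / 2)^-1.
    apply: HH => t tr; rewrite nrmV lef_pV2 ?posrE ?nrm_gt0 ?ne ?tr ?divr_gt0 //; last order_lra.
    have := hmu t tr; have := near0 t; rewrite tr lexx => /(_ isT).
    have aux : forall p q m : R, q < m / 2 -> m <= p -> m / 2 <= p - q by clear; move=> p q m; order_lra.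
    move=> h5 h6; apply: le_trans (aux _ _ _ h5 h6) _.
    exact: nrm_lowB.
  have ne0 : J (pt s 0) != 0 by apply: ne; rewrite nrm0.
  move: HH; rewrite nrmV lef_pV2 ?posrE ?nrm_gt0 ?divr_gt0 //.
  have := near0 0; rewrite nrm0 scale0r addr0 Ja subr0 => /(_ (ltW rhalf)); move: mu0; clear; order_lra.
have [ze hze] := choice exz.
pose X s := pt s (ze s).
have XB s : 0 <= s <= eta -> nrm (X s - a) <= 2 * r2.
  by move=> s01; apply: ptB => //; have [/ltW] := hze s s01.
have XS s : 0 <= s <= eta -> Sing (X s).
  by move=> s01; apply/singP; have [] := hze s s01.
(* Solving the cone condition for |ze s' - ze s| gives this Lipschitz constant; in particular the
   zero above each s is unique and no choice is lost. *)
pose L := 1 + 2 * nrm (Lh v : C) / nrm (D : C).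
have L0 : 0 <= L by rewrite addr_ge0 // divr_ge0 ?mulr_ge0 ?nrm_ge0.
have XL s s' : 0 <= s <= eta -> 0 <= s' <= eta -> nrm (X s' - X s) <= (1 + L) * `|s' - s|.
  move=> s01 s'01.
  have [h1 h2 _ _] := r2P _ (XB s s01); have [h1' h2' _ _] := r2P _ (XB s' s'01).
  have := hd1 _ _ h1 h1' (hz _ h2 (XS s s01)) (hz _ h2' (XS s' s'01)).
  have XX : X s' - X s = (s' - s)%:C *: v + (ze s' - ze s) *: u.
    by rewrite /X !ptE opprD addrACA subrr add0r opprD addrACA -!scalerBl rmorphB.
  rewrite XX.
  have -> : Lh ((s' - s)%:C *: v + (ze s' - ze s) *: u) = (s' - s)%:C * Lh v + (ze s' - ze s) * D.
    by rewrite LD !LZ.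
  have n1' : nrm ((s' - s)%:C *: v + (ze s' - ze s) *: u) <= `|s' - s| + nrm (ze s' - ze s).
    by apply: le_trans (nrmD _ _) _; rewrite !nrmZ nu nv !mulr1 nrm_real.
  have n2 := nrm_lowD ((ze s' - ze s) * D) ((s' - s)%:C * Lh v).
  rewrite !nrmM nrm_real [(ze s' - ze s) * D + _]addrC in n2.
  move=> n3; have n4 : nrm (ze s' - ze s) <= L * `|s' - s|.
    rewrite /L -(ler_pM2r D0).
    have -> : (1 + 2 * nrm (Lh v : C) / nrm (D : C)) * `|s' - s| * nrm (D : C) =
        nrm (D : C) * `|s' - s| + 2 * (`|s' - s| * nrm (Lh v : C)) by field; rewrite gt_eqF.
    have n5 : nrm (D : C) / 2 * nrm ((s' - s)%:C *: v + (ze s' - ze s) *: u) <=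
      nrm (D : C) / 2 * (`|s' - s| + nrm (ze s' - ze s)) by rewrite ler_wpM2l // divr_ge0 ?nrm_ge0.
    rewrite -/D in n3; move: n2 n3 n5; set a1 := nrm (_ *: v + _); set a2 := nrm (_ * Lh v + _).
    set b1 := nrm (ze s' - ze s); set b2 := nrm (D : C); set b3 := `|s' - s|.
    by set b4 := nrm (Lh v : C); clear; order_lra.
  by apply: le_trans n1' _; rewrite mulrDl mul1r lerD2l.
have L1 : 0 <= 1 + L by exact: addr_ge0.
have se s : 0 <= s <= 1 -> 0 <= s * eta <= eta.
  by move=> /andP[s0 s1]; rewrite mulr_ge0 ?(ltW eta0) //= ler_piMl // ltW.
have X16 s : 0 <= s <= eta -> nrm (X s - z0) <= r / 16.
  by move=> /XB /r2P [_ h1 _ _]; move: h1 r0; clear; order_lra.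
have Xl s (l : 'I_n) : (k < l)%N -> X s ord0 l = a ord0 l.
  move=> kl; have l1 : (1 < l)%N by exact: leq_ltn_trans kl.
  have -> : X s ord0 l = a ord0 l + s%:C * v ord0 l + (ze s *: u) ord0 l by rewrite !mxE.
  rewrite ul ?(ltn_trans _ l1) // ebaseE -val_eqE /= (gtn_eqF l1) mulr0; ring.
have := @chain_bound _ _ (fun s => F (X (s * eta))) 0 (K * ((1 + L) * eta) ^+ 2) 1 (lexx 0)
  (mulr_ge0 K0 (sqr_ge0 _)) ltr01.
rewrite mul0r mul1r => chain.
have : nrm (F (X eta) - F (X 0)) <= 0.
  apply: chain => s s' s01 s'01 _; rewrite mul0r add0r.
  apply: le_trans (quad _ _ (X16 _ (se _ s01)) (X16 _ (se _ s'01)) (XS _ (se _ s01)) _) _.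
    by move=> l kl; rewrite !Xl.
  have := XL _ _ (se _ s01) (se _ s'01); rewrite -mulrBl normrM (gtr0_norm eta0) => h1.
  have h2 : nrm (X (s' * eta) - X (s * eta)) ^+ 2 <= (`|s' - s| * ((1 + L) * eta)) ^+ 2.
    apply: lerXn2r; rewrite ?nnegrE ?nrm_ge0 //; last by rewrite mulrCA.
    by apply: mulr_ge0 => //; apply: mulr_ge0; [exact: L1|exact: ltW].
  apply: le_trans (ler_wpM2l K0 h2) _.
  by apply: quad_scale; [exact: K0|apply: mulr_ge0; [exact: L1|exact: ltW]|exact: lexx].
move=> hle; have /inj : F (X eta) = F (X 0).
  by apply/eqP; rewrite -subr_eq0; apply/eqP/nrm_eq0/eqP; rewrite eq_le hle nrm_ge0.
have i0 : 0 <= (0 : R) <= eta by rewrite lexx ltW.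
have ie : 0 <= eta <= eta by rewrite lexx ltW.
have := X16 _ i0; have := X16 _ ie => b1 b2.
have b1' : nrm (X eta - z0) < r by move: b1 r0; clear; order_lra.
have b2' : nrm (X 0 - z0) < r by move: b2 r0; clear; order_lra.
move=> /(_ b1' b2') /(congr1 (fun w : Cn => w ord0 (Ordinal n1))).
(* Coordinate 1 records s, so the endpoints of the collapsed curve are distinct. *)
have XE s : X s ord0 (Ordinal n1) = a ord0 (Ordinal n1) + s%:C.
  have -> : X s ord0 (Ordinal n1) = a ord0 (Ordinal n1) + s%:C * v ord0 (Ordinal n1) + (ze s *: u) ord0 (Ordinal n1) by rewrite !mxE.
  by rewrite ul // ebaseE eqxx mulr1 addr0.
rewrite !XE => /addrI /complexI h0; move: eta0; rewrite h0 ltxx //.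
Qed.

Theorem injective_holomorphic_regular F z r : 0 < r ->
  (forall w, nrm (w - z) < r -> differentiable F w) ->
  (forall x y, nrm (x - z) < r -> nrm (y - z) < r -> F x = F y -> x = y) ->
  regular F z.
Proof.
move=> r0 df inj.
have : forall k F z r, inj_fixing k F z r -> regular F z.
  elim=> [|k ih]; last exact: inj_fixing_regular_step.
  move=> {r0 df inj} F0 z0 s [s0 _ _ fx] v.
  have [_ E] : differentiable F0 z0 /\ 'd F0 z0 =1 'd (fun w => w) z0.
    by apply: (diff_ext (did z0)); exists s => // y yr; apply/rowP => j; exact: fx.
  by move=> h; rewrite -h; apply: esym; apply: (etrans (E v)); exact: diffid.
by move=> H; apply: (H n F z r); split=> // i w; rewrite leqNgt ltn_ord.
Qed.

End osgood.

(** * Self-maps of the polydisc and evolution families *)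

Section self_maps.
Context {R : realType} {n : nat}.
Local Notation C := R[i].
Local Notation Cn := 'rV[C]_n.
Implicit Types (z w u v : Cn) (a r : R).

Lemma nrm_sq (z : C) : nrm z ^+ 2 = complex.Re z ^+ 2 + complex.Im z ^+ 2.
Proof. by rewrite nrmc sqr_sqrtr // addr_ge0 // sqr_ge0. Qed.

(** The Moebius transform B of g vanishes at 0 and is bounded by 1, so the Schwarz lemma gives |B x|
    <= |x|. The rest is the identity (1 - g)(1 + a B) = (1 - a)(1 - B). *)
Lemma pick_real (g : C -> C) a (x : C) : holdisc g 1 -> g 0 = a%:C -> 0 <= a < 1 ->
  (forall t, nrm t < 1 -> nrm (g t) <= 1) -> nrm x < 1 ->
  nrm (1 - g x) <= (1 - a) * ((1 + nrm x) / (1 - nrm x)).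
Proof.
move=> hg g0 /andP[a0 a1] g1 x1.
have na : nrm (a%:C : C) = a by exact: real_C_nrm.
have den t : nrm t < 1 -> 1 - a%:C * g t != 0.
  move=> t1; apply/eqP => h; have : nrm (a%:C * g t) = 1.
    by have -> : a%:C * g t = 1 by [apply/eqP; rewrite eq_sym -subr_eq0 h]; rewrite nrm1.
  rewrite nrmM na => h2; have h3 := g1 t t1.
  suff : a * nrm (g t) < 1 by rewrite h2 ltxx.
  by apply: le_lt_trans a1; rewrite -[leRHS]mulr1 ler_wpM2l.
pose B t := (g t - a%:C) / (1 - a%:C * g t).
have hB : holdisc B 1.
  move=> t t1; apply: dM; first by apply: dB; [exact: hg|exact: dcst].
  by apply: dV; [apply: dB; [exact: dcst|apply: dM; [exact: dcst|exact: hg]]|exact: den].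
have B1 t : nrm t < 1 -> nrm (B t) <= 1.
  move=> t1; rewrite nrmM nrmV ler_pdivrMr ?mul1r; last exact/nrm_gt0/den.
  rewrite -(@ler_pXn2r _ 2) ?nnegrE ?nrm_ge0 // !nrm_sq.
  have : nrm (g t) ^+ 2 <= 1 by apply: exprn_ile1; rewrite ?nrm_ge0 ?g1.
  rewrite nrm_sq.
  case: (g t) => p q /=; rewrite ?mul0r ?mulr0 ?subr0 ?oppr0 ?addr0 ?sub0r ?add0r => pq.
  suff : 0 <= (1 - a ^+ 2) * (1 - (p ^+ 2 + q ^+ 2)) by nra.
  by apply: mulr_ge0; rewrite subr_ge0 //; nra.
have B0 : B 0 = 0 by rewrite /B g0 subrr mul0r.
have := schwarz hB B0 B1 x1; rewrite mul1r divr1 => Bx.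
have E : (1 - g x) * (1 + a%:C * B x) = (1 - a)%:C * (1 - B x).
  rewrite rmorphB /= rmorph1 /B; field; exact: den.
have {}E : nrm (1 - g x) * nrm (1 + a%:C * B x) = (1 - a) * nrm (1 - B x).
  by rewrite -nrmM E nrmM real_C_nrm // subr_ge0 ltW.
rewrite mulrA ler_pdivlMr ?subr_gt0 //.
have h1 : nrm (1 - B x) <= 1 + nrm x by apply: le_trans (nrmB _ _) _; rewrite nrm1 lerD2l.
have h2 : 1 - nrm x <= nrm (1 + a%:C * B x).
  apply: le_trans (nrm_lowD _ _); rewrite nrm1 nrmM na lerB //.
  by apply: le_trans Bx; rewrite -[leRHS]mul1r ler_wpM2r ?nrm_ge0 // ltW.
apply: le_trans (ler_wpM2l (nrm_ge0 _) h2) _; rewrite E.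
by rewrite ler_wpM2l // subr_ge0 ltW.
Qed.

Definition self_map (f : Cn -> Cn) := [/\ forall z, nrm z < 1 -> differentiable f z, f 0 = 0 &
  forall z, nrm z < 1 -> nrm (f z) < 1].

Lemma self_map_line f u j : self_map f -> nrm u = 1 ->
  [/\ holdisc (fun t : C => f (0 + t *: u) ord0 j) 1, f (0 + (0 : C) *: u) ord0 j = 0 &
   forall t : C, nrm t < 1 -> nrm (f (0 + t *: u) ord0 j : C) <= 1].
Proof.
move=> [df f0 f1] u1; split=> [t t1||t t1].
- have t1' : nrm (0 + t *: u) < 1 by rewrite add0r nrmZ u1 mulr1.
  by have [dl _] := @dline _ _ _ f 0 u t (df _ t1'); have [] := dcoordE j dl.
- by rewrite scale0r addr0 f0 mxE.
- apply: le_trans (nrm_coord _ _) _; apply/ltW/f1; by rewrite add0r nrmZ u1 mulr1.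
Qed.

Lemma self_map_schwarz f z : self_map f -> nrm z < 1 -> nrm (f z) <= nrm z.
Proof.
move=> sf z1; have [->|z0] := eqVneq z 0; first by case: sf => _ -> _.
have nz := nrm_gt0 z0.
pose u := ((nrm z)^-1)%:C *: z.
have nu : nrm u = 1 by rewrite nrmZ real_C_nrm ?invr_ge0 ?nrm_ge0 // mulVf // gt_eqF.
have zu : z = 0 + (nrm z)%:C *: u.
  by rewrite add0r scalerA -rmorphM /= divff ?gt_eqF // scale1r.
apply: nrm_row_le => [|j]; first exact: nrm_ge0.
have [h1 h2 h3] := self_map_line j sf nu.
have nz1 : nrm ((nrm z)%:C : C) < 1 by rewrite real_C_nrm ?nrm_ge0.
have := schwarz h1 h2 h3 nz1; rewrite -zu mul1r divr1 real_C_nrm ?nrm_ge0 //.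
Qed.

(** On the line through z, with unit vector u, the function f_j(t u) / (t u_j) is bounded by 1 and
    has the value a at 0, because |u_j| = 1 for a coordinate of maximal modulus. The estimate
    [pick_real] at t = |z| finishes. *)
Lemma self_map_close_main f a z j : self_map f -> 0 <= a < 1 ->
  (forall v, 'd f 0 v = a%:C *: v) -> nrm z < 1 -> nrm z = nrm (z ord0 j : C) ->
  nrm (f z ord0 j - z ord0 j : C) <= (1 - a) * ((1 + nrm z) / (1 - nrm z)).
Proof.
move=> sf a01 dfa z1 zj; have [a0 a1] := andP a01.
have [z0|z0] := eqVneq z 0.
  case: (sf) => _ f0 _; rewrite z0 f0 mxE subrr !nrm0 addr0 subr0 divr1 mulr1.
  by rewrite subr_ge0 ltW.
have nz := nrm_gt0 z0.
pose u := ((nrm z)^-1)%:C *: z.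
have nu : nrm u = 1 by rewrite nrmZ real_C_nrm ?invr_ge0 ?nrm_ge0 // mulVf // gt_eqF.
have zu : z = 0 + (nrm z)%:C *: u.
  by rewrite add0r scalerA -rmorphM /= divff ?gt_eqF // scale1r.
have nuj : nrm (u ord0 j : C) = 1.
  by rewrite mxE nrmM real_C_nrm ?invr_ge0 ?nrm_ge0 // -zj mulVf // gt_eqF.
have uj0 : u ord0 j != 0 by apply/eqP => h; move: nuj; rewrite h nrm0 => /eqP; rewrite eq_sym oner_eq0.
have [h1 h2 h3] := self_map_line j sf nu.
set g := (fun t : C => f (0 + t *: u) ord0 j) in h1 h2 h3.
have nz1 : nrm ((nrm z)%:C : C) < 1 by rewrite real_C_nrm ?nrm_ge0.
have n01 : nrm (0 : C) < 1 by rewrite nrm0.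
have dg0 : 'd g 0 1 = a%:C * u ord0 j.
  have d0 : differentiable f (0 + (0 : C) *: u).
    by case: sf => df _ _; apply: df; rewrite scale0r addr0 nrm0.
  have [dl El] := @dline _ _ _ f 0 u 0 d0.
  have [_ Ec] := dcoordE j dl; apply: (etrans (Ec 1)).
  apply: (etrans (congr1 (fun w : Cn => w ord0 j) El)).
  have -> : 0 + (0 : C) *: u = 0 by rewrite scale0r addr0.
  by apply: (etrans (congr1 (fun w : Cn => w ord0 j) (dfa u))); rewrite mxE.
have g0 : g 0 = 0 by exact: h2.
pose q := fun w : C => if w == 0 then 'd g 0 1 else (g w - g 0) / (w - 0).
have hq : holdisc q 1 := quotient_holdisc h1 n01.
pose p t := (u ord0 j)^-1 * q t.
have hp : holdisc p 1 by move=> t t1; apply: dM; [exact: dcst|exact: hq].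
have p0 : p 0 = a%:C by rewrite /p /q eqxx dg0 mulrCA mulVf // mulr1.
have p1 t : nrm t < 1 -> nrm (p t) <= 1.
  move=> t1; have [->|t0] := eqVneq t 0; first by rewrite p0 real_C_nrm // ltW.
  rewrite /p /q (negbTE t0) g0 !subr0 !nrmM !nrmV nuj invr1 mul1r.
  rewrite ler_pdivrMr ?nrm_gt0 // mul1r.
  by have := schwarz h1 h2 h3 t1; rewrite mul1r divr1.
have := pick_real hp p0 a01 p1 nz1; rewrite real_C_nrm ?nrm_ge0 //.
have nzC : (nrm z)%:C != 0 :> C.
  by apply/eqP => h; move: nz; rewrite -(real_C_nrm (nrm_ge0 z)) h nrm0 ltxx.
rewrite /p /q (negbTE nzC) g0 !subr0 /g -zu => H.
have zj' : z ord0 j = (nrm z)%:C * u ord0 j by rewrite {1}zu add0r mxE.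
have -> : f z ord0 j - z ord0 j = - (z ord0 j) * (1 - (u ord0 j)^-1 * (f z ord0 j / (nrm z)%:C)).
  by rewrite zj'; field; rewrite nzC.
rewrite nrmM nrmN -zj; apply: le_trans H.
by rewrite -[leRHS]mul1r ler_wpM2r ?nrm_ge0 // ltW.
Qed.

(** If |z_j| < |z|, the coordinate j alone is varied over the disc of radius |z|; on its boundary j
    is a coordinate of maximal modulus, and the maximum principle carries the bound inside. *)
Lemma self_map_close f a z : self_map f -> 0 <= a < 1 ->
  (forall v, 'd f 0 v = a%:C *: v) -> nrm z < 1 ->
  nrm (f z - z) <= (1 - a) * ((1 + nrm z) / (1 - nrm z)).
Proof.
move=> sf a01 dfa z1; have [a0 a1] := andP a01.
have B0 : 0 <= (1 - a) * ((1 + nrm z) / (1 - nrm z)).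
  by apply: mulr_ge0; [|apply: divr_ge0; [apply: addr_ge0; rewrite ?nrm_ge0 //|]]; rewrite subr_ge0 ltW.
apply: nrm_row_le => // j; rewrite mxE [X in _ + X]mxE.
have [E|ne] := eqVneq (nrm z) (nrm (z ord0 j : C)); first exact: self_map_close_main.
have zj : nrm (z ord0 j : C) < nrm z by rewrite lt_neqAle eq_sym ne nrm_coord.
pose c := z - z ord0 j *: ebase j.
have cE (t : C) l : (c + t *: ebase j) ord0 l = if l == j then t else z ord0 l.
  rewrite !mxE eqxx /=; case: (eqVneq l j) => [->|_] /=; ring.
have cz : c + z ord0 j *: ebase j = z by rewrite subrK.
have cn (t : C) r : 0 <= r -> nrm z <= r -> nrm t <= r -> nrm (c + t *: ebase j) <= r.
  move=> r0 zr tr; apply: nrm_row_le => // l; rewrite cE.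
  by case: ifP => // _; exact: le_trans (nrm_coord _ _) zr.
have hd : holdisc (fun t : C => f (c + t *: ebase j) ord0 j - t) 1.
  move=> t t1; apply: dB; last exact: did.
  have t1' : nrm (c + t *: ebase j) < 1.
    apply: le_lt_trans (cn t (Num.max (nrm z) (nrm t)) _ _ _) _; rewrite ?le_max ?lexx ?nrm_ge0 ?orbT //.
    by rewrite gt_max z1.
  case: sf => df _ _.
  by have [dl _] := @dline _ _ _ f c (ebase j) t (df _ t1'); have [] := dcoordE j dl.
have nr : nrm ((nrm z)%:C : C) = nrm z by rewrite real_C_nrm ?nrm_ge0.
have := @max_disc _ _ 1 (nrm z)%:C (z ord0 j) _ hd; rewrite cz nr; apply.
  by rewrite zj.
move=> t tz; have ct : nrm (c + t *: ebase j) = nrm z.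
  apply/eqP; rewrite eq_le cn ?nrm_ge0 ?tz //=.
  by rewrite -tz; have := nrm_coord (c + t *: ebase j) j; rewrite cE eqxx.
have := @self_map_close_main f a (c + t *: ebase j) j sf a01 dfa.
by rewrite ct cE eqxx tz; apply.
Qed.

End self_maps.

Lemma dscaleE {R : realType} {V W : normedModType R[i]} (a : R[i]) (f : V -> W) (z h : V) :
  differentiable f z -> 'd (fun w => a *: f w) z h = a *: 'd f z h.
Proof. by move=> df; exact: (congr1 (fun g => g h) (diffZ a df)). Qed.

(** * Loewner chains and their transition maps *)

Section chains.
Context {R : realType} {n : nat}.
Local Notation C := R[i].
Local Notation Cn := 'rV[C]_n.
Implicit Types (z w x y v : Cn) (r s t u h : R).

(** Near x this is a Cauchy estimate; for |y - x| > (1 - |x|) / 4 the trivial bound 2 is smaller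
    than the right side. *)
Lemma self_map_lip (f : Cn -> Cn) x y : self_map f -> nrm x < 1 -> nrm y < 1 ->
  nrm (f y - f x) <= 8 / (1 - nrm x) * nrm (y - x).
Proof.
move=> [df f0 f1] x1 y1; have r0 : 0 < 1 - nrm x by rewrite subr_gt0.
have hb w : nrm (w - x) < 1 - nrm x -> differentiable f w /\ nrm (f w) <= 1.
  move=> wx; have w1 : nrm w < 1.
    by have := nrmD (w - x) x; rewrite subrK => h; apply: le_lt_trans h _; rewrite -ltrBrDr.
  by split; [exact: df|exact/ltW/f1].
have [le|gt] := leP (nrm (y - x)) ((1 - nrm x) / 4).
  have xx : nrm (x - x) <= (1 - nrm x) / 4 by rewrite subrr nrm0 divr_ge0 // ltW.
  apply: le_trans (row_lip2 r0 ler01 hb xx le) _.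
  by rewrite mulr1 ler_wpM2r ?nrm_ge0 // ler_wpM2r ?invr_ge0 ?(ltW r0) // ler_nat.
apply: le_trans (nrmB _ _) _; apply: le_trans (_ : 2 <= _).
  by rewrite (_ : 2 = 1 + 1) //; apply: lerD; exact/ltW/f1.
rewrite mulrAC ler_pdivlMr //; move: gt; rewrite ltr_pdivrMr //; order_lra.
Qed.

Definition hchain (F : R -> Cn -> Cn) := [/\
  forall t z, 0 <= t -> nrm z < 1 -> differentiable (F t) z,
  forall t x y, 0 <= t -> nrm x < 1 -> nrm y < 1 -> F t x = F t y -> x = y,
  forall t, 0 <= t -> F t 0 = 0,
  forall t v, 0 <= t -> 'd (F t) 0 v = (expR t)%:C *: v &
  forall s t z, 0 <= s -> s <= t -> nrm z < 1 -> exists2 w, nrm w < 1 & F t w = F s z].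

(** The transition map F_t^-1 o F_s, with value 0 where there is no preimage. *)
Definition trans (F : R -> Cn -> Cn) s t z : Cn :=
  xget 0 [set w | nrm w < 1 /\ F t w = F s z].

Section transition.
Context (F : R -> Cn -> Cn) (hF : hchain F).

Lemma transP s t z : 0 <= s -> s <= t -> nrm z < 1 ->
  nrm (trans F s t z) < 1 /\ F t (trans F s t z) = F s z.
Proof.
move=> s0 st z1; case: hF => _ _ _ _ nest; have [w w1 wE] := nest s t z s0 st z1.
exact: (@xgetPex _ 0 [set w | nrm w < 1 /\ F t w = F s z] (ex_intro _ w (conj w1 wE))).
Qed.

Lemma trans_uniq s t z w : 0 <= s -> s <= t -> nrm z < 1 -> nrm w < 1 -> F t w = F s z ->
  trans F s t z = w.
Proof.
move=> s0 st z1 w1 wE; have [h1 h2] := transP s0 st z1; case: hF => _ inj _ _ _.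
by apply: (inj t) => //; [exact: le_trans st|rewrite wE].
Qed.

Lemma trans_id s z : 0 <= s -> nrm z < 1 -> trans F s s z = z.
Proof. by move=> s0 z1; apply: trans_uniq. Qed.

Lemma trans_comp s t u z : 0 <= s -> s <= t -> t <= u -> nrm z < 1 ->
  trans F t u (trans F s t z) = trans F s u z.
Proof.
move=> s0 st tu z1; have t0 := le_trans s0 st; have [h1 h2] := transP s0 st z1.
have [h3 h4] := transP t0 tu h1.
by apply/esym/trans_uniq => //; [exact: le_trans tu|rewrite h4].
Qed.

Lemma trans_inj s t x y : 0 <= s -> s <= t -> nrm x < 1 -> nrm y < 1 ->
  trans F s t x = trans F s t y -> x = y.
Proof.
move=> s0 st x1 y1 E; have [_ h2] := transP s0 st x1; have [_ h4] := transP s0 st y1.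
by case: hF => _ inj _ _ _; apply: (inj s) => //; rewrite -h2 -h4 E.
Qed.

Lemma ball_ball w x : nrm w < 1 -> nrm (x - w) < 1 - nrm w -> nrm x < 1.
Proof.
move=> w1 h; have := nrmD (x - w) w; rewrite subrK => h2.
by apply: le_lt_trans h2 _; rewrite -ltrBrDr.
Qed.

(** By Osgood's theorem F_t is regular at the image point and has a local inverse g; injectivity
    identifies the transition map with g o F_s near z. *)
Lemma trans_diff s t z : 0 <= s -> s <= t -> nrm z < 1 -> differentiable (trans F s t) z.
Proof.
move=> s0 st z1; have t0 := le_trans s0 st; have [w1 wE] := transP s0 st z1.
case: hF => df inj _ _ _; set w := trans F s t z in w1 wE.
have r0 : 0 < 1 - nrm w by rewrite subr_gt0.
have dFt x : nrm (x - w) < 1 - nrm w -> differentiable (F t) x.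
  by move=> xw; apply: (df t x t0); exact: ball_ball xw.
have reg : regular (F t) w.
  apply: (injective_holomorphic_regular r0 dFt) => x y xw yw.
  by apply: (inj t) => //; [exact: ball_ball xw|exact: ball_ball yw].
have [rho [d [K [g [/andP[rho0 rho1] d0 K0 _ hg]]]]] := local_inverse r0 dFt reg.
have dFs := df s z s0 z1.
have dg : differentiable g (F s z).
  by rewrite -wE; have := hg (F t w); rewrite subrr nrm0 => /(_ d0) [].
have [d1 d10 hd1] := diff_cont dFs d0.
have z0 : 0 < 1 - nrm z by rewrite subr_gt0.
apply: (proj1 (diff_ext (dcomp dFs dg) _)).
exists (Num.min d1 (1 - nrm z)); first by rewrite lt_min d10.
move=> y; rewrite lt_min => /andP[/hd1 yd yz].
rewrite -wE in yd; have [h1 h2 _] := hg _ yd.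
apply: trans_uniq => //; first exact: ball_ball yz.
by apply: (@ball_ball w) => //; exact: lt_trans rho1.
Qed.

Lemma trans0 s t : 0 <= s -> s <= t -> trans F s t 0 = 0.
Proof.
move=> s0 st; case: hF => _ _ F0 _ _.
by apply: trans_uniq; rewrite ?nrm0 ?F0 //; exact: le_trans st.
Qed.

Lemma trans_self_map s t : 0 <= s -> s <= t -> self_map (trans F s t).
Proof.
move=> s0 st; split=> [z|//|z z1]; [exact: trans_diff|exact: trans0|].
by have [] := transP s0 st z1.
Qed.

Lemma trans_d0 s t v : 0 <= s -> s <= t -> 'd (trans F s t) 0 v = (expR (s - t))%:C *: v.
Proof.
move=> s0 st; have t0 := le_trans s0 st; have n0 : nrm (0 : Cn) < 1 by rewrite nrm0.
have dt := trans_diff s0 st n0; case: (hF) => df _ _ d0 _.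
have dFt : differentiable (F t) (trans F s t 0) by rewrite trans0 //; exact: df.
have [_ E] : differentiable (F s) 0 /\ 'd (F s) 0 =1 'd (fun z => F t (trans F s t z)) 0.
  apply: (diff_ext (dcomp dt dFt)); exists 1 => // y; rewrite subr0 => y1.
  by have [_ ->] := transP s0 st y1.
have h1 : (expR s)%:C *: v = (expR t)%:C *: 'd (trans F s t) 0 v.
  apply: (etrans (esym (d0 s v s0))); apply: (etrans (E v)).
  apply: (etrans (dcompE dt dFt v)).
  have T0 := trans0 s0 st.
  apply: (etrans (congr1 (fun p => 'd (F t) p ('d (trans F s t) 0 v)) T0)); exact: (d0 t _ t0).
have et : (expR t)%:C != 0 :> C by apply/eqP => /complexI h; have := expR_gt0 t; rewrite h ltxx.
apply: (scalerI et); rewrite -h1 scalerA; congr (_ *: _).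
by rewrite -rmorphM /= -expRD addrC subrK.
Qed.

Lemma trans_schwarz s t z : 0 <= s -> s <= t -> nrm z < 1 -> nrm (trans F s t z) <= nrm z.
Proof. by move=> s0 st z1; apply: self_map_schwarz => //; exact: trans_self_map. Qed.

(** The differential at 0 is a = e^(s - t) times the identity, and 1 - a <= t - s. *)
Lemma trans_close s t z : 0 <= s -> s <= t -> nrm z < 1 ->
  nrm (trans F s t z - z) <= (t - s) * (2 / (1 - nrm z)).
Proof.
move=> s0; rewrite le_eqVlt => /predU1P[<- z1|st z1].
  by rewrite trans_id // !subrr nrm0 mul0r.
have a01 : 0 <= expR (s - t) < 1 by rewrite expR_ge0 expR_lt1 subr_lt0.
have z0 : 0 < 1 - nrm z by rewrite subr_gt0.
have := self_map_close (trans_self_map s0 (ltW st)) a01 (fun v => trans_d0 v s0 (ltW st)) z1.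
move=> h; apply: le_trans h _; apply: ler_pM.
- by rewrite subr_ge0 ltW //; case/andP: a01.
- by apply: divr_ge0; [apply: addr_ge0; rewrite ?nrm_ge0|exact: ltW].
- by have := expR_ge1Dx (s - t); order_lra.
- by rewrite ler_wpM2r ?invr_ge0 ?(ltW z0) //; order_lra.
Qed.

Lemma trans_lip_t s t u z : 0 <= s -> s <= t -> t <= u -> nrm z < 1 ->
  nrm (trans F s u z - trans F s t z) <= (u - t) * (2 / (1 - nrm z)).
Proof.
move=> s0 st tu z1; rewrite -(trans_comp s0 st tu z1).
have [w1 _] := transP s0 st z1; have wz := trans_schwarz s0 st z1.
apply: le_trans (trans_close (le_trans s0 st) tu w1) _.
have h1 : 0 < 1 - nrm z by rewrite subr_gt0.
have h2 : 0 < 1 - nrm (trans F s t z) by rewrite subr_gt0.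
rewrite ler_wpM2l ?subr_ge0 // ler_wpM2l // lef_pV2 ?posrE // lerB //.
Qed.

(** Both maps are compared with phi_(s,t+h). The estimate makes the difference quotients continuous
    in time, hence measurable. *)
Lemma trans_step_lip s t h z : 0 <= s -> s <= t -> 0 <= h -> nrm z < 1 ->
  nrm (trans F t (t + h) z - trans F s (s + h) z) <=
  (t - s) * (8 / (1 - nrm z) * (2 / (1 - nrm z)) + 2 / (1 - nrm z)).
Proof.
move=> s0 st h0 z1; have t0 := le_trans s0 st.
have th : t <= t + h by rewrite lerDl.
have sh : s <= s + h by rewrite lerDl.
apply: le_trans (nrm_tri (trans F s (t + h) z) _ _) _; rewrite mulrDr; apply: lerD.
  have [w1 _] := transP s0 st z1.
  rewrite -(trans_comp s0 st th z1) nrmC.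
  apply: le_trans (self_map_lip (trans_self_map t0 th) z1 w1) _.
  rewrite mulrCA ler_wpM2l ?divr_ge0 ?subr_ge0 ?(ltW z1) //; exact: trans_close.
have := @trans_lip_t s (s + h) (t + h) z s0 sh; rewrite lerD2r => /(_ st z1).
by rewrite opprD addrACA subrr addr0.
Qed.

(** Local boundedness of e^-t F_t, uniform in t: Montel's description of normality. *)
Definition chain_bounded := forall r, 0 <= r < 1 -> exists2 M : R, 0 <= M &
  forall t z, 0 <= t -> nrm z <= r -> nrm (F t z) <= M * expR t.

Lemma expR_small (d : R) : 0 < d -> exists2 T : R, 0 <= T & forall t, T <= t -> expR (- t) <= d.
Proof.
move=> d0; exists (Num.max 0 (- ln d)); first by rewrite le_max lexx.
move=> t; rewrite ge_max => /andP[_ h]; rewrite -[leRHS](lnK d0) ler_expR; order_lra.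
Qed.

(** The maps H_t = e^-t F_t differ from the identity by K |z|^2 near 0, uniformly in t. Since F_0 =
    F_t o phi_(0,t), the difference e^t phi_(0,t) - F_0 is e^t (phi_(0,t) - H_t o phi_(0,t)). With
    phi_(0,t) = O(e^-t) it is O(e^-t). *)
Lemma trans_limit (bF : chain_bounded) r e : 0 <= r < 1 -> 0 < e ->
  exists2 T : R, 0 <= T & forall t z, T <= t -> nrm z <= r ->
    nrm ((expR t)%:C *: trans F 0 t z - F 0 z) < e.
Proof.
move=> r01 e0; case: (hF) => df inj F0 d0 _.
have [M1 M10 hM1] : exists2 M : R, 0 <= M & forall t z, 0 <= t -> nrm z <= 2^-1 -> nrm (F t z) <= M * expR t.
  by apply: bF; order_lra.
have [M2 M20 hM2] := bF r r01.
pose H t z := (expR (- t))%:C *: F t z.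
have ee t : (expR (- t))%:C * (expR t)%:C = 1 :> C by rewrite -rmorphM /= -expRD addNr expR0.
have ne t : nrm ((expR (- t))%:C : C) = expR (- t) by rewrite real_C_nrm ?expR_ge0.
have HM t z : 0 <= t -> nrm z < 2^-1 -> differentiable (H t) z /\ nrm (H t z) <= M1.
  move=> t0 z2; have z1 : nrm z < 1 by order_lra.
  split; first by apply: dscale; exact: df.
  rewrite nrmZ ne; apply: le_trans (ler_wpM2l (expR_ge0 _) (hM1 t z t0 (ltW z2))) _.
  by rewrite mulrCA -expRD addNr expR0 mulr1.
pose K := 8 * M1 / 2^-1 ^+ 2.
have K0 : 0 <= K by rewrite divr_ge0 ?mulr_ge0 // sqr_ge0.
have h20 : (0 : R) < 2^-1 by rewrite invr_gt0.
have H0 t : 0 <= t -> H t 0 = 0 by move=> t0; rewrite /H F0 // scaler0.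
have dH0 t v : 0 <= t -> 'd (H t) 0 v = v.
  move=> t0; have n0 : nrm (0 : Cn) < 1 by rewrite nrm0.
  have [] := HM t 0 t0; first by rewrite nrm0.
  move=> _ _.
  have dF0 := df t 0 t0 n0.
  apply: (etrans (dscaleE (expR (- t))%:C v dF0)).
  by rewrite (d0 t v t0) scalerA ee scale1r.
have quad t z : 0 <= t -> nrm z <= 2^-1 / 4 -> nrm (H t z - z) <= K * nrm z ^+ 2.
  move=> t0 z8; have := @row_taylor2 _ _ _ (H t) 0 2^-1 M1 h20 M10 _ z z8.
  rewrite add0r (H0 t t0) subr0 (dH0 t z t0); apply=> w; rewrite subr0; exact: HM.
(* This radius makes 4 K sg at most 1/2, so that H_t - id is half-Lipschitz on the ball of radius sg
   / 4. *)
pose sg := Num.min (2^-1 / 4) (8 * K + 1)^-1.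
have k1 : 0 < 8 * K + 1 by order_lra.
have sg0 : 0 < sg by rewrite lt_min invr_gt0 k1 divr_gt0.
have sg8 : sg <= 2^-1 / 4 by rewrite ge_min lexx.
have sgK : 4 * K * sg <= 2^-1.
  apply: le_trans (_ : 4 * K / (8 * K + 1) <= _).
    by rewrite ler_wpM2l ?mulr_ge0 // ge_min lexx orbT.
  by rewrite ler_pdivrMr //; order_lra.
have lip t x y : 0 <= t -> nrm (x - 0) <= sg / 4 -> nrm (y - 0) <= sg / 4 ->
    nrm ((H t x - x) - (H t y - y)) <= 2^-1 * nrm (x - y).
  move=> t0 xs ys; have hb w : nrm (w - 0) < sg ->
      differentiable (fun w => H t w - w) w /\ nrm (H t w - w) <= K * sg ^+ 2.
    rewrite subr0 => ws; have w8 : nrm w <= 2^-1 / 4 by exact/ltW/(lt_le_trans ws).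
    split; last first.
      apply: le_trans (quad t w t0 w8) _; rewrite ler_wpM2l //.
      by apply: lerXn2r; rewrite ?nnegrE ?nrm_ge0 // ltW.
    apply: dB; last exact: did.
    by apply: (proj1 (HM t w t0 _)); apply: le_lt_trans w8 _; order_lra.
  have Ks : 0 <= K * sg ^+ 2 by rewrite mulr_ge0 // sqr_ge0.
  have := row_lip2 sg0 Ks hb ys xs.
  have -> : 4 * (K * sg ^+ 2) / sg = 4 * K * sg by field; rewrite gt_eqF.
  move=> h; apply: le_trans h _; by rewrite ler_wpM2r // nrm_ge0.
have [T1 T10 hT1] : exists2 T : R, 0 <= T & forall t, T <= t -> expR (- t) <= sg / 8 / (M2 + 1).
  by apply: expR_small; rewrite !divr_gt0 //; order_lra.
have [T2 T20 hT2] : exists2 T : R, 0 <= T & forall t, T <= t -> expR (- t) <= e / 2 / (K * (2 * M2) ^+ 2 + 1).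
  by apply: expR_small; rewrite !divr_gt0 // ltr_wpDl // mulr_ge0 // sqr_ge0.
exists (Num.max T1 T2); first by rewrite le_max T10.
move=> t z; rewrite ge_max => /andP[tT1 /hT2 t2] zr; have t0 := le_trans T10 tT1; have t1 := hT1 t tT1.
move: (t1); rewrite ler_pdivlMr; last order_lra.
move=> t1'; move: (t2); rewrite ler_pdivlMr; last by rewrite ltr_wpDl // mulr_ge0 // sqr_ge0.
move=> t2'.
have z1 : nrm z < 1 by case/andP: r01 => _; exact: le_lt_trans.
pose y := (expR (- t))%:C *: F 0 z.
have yn : nrm y <= expR (- t) * M2.
  rewrite nrmZ ne ler_wpM2l ?expR_ge0 //.
  by apply: le_trans (hM2 0 z (lexx 0) zr) _; rewrite expR0 mulr1.
have c0 : nrm (0 - 0 : Cn) <= sg / 4 by rewrite subrr nrm0 divr_ge0 // ltW.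
have lip' : forall x x', nrm (x - 0) <= sg / 4 -> nrm (x' - 0) <= sg / 4 ->
    nrm ((H t x - x) - (H t x' - x')) <= 2^-1 * nrm (x - x') by move=> x x'; exact: lip.
have [x [xs xE]] : exists x, nrm (x - 0) <= sg / 4 /\ H t x = y.
  apply: (@solve_near_identity _ _ (H t) 0 (sg / 4) y _ lip').
    by rewrite divr_ge0 // ltW.
  rewrite (H0 t t0) subr0; apply: le_trans yn _; move: t1' (expR_ge0 (- t)); clear; order_lra.
have xn : nrm x <= 2 * (expR (- t) * M2).
  have := near_identity_inj lip' xs c0; rewrite subr0 (H0 t t0) subr0 xE => h.
  by apply: le_trans h _; rewrite ler_wpM2l.
rewrite subr0 in xs.
(* The Picard solution x near 0 is a preimage of F_0 z under F_t, so by injectivity it is the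
   transition map. *)
have ex : trans F 0 t z = x.
  apply: trans_uniq => //; first by apply: le_lt_trans xs _; move: sg8; clear; order_lra.
  have := xE; rewrite /H /y => /(congr1 (fun v : Cn => (expR t)%:C *: v)).
  by rewrite !scalerA [(expR t)%:C * _]mulrC ee !scale1r.
have x8 : nrm x <= 2^-1 / 4 by apply: le_trans xs _; move: sg8 sg0; clear; order_lra.
have -> : (expR t)%:C *: trans F 0 t z - F 0 z = (expR t)%:C *: (x - H t x).
  by rewrite ex scalerBr xE /y scalerA [(expR t)%:C * _]mulrC ee scale1r.
rewrite nrmZ real_C_nrm ?expR_ge0 // nrmC.
apply: le_lt_trans (ler_wpM2l (expR_ge0 _) (quad t x t0 x8)) _.
have h2 : nrm x ^+ 2 <= (2 * (expR (- t) * M2)) ^+ 2.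
  by apply: lerXn2r; rewrite ?nnegrE ?nrm_ge0 // !mulr_ge0 ?expR_ge0.
apply: le_lt_trans (ler_wpM2l (expR_ge0 _) (ler_wpM2l K0 h2)) _.
have -> : expR t * (K * (2 * (expR (- t) * M2)) ^+ 2) = expR (- t) * (K * (2 * M2) ^+ 2).
  have : expR t * expR (- t) = 1 by rewrite -expRD subrr expR0.
  set p := expR t; set q := expR (- t) => pq.
  by have -> : p * (K * (2 * (q * M2)) ^+ 2) = p * q * (q * (K * (2 * M2) ^+ 2)) by [ring]; rewrite pq mul1r.
by move: t2' e0 (expR_ge0 (- t)); clear; set q := K * _; order_lra.
Qed.

End transition.
End chains.

(** * Lipschitz functions of a real variable *)

Section lebesgue.
Context {R : realType}.
Local Notation mu := (@lebesgue_measure R).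
Implicit Types (x y t s a b K : R) (A X : set R).

Lemma wlength_lipschitz (f : cumulative R R) K : 0 <= K ->
  (forall x y, x <= y -> f y - f x <= K * (y - x)) ->
  forall A : set (ocitv_type R), measurable A ->
  (wlength f A <= K%:E * wlength idfun A)%E.
Proof.
move=> K0 fK _ [[a b] _ <-] /=; rewrite !wlength_itv /= lte_fin.
case: ifPn => ab; last by rewrite mule0.
by rewrite -!EFinB -EFinM lee_fin; exact/fK/ltW.
Qed.

(** A cover by intervals has Stieltjes length at most K times its Lebesgue length; both outer
    measures are infima over the same covers. *)
Lemma stieltjes_lipschitz (f : cumulative R R) K X : 0 < K ->
  (forall x y, x <= y -> f y - f x <= K * (y - x)) ->
  (lebesgue_stieltjes_measure f X <= K%:E * mu X)%E.
Proof.
move=> K0 fK; rewrite -lee_pdivrMl //.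
apply: le_ereal_inf_tmp => _ [A [mA XA] <-].
rewrite lee_pdivrMl // -nneseriesZl; last by move=> i _; exact: wlength_ge0.
apply: (@le_trans _ _ (\sum_(k <oo) wlength f (A k))%E).
  by apply: ereal_inf_lbound; exists A.
apply: lee_nneseries => [i _ _|i _]; first exact: wlength_ge0.
by apply: wlength_lipschitz => //; exact: ltW.
Qed.

Lemma lipschitz_continuous (u : R -> R) K : (forall x y, `|u y - u x| <= K * `|y - x|) ->
  continuous u.
Proof.
move=> uK x; have K0 : 0 <= K by have := uK 0 1; rewrite subr0 normr1 mulr1; apply: le_trans.
apply/cvgrPdist_lt => e e0.
have K1 : 0 < K + 1 by order_lra.
near=> y; rewrite distrC; apply: le_lt_trans (uK x y) _.
have : `|y - x| < e / (K + 1).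
  near: y; exists (e / (K + 1)); first exact: divr_gt0.
  by move=> z /=; rewrite distrC.
rewrite ltr_pdivlMr // => h; have := normr_ge0 (y - x); nra.
Unshelve. all: by end_near. Qed.

(** The Stieltjes measure of v is absolutely continuous because v is Lipschitz. Its Radon-Nikodym
    density has v as indefinite integral, and Lebesgue's differentiation theorem applies. *)
Lemma monotone_lipschitz_ae_derivable (v : R -> R) K : 0 < K ->
  {homo v : x y / x <= y} -> (forall x y, `|v y - v x| <= K * `|y - x|) ->
  {ae mu, forall x, derivable v x 1}.
Proof.
move=> K0 ndv vK.
have rcv : right_continuous v by apply/right_continuousW/(lipschitz_continuous vK).
pose m := isCumulative.Build R _ R v ndv rcv.
have [f fE] : exists f : cumulative R R, f =1 v.
  by pose f : cumulative R R := HB.pack v m; exists f.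
have fK x y : x <= y -> f y - f x <= K * (y - x).
  move=> xy; have := vK x y; rewrite !fE [in X in _ <= X]ger0_norm ?subr_ge0 //.
  by apply: le_trans; exact: ler_norm.
pose nu := lebesgue_stieltjes_measure f.
suff H (N : nat) : {ae mu, forall x, - N%:R < x < N%:R -> derivable v x 1}.
  have : {ae mu, forall x (N : nat), - N%:R < x < N%:R -> derivable v x 1}.
    by apply/ae_foralln => N; exact: H.
  apply: filterS; first exact: (ae_filter_ringOfSetsType mu).
  move=> x; have [N hN] := natr_large `|x|.
  by move=> /(_ N); apply; rewrite -ltr_norml; exact: hN.
(* On a bounded interval the Stieltjes measure is finite, as the Radon-Nikodym theorem requires. *)
pose D := `]- N%:R, N%:R]%classic : set (measurableTypeR R).
have mD : measurable D by exact: measurable_itv.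
have nuD a b : a <= b -> nu `]a, b]%classic = (v b - v a)%:E.
  move=> ab; have mab : measurable (`]a, b]%classic : set (ocitv_type R)) by exact: is_ocitv.
  apply: etrans (measurable_mu_extE (wlength f) mab) _.
  by apply: etrans (wlength_itv_bnd f false false ab) _; rewrite !fE.
have finD : (nu D < +oo)%E by rewrite nuD ?ltry // ge0_cp.
pose nuN : {finite_measure set _ -> \bar R} := mfrestr mD finD.
have dom : charge_of_finite_measure nuN `<< mu.
  apply/null_content_dominatesP => A mA A0.
  rewrite /charge_of_finite_measure /nuN /= /mfrestr /mrestr.
  apply/eqP; rewrite eq_le measure_ge0 andbT.
  apply: le_trans (_ : nu A <= 0)%E; last first.
    by apply: le_trans (stieltjes_lipschitz A K0 fK) _; rewrite A0 mule0.
  apply: le_measure; rewrite ?inE //; exact: measurableI.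
have gint := Radon_Nikodym_integrable dom.
pose g := Radon_Nikodym (charge_of_finite_measure nuN) mu.
have gfin x : g x \is a fin_num by exact: Radon_Nikodym_fin_num.
have fgE : EFin \o (fine \o g) = g by apply/funext => x /=; rewrite fineK.
have fgint : mu.-integrable setT (EFin \o (fine \o g)) by rewrite fgE.
have vE x : - N%:R <= x <= N%:R -> v x = v (- N%:R) + \int[mu]_(t in `]- N%:R, x]) (fine \o g) t.
  move=> /andP[Nx xN].
  suff <- : v x - v (- N%:R) = \int[mu]_(t in `]- N%:R, x]) (fine \o g) t by rewrite addrC subrK.
  rewrite /Rintegral -[LHS]/(fine (v x - v (- N%:R))%:E); congr fine.
  rewrite -nuD // -[in RHS]/(EFin \o (fine \o g)) fgE.
  rewrite -(Radon_Nikodym_integral dom); last exact: measurable_itv.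
  rewrite /charge_of_finite_measure /nuN /= /mfrestr /mrestr setIidl //.
  by move=> y /=; rewrite /D /= !in_itv /= => /andP[h1 h2]; rewrite h1 /=; exact: le_trans xN.
have locg : locally_integrable [set: R] (fine \o g).
  by apply: open_integrable_locally => //; exact: openT.
have intg y : mu.-integrable [set` Interval (BRight (- N%:R)) (BRight y)] (EFin \o (fine \o g)).
  by apply: (integrableS measurableT) => //; exact: measurable_itv.
have := @FTC1 R (fine \o g) (BRight (- N%:R)) intg locg.
apply: filterS; first exact: (ae_filter_ringOfSetsType mu).
move=> x h /andP[Nx xN]; have [dx _] := h Nx.
apply: (@near_eq_derivable _ _ _ (fun x => v (- N%:R) + \int[mu]_(t in `]- N%:R, x]) (fine \o g) t)).
  near=> y; rewrite -vE //; apply/andP; split; near: y.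
    by near do apply/ltW; exact: lt_nbhsr.
  by near do apply/ltW; exact: lt_nbhsl.
by apply: derivableD; [exact: derivable_cst|exact: dx].
Unshelve. all: by end_near. Qed.

(** Adding (K + 1) x makes the function increasing, with slopes between 1 and 2 K + 1. *)
Lemma lipschitz_ae_derivable (u : R -> R) K : (forall x y, `|u y - u x| <= K * `|y - x|) ->
  {ae mu, forall x, derivable u x 1}.
Proof.
move=> uK; have K0 : 0 <= K by have := uK 0 1; rewrite subr0 normr1 mulr1; apply: le_trans.
pose v x := u x + (K + 1) * x.
have : {ae mu, forall x, derivable v x 1}.
  apply: (@monotone_lipschitz_ae_derivable v (2 * K + 1)); first order_lra.
    move=> x y xy; have := uK x y; rewrite [in X in _ <= X]ger0_norm ?subr_ge0 // ler_norml /v.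
    by move=> /andP[h _]; nra.
  move=> x y; have -> : v y - v x = (u y - u x) + (K + 1) * (y - x) by rewrite /v; ring.
  apply: le_trans (ler_normD _ _) _; rewrite normrM (@ger0_norm _ (K + 1)); last order_lra.
  have := uK x y; order_lra.
apply: filterS; first exact: (ae_filter_ringOfSetsType mu).
move=> x dv; have -> : u = v - (fun x => (K + 1) * x).
  by apply/funext => y; rewrite /v /= -[RHS]/(v y - (K + 1) * y) /v addrK.
apply: derivableB; first exact: dv.
by apply: derivableM; [exact: derivable_cst|exact: derivable_id].
Qed.

End lebesgue.

(** * Translations, null sets and absolute continuity *)

Section translations.
Context {R : realType}.
Local Notation mu := (@lebesgue_measure R).
Local Notation outer := (wlength (@idfun R))^*%mu.
Local Notation cara := (caratheodory_type outer).
Implicit Types (t s a b : R) (A X D : set R) (u v k : R -> R).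

Definition translate a X : set R := [set t | X (t + a)].

Lemma shiftK a X : translate (- a) (translate a X) = X.
Proof. by apply/seteqP; split=> t; rewrite /translate /= subrK. Qed.

Lemma outer_shift_le a X : (outer (translate a X) <= outer X)%E.
Proof.
apply: le_ereal_inf_tmp => _ [A [mA XA] <-].
have wA (k : nat) : measurable (translate a (A k) : set (ocitv_type R)) /\
    wlength idfun (translate a (A k)) = wlength idfun (A k).
  case: (mA k) => -[p q] _ /= <-.
  have -> : translate a `]p, q]%classic = `]p - a, q - a]%classic.
    by apply/seteqP; split=> t; rewrite /translate /= !in_itv /= ltrBlDr lerBrDr.
  split; first exact: is_ocitv.
  rewrite !wlength_itv /= !lte_fin ltrD2r; case: ifP => // _.
  by rewrite -!EFinB; congr (_%:E); rewrite /=; ring.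
apply: (@le_trans _ _ (\sum_(k <oo) wlength idfun (translate a (A k)))%E).
  apply: ereal_inf_lbound; exists (fun k : nat => translate a (A k)) => //; split=> [k|t Xt].
    by have [] := wA k.
  by have [i _ Ai] := XA _ Xt; exists i.
by apply: lee_nneseries => [k _ _|k _]; [exact: wlength_ge0|have [_ ->] := wA k].
Qed.

Lemma outer_shift a X : outer (translate a X) = outer X.
Proof.
apply/eqP; rewrite eq_le outer_shift_le /=.
by have := outer_shift_le (- a) (translate a X); rewrite shiftK.
Qed.

Lemma cara_shift a A : measurable (A : set cara) -> measurable (translate a A : set cara).
Proof.
move=> mA; suff : caratheodory_measurable outer (translate a A) by [].
have {}mA : caratheodory_measurable outer A by [].
move=> X; have -> : outer X = outer (translate (- a) X) by rewrite outer_shift.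
rewrite (mA (translate (- a) X)); congr (_ + _)%E; rewrite -[LHS](outer_shift a); congr outer.
  by apply/seteqP; split=> t; rewrite /translate /= addrK.
by apply/seteqP; split=> t; rewrite /translate /= addrK.
Qed.

(** The outer measure does not see a null set, so the splitting condition is trivial. Thanks to this
    a vector field may take prescribed values at a null set of times. *)
Lemma cara_negligible (N : set R) : mu.-negligible N -> measurable (N : set cara).
Proof.
move=> [A [mA A0 NA]]; apply: le_caratheodory_measurable => X.
have N0 : outer N = 0%E.
  apply/eqP; rewrite eq_le outer_measure_ge0 andbT -A0.
  exact: (le_outer_measure outer).
apply: (@le_trans _ _ (outer N + outer (X `&` ~` N)))%E.
  by rewrite leeD2r // (le_outer_measure outer).
by rewrite N0 add0e (le_outer_measure outer).
Qed.

Lemma cara_borel (A : set R) : measurable (A : set (measurableTypeR R)) -> measurable (A : set cara).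
Proof. exact: (@sub_caratheodory _ (ocitv_type R) R (wlength idfun) A). Qed.

Lemma ae_shift a (P : R -> Prop) : {ae mu, forall t, P t} -> {ae mu, forall t, P (t + a)}.
Proof.
move=> [A [mA A0 PA]].
have mS : measurable (translate a A : set (measurableTypeR R)).
  have cs : continuous (fun t : R => t + a).
    by move=> t; apply: cvgD; [exact: cvg_id|exact: cvg_cst].
  by have := measurable_realfun.continuous_measurable_fun cs measurableT mA; rewrite setTI.
exists (translate a A); split => //.
  by apply: etrans A0; exact: outer_shift.
by move=> t h; apply: PA.
Qed.

Lemma lebesgue_measurable_shift a D u : lebesgue_measurable_fun D u ->
  lebesgue_measurable_fun (translate a D) (fun t => u (t + a)).
Proof.
move=> mu mD Y mY.
have mD' : measurable (D : set cara) by rewrite -[D](shiftK a); exact: cara_shift.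
exact: (cara_shift a (mu mD' Y mY)).
Qed.

Lemma lebesgue_measurable_continuous D u : measurable (D : set cara) -> continuous u ->
  lebesgue_measurable_fun D u.
Proof.
move=> mD cu _ Y mY; apply: measurableI => //; apply: cara_borel.
have mu : measurable_fun (setT : set (measurableTypeR R)) u by exact: measurable_realfun.continuous_measurable_fun.
by have := mu measurableT Y mY; rewrite setTI.
Qed.

Definition lip_on u a b K := forall s t, a <= s -> s <= t -> t <= b -> `|u t - u s| <= K * (t - s).

Lemma lip_abs_continuous u a b (K : R) : lip_on u a b K -> abs_continuous u a b.
Proof.
move=> uK e e0; have K1 : 0 < `|K| + 1 by rewrite ltr_wpDl.
exists (e / (`|K| + 1)); first exact: divr_gt0.
move=> m x y xy _; rewrite ltr_pdivlMr // => h; apply: le_lt_trans h.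
rewrite mulr_suml; apply: ler_sum => i _; have [h1 h2 h3] := xy i.
apply: le_trans (uK _ _ h1 h2 h3) _; rewrite mulrC ler_wpM2l ?subr_ge0 //.
by have := ler_norm K; order_lra.
Qed.

Lemma abs_continuousD u v a b : abs_continuous u a b -> abs_continuous v a b ->
  abs_continuous (fun t => u t + v t) a b.
Proof.
move=> hu hv e e0; have e2 : 0 < e / 2 by order_lra.
have [d1 d10 h1] := hu _ e2; have [d2 d20 h2] := hv _ e2.
exists (Num.min d1 d2); first by rewrite lt_min d10.
move=> m x y xy dis; rewrite lt_min => /andP[l1 l2].
have := ltrD (h1 m x y xy dis l1) (h2 m x y xy dis l2); rewrite -splitr.
apply: le_lt_trans; rewrite -big_split; apply: ler_sum => i _ /=.
by rewrite opprD addrACA ler_normD.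
Qed.

(** Here k is a clamp such as s -> min s tau: being monotone and non-expanding, it sends disjoint
    intervals to disjoint ones of no larger total length. *)
Lemma abs_continuous_comp u k a b c d : {homo k : x y / x <= y} ->
  (forall s t, s <= t -> k t - k s <= t - s) ->
  (forall t, a <= t <= b -> c <= k t <= d) ->
  abs_continuous u c d -> abs_continuous (fun t => u (k t)) a b.
Proof.
move=> kh k1 kr hu e e0; have [dl dl0 H] := hu e e0; exists dl => // m x y xy dis l.
apply: (H m (fun i => k (x i)) (fun i => k (y i))).
- move=> i; have [h1 h2 h3] := xy i.
  have /kr/andP[c1 _] : a <= x i <= b by rewrite h1 (le_trans h2).
  have /kr/andP[_ c2] : a <= y i <= b by rewrite h3 (le_trans h1).
  by split=> //; exact: kh.
- apply/trivIsetP => i j _ _ ij; apply/seteqP; split=> // p [] /=.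
  rewrite !in_itv /= => /andP[p1 p2] /andP[p3 p4].
  have kk s t : k s < k t -> s < t by move=> h; rewrite ltNge; apply/negP => /kh; rewrite leNgt h.
  have s1 := kk _ _ (lt_trans p1 p2); have s2 := kk _ _ (lt_trans p3 p4).
  have s3 := kk _ _ (lt_trans p1 p4); have s4 := kk _ _ (lt_trans p3 p2).
  (* If two image intervals met, the midpoint of the overlap of the original intervals would lie in
     both of them. *)
  move/trivIsetP: dis => /(_ i j I I ij) /seteqP[+ _].
  move=> /(_ ((Num.max (x i) (x j) + Num.min (y i) (y j)) / 2)); apply; split; rewrite /= in_itv /=.
    by rewrite maxEle minEle; case: ifP; case: ifP; order_lra.
  by rewrite maxEle minEle; case: ifP; case: ifP; order_lra.
- apply: le_lt_trans l; apply: ler_sum => i _; apply: k1; by have [] := xy i.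
Qed.

Lemma abs_continuous_cst (c a b : R) : abs_continuous (fun=> c) a b.
Proof. by apply: (@lip_abs_continuous _ _ _ 0) => s t _ _ _; rewrite subrr normr0 mul0r. Qed.

End translations.

(** * The Herglotz vector field of a chain *)

Section herglotz.
Context {R : realType} {n : nat}.
Local Notation C := R[i].
Local Notation Cn := 'rV[C]_n.
Local Notation mu := (@lebesgue_measure R).
Implicit Types (z w x y v l : Cn) (r s t u h : R) (k : nat).

Lemma cvg_coord {T : Type} (F : set_system T) {FF : Filter F} (f : T -> Cn) l j :
  f @ F --> l -> (fun x : T => f x ord0 j) @ F --> l ord0 j.
Proof.
move=> /cvg_nrm h; apply/cvg_nrm => e /h; apply: filterS => t.
by apply: le_lt_trans; have := nrm_coord (f t - l) j; rewrite !mxE.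
Qed.

Lemma cvg_Re_le0 (s : nat -> C) (l : C) : s @ \oo --> l ->
  (forall k, complex.Re (s k) <= 0) -> complex.Re l <= 0.
Proof.
move=> /cvg_seqP h s0; rewrite leNgt; apply/negP => l0.
have [N /(_ N (leqnn N))] := h _ l0; have := ler_Re_nrm (s N - l); rewrite ReB.
rewrite ler_norml => /andP[h1 _] h2; have := s0 N; order_lra.
Qed.

Lemma cvgMc (s : nat -> C) (l c : C) : s @ \oo --> l -> (fun k => s k * c) @ \oo --> l * c.
Proof.
move=> /cvg_seqP h; apply/cvg_seqP => e e0; have c1 : 0 < nrm c + 1 by rewrite ltr_wpDl ?nrm_ge0.
have [N hN] := h _ (divr_gt0 e0 c1); exists N => k /hN; rewrite ltr_pdivlMr // => hk.
by rewrite -mulrBl nrmM; apply: le_lt_trans hk; rewrite ler_wpM2l ?nrm_ge0 // lerDl.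
Qed.

Definition step k : R := k.+1%:R^-1.

Lemma step_gt0 k : 0 < step k.
Proof. by rewrite invr_gt0 ltr0n. Qed.

Lemma step_small e : 0 < e -> exists N : nat, forall k, (N <= k)%N -> step k < e.
Proof.
move=> e0; have [N hN] := natr_large e^-1; exists N => k Nk.
rewrite -[e]invrK ltf_pV2 ?posrE ?invr_gt0 ?ltr0n //.
by apply: lt_le_trans (hN k Nk) _; rewrite ler_nat.
Qed.

(** Forward difference quotient of the transition maps at time t with step 1 / (k + 1). A sequence
    of steps keeps the vector field a sequential limit, which preserves measurability. *)
Definition dq (F : R -> Cn -> Cn) k t w : Cn := (k.+1%:R : R)%:C *: (trans F t (t + step k) w - w).

(** Convergence is asked at all points of the polydisc at once, so that one exceptional set of times
    serves every w. *)
Definition good F t := forall w, nrm w < 1 -> exists l, (fun k => dq F k t w) @ \oo --> l.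

Definition vfield F w t : Cn := xget (- w) [set l | good F t /\ (fun k => dq F k t w) @ \oo --> l].

(** In [vfield] the clause [good F t] inside the set makes the default -w apply to all w
    simultaneously at an exceptional time; w -> -w is in the class M. *)
Lemma vfieldP F t w : good F t -> nrm w < 1 -> (fun k => dq F k t w) @ \oo --> vfield F w t.
Proof.
move=> g w1; have [l hl] := g w w1.
by have [] := @xgetPex _ (- w) [set l | good F t /\ (fun k => dq F k t w) @ \oo --> l] (ex_intro _ l (conj g hl)).
Qed.

Lemma vfieldN F t w : ~ good F t -> vfield F w t = - w.
Proof. by move=> g; apply: xgetPN => l [/g]. Qed.

Section chain.
Context (F : R -> Cn -> Cn) (hF : hchain F).

Let stepD t k : t <= t + step k.
Proof. by rewrite lerDl ltW // step_gt0. Qed.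

Lemma nrm_natC k : nrm ((k.+1%:R : R)%:C : C) = k.+1%:R.
Proof. by rewrite real_C_nrm // ler0n. Qed.

Lemma dq_bound k t w : 0 <= t -> nrm w < 1 -> nrm (dq F k t w) <= 2 / (1 - nrm w).
Proof.
move=> t0 w1; rewrite nrmZ nrm_natC.
apply: le_trans (ler_wpM2l (ler0n _ _) (trans_close hF t0 (stepD t k) w1)) _.
by rewrite addrAC subrr add0r mulrA mulfV ?mul1r // pnatr_eq0.
Qed.

Lemma dq_diff k t w : 0 <= t -> nrm w < 1 -> differentiable (dq F k t) w.
Proof. by move=> t0 w1; apply: dscale; apply: dB; [exact: trans_diff|exact: did]. Qed.

Lemma dq0 k t : 0 <= t -> dq F k t 0 = 0.
Proof. by move=> t0; rewrite /dq trans0 // subrr scaler0. Qed.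

Lemma dq_d0 k t v : 0 <= t -> 'd (dq F k t) 0 v = (k.+1%:R * (expR (- step k) - 1) : R)%:C *: v.
Proof.
move=> t0; have n0 : nrm (0 : Cn) < 1 by rewrite nrm0.
have dt := trans_diff hF t0 (stepD t k) n0.
have dd : differentiable (fun w => trans F t (t + step k) w - w) 0 by apply: dB; [exact: dt|exact: did].
apply: (etrans (dscaleE _ v dd)); rewrite rmorphM /= -scalerA; congr (_ *: _).
have -> : 'd (fun w => trans F t (t + step k) w - w) 0 v = 'd (trans F t (t + step k)) 0 v - v.
  have := congr1 (fun g => g v) (diffB dt (did (0 : Cn))).
  by move=> /= E; apply: (etrans E); congr (_ - _); exact: (diffid (0 : Cn) v).
rewrite (trans_d0 hF v t0 (stepD t k)) rmorphB /= scalerBl scale1r.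
by rewrite opprD addrA subrr add0r.
Qed.

(** By the Schwarz lemma the j-th coordinate of the transition map is at most |z| = |z_j| in
    modulus, so its quotient by z_j, minus 1, has nonpositive real part. *)
Lemma dq_re k t z (j : 'I_n) : 0 <= t -> nrm z < 1 -> nrm z = nrm (z ord0 j : C) ->
  0 < nrm (z ord0 j : C) -> complex.Re (dq F k t z ord0 j / z ord0 j) <= 0.
Proof.
move=> t0 z1 zj zj0; have zn0 : z ord0 j != 0 by apply/eqP => h; move: zj0; rewrite h nrm0 ltxx.
have -> : dq F k t z ord0 j / z ord0 j = (k.+1%:R : R)%:C * (trans F t (t + step k) z ord0 j / z ord0 j - 1).
  by rewrite /dq !mxE; field.
rewrite ReZ pmulr_rle0 ?ltr0n // ReB /= subr_le0.
apply: le_trans (ler_norm _) _; apply: le_trans (ler_Re_nrm _) _.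
rewrite nrmM nrmV ler_pdivrMr // mul1r -zj.
by apply: le_trans (nrm_coord _ _) _; exact: trans_schwarz.
Qed.

Lemma expR_quotient : (fun k => (k.+1%:R * (expR (- step k) - 1) : R)%:C) @ \oo --> (-1 : C).
Proof.
apply/cvg_seqP => e e0; have [N hN] := step_small e0; exists N => k /hN ke.
have -> : (k.+1%:R * (expR (- step k) - 1) : R)%:C - -1 = (k.+1%:R * (expR (- step k) - 1) - -1)%:C :> C.
  by rewrite rmorphB rmorphN rmorph1.
rewrite nrm_real.
have s0 := step_gt0 k; have h1 := expR_ge1Dx (- step k).
have h2 : expR (- step k) * (1 + step k) <= 1.
  have := ler_wpM2l (expR_ge0 (- step k)) (expR_ge1Dx (step k)).
  by rewrite -expRD addNr expR0.
have ks : k.+1%:R * step k = 1 by rewrite mulfV // pnatr_eq0.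
have k0 : (0 : R) < k.+1%:R by rewrite ltr0n.
apply: le_lt_trans ke; rewrite -(ler_pM2l s0).
have -> : step k * `|k.+1%:R * (expR (- step k) - 1) - -1| = `|expR (- step k) - 1 + step k|.
  rewrite -{1}[step k]gtr0_norm // -normrM; congr `|_|.
  by rewrite mulrBr mulrA [step k * _]mulrC ks; ring.
rewrite ger0_norm; last by order_lra.
by move: h1 h2 s0; set p := expR _; set q := step k; clear; nra.
Qed.

(** At a good time the difference quotients are bounded on smaller polydiscs by 2 / (1 - |z|), so
    [lim_hol] passes holomorphy and differentials to the limit; the value at 0 and the sign
    condition pass pointwise. *)
Lemma vfield_M t : 0 <= t -> class_M (vfield F ^~ t : mappings R n).
Proof.
move=> t0; have [g|ng] := pselect (good F t); last first.
  have E : vfield F ^~ t = (fun w => (-1 : C) *: w).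
    by apply/funext => w; rewrite vfieldN // scaleN1r.
  rewrite E; split.
  - by move=> z _; apply: dscale; exact: did.
  - by rewrite scaler0.
  - move=> v; apply: (etrans (dscaleE (-1 : C) v (did (0 : Cn)))).
    by rewrite scaleN1r; congr (- _); exact: diffid.
  - move=> z j _ _ zj0; rewrite mxE mulN1r mulNr divff ?ReN ?oppr_le0 //=.
    by apply/eqP => h; move: zj0; rewrite h normr0 ltxx.
have M z : nrm z < 1 -> forall j, differentiable (fun w => vfield F w t ord0 j) z /\
   forall v, (fun k => 'd (fun w => dq F k t w ord0 j) z v : C) @ \oo --> ('d (fun w => vfield F w t ord0 j) z v : C).
  move=> z1 j; pose r := (1 - nrm z) / 2; have r0 : 0 < r by rewrite /r; order_lra.
  have rz w : nrm (w - z) < r -> nrm w < 1 - r.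
    by move=> h; have := nrmD (w - z) z; rewrite subrK /r in h *; order_lra.
  apply: (@lim_hol _ _ (fun k w => dq F k t w ord0 j) _ z r (2 / r)) => //.
  - move=> k w /rz wr; have w1 : nrm w < 1 by order_lra.
    by have [] := dcoordE j (dq_diff k t0 w1).
  - move=> k w /rz wr; have w1 : nrm w < 1 by order_lra.
    apply: le_trans (nrm_coord _ _) _; apply: le_trans (dq_bound k t0 w1) _.
    rewrite ler_wpM2l // lef_pV2 ?posrE ?subr_gt0 //; order_lra.
  - move=> w /rz wr; apply: cvg_coord; apply: vfieldP => //; order_lra.
have n0 : nrm (0 : Cn) < 1 by rewrite nrm0.
split.
- by move=> z; rewrite /= polydiscE => z1; apply: drow => j; have [] := M z z1 j.
- apply: (@cvgC_uniq _ _ (fun k => dq F k t 0)); first exact: vfieldP.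
  have -> : (fun k => dq F k t 0) = (fun=> 0) by apply/funext => k; exact: dq0.
  exact: cvg_cst.
- move=> v; apply/rowP => j; have [dj hj] := M 0 n0 j.
  have dV : differentiable (vfield F ^~ t) 0 by apply: drow => i; have [] := M 0 n0 i.
  have [_ Ej] := dcoordE j dV.
  apply: (etrans (esym (Ej v))); apply: (@cvgC_uniq _ _ _ _ _ (hj v)).
  have -> : (fun k => 'd (fun w => dq F k t w ord0 j) 0 v : C) =
      (fun k => (k.+1%:R * (expR (- step k) - 1) : R)%:C * v ord0 j).
    apply/funext => k; have [_ Ek] := dcoordE j (dq_diff k t0 n0).
    apply: (etrans (Ek v)); apply: (etrans (congr1 (fun w : Cn => w ord0 j) (dq_d0 k v t0))).
    by rewrite mxE.
  have -> : (- v) 0 j = (-1 : C) * v ord0 j by rewrite mxE mulN1r.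
  by apply: cvgMc; exact: expR_quotient.
- move=> z j; rewrite /= polydiscE => z1 zj zj0.
  have zj' : nrm z = nrm (z ord0 j : C) by rewrite /nrm zj.
  have zj0' : 0 < nrm (z ord0 j : C) by move: zj0; rewrite nrmE ltcR.
  apply: (@cvg_Re_le0 (fun k => dq F k t z ord0 j / z ord0 j)) => [|k]; last exact: dq_re.
  by apply: cvgMc; apply: cvg_coord; exact: vfieldP.
Qed.

(** By phi_(s,t+h) = phi_(t,t+h) o phi_(s,t), the difference quotient of the curve at time t is the
    one of the chain at the point phi_(s,t) z. *)
Lemma curve_cvg s t z v : 0 <= s -> s < t -> nrm z < 1 ->
  has_time_derivative (fun u => trans F s u z) t v ->
  (fun k => dq F k t (trans F s t z)) @ \oo --> v.
Proof.
move=> s0 st z1 hv; apply: cvg_row => j; have [hr hi] := hv j.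
have t0 : 0 <= t by exact: le_trans (ltW st).
apply/cvg_seqP => e e0; have e4 : 0 < e / 4 by order_lra.
move/real_deriveP: hr => /(_ _ e4) [d1 d10 h1]; move/real_deriveP: hi => /(_ _ e4) [d2 d20 h2].
have d0 : 0 < Num.min d1 d2 by rewrite lt_min d10.
have [N hN] := step_small d0; exists N => k /hN; rewrite lt_min => /andP[k1 k2].
have s0k := step_gt0 k; have ns : `|step k| = step k by rewrite gtr0_norm.
have := h1 (step k); rewrite ns => /(_ k1) {}h1; have := h2 (step k); rewrite ns => /(_ k2) {}h2.
rewrite /dq (trans_comp hF s0 (ltW st) (stepD t k) z1) [X in X - _]mxE.
have E : (k.+1%:R : R)%:C * (trans F s (t + step k) z - trans F s t z) ord0 j - v ord0 j =
   (k.+1%:R : R)%:C * (trans F s (t + step k) z ord0 j - trans F s t z ord0 j - (step k)%:C * v ord0 j).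
  have ks : (k.+1%:R : R)%:C * (step k)%:C = 1 :> C by rewrite -rmorphM /= mulfV ?pnatr_eq0.
  by rewrite mulrBr mulrA ks mul1r !mxE.
rewrite E nrmM nrm_natC.
have b : nrm (trans F s (t + step k) z ord0 j - trans F s t z ord0 j - (step k)%:C * v ord0 j : C) <= e / 2 * step k.
  apply: le_trans (nrm_le_ReIm _) _; rewrite !ReB !ImB ReZ ImZ.
  by move: h1 h2; clear; order_lra.
apply: le_lt_trans (ler_wpM2l (ler0n _ _) b) _.
by rewrite mulrCA mulfV ?pnatr_eq0 // mulr1; order_lra.
Qed.

Lemma curve_lip s t u z j : 0 <= s -> s <= t -> t <= u -> nrm z < 1 ->
  `|complex.Re (trans F s u z ord0 j) - complex.Re (trans F s t z ord0 j)| <= 2 / (1 - nrm z) * (u - t) /\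
  `|complex.Im (trans F s u z ord0 j) - complex.Im (trans F s t z ord0 j)| <= 2 / (1 - nrm z) * (u - t).
Proof.
move=> s0 st tu z1; have := trans_lip_t hF s0 st tu z1; rewrite mulrC => h.
have {}h : nrm (trans F s u z ord0 j - trans F s t z ord0 j : C) <= 2 / (1 - nrm z) * (u - t).
  by apply: le_trans h; have := nrm_coord (trans F s u z - trans F s t z) j; rewrite !mxE.
by rewrite -ReB -ImB; split; apply: le_trans h; [exact: ler_Re_nrm|exact: ler_Im_nrm].
Qed.

(** The curve is Lipschitz only on [s, +oo[; composing with max s makes it Lipschitz on the line
    without changing it near times t > s. *)
Lemma curve_ae s z : 0 <= s -> nrm z < 1 ->
  {ae mu, forall t, s < t -> exists v, has_time_derivative (fun u => trans F s u z) t v}.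
Proof.
move=> s0 z1.
have clamp (f : R -> R) : (forall t u, s <= t -> t <= u -> `|f u - f t| <= 2 / (1 - nrm z) * (u - t)) ->
    {ae mu, forall t, s < t -> derivable f t 1}.
  move=> fl; have : {ae mu, forall t, derivable (fun t => f (Num.max s t)) t 1}.
    apply: (@lipschitz_ae_derivable _ _ (2 / (1 - nrm z))) => x y.
    have L0 : 0 <= 2 / (1 - nrm z) by rewrite divr_ge0 // subr_ge0 ltW.
    have main (x' y' : R) : x' <= y' -> `|f (Num.max s y') - f (Num.max s x')| <= 2 / (1 - nrm z) * `|y' - x'|.
      move=> xy; apply: le_trans (fl _ _ _ _) _; first by rewrite le_max lexx.
        by rewrite ge_max !le_max lexx xy orbT.
      rewrite ler_wpM2l // ger0_norm ?subr_ge0 // !maxEle.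
      by case: ifP; case: ifP; order_lra.
    by have [/main//|/ltW/main] := leP x y; rewrite distrC [`|y - x|]distrC.
  apply: filterS; first exact: (ae_filter_ringOfSetsType mu).
  move=> t dt st; apply: near_eq_derivable dt.
  near=> u; rewrite max_r //; near: u; near do apply/ltW; exact: lt_nbhsr.
(* Coordinates are quantified through natural numbers, over which conull sets can be intersected. *)
have : {ae mu, forall t (j : nat), forall i : 'I_n, i = j :> nat -> s < t ->
    derivable (fun u => complex.Re (trans F s u z ord0 i)) t 1 /\
    derivable (fun u => complex.Im (trans F s u z ord0 i)) t 1}.
  apply/ae_foralln => j; have [jn|nj] := ltnP j n; last first.
    apply: aeW => t i E; by have := ltn_ord i; rewrite E ltnNge nj.
  pose i := Ordinal jn.
  have h1 := clamp _ (fun t u st tu => (@curve_lip s t u z i s0 st tu z1).1).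
  have h2 := clamp _ (fun t u st tu => (@curve_lip s t u z i s0 st tu z1).2).
  move: h1 h2; apply: filterS2; first exact: (ae_filter_ringOfSetsType mu).
  by move=> t d1 d2 i' E st; have -> : i' = i by [apply/val_inj]; split; [exact: d1|exact: d2].
apply: filterS; first exact: (ae_filter_ringOfSetsType mu).
move=> t H st.
exists (\row_j (('D_1 (fun u => complex.Re (trans F s u z ord0 j)) t) +i*
                ('D_1 (fun u => complex.Im (trans F s u z ord0 j)) t))).
move=> j; rewrite mxE /=; have [d1 d2] := H j j erefl st.
by split; [exact: DeriveDef d1 erefl|exact: DeriveDef d2 erefl].
Unshelve. all: by end_near. Qed.

End chain.
End herglotz.

(** * Normal chains have parametric representation *)

Section representation.
Context {R : realType} {n : nat}.
Local Notation C := R[i].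
Local Notation Cn := 'rV[C]_n.
Local Notation mu := (@lebesgue_measure R).
Local Notation cara := (caratheodory_type (wlength (@idfun R))^*%mu).
Implicit Types (z w x y v l : Cn) (r s t u h e : R) (k : nat).

Definition rational_point (p : 'rV[(rat * rat)%type]_n) : Cn :=
  \row_j (ratr (p ord0 j).1 +i* ratr (p ord0 j).2).

Lemma rational_near (x : R) e : 0 < e -> exists q : rat, `|ratr q - x| < e.
Proof.
move=> e0; have [|q] := @rat_in_itvoo R (x - e) (x + e); first by order_lra.
by rewrite in_itv /= => /andP[h1 h2]; exists q; rewrite ltr_norml; order_lra.
Qed.

Lemma rational_point_dense w e : 0 < e -> exists p, nrm (rational_point p - w) < e.
Proof.
move=> e0; have e3 : 0 < e / 3 by order_lra.
have /choice [f hf] : forall j, exists q : rat * rat,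
    `|ratr q.1 - complex.Re (w ord0 j)| < e / 3 /\ `|ratr q.2 - complex.Im (w ord0 j)| < e / 3.
  move=> j; have [q1 h1] := rational_near (complex.Re (w ord0 j)) e3.
  by have [q2 h2] := rational_near (complex.Im (w ord0 j)) e3; exists (q1, q2).
exists (\row_j f j); apply: le_lt_trans (_ : e / 3 + e / 3 < e); last by order_lra.
apply: nrm_row_le => [|j]; first by order_lra.
have [h1 h2] := hf j; have -> : (rational_point (\row_i f i) - w) ord0 j = (ratr (f j).1 +i* ratr (f j).2) - w ord0 j by rewrite !mxE.
apply: le_trans (nrm_le_ReIm _) _; rewrite ReB ImB /=.
by apply: lerD; exact: ltW.
Qed.

Section chain.
Context (F : R -> Cn -> Cn) (hF : hchain F).

Lemma dq_lip k t w x : 0 <= t -> nrm w < 1 -> nrm (x - w) <= (1 - nrm w) / 2 / 4 ->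
  nrm (dq F k t x - dq F k t w) <=
    4 * (4 / (1 - nrm w)) / ((1 - nrm w) / 2) * nrm (x - w).
Proof.
move=> t0 w1 xw; have r0 : 0 < (1 - nrm w) / 2 by order_lra.
apply: (row_lip2 r0 _ _ _ xw); last by rewrite subrr nrm0; order_lra.
  by rewrite divr_ge0 // subr_ge0 ltW.
move=> y yw; have y1 : nrm y < 1 - (1 - nrm w) / 2.
  by have := nrmD (y - w) w; rewrite subrK; order_lra.
split; first by apply: dq_diff => //; order_lra.
have y2 : nrm y < 1 by order_lra.
apply: le_trans (dq_bound hF k t0 y2) _.
have -> : 4 / (1 - nrm w) = 2 / ((1 - nrm w) / 2) by field; rewrite subr_eq0 gt_eqF.
rewrite ler_wpM2l // lef_pV2 ?posrE ?subr_gt0 //; order_lra.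
Qed.

(** For q slightly below t and z near w, the point phi_(q,t) z is near w, and there the difference
    quotients converge. Equicontinuity makes them Cauchy at w itself. Rational q and z suffice,
    which leaves countably many null sets. *)
Lemma good_criterion t : 0 < t ->
  (forall (q : rat) p, 0 <= ratr q :> R -> ratr q < t -> nrm (rational_point p) < 1 ->
     exists v, has_time_derivative (fun u => trans F (ratr q) u (rational_point p)) t v) ->
  good F t.
Proof.
move=> t0 H w w1; apply: cauchyCn => e e0.
pose L := 4 * (4 / (1 - nrm w)) / ((1 - nrm w) / 2).
have L0 : 0 <= L by apply: divr_ge0; [apply: mulr_ge0 => //; apply: divr_ge0 => //|]; order_lra.
(* Within distance eta of w the difference quotients vary by at most L eta <= e / 4. *)
pose eta := Num.min ((1 - nrm w) / 2 / 4) (e / (4 * (L + 1))).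
have eta0 : 0 < eta.
  by rewrite lt_min !divr_gt0 ?subr_gt0 // mulr_gt0 //; order_lra.
have eta1 : eta <= (1 - nrm w) / 2 / 4 by rewrite ge_min lexx.
have etaL : L * eta <= e / 4.
  apply: le_trans (_ : L * (e / (4 * (L + 1))) <= _).
    by rewrite ler_wpM2l // ge_min lexx orbT.
  by rewrite mulrA ler_pdivrMr; [nra|order_lra].
have e2 : 0 < eta / 2 by order_lra.
have [p hp] := rational_point_dense w e2; set z := rational_point p in hp.
have z1 : nrm z <= 1 - (1 - nrm w) / 2 by have := nrmD (z - w) w; rewrite subrK; order_lra.
have z1' : nrm z < 1 by order_lra.
(* The minimum with t leaves room for q >= 0; the other term bounds the displacement of z between q
   and t by eta / 4. *)
pose dl := Num.min t (eta * (1 - nrm w) / 16).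
have dl0 : 0 < dl by rewrite lt_min t0 !(divr_gt0, mulr_gt0) ?subr_gt0.
have [q] : exists q : rat, ratr q \in `]t - dl, t[ by apply: rat_in_itvoo; order_lra.
rewrite in_itv /= => /andP[q1 q2].
have q0 : 0 <= ratr q :> R by have : dl <= t by [rewrite ge_min lexx]; order_lra.
pose x := trans F (ratr q) t z.
have xz : nrm (x - z) <= eta / 2.
  apply: le_trans (trans_close hF q0 (ltW q2) z1') _.
  have h1 : t - ratr q <= eta * (1 - nrm w) / 16.
    apply: le_trans (_ : dl <= _); first order_lra.
    by rewrite ge_min lexx orbT.
  have h2 : 2 / (1 - nrm z) <= 4 / (1 - nrm w).
    have -> : 4 / (1 - nrm w) = 2 / ((1 - nrm w) / 2) by field; rewrite subr_eq0 gt_eqF.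
    by rewrite ler_wpM2l // lef_pV2 ?posrE ?subr_gt0 //; order_lra.
  apply: le_trans (ler_pM _ _ h1 h2) _; [order_lra|by rewrite divr_ge0 //; order_lra|].
  have -> : eta * (1 - nrm w) / 16 * (4 / (1 - nrm w)) = eta / 4 by field; rewrite subr_eq0 gt_eqF.
  order_lra.
have xw : nrm (x - w) <= eta by have := nrm_tri z x w; order_lra.
have [v hv] := H q p q0 q2 z1'.
have /cvg_seqP := curve_cvg hF q0 q2 z1' hv; rewrite -/x => cx.
have e8 : 0 < e / 8 by order_lra.
have [N hN] := cx _ e8; exists N => i j /hN hi /hN hj.
have lipk k : nrm (dq F k t x - dq F k t w) <= e / 4.
  have xw' : nrm (x - w) <= (1 - nrm w) / 2 / 4 by exact: le_trans eta1.
  apply: le_trans (dq_lip k (ltW t0) w1 xw') _; apply: le_trans etaL.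
  by rewrite -/L ler_wpM2l.
have h1 := nrm_tri (dq F i t x) (dq F i t w) (dq F j t w).
have h2 := nrm_tri (dq F j t x) (dq F i t x) (dq F j t w).
have h3 := nrm_tri v (dq F i t x) (dq F j t x).
have h4 := lipk i; have h5 := lipk j; rewrite nrmC in h4; rewrite [nrm (v - _)]nrmC in h3.
have aux : forall A B C D E P Q e : R, 0 < e -> A <= B + C -> C <= D + E -> D <= P + Q ->
    B <= e / 4 -> E <= e / 4 -> P < e / 8 -> Q < e / 8 -> A <= e by clear; move=> *; order_lra.
exact: aux e0 h1 h2 h3 h4 h5 hi hj.
Qed.

Lemma good_ae : {ae mu, forall t, 0 < t -> good F t}.
Proof.
pose P (i : nat) (t : R) := forall (q : rat) p, unpickle i = Some (q, p) ->
  0 <= ratr q :> R -> ratr q < t -> nrm (rational_point p) < 1 ->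
  exists v, has_time_derivative (fun u => trans F (ratr q) u (rational_point p)) t v.
have : {ae mu, forall t i, P i t}.
  apply/ae_foralln => i; rewrite /P.
  case E : (unpickle i) => [[q p]|]; last by apply: aeW.
  have [q0|q0] := leP 0 (ratr q : R); last first.
    by apply: aeW => t q' p' [<- _]; rewrite leNgt q0.
  have [p1|p1] := ltP (nrm (rational_point p)) 1; last first.
    by apply: aeW => t q' p' [_ <-] _ _; rewrite ltNge p1.
  have := curve_ae hF q0 p1; apply: filterS; first exact: (ae_filter_ringOfSetsType mu).
  by move=> t H q' p' [<- <-] _ qt _; exact: H.
apply: filterS; first exact: (ae_filter_ringOfSetsType mu).
move=> t H t0; apply: good_criterion => // q p q0 qt p1.
by apply: (H (pickle (q, p)) q p) => //; exact: pickleK.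
Qed.

Lemma bad_measurable : measurable ([set t | 0 <= t /\ ~ good F t] : set cara).
Proof.
apply: cara_negligible.
have : mu.-negligible (~` [set t | 0 < t -> good F t] `|` [set 0]).
  apply: negligibleU; first exact: good_ae.
  by exists [set 0]; split; [exact: measurable_set1|exact: lebesgue_measure_set1|].
apply: negligibleS => t [t0 ng]; have [->|tn] := eqVneq t 0; first by right.
by left => h; apply/ng/h; rewrite lt_neqAle eq_sym tn.
Qed.

Let halfline_measurable : measurable (`[0, +oo[%classic : set cara).
Proof. by apply: cara_borel; exact: measurable_itv. Qed.

(** On good times the field is a pointwise limit of functions continuous in t, and on the remaining
    null set it is the constant -w. *)
Lemma vfield_measurable w : nrm w < 1 -> lebesgue_measurable_curve `[0, +oo[ (vfield F w).
Proof.
move=> w1.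
pose N := [set t | 0 <= t /\ ~ good F t].
have E : `[0, +oo[%classic = (`[0, +oo[%classic `\` N) `|` N :> set R.
  apply/seteqP; split=> t /=.
    by rewrite in_itv /= andbT => t0; have [h|h] := pselect (N t); [right|left].
  by rewrite in_itv /= andbT => -[[]|[]].
have mG : measurable (`[0, +oo[%classic `\` N : set cara).
  by apply: measurableD; [exact: halfline_measurable|exact: bad_measurable].
have gen (c : Cn -> R) : (forall k, continuous (fun t => c (dq F k (Num.max t 0) w))) ->
    (forall t, 0 <= t -> good F t -> (fun k => c (dq F k t w)) @ \oo --> c (vfield F w t)) ->
    lebesgue_measurable_fun `[0, +oo[ (fun t => c (vfield F w t)).
  move=> cc cl; rewrite E; apply/measurable_funU; [exact: mG|exact: bad_measurable|split].
    apply: (@measurable_realfun.measurable_fun_cvg _ cara R _ (fun k t => c (dq F k (Num.max t 0) w))).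
      by move=> k; apply: lebesgue_measurable_continuous.
    move=> t [/=]; rewrite in_itv /= andbT => t0 nN; rewrite max_l //.
    by apply: cl => //; apply: contrapT => ng; apply: nN.
  apply: (@eq_measurable_fun _ _ cara R _ (cst (c (- w)))); last exact: measurable_cst.
  by move=> t; rewrite inE => -[_ ng]; rewrite vfieldN.
(* The clamp max t 0 extends the Lipschitz estimate, available for nonnegative times only, to the
   whole line. *)
have clip (c : Cn -> R) : (forall x y, `|c x - c y| <= nrm (x - y)) ->
    forall k, continuous (fun t => c (dq F k (Num.max t 0) w)).
  move=> c1 k; pose K := k.+1%:R * (8 / (1 - nrm w) * (2 / (1 - nrm w)) + 2 / (1 - nrm w)).
  have K0 : 0 <= K by apply: mulr_ge0 => //; apply: addr_ge0; [apply: mulr_ge0|]; apply: divr_ge0 => //; rewrite subr_ge0 ltW.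
  apply: (@lipschitz_continuous _ _ K) => t u.
  have main (t' u' : R) : t' <= u' -> `|c (dq F k (Num.max u' 0) w) - c (dq F k (Num.max t' 0) w)| <= K * `|u' - t'|.
    move=> tu; apply: le_trans (c1 _ _) _.
    rewrite /dq -scalerBr nrmZ nrm_natC opprB addrA subrK.
    have m0 : 0 <= Num.max t' 0 by rewrite le_max lexx orbT.
    have mm : Num.max t' 0 <= Num.max u' 0 by rewrite ge_max !le_max tu lexx orbT.
    apply: le_trans (ler_wpM2l (ler0n _ _) (trans_step_lip hF m0 mm (ltW (step_gt0 k)) w1)) _.
    rewrite mulrCA [leLHS]mulrC -/K ler_wpM2l // ger0_norm ?subr_ge0 // !maxEle.
    by case: ifP; case: ifP; order_lra.
  by have [/main//|/ltW/main] := leP t u; rewrite distrC [`|u - t|]distrC.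
move=> j; split; [apply: (gen (fun v => complex.Re (v ord0 j)))|apply: (gen (fun v => complex.Im (v ord0 j)))].
- by apply: (clip (fun v => complex.Re (v ord0 j))) => x y; rewrite -ReB; apply: le_trans (ler_Re_nrm _) _; have := nrm_coord (x - y) j; rewrite !mxE.
- move=> t t0 g; have /cvg_seqP h : (fun k => dq F k t w ord0 j) @ \oo --> vfield F w t ord0 j by apply: cvg_coord; exact: vfieldP.
  apply/cvgrPdist_lt => e /h [N' hN]; exists N' => // k /hN.
  by apply: le_lt_trans; rewrite distrC -ReB ler_Re_nrm.
- by apply: (clip (fun v => complex.Im (v ord0 j))) => x y; rewrite -ImB; apply: le_trans (ler_Im_nrm _) _; have := nrm_coord (x - y) j; rewrite !mxE.
- move=> t t0 g; have /cvg_seqP h : (fun k => dq F k t w ord0 j) @ \oo --> vfield F w t ord0 j by apply: cvg_coord; exact: vfieldP.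
  apply/cvgrPdist_lt => e /h [N' hN]; exists N' => // k /hN.
  by apply: le_lt_trans; rewrite distrC -ImB ler_Im_nrm.
Qed.

Lemma vfield_Herglotz : Herglotz_field (vfield F).
Proof.
split=> [t t0|z]; first exact: vfield_M.
by rewrite /= polydiscE; exact: vfield_measurable.
Qed.

Lemma trans_Loewner : Loewner_solution (vfield F) 0 (trans F 0).
Proof.
move=> z; rewrite /= polydiscE => z1; split.
- exact: trans_id.
- by move=> t t0; rewrite /= polydiscE; have [] := transP hF (lexx 0) t0 z1.
- move=> t t0 j; split; apply: (@lip_abs_continuous _ _ _ _ (2 / (1 - nrm z))) => s u s0 su _.
    exact: (curve_lip hF j (lexx 0) s0 su z1).1.
  exact: (curve_lip hF j (lexx 0) s0 su z1).2.
have n0 : {ae mu, forall t : R, t != 0}.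
  exists [set 0]; split; [exact: measurable_set1|exact: lebesgue_measure_set1|].
  by move=> t /= /negP; rewrite negbK => /eqP.
have := good_ae; have := curve_ae hF (lexx 0) z1; move: n0.
apply: filterS3; first exact: (ae_filter_ringOfSetsType mu).
move=> t tn cv g t0; have tp : 0 < t by rewrite lt_neqAle eq_sym tn.
have [v hv] := cv tp; have w1 := (transP hF (lexx 0) t0 z1).1.
(* The derivative of the curve and the field are limits of the same difference quotients. *)
have <- : v = vfield F (trans F 0 t z) t by exact: (cvgC_uniq (curve_cvg hF (lexx 0) tp z1 hv) (vfieldP (g tp) w1)).
exact: hv.
Qed.

Theorem chain_S0 : chain_bounded F -> class_S0 (F 0 : mappings R n).
Proof.
move=> bF; case: (hF) => df inj F0 dF0 _; split.
  split; last first.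
  - by move=> v; have := dF0 0 v (lexx 0); rewrite expR0 scale1r.
  - exact: F0.
  split=> [z|x y].
    by rewrite /= polydiscE; exact: df.
  by rewrite !inE /= !polydiscE; exact: inj.
exists (vfield F), (trans F 0); split; [exact: vfield_Herglotz|exact: trans_Loewner|].
apply/mapping_cvgP => r e r01 e0; have [T T0 hT] := trans_limit hF bF r01 e0.
exists T; split; first exact: num_real.
by move=> t Tt z zr; apply: hT => //; exact: ltW.
Qed.

End chain.
End representation.

(** * Concatenation *)

Section concatenation.
Context {R : realType} {n : nat}.
Local Notation C := R[i].
Local Notation Cn := 'rV[C]_n.
Local Notation mu := (@lebesgue_measure R).
Local Notation cara := (caratheodory_type (wlength (@idfun R))^*%mu).
Implicit Types (z w v : Cn) (r s t e tau : R).

Lemma has_time_derivative_near (f g : R -> Cn) t v d : 0 < d ->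
  (forall s, `|s - t| < d -> f s = g s) -> has_time_derivative f t v -> has_time_derivative g t v.
Proof.
move=> d0 fg hf j; have [h1 h2] := hf j.
have N : \near t, f t = g t.
  by exists d => // s /=; rewrite distrC; exact: fg.
split; [apply: near_eq_is_derive h1|apply: near_eq_is_derive h2]; apply: filterS N => s -> //.
Qed.

Lemma has_time_derivative_shift (f : R -> Cn) t v tau : has_time_derivative f (t - tau) v ->
  has_time_derivative (fun s => f (s - tau)) t v.
Proof.
move=> hf j; have [/real_deriveP h1 /real_deriveP h2] := hf j.
split; apply/real_deriveP => e e0.
  by have [d d0 H] := h1 e e0; exists d => // h /H; rewrite [t + h - tau]addrAC.
by have [d d0 H] := h2 e e0; exists d => // h /H; rewrite [t + h - tau]addrAC.
Qed.

(** Writing u s = A (min s tau) + B (max s tau - tau) - B 0 avoids cutting intervals at tau. *)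
Lemma abs_continuous_glue (A B u : R -> R) tau t : 0 <= tau -> 0 <= t ->
  (forall s, s < tau -> u s = A s) -> (forall s, tau <= s -> u s = B (s - tau)) ->
  A tau = B 0 -> (forall s, 0 <= s -> abs_continuous A 0 s) ->
  (forall s, 0 <= s -> abs_continuous B 0 s) -> abs_continuous u 0 t.
Proof.
move=> tau0 t0 uA uB AB acA acB.
have -> : u = (fun s => A (Num.min s tau) + (B (Num.max s tau - tau) + - B 0)).
  apply/funext => s; have [st|ts] := ltP s tau.
    by rewrite uA // subrr addrN addr0.
  by rewrite uB // AB addrCA subrr addr0.
apply: abs_continuousD; last apply: abs_continuousD; last exact: abs_continuous_cst.
- apply: (@abs_continuous_comp _ _ (fun s => Num.min s tau) _ _ 0 tau); last exact: acA.
  + by move=> x y xy; rewrite le_min !ge_min xy lexx orbT.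
  + by move=> x y xy; rewrite !minEle; case: ifP; case: ifP; order_lra.
  + by move=> x /andP[x0 _]; rewrite le_min x0 tau0 ge_min lexx orbT.
- apply: (@abs_continuous_comp _ _ (fun s => Num.max s tau - tau) _ _ 0 (Num.max t tau - tau)).
  + by move=> x y xy; rewrite lerD2r ge_max !le_max xy lexx orbT.
  + by move=> x y xy; rewrite !maxEle; case: ifP; case: ifP; order_lra.
  + move=> x /andP[_ xt]; rewrite subr_ge0 le_max lexx orbT /= lerD2r.
    by rewrite ge_max !le_max xt lexx orbT.
  + by apply: acB; rewrite subr_ge0 le_max lexx orbT.
Qed.

Context (F : R -> Cn -> Cn) (hF : hchain F).

Lemma compose_S (g : mappings R n) tau : 0 <= tau -> class_S g ->
  class_S ((fun z => (expR tau)%:C *: g (trans F 0 tau z)) : mappings R n).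
Proof.
move=> tau0 [[dg ig] g0 dg0].
have lx := lexx (0 : R).
have dphi z : nrm z < 1 -> differentiable (trans F 0 tau) z by exact: trans_diff.
have bphi z : nrm z < 1 -> nrm (trans F 0 tau z) < 1 by move=> /(transP hF lx tau0) [].
have dg' z : nrm z < 1 -> differentiable (g : Cn -> Cn) z by move=> z1; apply: dg; rewrite /= polydiscE.
have et0 : (expR tau)%:C != 0 :> C.
  by apply/eqP => /complexI h; have := expR_gt0 tau; rewrite h ltxx.
have dc z : nrm z < 1 -> differentiable (fun z => (g : Cn -> Cn) (trans F 0 tau z)) z.
  by move=> z1; apply: (dcomp (dphi z z1)); apply: dg'; exact: bphi.
split.
- split=> [z|x y]; first by rewrite /= polydiscE => z1; apply: dscale; exact: dc.
  rewrite !inE /= !polydiscE => x1 y1 /(scalerI et0) E.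
  apply: (trans_inj hF lx tau0 x1 y1); apply: ig => //; rewrite inE /= polydiscE; exact: bphi.
- by rewrite trans0 // g0 scaler0.
- have n0 : nrm (0 : Cn) < 1 by rewrite nrm0.
  have d0' := bphi 0 n0; move=> v.
  apply: (etrans (dscaleE (expR tau)%:C v (dc 0 n0))).
  have E := dcompE (dphi 0 n0) (dg' _ d0') v.
  have T0 := trans0 hF lx tau0.
  apply: (etrans (congr1 (fun w : Cn => (expR tau)%:C *: w) E)).
  apply: (etrans (congr1 (fun p => (expR tau)%:C *: 'd (g : Cn -> Cn) p ('d (trans F 0 tau) 0 v)) T0)).
  apply: (etrans (congr1 (fun w : Cn => (expR tau)%:C *: w) (dg0 _))).
  apply: (etrans (congr1 (fun w : Cn => (expR tau)%:C *: w) (trans_d0 hF v lx tau0))).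
  by rewrite scalerA -rmorphM /= -expRD sub0r subrr expR0 scale1r.
Qed.

Lemma concat_S0 (g : mappings R n) tau : 0 <= tau -> class_S0 g ->
  class_S0 ((fun z => (expR tau)%:C *: g (trans F 0 tau z)) : mappings R n).
Proof.
move=> tau0 [Sg [G [psi [[GM Gm] sol lim]]]]; split; first exact: compose_S.
have lx := lexx (0 : R).
have [FM Fm] := vfield_Herglotz hF; have solF := trans_Loewner hF.
pose H z t := if t < tau then vfield F z t else G z (t - tau).
pose phi t : mappings R n := if t < tau then trans F 0 t else (fun z => psi (t - tau) (trans F 0 tau z)).
have bphi z : nrm z < 1 -> nrm (trans F 0 tau z) < 1 by move=> /(transP hF lx tau0) [].
exists H, phi; split.
- split=> [t t0|z z1].
    rewrite /H; case: ltP => tt; first exact: FM.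
    by apply: GM; rewrite subr_ge0.
  move=> j; pose A := `[0, tau[%classic : set cara; pose B := `[tau, +oo[%classic : set cara.
  have AB : `[0, +oo[%classic = A `|` B.
    apply/seteqP; split=> t; rewrite /A /B /= !in_itv /= ?andbT; first by case: (ltP t tau) => h h0; [left; rewrite h0|right].
    by case=> [/andP[]//|]; exact: le_trans.
  have mA : measurable A by apply: cara_borel; exact: measurable_itv.
  have mB : measurable B by apply: cara_borel; exact: measurable_itv.
  have gen (c : Cn -> R) : lebesgue_measurable_fun `[0, +oo[ (fun t => c (vfield F z t)) ->
      lebesgue_measurable_fun `[0, +oo[ (fun t => c (G z t)) ->
      lebesgue_measurable_fun `[0, +oo[ (fun t => c (H z t)).
    move=> m1 m2; rewrite AB; apply/measurable_funU; [exact: mA|exact: mB|split].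
      apply: (@eq_measurable_fun _ _ cara R A (fun t => c (vfield F z t))).
        by move=> t; rewrite inE /A /= in_itv /= /H => /andP[_ ->].
      apply: measurable_funS m1; first by rewrite AB; exact: measurableU.
      by rewrite AB; exact: subsetUl.
    apply: (@eq_measurable_fun _ _ cara R B (fun t => c (G z (t - tau)))).
      by move=> t; rewrite inE /B /= in_itv /= andbT /H ltNge => ->.
    have := @lebesgue_measurable_shift R (- tau) _ _ m2.
    suff -> : translate (- tau) `[0, +oo[ = B by [].
    by apply/seteqP; split=> t; rewrite /translate /B /= !in_itv /= !andbT subr_ge0.
  have [v1 v2] := Fm z z1 j; have [g1 g2] := Gm z z1 j.
  split; [apply: (gen (fun v => complex.Re (v ord0 j)))|apply: (gen (fun v => complex.Im (v ord0 j)))];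
    [exact: v1|exact: g1|exact: v2|exact: g2].
- move=> z; rewrite /= polydiscE => z1; have z1' : polydisc R n z by rewrite /= polydiscE.
  have w1' : polydisc R n (trans F 0 tau z) by rewrite /= polydiscE; exact: bphi.
  have [a1 a2 a3 a4] := solF z z1'; have [b1 b2 b3 b4] := sol _ w1'.
  split.
  (* For tau = 0 the second branch is taken already at time 0, and both pieces start with the
     identity. *)
  + rewrite /phi; case: ltP => [//|tt]; have tt0 : tau = 0 by apply/eqP; rewrite eq_le tt.
    have e0 : 0 - tau = 0 by rewrite tt0 subrr.
    by rewrite e0 b1 tt0.
  + move=> t t0; rewrite /phi; case: ltP => tt; first exact: a2.
    by apply: b2; rewrite subr_ge0.
  + move=> t t0 j; split.
      apply: (@abs_continuous_glue (fun s => complex.Re (trans F 0 s z ord0 j))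
        (fun s => complex.Re (psi s (trans F 0 tau z) ord0 j)) _ tau t) => //.
      * by move=> s st; rewrite /phi st.
      * by move=> s st; rewrite /phi ltNge st.
      * by rewrite b1.
      * by move=> s s0; have [] := a3 s s0 j.
      * by move=> s s0; have [] := b3 s s0 j.
    apply: (@abs_continuous_glue (fun s => complex.Im (trans F 0 s z ord0 j))
      (fun s => complex.Im (psi s (trans F 0 tau z) ord0 j)) _ tau t) => //.
    * by move=> s st; rewrite /phi st.
    * by move=> s st; rewrite /phi ltNge st.
    * by rewrite b1.
    * by move=> s s0; have [] := a3 s s0 j.
    * by move=> s s0; have [] := b3 s s0 j.
  + have nt : {ae mu, forall t : R, t != tau}.
      exists [set tau]; split; [exact: measurable_set1|exact: lebesgue_measure_set1|].
      by move=> t /= /negP; rewrite negbK => /eqP.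
    (* The exceptional null set of the second solution is translated by tau, and the gluing time
       itself is discarded. *)
    have b4' := @ae_shift R (- tau) _ b4; move: nt a4 b4'.
    apply: filterS3; first exact: (ae_filter_ringOfSetsType mu).
    move=> t tn hA hB t0; have [tt|tt] := ltP t tau.
      apply: (@has_time_derivative_near (fun s => trans F 0 s z) _ _ _ (tau - t)); first by rewrite subr_gt0.
        by move=> s; rewrite ltr_norml => /andP[_ h]; rewrite /phi ifT //; order_lra.
      by rewrite /phi /H tt; exact: hA.
    have tt' : tau < t by rewrite lt_neqAle eq_sym tn.
    apply: (@has_time_derivative_near (fun s => psi (s - tau) (trans F 0 tau z)) _ _ _ (t - tau)).
    * by rewrite subr_gt0.
    * by move=> s; rewrite ltr_norml => /andP[h _]; rewrite /phi ifF //; apply/negbTE; rewrite -leNgt; order_lra.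
    apply: (@has_time_derivative_shift (fun s => psi s (trans F 0 tau z))).
    by rewrite /phi /H ltNge tt /=; apply: hB; rewrite subr_ge0.
- apply/mapping_cvgP => r e r01 e0.
  have ee : 0 < e / expR tau by rewrite divr_gt0 // expR_gt0.
  move/mapping_cvgP: lim => /(_ r _ r01 ee) [T [_ hT]].
  exists (Num.max tau (T + tau)); split; first exact: num_real.
  move=> t; rewrite gt_max => /andP[t1 t2] z zr.
  have z1 : nrm z < 1 by case/andP: r01 => _; exact: le_lt_trans.
  have wr : nrm (trans F 0 tau z) <= r by apply: le_trans zr; exact: trans_schwarz.
  have := hT (t - tau); rewrite ltrBrDr => /(_ t2 _ wr).
  have -> : phi t z = psi (t - tau) (trans F 0 tau z) by rewrite /phi ltNge (ltW t1).
  (* The factor e^tau is split off so that the limit for the second solution applies at time t -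
     tau. *)
  have -> : (expR t)%:C = (expR tau)%:C * (expR (t - tau))%:C :> C by rewrite -rmorphM /= -expRD subrKC.
  rewrite -scalerA -scalerBr nrmZ real_C_nrm ?expR_ge0 //.
  by rewrite ltr_pdivlMr ?expR_gt0 // mulrC.
Qed.

End concatenation.

(** * Perturbations of the identity *)

Section near_identity_maps.
Context {R : realType} {n : nat}.
Local Notation C := R[i].
Local Notation Cn := 'rV[C]_n.
Implicit Types (f g h : Cn -> Cn) (z w x y v : Cn) (a b r s t e M : R).

(** Cauchy estimates hold on balls of radius b - a about points of the smaller ball; [chain_bound]
    adds them up along the segment, which convexity keeps inside. *)
Lemma lip_ball g a b M : 0 <= a -> a < b -> 0 <= M ->
  (forall z, nrm z < b -> differentiable g z /\ nrm (g z) <= M) ->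
  forall x y, nrm x <= a -> nrm y <= a -> nrm (g x - g y) <= 4 * M / (b - a) * nrm (x - y).
Proof.
move=> a0 ab M0 hg x y xa ya; have r0 : 0 < b - a by rewrite subr_gt0.
have L0 : 0 <= 4 * M / (b - a) by rewrite divr_ge0 ?mulr_ge0 // ltW.
pose p s := y + s%:C *: (x - y).
have pE s : p s = (1 - s)%:C *: y + s%:C *: x.
  by apply/rowP => j; rewrite /p !mxE rmorphB rmorph1; ring.
have pa s : 0 <= s <= 1 -> nrm (p s) <= a.
  move=> /andP[s0 s1]; rewrite pE; apply: le_trans (nrmD _ _) _; rewrite !nrmZ !real_C_nrm ?subr_ge0 //.
  have s1' : 0 <= 1 - s by rewrite subr_ge0.
  by have := ler_wpM2l s0 xa; have := ler_wpM2l s1' ya; order_lra.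
pose d := (b - a) / 4 / (nrm (x - y) + 1).
have n1 : 0 < nrm (x - y) + 1 by rewrite ltr_wpDl ?nrm_ge0.
have d0 : 0 < d by rewrite !divr_gt0.
have := @chain_bound _ _ (fun s => g (p s)) (4 * M / (b - a) * nrm (x - y)) 0 d.
have p0 : p 0 = y by rewrite /p rmorph0 scale0r addr0.
have p1 : p 1 = x by rewrite /p rmorph1 scale1r subrKC.
rewrite p0 p1; apply => //.
  by rewrite mulr_ge0 ?nrm_ge0.
move=> s s' s01 s'01 sd; rewrite mul0r addr0.
have pp : p s' - p s = (s' - s)%:C *: (x - y) by apply/rowP => j; rewrite /p !mxE rmorphB; ring.
have np : nrm (p s' - p s) = nrm (x - y) * `|s' - s| by rewrite pp nrmZ nrm_real mulrC.
have hb w : nrm (w - p s) < b - a -> differentiable g w /\ nrm (g w) <= M.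
  move=> h; apply: hg; have := nrmD (w - p s) (p s); rewrite subrK => h2.
  by apply: le_lt_trans h2 _; have := pa s s01; order_lra.
have xx : nrm (p s - p s) <= (b - a) / 4 by rewrite subrr nrm0 divr_ge0 // ltW.
have yy : nrm (p s' - p s) <= (b - a) / 4.
  rewrite np; move: sd; rewrite /d ler_pdivlMr // mulrC; apply: le_trans.
  by rewrite ler_wpM2r // lerDl.
by apply: le_trans (row_lip2 r0 M0 hb xx yy) _; rewrite np mulrA.
Qed.

(** Holomorphy beyond the closed polydisc, which gives a Lipschitz constant up to the boundary. *)
Definition nice g := exists2 rho : R, 1 < rho & forall z, nrm z < rho -> differentiable g z.

(** Order two at the origin, stated as a growth condition so that it passes through compositions
    without computing differentials. *)
Definition flat g := exists K d : R, [/\ 0 <= K, 0 < d & forall z, nrm z < d -> nrm (g z) <= K * nrm z ^+ 2].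

Lemma nice_lip g : nice g -> exists2 L : R, 0 <= L &
  forall x y, nrm x <= 1 -> nrm y <= 1 -> nrm (g x - g y) <= L * nrm (x - y).
Proof.
move=> [rho rho1 dg].
have dg' z : nrm z <= (1 + rho) / 2 -> differentiable g z by move=> zr; apply: dg; order_lra.
have [M M0 hM] := cball_bounded dg'.
have ab : 1 < (1 + rho) / 2 by order_lra.
exists (4 * M / ((1 + rho) / 2 - 1)); first by rewrite divr_ge0 ?mulr_ge0 //; order_lra.
by apply: lip_ball => // z zr; split; [apply: dg'|apply: hM]; exact: ltW.
Qed.

Lemma flat0 g : flat g -> g 0 = 0.
Proof.
move=> [K [d [K0 d0 h]]]; apply: nrm_eq0; apply/eqP; rewrite eq_le nrm_ge0 andbT.
by have := h 0; rewrite nrm0 expr0n /= mulr0; apply.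
Qed.

Lemma flat_d0 g v : flat g -> differentiable g 0 -> 'd g 0 v = 0.
Proof.
move=> fg dg; have g0 := flat0 fg; have [K [d [K0 d0 h]]] := fg.
apply: nrm_eq0; apply/eqP; rewrite eq_le nrm_ge0 andbT.
apply/ler_addgt0Pr => e e0; rewrite add0r.
have v1 : 0 < nrm v + 1 by rewrite ltr_wpDl ?nrm_ge0.
have e2 : 0 < e / 2 / (nrm v + 1) by rewrite !divr_gt0.
have [d1 d10 h1] := diff_nrm dg e2.
(* For t <= c the quadratic growth bound at t v, divided by t, contributes at most e / 2. *)
pose c := e / 2 / ((K + 1) * (nrm v + 1) ^+ 2).
have c0 : 0 < c by rewrite !divr_gt0 // mulr_gt0 ?exprn_gt0 //; order_lra.
pose t := Num.min c (Num.min (d / (nrm v + 1)) (d1 / (nrm v + 1))).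
have t0 : 0 < t by rewrite !lt_min c0 !divr_gt0.
have tc : t <= c by rewrite ge_min lexx.
have tv q : 0 < q -> t <= q / (nrm v + 1) -> nrm (t%:C *: v) < q.
  move=> q0; rewrite ler_pdivlMr // nrmZ real_C_nrm ?(ltW t0) // => hq.
  by apply: lt_le_trans hq; rewrite ltr_pM2l // ltrDl.
have td : nrm (t%:C *: v) < d by apply: tv => //; rewrite !ge_min lexx orbT.
have td1 : nrm (t%:C *: v) < d1 by apply: tv => //; rewrite !ge_min lexx !orbT.
have := h1 _ td1; rewrite add0r g0 subr0 => h2; have h3 := h _ td.
have E : 'd g 0 (t%:C *: v) = t%:C *: 'd g 0 v by rewrite linearZ.
rewrite E in h2.
have h4 : t * nrm ('d g 0 v) <= e / 2 / (nrm v + 1) * nrm (t%:C *: v) + K * nrm (t%:C *: v) ^+ 2.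
  have -> : t * nrm ('d g 0 v) = nrm (t%:C *: 'd g 0 v) by rewrite nrmZ real_C_nrm // ltW.
  have := nrm_lowB (t%:C *: 'd g 0 v) (g (t%:C *: v)) => h5.
  by move: h2 h3 h5; clear; order_lra.
move: h4; rewrite nrmZ real_C_nrm ?(ltW t0) // => h4.
rewrite -(ler_pM2l t0); apply: le_trans h4 _.
have a1 : e / 2 / (nrm v + 1) * nrm v <= e / 2.
  by rewrite -mulrA ler_piMr ?divr_ge0 ?(ltW e0) // mulrC ler_pdivrMr // mul1r lerDl.
have a2 : K * (t * nrm v ^+ 2) <= e / 2.
  apply: le_trans (_ : c * ((K + 1) * (nrm v + 1) ^+ 2) <= _); last first.
    by rewrite /c divfK // gt_eqF // mulr_gt0 ?exprn_gt0 //; order_lra.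
  rewrite mulrCA; apply: ler_pM => //; first exact: ltW.
    by rewrite mulr_ge0 // sqr_ge0.
  apply: ler_pM => //; [exact: sqr_ge0|order_lra|].
  by apply: lerXn2r; rewrite ?nnegrE ?nrm_ge0 ?(ltW v1) // lerDl.
have -> : e / 2 / (nrm v + 1) * (t * nrm v) + K * (t * nrm v) ^+ 2 =
  t * (e / 2 / (nrm v + 1) * nrm v + K * (t * nrm v ^+ 2)) by ring.
by rewrite ler_pM2l // [leRHS]splitr lerD.
Qed.

(* The chain is [e^t h]: a map close to the identity is starlike, as
   [h x = l h z] is solvable with [|x - l z| <= (1 - l) |z|] for [0 < l <= 1]. *)
Lemma near_identity_S0 h : (forall z, nrm z < 1 -> differentiable h z) -> h 0 = 0 ->
  (forall v, 'd h 0 v = v) ->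
  (forall x y, nrm x <= 1 -> nrm y <= 1 -> nrm ((h x - x) - (h y - y)) <= 4^-1 * nrm (x - y)) ->
  class_S0 (h : mappings R n).
Proof.
move=> dh h0 dh0 lip; pose F t z := (expR t)%:C *: h z.
have et t : (expR t)%:C != 0 :> C by apply/eqP => /complexI E; have := expR_gt0 t; rewrite E ltxx.
have lip2 (c : Cn) (q : R) : nrm c + q <= 1 -> forall x y, nrm (x - c) <= q -> nrm (y - c) <= q ->
    nrm ((h x - x) - (h y - y)) <= 2^-1 * nrm (x - y).
  move=> cq x y xc yc.
  have b1 u : nrm (u - c) <= q -> nrm u <= 1.
    by move=> uc; have := nrmD (u - c) c; rewrite subrK; order_lra.
  apply: le_trans (lip x y (b1 x xc) (b1 y yc)) _.
  by rewrite ler_wpM2r ?nrm_ge0 //; order_lra.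
have hc : hchain F.
  split.
  - by move=> t z _ z1; apply: dscale; exact: dh.
  - move=> t x y _ x1 y1 /(scalerI (et t)) E.
    have L := lip2 0 1; rewrite nrm0 add0r in L.
    have := near_identity_inj (L (lexx 1)) (x := x) (x' := y); rewrite !subr0 E subrr nrm0 mulr0.
    move=> /(_ (ltW x1) (ltW y1)) H; apply/eqP; rewrite -subr_eq0; apply/eqP/nrm_eq0/eqP.
    by rewrite eq_le H nrm_ge0.
  - by move=> t _; rewrite /F h0 scaler0.
  - move=> t v _; have n0 : nrm (0 : Cn) < 1 by rewrite nrm0.
    by apply: (etrans (dscaleE (expR t)%:C v (dh 0 n0))); congr (_ *: _).
  - move=> s t z s0 st z1.
    pose l := expR (s - t); have l0 : 0 < l by exact: expR_gt0.
    have l1 : l <= 1 by rewrite -expR0 ler_expR subr_le0.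
    have nl : nrm (l%:C *: z) = l * nrm z by rewrite nrmZ real_C_nrm // ltW.
    have cq : nrm (l%:C *: z) + (1 - l) * nrm z <= 1 by rewrite nl -mulrDl addrC subrK mul1r ltW.
    have [|||x [xc xE]] := @solve_near_identity _ _ h (l%:C *: z) ((1 - l) * nrm z) (l%:C *: h z).
    + by rewrite mulr_ge0 ?nrm_ge0 // subr_ge0.
    + exact: lip2.
    + have b1 : nrm z <= 1 by exact: ltW.
      have b2 : nrm (l%:C *: z) <= 1 by rewrite nl mulr_ile1 ?nrm_ge0 // ltW.
      have b3 : nrm (0 : Cn) <= 1 by rewrite nrm0.
      (* Each of the two differences contributes a quarter of (1 - l) |z|; together they are the
         half of the radius that Picard iteration allows. This is the origin of the constant 1/4. *)
      have k1 := lip z (l%:C *: z) b1 b2; have k2 := lip z 0 b1 b3.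
      rewrite h0 !subr0 in k2.
      have zl : nrm (z - l%:C *: z) = (1 - l) * nrm z.
        have -> : z - l%:C *: z = (1 - l)%:C *: z by rewrite rmorphB rmorph1 /= scalerBl scale1r.
        by rewrite nrmZ real_C_nrm // subr_ge0.
      rewrite zl in k1.
      have -> : l%:C *: h z - h (l%:C *: z) =
          ((h z - z) - (h (l%:C *: z) - l%:C *: z)) - (1 - l)%:C *: (h z - z).
        by apply/rowP => j; rewrite !mxE rmorphB rmorph1; ring.
      apply: le_trans (nrmB _ _) _; rewrite nrmZ real_C_nrm ?subr_ge0 //.
      have l1' : 0 <= 1 - l by rewrite subr_ge0.
      have := ler_wpM2l l1' k2; move: k1; set q1 := nrm _; set q2 := nrm _.
      by move: (nrm z) => q3; clear; order_lra.
    exists x.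
      have := nrmD (x - l%:C *: z) (l%:C *: z); rewrite subrK => H.
      apply: le_lt_trans H _; rewrite nl; move: xc z1; set q1 := nrm _; clear; order_lra.
    by rewrite /F xE scalerA -rmorphM /= /l -expRD addrC subrK.
have -> : (h : mappings R n) = F 0 by apply/funext => z; rewrite /F expR0 scale1r.
apply: (chain_S0 hc) => r /andP[r0 r1].
have [M M0 hM] := @cball_bounded _ _ _ h r (fun z zr => dh z (le_lt_trans zr r1)).
exists M => // t z t0 zr; rewrite nrmZ real_C_nrm ?expR_ge0 // mulrC.
by rewrite ler_wpM2r ?expR_ge0 // hM.
Qed.

Lemma perturb_S0 g : nice g -> flat g -> exists2 e : R, 0 < e &
  forall c : C, nrm c <= e -> class_S0 ((fun z => z + c *: g z) : mappings R n).
Proof.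
move=> ng fg; have [L L0 hL] := nice_lip ng; have [rho rho1 dg] := ng.
(* This bound gives c g a Lipschitz constant of at most 1/4. *)
exists (4 * (L + 1))^-1; first by rewrite invr_gt0 mulr_gt0 //; order_lra.
move=> c ce; have n0 : nrm (0 : Cn) < rho by rewrite nrm0; order_lra.
have dz z : nrm z < 1 -> differentiable g z by move=> z1; apply: dg; order_lra.
apply: near_identity_S0.
- by move=> z z1; apply: dD; [exact: did|apply: dscale; exact: dz].
- by rewrite flat0 // scaler0 addr0.
- move=> v; have dc := dscale c (dg 0 n0).
  have E := congr1 (fun k => k v) (diffD (did (0 : Cn)) dc).
  have E2 := etrans (dscaleE c v (dg 0 n0)) (congr1 (fun w : Cn => c *: w) (flat_d0 v fg (dg 0 n0))).
  apply: (etrans E); apply: (etrans (congr2 +%R (diffid (0 : Cn) v) E2)).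
  by rewrite scaler0 addr0.
- move=> x y x1 y1; have -> : (x + c *: g x - x) - (y + c *: g y - y) = c *: (g x - g y).
    by apply/rowP => j; rewrite !mxE; ring.
  rewrite nrmZ; apply: le_trans (ler_wpM2l (nrm_ge0 _) (hL x y x1 y1)) _.
  rewrite mulrA ler_wpM2r ?nrm_ge0 //; apply: le_trans (ler_wpM2r L0 ce) _.
  by rewrite invfM -mulrA ler_piMr ?invr_ge0 // mulrC ler_pdivrMr ?mul1r //; order_lra.
Qed.

End near_identity_maps.

(** * Homogeneous expansions *)

Section homogeneous_expansion.
Context {R : realType} {n : nat}.
Local Notation C := R[i].
Local Notation Cn := 'rV[C]_n.
Implicit Types (z w x y v : Cn) (a b c r s e M : R).

Lemma pow_small (x e : R) : 0 <= x < 1 -> 0 < e -> exists m : nat, x ^+ m < e.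
Proof.
move=> /andP[x0 x1] e0; have : (x ^+ k) @[k --> \oo] --> (0 : R).
  by apply: cvg_expr; rewrite ger0_norm.
move=> /cvgrPdist_lt /(_ _ e0) [N _ hN]; exists N.
by have := hN N (leqnn N); rewrite /= sub0r normrN; apply: le_lt_trans; exact: ler_norm.
Qed.

Lemma dsum_diff m (U : R -> Cn -> C) w : (forall t, differentiable (U t) w) ->
  differentiable (fun w => dsum m (U^~ w)) w.
Proof.
elim: m U => [|m ih] U hU /=; first exact: hU.
apply: dM; first exact: dcst.
by apply: dD; [apply: (ih (fun t => U (t / 2)))|apply: (ih (fun t => U ((1 + t) / 2)))] => t; exact: hU.
Qed.

Section scalar.
Context (k : Cn -> C) (b : R) (r0 : R).
Context (hk : forall w, nrm w < b -> differentiable k w) (r0b : 0 < r0).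

(* The homogeneous component of degree [i] of [k]. *)
Definition hom (i : nat) z : C := coef (fun t : C => k (t *: z)) r0%:C i.

Let nr0 : nrm (r0%:C : C) = r0.
Proof. by rewrite real_C_nrm // ltW. Qed.

Let line z c : 0 < c -> nrm z <= c -> holdisc (fun t : C => k (t *: z)) (b / c).
Proof.
move=> c0 zc t; rewrite (ltr_pdivlMr _ _ c0) => tc.
have tz : nrm (0 + t *: z) < b.
  by rewrite add0r nrmZ; apply: le_lt_trans tc; rewrite ler_wpM2l ?nrm_ge0.
have [dl _] := @dline _ _ _ k 0 z t (hk tz).
have -> : (fun t : C => k (t *: z)) = (fun t => k (0 + t *: z)).
  by apply/funext => q; rewrite add0r.
exact: dl.
Qed.

Lemma hom_bound i z c M : 0 < c -> c * r0 < b -> nrm z <= c ->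
  (forall w, nrm w <= r0 * nrm z -> nrm (k w) <= M) -> nrm (hom i z) <= M / r0 ^+ i.
Proof.
move=> c0 cb zc hM; have := @coef_bound _ _ _ r0%:C i M (line c0 zc).
rewrite nr0; apply; first by rewrite r0b ltr_pdivlMr // mulrC.
by move=> t tr; apply: hM; rewrite nrmZ tr.
Qed.

(** A mean over a circle of the holomorphic maps w -> k (t w) / t^i is a limit of locally bounded
    dyadic sums, to which [lim_hol] applies. *)
Lemma hom_diff i z : nrm z * r0 < b -> differentiable (hom i) z.
Proof.
move=> zb; pose d := (b / r0 - nrm z) / 2.
have d0 : 0 < d by rewrite divr_gt0 // subr_gt0 ltr_pdivlMr.
pose c := nrm z + d.
have c0 : 0 < c by rewrite ltr_wpDl ?nrm_ge0.
have cb : c * r0 < b by rewrite -ltr_pdivlMr // /c /d; move: d0; rewrite /d; order_lra.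
have wc w : nrm (w - z) < d -> nrm w <= c.
  by move=> h; have := nrmD (w - z) z; rewrite subrK /c; order_lra.
have hk' w : nrm w <= c * r0 -> differentiable k w by move=> wb; apply: hk; exact: le_lt_trans cb.
have [M M0 hM] := cball_bounded hk'.
pose u (t : R) : C := r0%:C * cexp (t%:C * tau).
have nu t : nrm (u t) = r0 by rewrite /u nrm_circle nr0.
have u0 t : u t != 0 by apply/eqP => h; have := nu t; rewrite h nrm0 => h0; move: r0b; rewrite h0 ltxx.
have tw (t : C) w : nrm (w - z) < d -> nrm t = r0 -> nrm (t *: w) <= c * r0.
  by move=> /wc h tr; rewrite nrmZ tr mulrC ler_wpM2r // ltW.
apply: (proj1 (@lim_hol _ _ (fun m w => dsum m (fun t => k (u t *: w) / u t ^+ i)) (hom i) z d (M / r0 ^+ i) d0 _ _ _)).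
- move=> m w wd; apply: (@dsum_diff m (fun t w => k (u t *: w) / u t ^+ i)) => t.
  apply: dM; last exact: dcst.
  by apply: (dcomp (dscale (u t) (did w))); apply: hk'; exact: tw.
- move=> m w wd; apply: dsum_bound => t _; rewrite nrmM nrmV nrmX nu ler_wpM2r //.
    by rewrite invr_ge0 exprn_ge0 // ltW.
  by apply: hM; exact: tw.
- move=> w wd; apply: dintP; apply: (@cont01_circ _ (fun t => k (t *: w) / t ^+ i) r0%:C).
  move=> t; rewrite nr0 => tr; apply: diff_contAt; apply: dM.
    by apply: (line c0 (wc w wd)); rewrite tr ltr_pdivlMr // mulrC.
  apply: dV; first by apply: dX; exact: did.
  by rewrite expf_neq0 //; apply/eqP => h; move: tr r0b; rewrite h nrm0 => <-; rewrite ltxx.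
Qed.

(** Taylor expansion of t -> k (t z) at t = 1, with remainder taken on the circle of radius r1 / r0
    > 1. *)
Lemma hom_sum (r1 M : R) m z : b <= 1 -> r0 < r1 -> r1 < b -> nrm z <= r0 ->
  (forall w, nrm w <= r1 -> nrm (k w) <= M) ->
  nrm (k z - \sum_(i < m) hom i z) <= M * (r0 / r1) ^+ m * (r1 / (r1 - r0)).
Proof.
move=> b1 r01 r1b zr hM; have r10 : 0 < r1 by exact: lt_trans r01.
have hd := line r0b zr; have r0n : r0 != 0 by rewrite gt_eqF.
have nq : nrm ((r1 / r0)%:C : C) = r1 / r0 by rewrite real_C_nrm // divr_ge0 // ltW.
have q1 : nrm (1 : C) < nrm ((r1 / r0)%:C : C) < b / r0.
  by rewrite nq nrm1 ltr_pdivlMr // mul1r r01 ltr_pM2r // invr_gt0.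
have := @taylor_rem _ _ _ _ 1 m hd q1; rewrite scale1r expr1n mul1r => ->.
have -> : \sum_(i < m) 1 ^+ i * coef (fun t => k (t *: z)) (r1 / r0)%:C i = \sum_(i < m) hom i z.
  apply: eq_bigr => i _; rewrite expr1n mul1r /hom.
  apply: (coef_indep i hd); rewrite ?nr0 ?r0b ?nq.
    by case/andP: q1 => _; rewrite nq => ->; rewrite divr_gt0.
  rewrite /= ltr_pdivlMr //; apply: le_lt_trans (lt_trans r01 r1b).
  by rewrite ler_piMr ?(ltW r0b) // ltW // (lt_le_trans _ b1) // (lt_trans r01).
rewrite addrAC subrr add0r.
have := @rem_bound _ _ _ _ 1 m M hd q1; rewrite nq nrm1 => H.
have {}H := H _; apply: le_trans (H _) _.
  move=> t tr; apply: hM; rewrite nrmZ tr.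
  by apply: le_trans (ler_wpM2l _ zr) _; rewrite ?divr_ge0 ?(ltW r0b) ?(ltW r10) // divfK.
have -> : (r0 / r1) ^+ m = ((r1 / r0) ^+ m)^-1 by rewrite -exprVn invf_div.
suff -> : r1 / r0 / (r1 / r0 - 1) = r1 / (r1 - r0) by [].
by field; rewrite r0n /= !subr_eq0 (gt_eqF r01).
Qed.

End scalar.

(** The homogeneous components at z read k only at radius r0 |z|. So partial sums are holomorphic up
    to radius b / r0 > 1, although k itself lives on radius b <= 1. *)
Lemma nice_approx (k : Cn -> Cn) r0 b e : 0 < r0 -> r0 < b -> b <= 1 -> 0 < e ->
  (forall z, nrm z < b -> differentiable k z) -> flat k ->
  exists p : Cn -> Cn, [/\ nice p, flat p & forall z, nrm z <= r0 -> nrm (k z - p z) <= e].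
Proof.
move=> r00 r0b b1 e0 dk [K [d [K0 d0 hK]]].
pose r1 := (r0 + b) / 2; have r01 : r0 < r1 by rewrite /r1; order_lra.
have r1b : r1 < b by rewrite /r1; order_lra.
have [M M0 hM] := @cball_bounded _ _ _ k r1 (fun z h => dk z (le_lt_trans h r1b)).
pose q := r1 / (r1 - r0); have q0 : 0 < q by rewrite divr_gt0 ?subr_gt0 //; order_lra.
have [m hm] : exists m : nat, (r0 / r1) ^+ m < e / (M * q + 1).
  apply: pow_small; last by rewrite divr_gt0 // ltr_wpDl // mulr_ge0 // ltW.
  have r10 : 0 < r1 by exact: lt_trans r01.
  by apply/andP; split; [apply: divr_ge0; exact: ltW|rewrite ltr_pdivrMr ?mul1r].
pose kj j z := k z ord0 j.
have dkj j w : nrm w < b -> differentiable (kj j) w by move=> /dk dw; have [] := dcoordE j dw.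
exists (fun z => \row_j \sum_(i < m) hom (kj j) r0 i z); split.
- exists (b / r0); first by rewrite ltr_pdivlMr // mul1r.
  move=> z; rewrite ltr_pdivlMr // => zb; apply: drow => j.
  have -> : (fun w => (\row_j \sum_(i < m) hom (kj j) r0 i w) ord0 j) = (fun w => \sum_(i < m) hom (kj j) r0 i w).
    by apply/funext => w; rewrite mxE.
  by apply: dbigsum => i; apply: (hom_diff (dkj j) r00).
- exists (\sum_(i < m) K * r0 ^+ 2 / r0 ^+ i), (Num.min 1 (d / r0)); split.
  + by apply: sumr_ge0 => i _; rewrite divr_ge0 ?mulr_ge0 ?exprn_ge0 // ltW.
  + by rewrite lt_min ltr01 divr_gt0.
  + move=> z; rewrite lt_min ltr_pdivlMr // => /andP[z1 zd].
    have S0 : 0 <= \sum_(i < m) K * r0 ^+ 2 / r0 ^+ i.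
      by apply: sumr_ge0 => i _; rewrite divr_ge0 ?mulr_ge0 ?exprn_ge0 // ltW.
    apply: nrm_row_le => [|j]; first by rewrite mulr_ge0 // sqr_ge0.
    rewrite mxE; apply: le_trans (nrm_sum _ _ _) _; rewrite mulr_suml; apply: ler_sum => i _.
    apply: le_trans (_ : K * (r0 * nrm z) ^+ 2 / r0 ^+ i <= _); last by rewrite exprMn mulrA mulrAC.
    apply: (hom_bound (dkj j) r00 i ltr01 _ (ltW z1)); first by rewrite mul1r.
    move=> w wr; apply: le_trans (nrm_coord _ _) _.
    apply: le_trans (hK w _) _; first by apply: le_lt_trans wr _; rewrite mulrC.
    by rewrite ler_wpM2l //; apply: lerXn2r; rewrite ?nnegrE ?nrm_ge0 ?mulr_ge0 ?nrm_ge0 // ltW.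
- move=> z zr; apply: nrm_row_le => [|j]; first exact: ltW.
  have -> : (k z - \row_j0 \sum_(i < m) hom (kj j0) r0 i z) ord0 j = kj j z - \sum_(i < m) hom (kj j) r0 i z.
    by rewrite !mxE.
  apply: le_trans (hom_sum (dkj j) r00 m b1 r01 r1b zr _) _.
    by move=> w wr; apply: le_trans (nrm_coord _ _) _; exact: hM.
  rewrite -/q mulrAC; apply: le_trans (ler_wpM2l _ (ltW hm)) _; first by rewrite mulr_ge0 // ltW.
  rewrite mulrCA ler_piMr ?(ltW e0) // ler_pdivrMr ?mul1r ?lerDl //.
  by rewrite ltr_wpDl // mulr_ge0 // ltW.
Qed.

End homogeneous_expansion.

(** * Continuous linear functionals *)

Section pull_back.
Context {R : realType} {n : nat}.
Local Notation C := R[i].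
Local Notation Cn := 'rV[C]_n.
Implicit Types (z w x y v : Cn) (a b c r s e M : R).

(** By Osgood's theorem psi has local holomorphic inverses, and injectivity identifies them with
    chi. *)
Lemma inverse_hol (psi chi : Cn -> Cn) y0 e : 0 < e ->
  (forall z, nrm z < 1 -> differentiable psi z) ->
  (forall x y, nrm x < 1 -> nrm y < 1 -> psi x = psi y -> x = y) ->
  (forall y, nrm (y - y0) < e -> nrm (chi y) < 1 /\ psi (chi y) = y) -> differentiable chi y0.
Proof.
move=> e0 dpsi inj hchi.
have [w1 wE] : nrm (chi y0) < 1 /\ psi (chi y0) = y0 by apply: hchi; rewrite subrr nrm0.
set w := chi y0 in w1 wE.
have r0 : 0 < 1 - nrm w by rewrite subr_gt0.
have dp x : nrm (x - w) < 1 - nrm w -> differentiable psi x.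
  by move=> xw; apply: dpsi; exact: ball_ball xw.
have reg : regular psi w.
  apply: (injective_holomorphic_regular r0 dp) => x y xw yw.
  by apply: inj; [exact: ball_ball xw|exact: ball_ball yw].
have [rho [d [K [g [/andP[rho0 rho1] d0 K0 _ hg]]]]] := local_inverse r0 dp reg.
rewrite wE in hg.
have dg : differentiable g y0 by have := hg y0; rewrite subrr nrm0 => /(_ d0) [].
apply: (proj1 (diff_ext dg _)); exists (Num.min d e); first by rewrite lt_min d0.
move=> y; rewrite lt_min => /andP[yd ye].
have [h1 h2 _] := hg _ yd; have [h3 h4] := hchi _ ye.
apply: inj => //; last by rewrite h2.
by apply: (@ball_ball _ _ w) => //; exact: lt_trans rho1.
Qed.

(** If psi moves points little, it has an inverse chi on a polydisc of radius larger than r0, and g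
    o chi is approximated there by a partial sum p of its homogeneous expansion. The tolerance [dl]
    depends on r0 alone. *)
Lemma pull_back_approx r0 : 0 < r0 < 1 -> exists2 dl : R, 0 < dl &
  forall psi : Cn -> Cn, self_map psi ->
    (forall x y, nrm x < 1 -> nrm y < 1 -> psi x = psi y -> x = y) ->
    (forall z, nrm z < 1 -> nrm (psi z - z) <= dl * (2 / (1 - nrm z))) ->
  forall (g : Cn -> Cn) e, nice g -> flat g -> 0 < e ->
  exists p : Cn -> Cn, [/\ nice p, flat p & forall w, nrm w <= r0 -> nrm (g w - p (psi w)) <= e].
Proof.
(* The radii r0 + d, r0 + 2 d and r0 + 3 d = 1 - d serve for the domain of chi, for its values, and
   for the Cauchy estimate of psi - id. *)
move=> /andP[r00 r01]; pose d := (1 - r0) / 4; have d0 : 0 < d by rewrite /d; order_lra.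
have dE : 1 - r0 = 4 * d by rewrite /d; field.
(* Where 1 - |z| > d the displacement is at most (d^2 / 16) (2 / d) = d / 8, which makes psi - id
   half-Lipschitz at radius r0 + 2 d. *)
exists (d ^+ 2 / 16); first by rewrite divr_gt0 // exprn_gt0.
move=> psi spsi inj cl g e [rho rho1 dg] [K [d' [K0 d'0 hK]]] e0.
have [dpsi psi0 _] := spsi.
have near3 z : nrm z < r0 + 3 * d -> differentiable (fun z => psi z - z) z /\ nrm (psi z - z) <= d / 8.
  move=> z3; have z1 : nrm z < 1 by order_lra.
  split; first by apply: dB; [exact: dpsi|exact: did].
  apply: le_trans (cl z z1) _; have h : 2 / (1 - nrm z) <= 2 / d.
    by rewrite ler_wpM2l // lef_pV2 ?posrE //; order_lra.
  apply: le_trans (ler_wpM2l _ h) _; first by rewrite divr_ge0 // sqr_ge0.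
  suff -> : d ^+ 2 / 16 * (2 / d) = d / 8 by [].
  by field; rewrite gt_eqF.
have d8 : 0 <= d / 8 by order_lra.
have a0 : 0 <= r0 + 2 * d by order_lra.
have ab : r0 + 2 * d < r0 + 3 * d by order_lra.
have lip x y : nrm x <= r0 + 2 * d -> nrm y <= r0 + 2 * d ->
    nrm ((psi x - x) - (psi y - y)) <= 2^-1 * nrm (x - y).
  move=> xr yr; have := lip_ball a0 ab d8 near3 xr yr.
  have -> : 4 * (d / 8) / (r0 + 3 * d - (r0 + 2 * d)) = 2^-1 by field; rewrite gt_eqF //; order_lra.
  by [].
have /choice [chi hchi] : forall y, exists x, nrm y < r0 + d -> nrm x <= r0 + 2 * d /\ psi x = y.
  move=> y; have [yr|yr] := boolP (nrm y < r0 + d); last by exists 0.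
  have sub x : nrm (x - y) <= d -> nrm x <= r0 + 2 * d.
    by have := nrmD (x - y) y; rewrite subrK; order_lra.
  have [|||x [xy xE]] := @solve_near_identity _ _ psi y d y.
  - exact: ltW.
  - by move=> x x' /sub h1 /sub h2; exact: lip.
  - have y3 : nrm y < r0 + 3 * d by order_lra.
    by have [_ h] := near3 y y3; rewrite nrmC; order_lra.
  by exists x => _; split=> //; exact: sub.
have chi1 y : nrm y < r0 + d -> nrm (chi y) < 1 by move=> /hchi [h _]; order_lra.
pose k y := g (chi y).
have dk y : nrm y < r0 + d -> differentiable k y.
  move=> yr; have y0 : 0 < r0 + d - nrm y by rewrite subr_gt0.
  have dchi : differentiable chi y.
    apply: (inverse_hol y0 dpsi inj) => y' yy'.
    have y'r : nrm y' < r0 + d by have := nrmD (y' - y) y; rewrite subrK; order_lra.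
    by split; [exact: chi1|have [] := hchi y' y'r].
  by apply: (dcomp dchi); apply: dg; have := chi1 y yr; order_lra.
have chi2 y : nrm y < r0 + d -> nrm (chi y) <= 2 * nrm y.
  move=> /hchi [h1 h2].
  have lip' : forall x x', nrm (x - 0) <= r0 + 2 * d -> nrm (x' - 0) <= r0 + 2 * d ->
    nrm ((psi x - x) - (psi x' - x')) <= 2^-1 * nrm (x - x') by move=> x x'; rewrite !subr0; exact: lip.
  have := near_identity_inj (x := chi y) (x' := 0) lip'.
  by rewrite !subr0 nrm0 h2 psi0 subr0; apply.
have fk : flat k.
  exists (4 * K), (Num.min (r0 + d) (d' / 2)); split; first by rewrite mulr_ge0.
    by rewrite lt_min divr_gt0 // andbT addr_gt0.
  move=> y; rewrite lt_min => /andP[y1 y2]; have h := chi2 y y1.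
  apply: le_trans (hK _ _) _; first by order_lra.
  have h2 : nrm (chi y) ^+ 2 <= (2 * nrm y) ^+ 2.
    by apply: lerXn2r; rewrite ?nnegrE ?nrm_ge0 ?mulr_ge0 ?nrm_ge0.
  by apply: le_trans (ler_wpM2l K0 h2) _; rewrite exprMn mulrA; apply: ler_wpM2r; [exact: sqr_ge0|order_lra].
have r0d : r0 < r0 + d by order_lra.
have r1d : r0 + d <= 1 by order_lra.
have [p [np fp hp]] := nice_approx r00 r0d r1d e0 dk fk.
exists p; split=> // w wr; have w1 : nrm w < 1 by exact: le_lt_trans r01.
have yr : nrm (psi w) <= r0 by apply: le_trans wr; exact: self_map_schwarz.
have yr' : nrm (psi w) < r0 + d by order_lra.
have <- : chi (psi w) = w by apply: inj => //; [exact: chi1|have [_ ->] := hchi _ yr'].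
by have [_ E] := hchi _ yr'; rewrite E; exact: hp.
Qed.

End pull_back.

(** * Continuous linear functionals on holomorphic mappings *)

Section functionals.
Context {R : realType} {n : nat}.
Local Notation C := R[i].
Local Notation Cn := 'rV[C]_n.
Implicit Types (z w x y v : Cn) (a b c r s e M : R) (f g h : mappings R n).
Context (L : mappings R n -> C) (hL : continuous_linear_functional L).

Lemma functional_seq (u : nat -> mappings R n) f : (forall k, holomorphic (u k)) -> holomorphic f ->
  (forall r e, 0 <= r < 1 -> 0 < e -> exists N : nat, forall k, (N <= k)%N ->
     forall z, nrm z <= r -> nrm (u k z - f z) < e) ->
  (fun k => L (u k)) @ \oo --> L f.
Proof.
move=> hu hf uf; have [_ /subspace_continuousP cL] := hL.
have uc : u @ \oo --> f.
  apply/mapping_cvgP => r e r01 e0; have [N hN] := uf r e r01 e0.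
  by exists N => // k /hN.
move=> P /(cL f hf) /uc; rewrite /= /nbhs /=; apply: filterS => k; apply; exact: hu.
Qed.

Lemma functional_ext f g : holomorphic f -> holomorphic g ->
  (forall z, nrm z < 1 -> f z = g z) -> L f = L g.
Proof.
move=> hf hg fg; apply: (@cvgC_uniq _ _ (fun=> L f)); first exact: cvg_cst.
apply: (@functional_seq (fun=> f)) => // r e /andP[_ r1] e0; exists 0%N => _ _ z zr.
by rewrite fg ?subrr ?nrm0 //; exact: le_lt_trans r1.
Qed.

Lemma hol0 : holomorphic ((fun=> 0) : mappings R n).
Proof. by move=> z _; exact: dcst. Qed.

Lemma functional0 : L (fun=> 0) = 0.
Proof.
have [lin _] := hL; have := lin 1 _ _ hol0 hol0.
have -> : (fun z => 1 *: ((fun=> 0) : mappings R n) z + ((fun=> 0) : mappings R n) z) = (fun=> 0) :> (Cn -> Cn).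
  by apply/funext => z; rewrite scaler0 addr0.
by rewrite mul1r => /eqP; rewrite eq_sym -subr_eq0 addrK => /eqP.
Qed.

Lemma functionalZ (a : C) f : holomorphic f -> L (fun z => a *: f z) = a * L f.
Proof.
move=> hf; have [lin _] := hL; have := lin a f _ hf hol0; rewrite functional0 addr0 => <-.
by congr L; apply/funext => z; rewrite addr0.
Qed.

Lemma functionalB f g : holomorphic f -> holomorphic g -> L (fun z => f z - g z) = L f - L g.
Proof.
move=> hf hg; have [lin _] := hL; have := lin (-1) g f hg hf; rewrite mulN1r addrC => <-.
by congr L; apply/funext => z; rewrite scaleN1r addrC.
Qed.

(* [L] is carried by a smaller polydisc. *)
Lemma functional_local : exists2 r0 : R, 0 < r0 < 1 & forall f, holomorphic f ->
  (forall e, 0 < e -> exists g, [/\ holomorphic g, L g = 0 &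
     forall z, nrm z <= r0 -> nrm (f z - g z) <= e]) -> L f = 0.
Proof.
apply: contrapT => H.
pose r (N : nat) : R := 1 - (N.+2%:R)^-1.
have r01 N : 0 < r N < 1.
  have h : (N.+2%:R : R)^-1 < 1 by rewrite invf_lt1 ?ltr1n ?ltr0n.
  by rewrite /r subr_gt0 h ltrBlDr ltrDl invr_gt0 ltr0n.
(* If no radius carried L, dividing f - g by L f would give maps of value 1 under L that are at most
   1 / (N + 1) on radius r N. They tend to 0 locally uniformly, against continuity of L. *)
have ex (N : nat) : exists w : mappings R n, [/\ holomorphic w, L w = 1 & forall z, nrm z <= r N -> nrm (w z) <= (N.+1%:R)^-1].
  apply: contrapT => K; apply: H; exists (r N); first exact: r01.
  move=> f hf app; apply: contrapT => Lf; apply: K.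
  have Lf0 : L f != 0 by apply/eqP.
  have nL : 0 < nrm (L f) by exact: nrm_gt0.
  have e0 : 0 < nrm (L f) / N.+1%:R by rewrite divr_gt0 // ltr0n.
  have [g [hg Lg fg]] := app _ e0.
  have hB : holomorphic ((fun z => f z - g z) : mappings R n).
    by move=> z z1; apply: dB; [exact: hf|exact: hg].
  exists (fun z => (L f)^-1 *: (f z - g z)); split.
  - by move=> z z1; apply: dscale; exact: hB.
  - by rewrite (functionalZ (L f)^-1 hB) functionalB // Lg subr0 mulVf.
  - move=> z zr; rewrite nrmZ nrmV ler_pdivrMl //.
    exact: fg.
have /choice [w hw] := ex.
have := @functional_seq w (fun=> 0) (fun k => let: And3 h _ _ := hw k in h) hol0.
have -> : (fun k => L (w k)) = (fun=> 1) by apply/funext => k; have [] := hw k.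
rewrite functional0 => H1.
have /H1 /cvg_seqP /(_ 1 ltr01) [N /(_ N (leqnn N))] : forall s e, 0 <= s < 1 -> 0 < e ->
    exists N : nat, forall k, (N <= k)%N -> forall z, nrm z <= s -> nrm (w k z - 0) < e.
  move=> s e /andP[_ s1] e0; have s1' : 0 < 1 - s by rewrite subr_gt0.
  have [N1 h1] := step_small s1'; have [N2 h2] := step_small e0.
  exists (maxn N1 N2) => k; rewrite geq_max => /andP[k1 k2] z zs; rewrite subr0.
  have [_ _ hz] := hw k; apply: le_lt_trans (hz z _) (h2 k k2).
  (* The index is shifted because r k = 1 - 1 / (k + 2) is 1 - [step] (k + 1). *)
  by apply: le_trans zs _; rewrite /r lerBrDr -lerBrDl; exact/ltW/(h1 k.+1 (leqW k1)).
by rewrite subr0 nrm1 ltxx.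
Qed.

End functionals.

(** * Pulling support points along the chain *)

Section support_points.
Context {R : realType} {n : nat}.
Local Notation C := R[i].
Local Notation Cn := 'rV[C]_n.
Implicit Types (z w x y v : Cn) (r s t tau e M : R) (f g : mappings R n).

Lemma chain_hchain (F : R -> mappings R n) : normalized_Loewner_chain F -> hchain F.
Proof.
move=> [hF nest]; split.
- by move=> t z /hF [[dF _] _ _] z1; apply: dF; rewrite /= polydiscE.
- by move=> t x y /hF [[_ inj] _ _] x1 y1; apply: inj; rewrite inE /= polydiscE.
- by move=> t /hF [].
- by move=> t v /hF [_ _]; apply.
- move=> s t z s0 st z1; have zp : polydisc R n z by rewrite /= polydiscE.
  have [w w1 <-] := nest s t s0 st (F s z) (ex_intro2 _ _ z zp erefl).
  by exists w => //; move: w1; rewrite /= polydiscE.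
Qed.

(** Otherwise there are t_N and |z_N| <= r where e^-t F_t exceeds N in modulus; a subsequence would
    converge uniformly on that polydisc to a bounded limit. *)
Lemma normal_bounded (F : R -> mappings R n) : hchain F ->
  normal_family [set g : mappings R n | exists2 t : R, 0 <= t &
    g = (fun z => (expR (- t))%:C *: F t z)] -> chain_bounded F.
Proof.
move=> hF hn r r01; apply: contrapT => H.
have /choice [p hp] : forall N : nat, exists p : R * Cn, [/\ 0 <= p.1, nrm p.2 <= r &
    N%:R * expR p.1 < nrm (F p.1 p.2)].
  move=> N; apply: contrapT => K; apply: H; exists N%:R => // t z t0 zr.
  by rewrite leNgt; apply/negP => h; apply: K; exists (t, z).
pose u (N : nat) : mappings R n := fun z => (expR (- (p N).1))%:C *: F (p N).1 z.
have [|s [g [sh hg /mapping_cvgP cv]]] := hn u.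
  by move=> N; exists (p N).1 => //; have [] := hp N.
have sk (k : nat) : (k <= s k)%N.
  elim: k => // k ih; exact: leq_ltn_trans (sh _ _ (ltnSn k)).
have dg z : nrm z <= r -> differentiable (g : Cn -> Cn) z.
  by move=> zr; apply: hg; rewrite /= polydiscE; case/andP: r01 => _; exact: le_lt_trans.
have [M M0 hM] := cball_bounded dg.
have [N _ hN] := cv r 1 r01 ltr01; have [N' hN'] := natr_large (M + 1).
pose k := maxn N N'; have := hN k (leq_maxl _ _); have [h1 h2 h3] := hp (s k).
move=> /(_ _ h2) /= h4; have h5 := hM _ h2.
have h6 : nrm (u (s k) (p (s k)).2) <= M + 1.
  have := nrmD (u (s k) (p (s k)).2 - g (p (s k)).2) (g (p (s k)).2); rewrite subrK => h.
  by apply: le_trans h _; rewrite addrC; apply: lerD => //; exact: ltW.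
have h7 : M + 1 < (s k)%:R by apply: hN'; exact: leq_trans (leq_maxr _ _) (sk k).
move: h6; rewrite /u nrmZ real_C_nrm ?expR_ge0 // => h6.
have h8 : (s k)%:R < expR (- (p (s k)).1) * nrm (F (p (s k)).1 (p (s k)).2).
  have := ltr_pM2l (expR_gt0 (- (p (s k)).1)) ((s k)%:R * expR (p (s k)).1) (nrm (F (p (s k)).1 (p (s k)).2)).
  by rewrite h3 mulrCA -expRD addNr expR0 mulr1.
by have := lt_le_trans (lt_trans h7 h8) h6; rewrite ltxx.
Qed.

Lemma shift_chain (F : R -> Cn -> Cn) tau : 0 <= tau -> hchain F ->
  hchain (fun t z => (expR (- tau))%:C *: F (t + tau) z).
Proof.
move=> tau0 [dF inj F0 dF0 nest].
have et : (expR (- tau))%:C != 0 :> C by apply/eqP => /complexI E; have := expR_gt0 (- tau); rewrite E ltxx.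
split.
- by move=> t z t0 z1; apply: dscale; apply: dF => //; rewrite addr_ge0.
- by move=> t x y t0 x1 y1 /(scalerI et); apply: inj => //; rewrite addr_ge0.
- by move=> t t0; rewrite F0 ?addr_ge0 // scaler0.
- move=> t v t0; have t1 : 0 <= t + tau by rewrite addr_ge0.
  have n0 : nrm (0 : Cn) < 1 by rewrite nrm0.
  apply: (etrans (dscaleE (expR (- tau))%:C v (dF _ _ t1 n0))).
  apply: (etrans (congr1 (fun w : Cn => (expR (- tau))%:C *: w) (dF0 _ v t1))).
  by rewrite scalerA -rmorphM /= -expRD addrC addrK.
- move=> s t z s0 st z1; have [||w w1 wE] := nest (s + tau) (t + tau) z _ _ z1.
  + by rewrite addr_ge0.
  + by rewrite lerD2r.
  by exists w => //; rewrite wE.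
Qed.

Lemma shift_bounded (F : R -> Cn -> Cn) tau : 0 <= tau -> chain_bounded F ->
  chain_bounded (fun t z => (expR (- tau))%:C *: F (t + tau) z).
Proof.
move=> tau0 bF r r01; have [M M0 hM] := bF r r01; exists M => // t z t0 zr.
have t1 : 0 <= t + tau by rewrite addr_ge0.
rewrite nrmZ real_C_nrm ?expR_ge0 //; apply: le_trans (ler_wpM2l (expR_ge0 _) (hM _ z t1 zr)) _.
by rewrite mulrCA -expRD addrC addrK.
Qed.

Section functional.
Context (F : R -> Cn -> Cn) (hF : hchain F).
Context (L : mappings R n -> C) (hL : continuous_linear_functional L).

Definition pull tau : mappings R n -> C :=
  fun g => L ((fun z => (expR tau)%:C *: g (trans F 0 tau z)) : mappings R n).

Lemma pull_hol tau g : 0 <= tau -> holomorphic g ->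
  holomorphic ((fun z => g (trans F 0 tau z)) : mappings R n).
Proof.
move=> tau0 hg z; rewrite /= polydiscE => z1.
apply: (dcomp (trans_diff hF (lexx 0) tau0 z1)); apply: hg; rewrite /= polydiscE.
by have [] := transP hF (lexx 0) tau0 z1.
Qed.

Lemma pull_hol_scale tau g : 0 <= tau -> holomorphic g ->
  holomorphic ((fun z => (expR tau)%:C *: g (trans F 0 tau z)) : mappings R n).
Proof. by move=> tau0 hg z z1; apply: dscale; exact: (pull_hol tau0 hg). Qed.

(** Continuity holds because by the Schwarz lemma the transition map sends each smaller polydisc
    into itself. *)
Lemma pull_functional tau : 0 <= tau -> continuous_linear_functional (pull tau).
Proof.
move=> tau0; have [lin /subspace_continuousP cL] := hL; split.
  move=> a f g hf hg; rewrite /pull -(lin a _ _ (pull_hol_scale tau0 hf) (pull_hol_scale tau0 hg)).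
  by congr L; apply/funext => z; rewrite scalerDr !scalerA mulrC.
apply/subspace_continuousP => g hg.
have cv : (fun f => (fun z => (expR tau)%:C *: f (trans F 0 tau z)) : mappings R n) @ within holomorphic (nbhs g)
    --> ((fun z => (expR tau)%:C *: g (trans F 0 tau z)) : mappings R n).
  apply/mapping_cvgP => r e r01 e0.
  have ee : 0 < e / expR tau by rewrite divr_gt0 // expR_gt0.
  have idc : (fun f => f) @ within holomorphic (nbhs g) --> g by exact: cvg_within.
  move/mapping_cvgP: idc => /(_ r _ r01 ee); apply: filterS => f hf z zr.
  have z1 : nrm z < 1 by case/andP: r01 => _; exact: le_lt_trans.
  have wr : nrm (trans F 0 tau z) <= r by apply: le_trans zr; exact: (trans_schwarz hF (lexx 0)).
  rewrite -scalerBr nrmZ real_C_nrm ?expR_ge0 // mulrC -ltr_pdivlMr ?expR_gt0 //.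
  exact: hf.
move=> P /(cL _ (pull_hol_scale tau0 hg)) HP.
have H1 : nbhs g [set f | holomorphic f ->
    holomorphic ((fun z => (expR tau)%:C *: f (trans F 0 tau z)) : mappings R n) -> P (pull tau f)].
  exact: (cv _ HP).
have H2 : nbhs g [set f | holomorphic f -> P (pull tau f)].
  apply: (@filterS _ (nbhs g) _ _ _ _ H1) => f hP hf; apply: hP => //.
  exact: pull_hol_scale.
exact: H2.
Qed.

(** The property that is carried back in time. The maps g are those for which small perturbations id
    + c g of the identity lie in the class [class_S0]. *)
Definition annihilates tau := forall g, nice g -> flat g -> L (fun z => g (trans F 0 tau z)) = 0.

Lemma nice_hol g : nice g -> holomorphic g.
Proof. by move=> [rho rho1 dg] z; rewrite /= polydiscE => z1; apply: dg; exact: lt_trans rho1. Qed.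

(** On the polydisc carrying L, the map g o phi_(0,s) is a limit of p o phi_(s,t) o phi_(0,s) = p o
    phi_(0,t), which L annihilates. The step length is fixed by that polydisc and so does not depend
    on s. *)
Lemma annihilates_step : exists2 dl : R, 0 < dl & forall s t, 0 <= s -> s <= t -> t <= s + dl ->
  annihilates t -> annihilates s.
Proof.
have [r0 r001 loc] := functional_local hL.
have [dl dl0 app] := @pull_back_approx R n r0 r001.
exists dl => // s t s0 st tdl At g ng fg; have lx := lexx (0 : R); have t0 := le_trans s0 st.
apply: loc; first by apply: pull_hol => //; exact: nice_hol.
move=> e e0; have sm := trans_self_map hF s0 st.
have inj x y : nrm x < 1 -> nrm y < 1 -> trans F s t x = trans F s t y -> x = y.
  by move=> x1 y1; exact: trans_inj.
have close z : nrm z < 1 -> nrm (trans F s t z - z) <= dl * (2 / (1 - nrm z)).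
  move=> z1; apply: le_trans (trans_close hF s0 st z1) _.
  rewrite ler_wpM2r ?divr_ge0 ?subr_ge0 ?(ltW z1) //; order_lra.
have [p [np fp hp]] := app _ sm inj close g e ng fg e0.
exists (fun z => p (trans F 0 t z)); split.
- by apply: pull_hol => //; exact: nice_hol.
- exact: At.
- move=> z zr; have z1 : nrm z < 1 by case/andP: r001 => _; exact: le_lt_trans.
  rewrite -(trans_comp hF lx s0 st z1); apply: hp; apply: le_trans zr; exact: (trans_schwarz hF lx).
Qed.

Lemma annihilates0 tau : 0 <= tau -> annihilates tau -> annihilates 0.
Proof.
move=> tau0 At; have [dl dl0 st] := annihilates_step.
have [N hN] := natr_large (tau / dl).
(* The maximum with 0 stops the descent at time 0. *)
have down (k : nat) : annihilates (Num.max 0 (tau - k%:R * dl)).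
  elim: k => [|k ih]; first by rewrite mul0r subr0 max_r.
  apply: st ih; first by rewrite le_max lexx.
    by rewrite ge_max !le_max lexx /= -natr1 mulrDl mul1r; apply/orP; right; order_lra.
  rewrite -natr1 mulrDl mul1r ge_max; apply/andP; split.
    by rewrite addr_ge0 ?(ltW dl0) // le_max lexx.
  by rewrite -lerBlDr le_max; apply/orP; right; order_lra.
have := down N; rewrite max_l // subr_le0 -ler_pdivrMr //; exact/ltW/hN.
Qed.

(** For f in S the map f - id has order two at 0 but is holomorphic only in the polydisc; on the
    polydisc carrying L it is approximated by maps holomorphic beyond. Hence L f = L id. *)
Lemma annihilates_const : annihilates 0 -> forall f g, class_S f -> class_S g -> L f = L g.
Proof.
move=> A0; have lx := lexx (0 : R).
have A g : nice g -> flat g -> L g = 0.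
  move=> ng fg; rewrite -(A0 g ng fg); apply: (functional_ext hL); first exact: nice_hol.
    by apply: pull_hol => //; exact: nice_hol.
  by move=> z z1; rewrite trans_id.
have n0 : polydisc R n 0 by rewrite /= polydiscE nrm0.
have S f : class_S f -> L (fun z => f z - z) = 0.
  move=> [[hf _] f0 df0]; have [r0 /andP[r00 r01] loc] := functional_local hL.
  have hB : holomorphic ((fun z => f z - z) : mappings R n).
    by move=> z z1; apply: dB; [exact: hf|exact: did].
  have fl : flat (fun z => f z - z).
    have d2 z : nrm z <= 2^-1 -> differentiable (f : Cn -> Cn) z.
      by move=> z2; apply: hf; rewrite /= polydiscE; order_lra.
    have [M M0 hM] := cball_bounded d2.
    exists (8 * M / 2^-1 ^+ 2), (2^-1 / 4); split; first by rewrite divr_ge0 ?mulr_ge0 // sqr_ge0.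
      by rewrite divr_gt0 // invr_gt0.
    move=> z zr; have h0 : (0 : R) < 2^-1 by rewrite invr_gt0.
    have hb w : nrm (w - 0) < 2^-1 -> differentiable (f : Cn -> Cn) w /\ nrm (f w) <= M.
      by rewrite subr0 => /ltW w2; split; [exact: d2|exact: hM].
    have := row_taylor2 h0 M0 hb (ltW zr); rewrite add0r f0 subr0.
    by have -> : 'd (f : Cn -> Cn) 0 z = z by exact: df0.
  apply: loc => // e e0.
  have dB' z : nrm z < 1 -> differentiable (fun z => f z - z) z.
    by move=> z1; apply: hB; rewrite /= polydiscE.
  have [p [np fp hp]] := nice_approx r00 r01 (lexx 1) e0 dB' fl.
  by exists p; split=> //; [exact: nice_hol|exact: A].
have hid : holomorphic ((fun z => z) : mappings R n) by move=> z _; exact: did.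
have E f : class_S f -> L f = L (fun z => z).
  move=> Sf; have [[hf _] _ _] := Sf; have := S f Sf; rewrite functionalB // => /eqP.
  by rewrite subr_eq0 => /eqP.
by move=> f g /E -> /E ->.
Qed.

(** Comparing id + c g with id for c = e and for c = i e shows that the real and the imaginary part
    of e^tau L (g o phi_(0,tau)) vanish. *)
Lemma pull_const_annihilates tau : 0 <= tau ->
  (forall f g, class_S0 f -> class_S0 g -> complex.Re (pull tau f) = complex.Re (pull tau g)) ->
  annihilates tau.
Proof.
move=> tau0 cst g ng fg; have [e e0 he] := perturb_S0 ng fg.
have hid : holomorphic ((fun z => z) : mappings R n) by move=> z _; exact: did.
have hg := nice_hol ng; have lP := pull_functional tau0.
pose gc : mappings R n := fun z => g (trans F 0 tau z).
have val (c : C) : nrm c <= e -> complex.Re (c * ((expR tau)%:C * L gc)) = 0.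
  move=> ce; have c0 : nrm (0 : C) <= e by rewrite nrm0 ltW.
  have := cst _ _ (he c ce) (he 0 c0).
  have lin d : pull tau (fun z => z + d *: g z) = d * ((expR tau)%:C * L gc) + pull tau (fun z => z).
    have [l _] := lP.
    have -> : (fun z => z + d *: g z) = (fun z => d *: g z + z) by apply/funext => z; rewrite addrC.
    rewrite (l d g _ hg hid); congr (_ * _ + _).
    by rewrite /pull (functionalZ hL (expR tau)%:C (pull_hol tau0 hg)).
  by rewrite !lin mul0r add0r ReD => /eqP; rewrite -subr_eq0 addrK => /eqP.
have h1 := val e%:C; rewrite real_C_nrm ?(ltW e0) // in h1; have {}h1 := h1 (lexx e).
have h2 := val (e%:C * 'i%C); rewrite nrmM nrm_i mulr1 real_C_nrm ?(ltW e0) // in h2.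
have {}h2 := h2 (lexx e).
have : (expR tau)%:C * L gc = 0.
  move: h1 h2; case: (_ * L gc) => a b /=; rewrite ?mul0r ?mulr0 ?subr0 ?sub0r ?add0r ?addr0 ?mulr1.
  move=> /eqP; rewrite mulf_eq0 (gt_eqF e0) /= => /eqP -> /eqP.
  by rewrite mul0r sub0r oppr_eq0 mulf_eq0 (gt_eqF e0) /= => /eqP ->.
move=> /eqP; rewrite mulf_eq0 => /orP[/eqP/complexI h|/eqP //].
by have := expR_gt0 tau; rewrite h ltxx.
Qed.

End functional.
End support_points.

Theorem theorem3p3 (R : realType) (n : nat) (hn : (1 <= n)%N)
    (f : mappings R n) (hf : supp class_S0 f)
    (F : R -> mappings R n) (hF : normalized_Loewner_chain F)
    (hF0 : forall z, polydisc R n z -> F 0 z = f z)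
    (hnormal : normal_family
      [set g : mappings R n | exists2 t : R, 0 <= t &
         g = (fun z => (expR (- t))%:C *: F t z)]) :
  forall t : R, 0 <= t ->
    supp class_S0 ((fun z => (expR (- t))%:C *: F t z) : mappings R n).
Proof.
move=> tau tau0; have hc := chain_hchain hF; have bc := normal_bounded hc hnormal.
have lx := lexx (0 : R).
have [S0f [L [hL [g1 [g2 [S1 S2 ne]]] fmax]]] := hf.
have hS (h : mappings R n) : class_S0 h -> holomorphic h by move=> [[[hh _] _ _] _].
have S0h : class_S0 ((fun z => (expR (- tau))%:C *: F tau z) : mappings R n).
  have := chain_S0 (shift_chain tau0 hc) (shift_bounded tau0 bc).
  by rewrite add0r.
split; first exact: S0h.
(* Composing F_tau with phi_(0,tau) gives back F_0, which equals f only on the polydisc; L does not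
   see the other values. *)
have top : pull F L tau (fun z => (expR (- tau))%:C *: F tau z) = L f.
  apply: (functional_ext hL).
  - exact: (pull_hol_scale hc tau0 (hS _ S0h)).
  - exact: (hS _ S0f).
  - move=> z z1; have [_ ->] := transP hc lx tau0 z1.
    rewrite scalerA -rmorphM /= -expRD subrr expR0 scale1r; apply: hF0.
    by rewrite /= polydiscE.
exists (pull F L tau); split; first exact: pull_functional.
(* A pulled back functional with constant real part on S0 would make L constant on S, contrary to
   the values of L at g1 and g2. *)
- apply: contrapT => H; apply: ne; congr complex.Re.
  have [Sg1 _] := S1; have [Sg2 _] := S2.
  apply: (annihilates_const hc hL _ Sg1 Sg2); apply: (annihilates0 hc hL tau0).
  apply: (pull_const_annihilates hc hL tau0) => h1 h2 Sh1 Sh2.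
  by apply: contrapT => K; apply: H; exists h1, h2.
- by move=> g Sg; rewrite top; apply: fmax; exact: concat_S0.
Qed.
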